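(* Let $n\ge1$, $k\in\frac12+\mathbb Z$, let $\mathfrak b$ be a fractional ideal and $\mathfrak c$ an integral ideal of $\mathbb Q$ with $\mathfrak b^{-1}\subseteq2\mathbb Z$, $\mathfrak b\mathfrak c\subseteq2\mathbb Z$, and let $\psi$ be a normalised Hecke character of $\mathbb Q$ with $\psi_q(a)=1$ for every prime $q$ and $a\in\mathbb Z_q^\times\cap(1+\mathfrak c_q)$, and $\psi_\infty(x)^n=\operatorname{sgn}(x)^{n[k]}$. Let $p\nmid\mathfrak c$ be a prime. If $f\in\mathcal M_k(\Gamma[\mathfrak b^{-1},\mathfrak b\mathfrak c],\psi)$ is a (non-zero) Hecke eigenform, then its $p$-stabilisation $f_0$ satisfies $f_0\in\mathcal M_k(\Gamma[\mathfrak b^{-1},\mathfrak b\mathfrak c_0],\psi)$, where $\mathfrak c_0=\mathfrak cp^{2(2^n-1)}$. Moreover, $$f_0|U_p=\lambda_0f_0.$$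
   Context: **General notation.** For a square matrix $a$: $|a|=\det a$, $\tilde a=(a^T)^{-1}$. $e(z)=e^{2\pi iz}$, $[k]=k-\frac12$. For a fractional ideal $\mathfrak r$ of $\mathbb Q$, $\mathfrak r_q$ is its completion at $q$. $\mathbb T$ is the unit circle. **Groups.** $G=Sp_n(\mathbb Q)=\{\alpha\in GL_{2n}(\mathbb Q):\alpha^T\iota\alpha=\iota\}$, $\iota=\begin{pmatrix}0&-I_n\\ I_n&0\end{pmatrix}$; write $\alpha=\begin{pmatrix}a_\alpha&b_\alpha\\ c_\alpha&d_\alpha\end{pmatrix}$; $P=\{c_\alpha=0\}$. $G_{\mathbb A},P_{\mathbb A},G_q,P_q$ are adelic and local points. $D_q[\mathfrak x,\mathfrak y]=\{x\in G_q: a_x,d_x\in M_n(\mathbb Z_q),b_x\in M_n(\mathfrak x_q),c_x\in M_n(\mathfrak y_q)\}$, $D[\mathfrak x,\mathfrak y]=Sp_n(\mathbb R)\prod_qD_q[\mathfrak x,\mathfrak y]$, $\Gamma[\mathfrak x,\mathfrak y]=G\cap D[\mathfrak x,\mathfrak y]$. $C^\theta=Sp_n(\mathbb R)\prod_qC_q^\theta$, $C_q^\theta=\{\xi\in D_q[1,1]:(a_\xi b_\xi^T)_{ii},(c_\xi d_\xi^T)_{ii}\in2\mathbb Z_q\ \forall i\}$. $\mathbb H_n$ is the Siegel upper half-space, $\gamma z=(a_\gamma z+b_\gamma)(c_\gamma z+d_\gamma)^{-1}$, $j(\gamma,z)=\det(c_\gamma z+d_\gamma)$ (adelic elements act through their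 archimedean component). **Metaplectic group and factors of automorphy.** $1\to\mathbb T\to M_{\mathbb A}\xrightarrow{\mathrm{pr}}G_{\mathbb A}\to1$ is Weil's metaplectic group of unitary operators on $L^2(\mathbb A_{\mathbb Q}^n)$, with canonical lifts $r:G\to M_{\mathbb A}$, $r_P:P_{\mathbb A}\to M_{\mathbb A}$ (homomorphisms), through which $G,P_{\mathbb A}$ are regarded as subgroups. $\mathfrak M=\{\sigma\in M_{\mathbb A}:\mathrm{pr}(\sigma)\in P_{\mathbb A}C^\theta\}$. For $\sigma\in\mathfrak M$, $h(\sigma,\cdot):\mathbb H_n\to\mathbb C$ is Shimura's holomorphic half-integral factor of automorphy: $h(\sigma,z)^2=\zeta j(\mathrm{pr}(\sigma),z)$ with $\zeta=\zeta(\sigma)\in\mathbb T$; $h(r_P(\gamma),z)=|\det(d_\gamma)_\infty|^{1/2}$ for $\gamma\in P_{\mathbb A}$; $h(\rho\sigma\tau,z)=h(\rho,z)h(\sigma,\tau z)h(\tau,z)$ if $\mathrm{pr}(\rho)\in P_{\mathbb A}$, $\mathrm{pr}(\tau)\in C^\theta$; $h(t\sigma,z)=t^{-1}h(\sigma,z)$ for $t\in\mathbb T$; and $h(\gamma,z)=\theta(\gamma z)/\theta(z)$ for $\gamma\in G\cap C^\theta$, $\theta(z)=\sum_{x\in\mathbb Z^n}e(x^Tzx/2)$. Put $j^k_\sigma(z)=h(\sigma,z)j(\mathrm{pr}(\sigma),z)^{[k]}$ and $(f\|_k\sigma)(z)=j_\sigma^k(z)^{-1}f(\sigma z)$. **Modular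 forms.** A Hecke character is a continuous $\psi:\mathbb I_{\mathbb Q}/\mathbb Q^\times\to\mathbb T$; normalised means $\psi_\infty(x)=\operatorname{sgn}(x)^t$; $\psi_{\mathfrak a}=\prod_{q\mid\mathfrak a}\psi_q$. For $\Gamma=\Gamma[\mathfrak b^{-1},\mathfrak b\mathfrak c']$, $\mathcal M_k(\Gamma,\psi)$ is the space of holomorphic $f:\mathbb H_n\to\mathbb C$ (holomorphic at cusps if $n=1$) with $f\|_k\gamma=\psi_{\mathfrak c'}(|a_\gamma|)f$ for all $\gamma\in\Gamma$. **Hecke rings and Satake parameters.** Let $q$ be a prime, $O_q=GL_n(\mathbb Z_q)$, $D_q=D_q[\mathfrak b^{-1},\mathfrak b\mathfrak c]$, $(D_0)_q=D_q\cap P_q$. $\mathcal S_{0q}$ is the Hecke ring (over $\mathbb C$, usual multiplication via right cosets $(D_0)_q\alpha$) of double cosets $A_r=(D_0)_q\,\mathrm{diag}[\tilde r,r](D_0)_q$, $r\in GL_n(\mathbb Q_q)$ (regarded in the metaplectic group through $r_P$). A formal sum $\sum_\alpha c_\alpha(D_0)_q\alpha$ in it, with representatives $\alpha\in P$ lying in $(D_0)_{q'}$ for all $q'\ne q$, acts on weight $k$ forms by $f\mapsto\sum_\alpha c_\alpha\psi_{\mathfrak c}(|a_\alpha|)^{-1}\,|\det d_\alpha|_\infty^{-1/2}\det(d_\alpha)^{-[k]}f(\alpha z)$, where $|\cdot|_\infty$ is the usual absolute value. $\mathcal R_q$ is the complex vector space spanned by the metaplectic double cosets $A_y$ of $D_q\mathrm{diag}[\tilde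 y,y]D_q$, $y\in M_n(\mathbb Z_q)\cap GL_n(\mathbb Q_q)$. One has $D_q\mathrm{diag}[\tilde y,y]D_q=\bigsqcup D_q\alpha_{x,s}$ with $\alpha_{x,s}=\begin{pmatrix}\tilde x&sx\\ 0&x\end{pmatrix}$, $x\in GL_n(\mathbb Q_q)$, $s=s^T\in M_n(\mathbb Q_q)$; the embedding $\varepsilon:\mathcal R_q\to\mathcal S_{0q}$ is $\varepsilon(A_y)=\sum_{x,s}J(r_P(\alpha_{x,s}))^{-1}(D_0)_q\alpha_{x,s}$, where $J(\alpha)=h(\beta,\gamma\mathbf i)h(\gamma,\mathbf i)$ ($\mathbf i=iI_n$) for $\alpha=\beta\,r_P(\mathrm{diag}[\tilde y,y])\gamma$ with $\beta,\gamma\in M_{\mathbb A}$ lying over $D_q$ (trivial at other places). Let $\Phi'_q$ send $(D_0)_q\alpha_{x,s}$ to $O_qx$, and let $\omega_{0q}(O_qx)=\prod_{i=1}^n(q^{-i}x_i)^{a_i}$ if $O_qx$ contains an upper triangular matrix with diagonal $(q^{a_1},\dots,q^{a_n})$; $\omega_q=\omega_{0q}\circ\Phi'_q\circ\varepsilon$. For $q\nmid\mathfrak c$, $\omega_q$ is a linear bijection of $\mathcal R_q$ onto $\mathbb C[x_1^{\pm},\dots,x_n^{\pm}]^{W_n}$, $W_n$ being generated by permutations of the variables and the inversions $x_i\mapsto x_i^{-1}$ (Satake isomorphism). A Hecke eigenform is a nonzero common eigenform of all $\mathcal R_q$ (acting through $\varepsilon$); its Satake $q$-parameters $(\lambda_{q,1},\dots,\lambda_{q,n})$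 are such that $A\in\mathcal R_q$ has eigenvalue $\omega_q(A)(\lambda_{q,1},\dots,\lambda_{q,n})$. **$p$-stabilisation ($p\nmid\mathfrak c$).** $U_p=(D_0)_p\,\mathrm{diag}[p^{-1}I_n,pI_n](D_0)_p\in\mathcal S_{0p}$, which is the disjoint union of the cosets $(D_0)_p\begin{pmatrix}p^{-1}I_n&p^{-1}u\\ 0&pI_n\end{pmatrix}$, $u\in S(\mathfrak b^{-1}/p^2\mathfrak b^{-1})$ (symmetric matrices); it acts on forms of level $\Gamma[\mathfrak b^{-1},\mathfrak b\mathfrak c_0]$ by the same representatives and formula. Let $\widetilde R_n(z)=\prod_{\delta_i\in\{\pm1\}}(1-p^{n(n+1)/2}x_1^{\delta_1}\cdots x_n^{\delta_n}z)=\sum_{m=0}^{2^n}(-1)^m\widetilde T_mz^m$, let $T_m\in\mathcal R_p$ with $\omega_p(T_m)=\widetilde T_m$ (viewed in $\mathcal S_{0p}$ via $\varepsilon$), and $V_{m,p}=\sum_{\ell=0}^m(-1)^\ell T_\ell U_p^{m-\ell}\in\mathcal S_{0p}$. Put $\lambda_0=p^{n(n+1)/2}\lambda_{p,1}\cdots\lambda_{p,n}$ and define the $p$-stabilisation $f_0=\sum_{m=0}^{2^n-1}\lambda_0^{-m}f|V_{m,p}$. *)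

(* Defs.v *)
From HB Require Import structures.
From mathcomp Require Import all_boot all_order all_algebra.
From mathcomp Require Import complex.
From mathcomp Require Import all_classical all_reals all_analysis.

Set Implicit Arguments.
Unset Strict Implicit.
Unset Printing Implicit Defensive.
Import Order.TTheory GRing.Theory Num.Theory.
Import numFieldNormedType.Exports.

Local Open Scope classical_set_scope.
Local Open Scope ring_scope.
Local Open Scope complex_scope.

Definition primeT := {q : nat | prime q}.

(* Z_q is the inverse limit of the Z/q^i, the i-th component being stored as  *)
(* its representative in [0, q^i[.                                            *)
Record padic_int (q : primeT) := PadicInt {
  approx :> nat -> int;
  approx_coh : forall i, approx i = (approx i.+1 %% (val q)%:Z ^+ i)%Z
}.

HB.instance Definition _ q := gen_eqMixin (padic_int q).
HB.instance Definition _ q := gen_choiceMixin (padic_int q).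

Section PadicInt.
Variable q : primeT.
Local Notation Q := ((val q)%:Z).
Implicit Types x y z : padic_int q.

Lemma padic_intP x y : approx x =1 approx y -> x = y.
Proof.
case: x => f hf; case: y => g hg /= /funext fg; subst g.
by congr PadicInt; apply: Prop_irrelevance.
Qed.

Lemma approx_mod x i : (x i %% Q ^+ i)%Z = x i.
Proof. by rewrite (approx_coh x i) modz_mod. Qed.

Lemma approxS x i : (x i.+1 = x i %[mod Q ^+ i])%Z.
Proof. by rewrite approx_mod -approx_coh. Qed.

Lemma padic_of_proof (g : nat -> int) :
  (forall i, (g i.+1 = g i %[mod Q ^+ i])%Z) ->
  forall i, (g i %% Q ^+ i)%Z = ((g i.+1 %% Q ^+ i.+1)%Z %% Q ^+ i)%Z.
Proof.
move=> h i; rewrite -h {1}(divz_eq (g i.+1) (Q ^+ i.+1)).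
by rewrite {2}exprS mulrA modzMDl.
Qed.

Definition padic_of g (h : forall i, (g i.+1 = g i %[mod Q ^+ i])%Z) :=
  PadicInt (padic_of_proof h).

Lemma padic_cst_proof (a : int) i : (a = a %[mod Q ^+ i])%Z. Proof. by []. Qed.
Definition padic_cst a : padic_int q := padic_of (padic_cst_proof a).

Lemma padic_add_proof x y i :
  (x i.+1 + y i.+1 = x i + y i %[mod Q ^+ i])%Z.
Proof. by rewrite -modzDm !approxS modzDm. Qed.
Definition padic_add x y := padic_of (padic_add_proof x y).

Lemma padic_opp_proof x i : (- x i.+1 = - x i %[mod Q ^+ i])%Z.
Proof. by rewrite -modzNm approxS modzNm. Qed.
Definition padic_opp x := padic_of (padic_opp_proof x).

Lemma padic_mul_proof x y i :
  (x i.+1 * y i.+1 = x i * y i %[mod Q ^+ i])%Z.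
Proof. by rewrite -modzMm !approxS modzMm. Qed.
Definition padic_mul x y := padic_of (padic_mul_proof x y).

Fact padic_addA : associative padic_add.
Proof.
by move=> x y z; apply: padic_intP => i /=; rewrite modzDmr modzDml addrA.
Qed.
Fact padic_addC : commutative padic_add.
Proof. by move=> x y; apply: padic_intP => i /=; rewrite addrC. Qed.
Fact padic_add0 : left_id (padic_cst 0) padic_add.
Proof.
by move=> x; apply: padic_intP => i /=; rewrite modzDml add0r approx_mod.
Qed.
Fact padic_addN : left_inverse (padic_cst 0) padic_opp padic_add.
Proof. by move=> x; apply: padic_intP => i /=; rewrite modzDml addNr. Qed.
HB.instance Definition _ := GRing.isZmodule.Build (padic_int q)
  padic_addA padic_addC padic_add0 padic_addN.

Fact padic_mulA : associative padic_mul.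
Proof.
by move=> x y z; apply: padic_intP => i /=; rewrite modzMmr modzMml mulrA.
Qed.
Fact padic_mulC : commutative padic_mul.
Proof. by move=> x y; apply: padic_intP => i /=; rewrite mulrC. Qed.
Fact padic_mul1 : left_id (padic_cst 1) padic_mul.
Proof.
by move=> x; apply: padic_intP => i /=; rewrite modzMml mul1r approx_mod.
Qed.
Fact padic_mulD : left_distributive padic_mul padic_add.
Proof.
by move=> x y z; apply: padic_intP => i /=; rewrite modzMml modzDm mulrDl.
Qed.
Fact padic_1neq0 : padic_cst 1 != 0.
Proof.
apply/eqP => /(congr1 (fun x => approx x 1%N)) /=.
have q1 := prime_gt1 (valP q).
by rewrite expr1 mod0z modz_small // ltz_nat q1.
Qed.
HB.instance Definition _ := GRing.Zmodule_isComNzRing.Build (padic_int q)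
  padic_mulA padic_mulC padic_mul1 padic_mulD padic_1neq0.

Definition padic_unit : {pred padic_int q} :=
  fun x => `[< exists y : padic_int q, y * x = 1 >].
Definition padic_inv x : padic_int q :=
  if x \in padic_unit then xget x [set y | y * x = 1] else x.

Fact padic_mulV : {in padic_unit, left_inverse 1 padic_inv *%R}.
Proof.
move=> x xu; rewrite /padic_inv xu.
by move: xu; rewrite unfold_in => /asboolP /(xgetPex x).
Qed.
Fact padic_unitP x y : y * x = 1 -> padic_unit x.
Proof. by move=> yx; apply/asboolP; exists y. Qed.
Fact padic_inv_out : {in [predC padic_unit], padic_inv =1 id}.
Proof. by move=> x; rewrite inE /padic_inv => /negbTE ->. Qed.
HB.instance Definition _ := GRing.ComNzRing_hasMulInverse.Build (padic_int q)
  padic_mulV padic_unitP padic_inv_out.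

Lemma approx_add x i k : (x (i + k)%N %% Q ^+ i)%Z = x i.
Proof.
elim: k => [|k IH]; first by rewrite addn0 approx_mod.
rewrite addnS -IH; have /eqP := approxS x (i + k)%N.
rewrite eqz_mod_dvd exprD => /(dvdz_trans (dvdz_mulr _ (dvdzz _))) h.
by apply/eqP; rewrite eqz_mod_dvd.
Qed.

Fact padic_integral : GRing.integral_domain_axiom (padic_int q).
Proof.
move=> x y xy0; apply: contraT; rewrite negb_or => /andP[/eqP x0 /eqP y0].
have nz (z : padic_int q) : z <> 0 ->
    exists i, forall k, ~~ (Q ^+ i %| z (i + k)%N)%Z.
  move=> z0; have [i zi] : exists i, z i != 0.
    apply: contrapT => /forallNP h; apply: z0; apply: padic_intP => i /=.
    by rewrite mod0z; apply/eqP; apply: contraT => /(h i).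
  exists i => k; apply: contra zi => /dvdz_mod0P.
  by rewrite approx_add => ->.
have [i hi] := nz _ x0; have [j hj] := nz _ y0.
have := congr1 (fun z : padic_int q => approx z (i + j)%N) xy0.
rewrite /= mod0z => /dvdz_mod0P.
move: (hi j) (hj i); rewrite (addnC j i); move: (x _) (y _) => a b.
rewrite !dvdzE !abszM !abszX !absz_nat => {}hi {}hj.
have pq := valP q; have [a0 b0] : (0 < `|a|)%N /\ (0 < `|b|)%N.
  by split; rewrite lt0n; apply/eqP => z0;
    [move: hi|move: hj]; rewrite z0 dvdn0.
move: hi hj; rewrite !pfactor_dvdn // ?muln_gt0 ?a0 // lognM // -!ltnNge.
by move=> h1 h2; rewrite leqNgt (leq_trans _ (leq_add h1 h2)) // addSn addnS.
Qed.
HB.instance Definition _ :=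
  GRing.ComUnitRing_isIntegral.Build (padic_int q) padic_integral.

End PadicInt.

Notation padic q := {fraction (padic_int q)}.

Section PadicField.
Variable q : primeT.
Implicit Types x : padic q.

Definition in_Zq x := exists a : padic_int q, x = FracField.tofrac a.
Definition Zq_unit x := x != 0 /\ in_Zq x /\ in_Zq x^-1.

Definition padic_val x : int :=
  xget 0 [set m : int | Zq_unit (x / ((val q)%:R : padic q) ^ m)].

Definition Zq_mx m n (A : 'M[padic q]_(m, n)) := forall i j, in_Zq (A i j).

Definition GLZq n (u : 'M[padic q]_n) :=
  [/\ u \in unitmx, Zq_mx u & Zq_mx (invmx u)].

End PadicField.

Section Symplectic.
Variables (F : fieldType) (n : nat).
Implicit Types g : 'M[F]_(n + n).

Definition iota_mx : 'M[F]_(n + n) := block_mx 0 (- 1%:M) 1%:M 0.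
Definition Sp : set 'M[F]_(n + n) := [set g | g^T *m iota_mx *m g = iota_mx].
Definition siegelP : set 'M[F]_(n + n) := [set g | Sp g /\ dlsubmx g = 0].

Definition tilde (y : 'M[F]_n) : 'M[F]_n := invmx y^T.
Definition levi (y : 'M[F]_n) : 'M[F]_(n + n) := block_mx (tilde y) 0 0 y.

End Symplectic.

(* A fractional ideal of Q is represented by its positive generator, so that  *)
(* the completion at q of the ideal of generator x is x Z_q.                  *)
Definition Dgrp n (q : primeT) (x y : rat) : set 'M[padic q]_(n + n) :=
  [set g | [/\ Sp g, Zq_mx (ulsubmx g), Zq_mx (drsubmx g),
               Zq_mx ((ratr x)^-1 *: ursubmx g)
             & Zq_mx ((ratr y)^-1 *: dlsubmx g)]].
Arguments Dgrp : clear implicits.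

Definition Gamma n (x y : rat) : set 'M[rat]_(n + n) :=
  [set g | Sp g /\ forall q, Dgrp n q x y (map_mx ratr g)].
Arguments Gamma : clear implicits.

Section HeckeCharacter.
Variable R : realType.

Definition adele_tuple := (R * (forall q : primeT, padic q))%type.

Definition is_idele (x : adele_tuple) :=
  [/\ x.1 != 0, forall q, x.2 q != 0
    & finite_set [set q | ~ Zq_unit (x.2 q)]].

Definition idele_mul (x y : adele_tuple) : adele_tuple :=
  (x.1 * y.1, fun q => x.2 q * y.2 q).

Definition principal (r : rat) : adele_tuple := (ratr r, fun q => ratr r).

Definition at_infty (x : R) : adele_tuple := (x, fun q => 1).
Definition at_prime (q : primeT) (x : padic q) : adele_tuple :=
  (1, @dfwith primeT (fun l => padic l) (fun=> 1) q x).

(* For a homomorphism into the unit circle, continuity is continuity at 1;    *)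
(* the sets |x_oo - 1| < d, x_q in Z_q^* and x_q in 1 + N Z_q for all q form  *)
(* a basis of neighbourhoods of 1 in the idele topology.                      *)
Definition hecke_character (psi : adele_tuple -> R[i]) :=
  [/\ forall x y, is_idele x -> is_idele y ->
        psi (idele_mul x y) = psi x * psi y,
      forall x, is_idele x -> `|psi x| = 1,
      forall r : rat, r != 0 -> psi (principal r) = 1
    & forall e : R, 0 < e -> exists (N : nat) (d : R),
        [/\ (0 < N)%N, 0 < d & forall x, is_idele x -> `|x.1 - 1| < d ->
          (forall q, Zq_unit (x.2 q) /\ in_Zq ((x.2 q - 1) / N%:R)) ->
          `|psi x - 1| < e%:C]].

Definition normalised (psi : adele_tuple -> R[i]) :=
  exists t : nat, forall x : R, x != 0 -> psi (at_infty x) = (Num.sg x)%:C ^+ t.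

Definition psi_ideal (psi : adele_tuple -> R[i]) (c : nat) (x : rat) : R[i] :=
  \prod_(q <- pmap insub (primes c)) psi (at_prime (ratr x : padic q)).

End HeckeCharacter.

Section ModularForms.
Variables (R : realType) (n : nat).
Local Notation C := R[i].
Implicit Types (f : 'M[C]_n -> C) (z : 'M[C]_n) (g : 'M[rat]_(n + n)).

Definition expC (z : C) : C :=
  (expR (- (2 * pi * complex.Im z)))%:C *
  (cos (2 * pi * complex.Re z) +i* sin (2 * pi * complex.Re z)).

Definition Hn : set 'M[C]_n := [set z | z^T = z /\
  forall v : 'rV[R]_n, v != 0 ->
    0 < (v *m map_mx (@complex.Im R) z *m v^T) 0 0].

Definition cd_mx g z : 'M[C]_n :=
  map_mx ratr (dlsubmx g) *m z + map_mx ratr (drsubmx g).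
Definition act g z : 'M[C]_n :=
  (map_mx ratr (ulsubmx g) *m z + map_mx ratr (ursubmx g)) *m invmx (cd_mx g z).
Definition jfac g z : C := \det (cd_mx g z).

(* H_n is open in the space of symmetric matrices, onto which                 *)
(* w |-> (w + w^T) / 2 is a linear projection.                                *)
Definition holomorphic f := forall z, Hn z ->
  differentiable (fun w : 'M[C]_n => f (2^-1 *: (w + w^T)) : C^o)
                 (z : ('M[C]_n : normedModType C)).

Definition theta z : C := lim ((fun N : nat =>
  \sum_(m : {ffun 'I_n -> 'I_(2 * N).+1})
     let x := \row_i ((m i)%:R - N%:R) : 'rV[C]_n in
     expC (2^-1 * (x *m z *m x^T) 0 0) : C^o) @ \oo).

(* h(g, z) = theta(g z) / theta(z) for g in G \cap C^theta. As theta has      *)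
(* zeros in H_n when n >= 2, the quotient is taken among holomorphic          *)
(* functions.                                                                 *)
Definition hfac g : 'M[C]_n -> C :=
  xget (fun=> 1) [set h | holomorphic h /\
                          forall z, Hn z -> h z * theta z = theta (act g z)].

(* The integer k stands for the weight k + 1/2.                               *)
Definition jk (k : int) g z : C := hfac g z * jfac g z ^ k.
Definition slash (k : int) f g z : C := (jk k g z)^-1 * f (act g z).

(* |f|_k g| is bounded as Im z -> oo, for every g in G; this is raised to the *)
(* power 2, |j^k|^2 being |j|^(2k+1).                                         *)
Definition holomorphic_at_cusps (k : int) f := forall g, Sp g ->
  exists A B : R, forall z, Hn z -> A <= complex.Im (\tr z) ->
    `|f (act g z)| ^+ 2 <= B%:C * `|jfac g z| ^ (2 * k + 1).

(* M_{k+1/2}(Gamma[b^-1, b c], psi) *)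
Definition modular_form (k : int) (b : rat) (c : nat)
    (psi : adele_tuple R -> C) f :=
  [/\ holomorphic f, n = 1%N -> holomorphic_at_cusps k f
    & forall g, Gamma n b^-1 (b * c%:R) g -> forall z, Hn z ->
        slash k f g z = psi_ideal psi c (\det (ulsubmx g)) * f z].

End ModularForms.

Section Weil.
Variables (R : realType) (n : nat) (q : primeT).
Local Notation C := R[i].
Local Notation K := (padic q).
Local Notation qK := ((val q)%:R : K).
Implicit Types (phi : 'rV[K]_n -> C) (g : 'M[K]_(n + n)).

(* The component at q of the additive character of A/Q equal to e(x) at       *)
(* infinity: e_q(x) = e(-y) for y in Z[1/q] with x - y in Z_q.                *)
Definition frac_part (x : K) : rat := xget 0 [set y : rat |
  (exists k : nat, y * (val q)%:R ^+ k \is a Num.int) /\ in_Zq (x - ratr y)].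
Definition eq_char (x : K) : C := expC (- (ratr (frac_part x) : R))%:C.

(* Schwartz-Bruhat functions on Q_q^n (row vectors), a dense subspace of      *)
(* L^2(Q_q^n) which is stable under the metaplectic group.                    *)
Definition schwartz phi := exists N : nat,
  (forall x, phi x != 0 -> Zq_mx (qK ^+ N *: x)) /\
  (forall x h, Zq_mx (qK ^- N *: h) -> phi (x + h) = phi x).

(* Integration against the Haar measure giving Z_q^n volume 1; the sequence   *)
(* below is eventually constant when phi is Schwartz-Bruhat.                  *)
Definition haar phi : C := lim ((fun N : nat =>
  (\sum_(m : {ffun 'I_n -> 'I_(val q ^ (2 * N))})
     phi (\row_i ((m i)%:R / qK ^+ N))) / (val q)%:R ^+ (n * N) : C^o) @ \oo).

Definition heisenberg (w : 'rV[K]_(n + n)) phi : 'rV[K]_n -> C := fun x =>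
  let u := lsubmx w in let v := rsubmx w in
  eq_char (2^-1 * (u *m v^T) 0 0 + (x *m v^T) 0 0) * phi (x + u).

Definition weil_op := ('rV[K]_n -> C) -> ('rV[K]_n -> C).
Definition mp_elt := ('M[K]_(n + n) * weil_op)%type.

(* The preimage of G_q (trivial at the other places) in Weil's metaplectic    *)
(* group: pairs (pr(s), s) with s unitary and s^-1 U(w) s = U(w pr(s)).       *)
Definition Mp : set mp_elt := [set s | Sp s.1 /\
  [/\ forall phi, schwartz phi -> schwartz (s.2 phi),
      forall (a : C) phi1 phi2, schwartz phi1 -> schwartz phi2 ->
        s.2 (fun x => a * phi1 x + phi2 x) =
        (fun x => a * s.2 phi1 x + s.2 phi2 x),
      forall phi, schwartz phi -> exists2 phi', schwartz phi' & s.2 phi' = phi,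
      forall phi, schwartz phi ->
        haar (fun x => `|s.2 phi x| ^+ 2) = haar (fun x => `|phi x| ^+ 2)
    & forall w phi, schwartz phi ->
        heisenberg w (s.2 phi) = s.2 (heisenberg (w *m s.1) phi)]].

Definition mp_mul (s t : mp_elt) : mp_elt := (s.1 *m t.1, s.2 \o t.2).
Definition mp_eq (s t : mp_elt) :=
  s.1 = t.1 /\ forall phi, schwartz phi -> s.2 phi = t.2 phi.

Definition rP g : mp_elt := (g, fun phi x =>
  (Num.sqrt ((val q)%:R ^ (- padic_val (\det (ulsubmx g))) : R))%:C *
  eq_char (2^-1 * (x *m ulsubmx g *m (ursubmx g)^T *m x^T) 0 0) *
  phi (x *m ulsubmx g)).

Definition phi0 : 'rV[K]_n -> C := \1_[set x | Zq_mx x].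

(* For s lying over C^theta_q and trivial at the other places, h(s, z) is     *)
(* constant in z and s phi0 = h(s)^-1 phi0. In general, for pr(s) in C^theta, *)
(* s sends e(x z x^T / 2) tensor phi0 to h(s, z)^-1 times e(x (s z) x^T / 2)  *)
(* tensor phi0; applying phi |-> \sum_(x in Q^n) phi(x), which is invariant   *)
(* under G, this gives h(s, z) = theta(s z) / theta(z) for s in G.            *)
Definition hloc (s : mp_elt) : C := (s.2 phi0 0)^-1.

Variables (b : rat) (c : nat).
Local Notation D := (Dgrp n q b^-1 (b * c%:R)).

Definition admissible (y : 'M[K]_n) := y \in unitmx /\ Zq_mx y.

(* J(r_P(g)); it does not depend on the factorisation of r_P(g).              *)
Definition Jfac g : C := xget 0 [set t : C | exists y beta gamma,
  [/\ admissible y, Mp beta /\ D beta.1, Mp gamma /\ D gamma.1,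
      mp_eq (rP g) (mp_mul beta (mp_mul (rP (levi y)) gamma))
    & t = hloc beta * hloc gamma]].

End Weil.

Section Hecke.
Variables (R : realType) (n : nat) (q : primeT) (b : rat) (c : nat).
Local Notation C := R[i].
Local Notation K := (padic q).
Local Notation D := (Dgrp n q b^-1 (b * c%:R)).
Implicit Types (F : 'M[K]_(n + n) -> C) (g : 'M[K]_(n + n)).

Definition D0 : set 'M[K]_(n + n) := D `&` @siegelP K n.

Definition double_coset (H : set 'M[K]_(n + n)) g : set 'M[K]_(n + n) :=
  [set x | exists d e, [/\ H d, H e & x = d *m g *m e]].

Definition coset0 g : set 'M[K]_(n + n) := [set d *m g | d in D0].
Definition cosets0 : set (set 'M[K]_(n + n)) :=
  [set coset0 g | g in @siegelP K n].
Definition rep0 (X : set 'M[K]_(n + n)) : 'M[K]_(n + n) := xget 1%:M X.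

(* An element \sum_g c_g (D_0)_q g of S_{0q} is represented by the function   *)
(* sending g in P_q to the coefficient of (D_0)_q g, extended by 0: a         *)
(* (D_0)_q-bi-invariant function supported on finitely many cosets.           *)
Definition S0_mul F1 F2 : 'M[K]_(n + n) -> C := fun g =>
  \sum_(X \in cosets0) F1 (g *m invmx (rep0 X)) * F2 (rep0 X).
Definition S0_one : 'M[K]_(n + n) -> C := \1_D0.
Definition S0_exp F (m : nat) := iter m (S0_mul F) S0_one.

Definition U_op : 'M[K]_(n + n) -> C :=
  \1_(double_coset D0 (levi ((val q)%:R%:M : 'M[K]_n))).

(* The vector space R_q, the combination \sum_y c_y A_y being represented by  *)
(* the function \sum_y c_y 1_(D_q diag[~y, y] D_q) on G_q.                    *)
Definition Rq F :=
  (forall d e g, D d -> D e -> F (d *m g *m e) = F g) /\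
  exists s : seq 'M[K]_n, (forall y, y \in s -> admissible y) /\
    forall g, F g != 0 -> exists2 y, y \in s & double_coset D (levi y) g.

(* The embedding of R_q in S_{0q}: since D_q g \cap P_q = (D_0)_q g for g in  *)
(* P_q, the cosets (D_0)_q g met by D_q diag[~y, y] D_q are the               *)
(* (D_0)_q alpha_{x,s}.                                                       *)
Definition eps F : 'M[K]_(n + n) -> C := fun g =>
  if `[< siegelP g >] then (Jfac R b c g)^-1 * F g else 0.

(* omega_{0q}(O_q x) at X = (x_1, ..., x_n), the indices of X being shifted   *)
(* by one. Elements of C[x_1^+-, ..., x_n^+-] are represented by the          *)
(* functions they define on the points with nonzero coordinates.              *)
Definition omega0 (x : 'M[K]_n) (X : 'I_n -> C) : C :=
  let a := xget [ffun=> 0] [set a : {ffun 'I_n -> int} | exists2 u, GLZq u &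
    (forall i j : 'I_n, (j < i)%N -> (u *m x) i j = 0) /\
    (forall i, (u *m x) i i = (val q)%:R ^ a i)] in
  \prod_(i < n) ((val q)%:R ^- i.+1 * X i) ^ a i.

(* omega_{0q} o Phi'_q *)
Definition omegaS0 F (X : 'I_n -> C) : C :=
  \sum_(Y \in cosets0) F (rep0 Y) * omega0 (drsubmx (rep0 Y)) X.
Definition omega F := omegaS0 (eps F).

End Hecke.

Section HeckeAction.
Variables (R : realType) (n : nat) (k : int) (b : rat) (c : nat).
Variables (psi : adele_tuple R -> R[i]) (q : primeT).
Local Notation C := R[i].
Local Notation K := (padic q).
Implicit Types (F : 'M[K]_(n + n) -> C) (f : 'M[C]_n -> C).

Definition global_rep (X : set 'M[K]_(n + n)) : 'M[rat]_(n + n) :=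
  xget 1%:M [set g | [/\ siegelP g, X (map_mx ratr g)
    & forall l : primeT, l != q ->
        D0 b c (map_mx ratr g : 'M[padic l]_(n + n))]].

Definition hecke_act F f : 'M[C]_n -> C := fun z =>
  \sum_(X \in @cosets0 n q b c)
    let g := global_rep X in
    let d := \det (drsubmx g) in
    F (map_mx ratr g) * (psi_ideal psi c (\det (ulsubmx g)))^-1 *
    ((Num.sqrt `|ratr d|)%:C)^-1 * ratr d ^ (- k) * f (act g z).

End HeckeAction.

Section Eigenforms.
Variables (R : realType) (n : nat) (k : int) (b : rat) (c : nat).
Variable psi : adele_tuple R -> R[i].
Local Notation C := R[i].
Implicit Types f : 'M[C]_n -> C.

Definition hecke_eigenform f :=
  (exists2 z, Hn z & f z != 0) /\
  forall q (A : 'M[padic q]_(n + n) -> C), Rq b c A ->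
    exists mu : C, forall z, Hn z ->
      hecke_act k b c psi (eps b c A) f z = mu * f z.

Definition satake_parameters (q : primeT) f (lam : 'I_n -> C) :=
  (forall i, lam i != 0) /\
  forall A : 'M[padic q]_(n + n) -> C, Rq b c A -> forall z, Hn z ->
    hecke_act k b c psi (eps b c A) f z = omega b c A lam * f z.

Variable p : primeT.

Definition Rtilde (X : 'I_n -> C) : {poly C} :=
  \prod_(delta : {ffun 'I_n -> bool})
    (1 - ((val p)%:R ^+ 'C(n.+1, 2) *
          \prod_i (if delta i then X i else (X i)^-1)) *: 'X).

Definition Ttilde (m : nat) (X : 'I_n -> C) : C := (-1) ^+ m * (Rtilde X)`_m.

Variable T : nat -> 'M[padic p]_(n + n) -> C.

Definition is_T := forall m, (m <= 2 ^ n)%N ->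
  Rq b c (T m) /\
  forall X : 'I_n -> C, (forall i, X i != 0) -> omega b c (T m) X = Ttilde m X.

Definition V_op (m : nat) : 'M[padic p]_(n + n) -> C := fun g =>
  \sum_(l < m.+1)
    (-1) ^+ l * S0_mul b c (eps b c (T l)) (S0_exp b c (U_op R b c) (m - l)) g.

Definition lambda0 (lam : 'I_n -> C) : C :=
  (val p)%:R ^+ 'C(n.+1, 2) * \prod_i lam i.

Definition p_stabilisation (lam : 'I_n -> C) f : 'M[C]_n -> C := fun z =>
  \sum_(m < 2 ^ n) lambda0 lam ^- m * hecke_act k b c psi (V_op m) f z.

End Eigenforms.

(* Main.v *)
Require Import Defs.
From HB Require Import structures.
From mathcomp Require Import all_boot all_order all_algebra perm.
From mathcomp Require Import complex.
From mathcomp Require Import all_classical all_reals all_analysis.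
From mathcomp Require Import zify ring lra.
Set Implicit Arguments.
Unset Strict Implicit.
Unset Printing Implicit Defensive.
Import Order.TTheory GRing.Theory Num.Theory.
Import numFieldNormedType.Exports.
Local Open Scope classical_set_scope.
Local Open Scope ring_scope.
Local Open Scope complex_scope.

(* Let U = U_p, N = 2^n and lambda = p^(n(n+1)/2) x_1 ... x_n. The p-stabilisation is an eigenform because
   the element V_N = sum_l (-1)^l T_l U^(N-l) of the Hecke ring of the parabolic vanishes: then
   f|V_N = 0 and f_0|U telescopes. The Satake transform of V_N is lambda^N Rtilde(lambda^-1) = 0. On the
   parabolic this transform is not injective, but it is on bi-invariant functions supported on the
   diag[~d, d] [1, v; 0, 1] with v integral. The exponents of the monomials of Ttilde_l are at most N - l,
   and a leading term argument bounds by p^(N-l) the denominators of the support of the image of T_l;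
   right multiplication by U^(N-l) therefore clears the denominators of v.

   For the modularity of f|U one moves gamma past the representatives alpha of U, say
   alpha gamma = gamma' alpha', and has to compare the half-integral factors h(gamma', alpha' z) and
   h(gamma, z), that is theta(alpha gamma z) theta(z) and theta(gamma z) theta(alpha' z). Up to scalars
   w |-> theta(z, w) is the only entire function with its quasi-periodicity (Fejer means along the real
   periods, then the imaginary periods), which yields the transformation of theta with characteristics;
   theta(alpha z) is a sum of such functions. As h is only characterised by h(gamma, z) theta(z) =
   theta(gamma z), the possible zeros of theta are avoided on rays z + i t, on which theta is a power
   series in exp(-t). *)

(** * p-adic numbers and matrices over Z_p *)

(** No commutation of the T_l with U is used: in T_l U^(m-l) the left factor acts first, on f, where
    it is a scalar. So f|V_m = sum_l r_l f|U^(m-l), with r_l the coefficients of Rtilde at the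
    Satake parameters, and f|V_m U = f|V_(m+1) - r_(m+1) f; the surplus terms add up to a multiple
    of Rtilde(lambda^-1) = 0.

    Several objects are known only as choices. J is never computed: its set of possible values is
    bi-invariant under D_0, and contains only nonzero numbers at diag[~y, y]; the leading term
    argument needs nothing more. In the same way h is compared through the set of functions among
    which it is chosen, which moves as a whole from gamma to gamma'.

    The evenness of b^-1 and bc has two effects. It forces 4 | c, so p is odd, b, c and 2 are units
    at p, and D_p is the full integral symplectic group. It also removes every sign from the
    quasi-periodicity of theta(z, w) and of its transform.

    The matrices gamma' stay at level c p^2, so each f|U^j, hence f_0, has this level; the exponent
    2 (2^n - 1) of the statement is at least 2. *)

Lemma PoszX (a k : nat) : (a ^ k)%N%:Z = a%:Z ^+ k.
Proof. by rewrite -!natz natrX. Qed.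

Section PadicIntTheory.
Variable q : primeT.
Local Notation Q := ((val q)%:Z).
Implicit Types x y : padic_int q.

Lemma padic_intE (m : int) : m%:~R = padic_cst q m.
Proof.
have natE (k : nat) : k%:R = padic_cst q k%:Z.
  elim: k => [|k IH]; first by apply: padic_intP.
  rewrite -natr1 IH; apply: padic_intP => i /=.
  by rewrite modzDm -PoszD addn1.
case: m => k; first exact: natE.
rewrite NegzE mulrNz -pmulrn natE; apply: padic_intP => i /=.
by rewrite modzNm.
Qed.

Lemma approx_int (m : int) i : (m%:~R : padic_int q) i = (m %% Q ^+ i)%Z.
Proof. by rewrite padic_intE. Qed.

Lemma approxB x y i : (x - y) i = ((x i - y i) %% Q ^+ i)%Z.
Proof. by rewrite /= modzDmr. Qed.

(** Dividing by [Q ^+ i] costs i digits of precision, so the j-th approximation of the quotient is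
    read off from x modulo [Q ^+ (i + j)]. *)
Lemma padic_int_dvd x i : x i = 0 -> exists y, x = Q%:~R ^+ i * y.
Proof.
move=> x0; pose g j := (x (i + j)%N %/ Q ^+ i)%Z.
have dv j : (Q ^+ i %| x (i + j)%N)%Z by apply/dvdz_mod0P; rewrite approx_add.
have qi0 : Q ^+ i != 0.
  by rewrite expf_neq0 //; case: q => p pp /=; rewrite -lt0n prime_gt0.
have hg j : (g j.+1 = g j %[mod Q ^+ j])%Z.
  apply/eqP; rewrite eqz_mod_dvd -(dvdz_mul2r (p := Q ^+ i)) //.
  rewrite mulrBl /g !divzK // -exprD [(j + i)%N]addnC -eqz_mod_dvd addnS; apply/eqP.
  exact: approxS.
exists (padic_of hg); apply: padic_intP => j.
rewrite -rmorphXn /= padic_intE /= modzMm mulrC divzK //.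
by rewrite addnC approx_add.
Qed.

(** The Bezout coefficient of [x i] against [Q ^+ i] inverts it modulo [Q ^+ i]; these inverses are
    coherent because an inverse is unique. *)
Lemma padic_int_unit x : x 1%N != 0 -> x \is a GRing.unit.
Proof.
move=> x1; pose g i := (egcdz (x i) (Q ^+ i)).1.
have cop i : (Q ^+ i %| x i * g i - 1)%Z.
  case: i => [|i]; first by rewrite expr0 dvd1z.
  have : coprimez (x i.+1) (Q ^+ i.+1).
    rewrite /coprimez; apply/eqP.
    suff: coprime `|x i.+1| (val q ^ i.+1).
      by rewrite /coprime => /eqP; rewrite /gcdz abszX absz_nat => ->.
    rewrite coprimeXr // coprime_sym prime_coprime ?(valP q) //.
    apply: contra x1 => d.
    have := approx_add x 1 i; rewrite add1n => <-.
    by apply/eqP/dvdz_mod0P; rewrite expr1 dvdzE absz_nat.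
  rewrite /g; case: egcdzP => u v /= e _ /eqP g1; rewrite g1 in e.
  by apply/dvdzP; exists (- v); rewrite -[X in _ - X]e; ring.
have hg i : (g i.+1 = g i %[mod Q ^+ i])%Z.
  apply/eqP; rewrite eqz_mod_dvd.
  have c1 := cop i; have c2 := cop i.+1.
  have c3 : (Q ^+ i %| x i.+1 - x i)%Z by rewrite -eqz_mod_dvd approxS.
  have {}c2 : (Q ^+ i %| x i.+1 * g i.+1 - 1)%Z.
    by apply: dvdz_trans c2; rewrite exprS dvdz_mull.
  have -> : g i.+1 - g i = - g i.+1 * (x i * g i - 1) +
     g i * ((x i.+1 * g i.+1 - 1) - (x i.+1 - x i) * g i.+1) by ring.
  by rewrite rpredD ?dvdz_mull // rpredB // dvdz_mulr.
apply/asboolP; exists (padic_of hg); apply: padic_intP => i /=.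
rewrite modzMml mulrC; apply/eqP; rewrite eqz_mod_dvd.
exact: cop.
Qed.

Lemma padic_int_factor x : x != 0 ->
  exists k u, u \is a GRing.unit /\ x = Q%:~R ^+ k * u.
Proof.
move=> x0; have ex : exists i, x i != 0.
  apply: contrapT => /forallNP h; case/eqP: x0; apply: padic_intP => i /=.
  by rewrite mod0z; apply/eqP; apply: contraT => /(h i).
(* The exponent is one below the first nonzero approximation; index 0 is excluded, since [x 0] is a
   residue modulo 1. *)
case: (ex_minnP ex) => -[|k] xk kmin.
  by have := approx_mod x 0; rewrite expr0 modz1 => e; rewrite -e eqxx in xk.
have /padic_int_dvd[u xE] : x k = 0.
  by apply/eqP; apply: contraT => /kmin; rewrite ltnn.
exists k, u; split=> //; apply: padic_int_unit.
apply: contra xk => /eqP /padic_int_dvd[v uE].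
by rewrite xE uE mulrA -exprD addn1 -rmorphXn /= padic_intE /= modzz mul0r mod0z.
Qed.

End PadicIntTheory.

Section PadicFieldTheory.
Variable q : primeT.
Local Notation K := (padic q).
Local Notation Q := ((val q)%:R : K).
Local Notation F := (@FracField.tofrac (padic_int q)).
Implicit Types (x y : K) (a b : padic_int q).

Lemma fracP x : exists a b, b != 0 /\ x = F a / F b.
Proof.
elim/quotW: x => r; exists (frac r).1, (frac r).2; rewrite denom_ratioP; split=> //.
have d0 : F (frac r).2 != 0 by rewrite tofrac_eq0 denom_ratioP.
apply: (mulIf d0); rewrite divfK //; unlock FracField.tofrac.
rewrite -[LHS]FracField.pi_mul; apply/eqmodP.
rewrite /= FracField.equivfE /FracField.mulf.
rewrite !numden_Ratio ?oner_neq0 ?mulr1 ?denom_ratioP //=.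
by rewrite mulrC.
Qed.

Lemma padic_q_neq0 : Q != 0.
Proof.
rewrite -(rmorph_nat F) tofrac_eq0 -[_%:R]/(((val q)%:Z)%:~R) padic_intE.
apply/eqP => /(congr1 (fun z : padic_int q => z 2%N)) /=; rewrite mod0z => /eqP.
rewrite modz_small; first by case: (q) => p pp /= /eqP[] p0; rewrite p0 in pp.
rewrite lez_nat /= -PoszX ltz_nat -{1}[sval q]expn1 ltn_exp2l //.
exact: prime_gt1 (valP q).
Qed.

Lemma in_Zq0 : in_Zq (0 : K). Proof. by exists 0; rewrite rmorph0. Qed.
Lemma in_Zq1 : in_Zq (1 : K). Proof. by exists 1; rewrite rmorph1. Qed.
Lemma in_ZqD x y : in_Zq x -> in_Zq y -> in_Zq (x + y).
Proof. by move=> [a ->] [b ->]; exists (a + b); rewrite rmorphD. Qed.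
Lemma in_ZqN x : in_Zq x -> in_Zq (- x).
Proof. by move=> [a ->]; exists (- a); rewrite rmorphN. Qed.
Lemma in_ZqB x y : in_Zq x -> in_Zq y -> in_Zq (x - y).
Proof. by move=> hx hy; apply/in_ZqD/in_ZqN. Qed.
Lemma in_ZqM x y : in_Zq x -> in_Zq y -> in_Zq (x * y).
Proof. by move=> [a ->] [b ->]; exists (a * b); rewrite rmorphM. Qed.
Lemma in_Zq_int (m : int) : in_Zq (m%:~R : K).
Proof. by exists m%:~R; rewrite rmorph_int. Qed.
Lemma in_Zq_nat (m : nat) : in_Zq (m%:R : K).
Proof. exact: (in_Zq_int m). Qed.
Lemma in_ZqX x m : in_Zq x -> in_Zq (x ^+ m).
Proof. by move=> [a ->]; exists (a ^+ m); rewrite rmorphXn. Qed.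
Lemma in_Zq_sum I r (P : pred I) (E : I -> K) :
  (forall i, P i -> in_Zq (E i)) -> in_Zq (\sum_(i <- r | P i) E i).
Proof.
by move=> h; elim/big_ind: _ => //; [exact: in_Zq0|exact: in_ZqD].
Qed.
Lemma in_Zq_prod I r (P : pred I) (E : I -> K) :
  (forall i, P i -> in_Zq (E i)) -> in_Zq (\prod_(i <- r | P i) E i).
Proof.
by move=> h; elim/big_ind: _ => //; [exact: in_Zq1|exact: in_ZqM].
Qed.
Hint Resolve in_Zq0 in_Zq1 in_Zq_int in_Zq_nat : core.

Lemma Zq_unitP a : a \is a GRing.unit -> Zq_unit (F a).
Proof.
move=> ua; have a0 : a != 0 by apply: contraTneq ua => ->; rewrite unitr0.
split; first by rewrite tofrac_eq0.
split; first by exists a.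
by exists a^-1; apply: (mulfI (x := F a)); rewrite ?tofrac_eq0 // divff
  ?tofrac_eq0 // -rmorphM /= divrr.
Qed.

Lemma Zq_unit1 : Zq_unit (1 : K).
Proof. by rewrite /Zq_unit oner_neq0 invr1. Qed.
Lemma Zq_unitM x y : Zq_unit x -> Zq_unit y -> Zq_unit (x * y).
Proof.
move=> [x0 [hx hx']] [y0 [hy hy']]; split; first by rewrite mulf_neq0.
by rewrite invfM; split; apply: in_ZqM.
Qed.
Lemma Zq_unitV x : Zq_unit x -> Zq_unit x^-1.
Proof. by move=> [x0 [hx hx']]; split; rewrite ?invr_eq0 // invrK. Qed.

Lemma padic_factor x : x != 0 -> exists (m : int) u, Zq_unit u /\ x = Q ^ m * u.
Proof.
have [a [b [b0 ->]]] := fracP x => x0.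
have a0 : a != 0 by apply: contraNneq x0 => ->; rewrite rmorph0 mul0r.
have [k [u [uu ->]]] := padic_int_factor a0.
have [l [v [vu ->]]] := padic_int_factor b0.
exists (k%:Z - l%:Z), (F u / F v); split.
  by apply/Zq_unitM/Zq_unitV; apply: Zq_unitP.
rewrite !rmorphM !rmorphXn /= !rmorph_int expfzDr ?padic_q_neq0 //.
rewrite -invr_expz -!exprnP -!pmulrn invfM; ring.
Qed.

Lemma padic_q_ninv : ~ in_Zq Q^-1.
Proof.
move=> [a qa]; have : 1 = F (a * (val q)%:R).
  by rewrite rmorphM rmorph_nat /= -qa mulVf ?padic_q_neq0.
move=> /eqP; rewrite -(rmorph1 F) tofrac_eq.
move=> /eqP /(congr1 (fun z : padic_int q => z 1%N)) /=.
rewrite -[(val q)%:R]/(((val q)%:Z)%:~R) padic_intE /= modzMmr expr1.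
rewrite modzMl modz_small // ltz_nat.
exact: prime_gt1 (valP q).
Qed.

Lemma in_Zq_qexp (m : int) u : Zq_unit u -> in_Zq (Q ^ m * u) <-> 0 <= m.
Proof.
move=> uu; split; last first.
  case: m => // k _; apply: in_ZqM; last by case: uu => ? [].
  by rewrite -exprnP; apply: in_ZqX.
case: m => // k h; exfalso; apply: padic_q_ninv.
have -> : Q^-1 = Q ^+ k * (Q ^ Negz k * u) * u^-1.
  rewrite NegzE -exprnN exprS; case: uu => u0 _.
  rewrite mulrA mulfK // invfM [RHS]mulrC -mulrA mulVf ?mulr1 //.
  by rewrite expf_neq0 ?padic_q_neq0.
apply: in_ZqM; last by case: uu => ? [].
by apply: in_ZqM => //; apply: in_ZqX.
Qed.

Lemma padic_natr_neq0 (m : nat) : (0 < m)%N -> m%:R != 0 :> K.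
Proof.
move=> m0; rewrite -(rmorph_nat F) tofrac_eq0 -[_%:R]/((m%:Z)%:~R) padic_intE.
apply/eqP => /(congr1 (fun z : padic_int q => z m)) /=; rewrite mod0z => /eqP.
rewrite modz_small; first by move=> /eqP[] m00; rewrite m00 in m0.
rewrite lez_nat /= -PoszX ltz_nat ltn_expl //; exact: prime_gt1 (valP q).
Qed.

End PadicFieldTheory.

#[global] Hint Resolve in_Zq0 in_Zq1 in_Zq_int in_Zq_nat padic_q_neq0 Zq_unit1 : core.

Section RatPadic.
Variable q : primeT.
Local Notation K := (padic q).
Local Notation Q := ((val q)%:R : K).
Implicit Types (x y : K) (r : rat).

Lemma padic_intr_neq0 (m : int) : m != 0 -> m%:~R != 0 :> K.
Proof.
case: m => m; first by rewrite eqz_nat -lt0n -pmulrn; exact: padic_natr_neq0.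
by move=> _; rewrite NegzE mulrNz oppr_eq0 -pmulrn padic_natr_neq0.
Qed.

Lemma qX_neq0 (k : nat) : Q ^+ k != 0.
Proof. by rewrite expf_neq0 ?padic_q_neq0. Qed.
Lemma qz_neq0 (m : int) : Q ^ m != 0.
Proof. by rewrite expfz_neq0 ?padic_q_neq0. Qed.

(** [ratr] under a name that carries the structure of a ring morphism into Q_q; the proofs rest on
    nonzero integers staying nonzero there. *)
Definition rq : rat -> K := ratr.

Lemma rq_frac (a b : int) : b != 0 -> rq (a%:~R / b%:~R) = a%:~R / b%:~R.
Proof.
move=> b0; rewrite /rq /ratr; set r : rat := a%:~R / b%:~R.
have rb : r * b%:~R = a%:~R by rewrite /r divfK // intr_eq0.
have d0 : (denq r)%:~R != 0 :> K by rewrite padic_intr_neq0 ?denq_eq0.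
have : numq r * b = a * denq r.
  apply: (@intr_inj rat); rewrite !rmorphM /= -rb numqE; exact: mulrAC.
move/(congr1 (fun m : int => m%:~R : K)); rewrite !rmorphM /= => e.
by apply/eqP; rewrite eqr_div ?padic_intr_neq0 ?denq_eq0 // e mulrC.
Qed.

Lemma rq_zmod_morphism : zmod_morphism rq.
Proof.
move=> r s; rewrite -[in LHS](divq_num_den r) -[in LHS](divq_num_den s).
have dr : (denq r)%:~R != 0 :> rat by rewrite intr_eq0 denq_eq0.
have ds : (denq s)%:~R != 0 :> rat by rewrite intr_eq0 denq_eq0.
have dr' : (denq r)%:~R != 0 :> K by rewrite padic_intr_neq0 ?denq_eq0.
have ds' : (denq s)%:~R != 0 :> K by rewrite padic_intr_neq0 ?denq_eq0.
rewrite -mulNr addf_div // -rmorphN -!rmorphM /= -rmorphD /= rq_frac; last first.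
  by rewrite mulf_neq0 ?denq_eq0.
by rewrite !(rmorphD, rmorphM, rmorphN) /= /rq /ratr -mulNr addf_div.
Qed.

Lemma rq_monoid_morphism : monoid_morphism rq.
Proof.
split; first by rewrite -[1]/(1%:~R) -[1%:~R]divr1 -[1]/(1%:~R) rq_frac // divr1.
move=> r s; rewrite -[in LHS](divq_num_den r) -[in LHS](divq_num_den s).
rewrite mulf_div -!rmorphM /= rq_frac; last by rewrite mulf_neq0 ?denq_eq0.
by rewrite !rmorphM /= /rq /ratr mulf_div.
Qed.

HB.instance Definition _ := GRing.isZmodMorphism.Build rat K rq rq_zmod_morphism.
HB.instance Definition _ := GRing.isMonoidMorphism.Build rat K rq rq_monoid_morphism.

Lemma rqE : (ratr : rat -> K) = rq. Proof. by []. Qed.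

Lemma in_Zq_unitN m : ~~ (val q %| m)%N -> Zq_unit (m%:R : K).
Proof.
move=> hm; rewrite -(rmorph_nat (@FracField.tofrac _)); apply: Zq_unitP.
apply: padic_int_unit; rewrite pmulrn padic_intE /= expr1.
by apply: contra hm => /eqP/dvdz_mod0P; rewrite dvdzE.
Qed.

Lemma in_Zq_intP (m : int) k : in_Zq ((m%:~R : K) / Q ^+ k) -> ((val q)%:Z ^+ k %| m)%Z.
Proof.
move=> [a e]; have : (m%:~R : padic_int q) = a * (val q)%:R ^+ k.
  apply/eqP; rewrite -tofrac_eq rmorphM rmorphXn rmorph_nat /= rmorph_int -e.
  by rewrite divfK ?qX_neq0.
move/(congr1 (fun z : padic_int q => z k)); rewrite padic_intE /=.
have -> : (val q)%:R ^+ k = padic_cst q ((val q)%:Z ^+ k).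
  by rewrite -padic_intE rmorphXn.
by rewrite /= modzz mulr0 mod0z => /dvdz_mod0P.
Qed.

Lemma in_Zq_ratr r : in_Zq (rq r) <-> ~~ (val q %| `|denq r|)%N.
Proof.
have dN : rq r = (numq r)%:~R / (`|denq r|%N)%:R.
  by rewrite /rq /ratr -{1}[denq r]gez0_abs ?denq_ge0.
split; last first.
  by move=> h; rewrite dN; apply: in_ZqM; [exact: in_Zq_int|case: (in_Zq_unitN h) => ? []].
move=> h; apply/negP => dv.
have d0 : (`|denq r|%N)%:R != 0 :> K by rewrite padic_natr_neq0 ?absz_gt0 ?denq_eq0.
have : in_Zq ((numq r)%:~R / Q ^+ 1).
  have [m e] := dvdnP dv; rewrite -[_%:~R](divfK d0) -dN e natrM mulrA expr1 mulfK ?padic_q_neq0 //.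
  by apply: in_ZqM; [exact: h|exact: in_Zq_nat].
move/in_Zq_intP; rewrite expr1 dvdzE absz_nat => dv2.
have /eqP cop := coprime_num_den r.
have := dvdn_gcd (val q) `|numq r| `|denq r|; rewrite dv dv2 cop /= => /idP.
by rewrite dvdn1 => /eqP q1; have := prime_gt1 (valP q); rewrite /= q1.
Qed.

Lemma padic_valP x : x != 0 -> Zq_unit (x / Q ^ padic_val x).
Proof.
move=> x0; rewrite /padic_val; apply: (@xgetPex _ 0 [set m | Zq_unit (x / Q ^ m)]).
have [m [u [uu ->]]] := padic_factor x0; exists m => /=.
by rewrite mulrAC mulfV ?mul1r // qz_neq0.
Qed.

Lemma padic_valE x : x != 0 -> exists2 u, Zq_unit u & x = Q ^ padic_val x * u.
Proof.
move=> x0; exists (x / Q ^ padic_val x); first exact: padic_valP.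
by rewrite mulrCA mulfV ?mulr1 // qz_neq0.
Qed.

Lemma mulf_div_swap (F : fieldType) (a b u v : F) :
  b != 0 -> a * u = b * v -> a / b * u = v.
Proof. by move=> b0 e; rewrite mulrAC e mulrAC mulfV ?mul1r. Qed.

Lemma Zq_unit_val m u v : Zq_unit u -> Zq_unit v -> Q ^ m * u = v -> m = 0.
Proof.
move=> uu vu e; apply/eqP; rewrite eq_le.
have /(in_Zq_qexp _ uu) -> : in_Zq (Q ^ m * u) by rewrite e; case: vu => ? [].
have /(in_Zq_qexp _ (Zq_unitV uu)) : in_Zq (Q ^ (- m) * u^-1).
  by rewrite -invr_expz -invfM e; case: vu => ? [].
by rewrite oppr_ge0 => ->.
Qed.

Lemma padic_val_unique m u : Zq_unit u -> padic_val (Q ^ m * u) = m.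
Proof.
move=> uu; have [u0 _] := uu.
have x0 : Q ^ m * u != 0 by rewrite mulf_neq0 // qz_neq0.
have [v vu e] := padic_valE x0; apply/eqP; rewrite eq_sym -subr_eq0; apply/eqP.
apply: (Zq_unit_val uu vu); by rewrite expfzDr ?padic_q_neq0 // -invr_expz; apply/mulf_div_swap/e/qz_neq0.
Qed.

Lemma padic_valM x y : x != 0 -> y != 0 ->
  padic_val (x * y) = padic_val x + padic_val y.
Proof.
move=> x0 y0; have [u uu e] := padic_valE x0; have [v vu e'] := padic_valE y0.
rewrite [in LHS]e [in LHS]e' mulrACA -expfzDr ?padic_q_neq0 // padic_val_unique //.
exact: Zq_unitM.
Qed.

Lemma padic_val_Zq_unit x : Zq_unit x -> padic_val x = 0.
Proof. by move=> xu; have := padic_val_unique 0 xu; rewrite mul1r. Qed.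

Lemma in_Zq_val x : x != 0 -> in_Zq x <-> 0 <= padic_val x.
Proof.
by move=> x0; have [u uu e] := padic_valE x0; rewrite {1}e; apply: in_Zq_qexp.
Qed.

Lemma in_Zq_quo x y : x != 0 -> y != 0 ->
  in_Zq (x / y) <-> padic_val y <= padic_val x.
Proof.
move=> x0 y0; rewrite in_Zq_val ?mulf_neq0 ?invr_eq0 //.
suff -> : padic_val x = padic_val (x / y) + padic_val y by rewrite lerDr.
by rewrite -padic_valM ?divfK ?mulf_neq0 ?invr_eq0.
Qed.

(** An entry of least valuation divides all the others; this choice of pivot keeps elimination over
    Z_q integral. *)
Lemma padic_pivot (I : finType) (x : I -> K) i0 : x i0 != 0 ->
  exists2 i, x i != 0 & forall j, in_Zq (x j / x i).
Proof.
move=> x0; case: (@Order.TotalTheory.arg_minP _ _ I i0 (fun i => x i != 0)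
  (fun i => padic_val (x i)) x0) => i xi imin.
exists i => // j; have [->|xj] := eqVneq (x j) 0; first by rewrite mul0r.
by apply/in_Zq_quo => //; exact: imin.
Qed.

Lemma in_Zq_approx x k : in_Zq x ->
  exists2 m : nat, (m < val q ^ k)%N & in_Zq ((x - m%:R) / Q ^+ k).
Proof.
move=> [a ->]; have qk0 : (val q)%:Z ^+ k != 0.
  by rewrite expf_neq0 //; case: (q) => p pp /=; rewrite eqz_nat -lt0n prime_gt0.
have : 0 <= a k < (val q)%:Z ^+ k.
  by rewrite -(approx_mod a k) modz_ge0 //= ltz_pmod // lt_neqAle eq_sym qk0 exprn_ge0.
case e : (a k) => [m|m] // /andP[_]; rewrite -PoszX ltz_nat => mlt.
exists m => //; have /padic_int_dvd[y ey] : (a - (m%:Z)%:~R : padic_int q) k = 0.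
  by rewrite approxB approx_int e -modzDmr modzNm modzDmr subrr mod0z.
exists y; have -> : m%:R = FracField.tofrac (m%:~R : padic_int q).
  by rewrite rmorph_int.
rewrite -rmorphB /= ey.
by rewrite rmorphM rmorphXn rmorph_int /= mulrAC mulfV ?mul1r // qX_neq0.
Qed.

Lemma padic_den x : exists k, in_Zq (Q ^+ k * x).
Proof.
have [->|x0] := eqVneq x 0; first by exists 0; rewrite mulr0.
have [u uu e] := padic_valE x0; exists `|padic_val x|%N.
rewrite [X in _ * X]e mulrA exprnP -expfzDr ?padic_q_neq0 //; apply/(in_Zq_qexp _ uu); lia.
Qed.

(** The approximant lies in Z[1/q], hence is integral at every other prime; strong approximation and
    the additive character e_q both rest on this. *)
Lemma padic_rat_approx x k : exists r : rat,
  (exists l : nat, r * (val q)%:R ^+ l \is a Num.int) /\ in_Zq ((x - rq r) / Q ^+ k).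
Proof.
have [l hl] := padic_den x; have [m _ hm] := in_Zq_approx (k + l) hl.
exists (m%:R / (val q)%:R ^+ l); split.
  exists l; rewrite divfK ?intr_nat //; apply/expf_neq0.
  by case: (q) => p pp; rewrite pnatr_eq0 /= -lt0n prime_gt0.
rewrite fmorph_div rmorphXn !rmorph_nat /=.
suff -> : (x - m%:R / Q ^+ l) / Q ^+ k = (Q ^+ l * x - m%:R) / Q ^+ (k + l) by [].
rewrite exprD; set A := Q ^+ k; set B := Q ^+ l.
by rewrite invfM mulrBl mulrBl !mulrA; congr (_ - _);
  rewrite ?[_ / A / B]mulrAC // [B * x]mulrC mulfK ?qX_neq0.
Qed.

End RatPadic.

Lemma rat_int_local (r : rat) : (forall q, in_Zq (rq q r)) -> r \is a Num.int.
Proof.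
move=> h; rewrite -[r]divq_num_den.
suff -> : denq r = 1 by rewrite divr1 intr_int.
have d0 := denq_gt0 r; have := h; case: (denq r) d0 (in_Zq_ratr^~ r) => // d d0 e _.
congr Posz; apply/eqP; apply: contraT => d1.
have : (1 < d)%N by case: d d0 d1 {e} => // -[].
move=> /pdiv_prime pp; have := e (exist (fun q => is_true (prime q)) _ pp).
rewrite absz_nat /= pdiv_dvd /= => -[/(_ (h _))]; by [].
Qed.

Lemma split_ord_ind m n (P : 'I_(m + n) -> Prop) :
  (forall i, P (lshift n i)) -> (forall j, P (rshift m j)) -> forall k, P k.
Proof. by move=> hl hr k; rewrite -(splitK k); case: (fintype.split k). Qed.

Section Pivot.
Variables (F : fieldType) (n : nat) (y : 'M[F]_(1 + n)) (d e u : F).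
Hypotheses (ulE : ulsubmx y = d%:M) (d0 : d != 0) (u0 : u != 0) (de : d = e * u).
Let c := d^-1 *: dlsubmx y.
Let r := d^-1 *: ursubmx y.

(** Elimination below a corner [d = e * u], with u the unit part of the pivot: scaling the first row
    leaves the pure power e which the Hermite form requires. *)
Lemma pivot_row : block_mx (u^-1)%:M 0 (- c) 1%:M *m y =
  block_mx e%:M (u^-1 *: ursubmx y) 0 (drsubmx y - c *m ursubmx y).
Proof.
rewrite -{1}[y]submxK mulmx_block ulE !mul0mx !addr0 !mul1mx !mul_scalar_mx.
congr block_mx.
- by rewrite scale_scalar_mx de mulrC mulfK.
- by rewrite mulNmx mul_mx_scalar scalerA mulfV // scale1r addNr.
- by rewrite mulNmx addrC.
Qed.

Lemma pivot_row_col : y = block_mx u%:M 0 (u *: c) 1%:M *m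
   block_mx e%:M 0 0 (drsubmx y - d *: (c *m r)) *m block_mx 1%:M r 0 1%:M.
Proof.
rewrite !mulmx_block !(mul0mx, mulmx0, mul1mx, mulmx1, addr0, add0r).
rewrite -[LHS]submxK ulE; congr block_mx.
- by rewrite -scalar_mxM mulrC -de.
- by rewrite -scalar_mxM mulrC -de mul_scalar_mx scalerA mulfV // scale1r.
- by rewrite mul_mx_scalar scalerA -de scalerA mulfV // scale1r.
- by rewrite mul_mx_scalar scalerA -de -scalemxAl addrC subrK.
Qed.
End Pivot.

Lemma invmx_conj (F : fieldType) n (d : F) (x u a v : 'M[F]_n) :
  u \in unitmx -> v \in unitmx -> x = u *m a *m v ->
  invmx u *m (d *: x) *m invmx v = d *: a.
Proof. by move=> uu uv ->; rewrite -scalemxAr -scalemxAl -!mulmxA mulKmx // mulmxA mulmxK. Qed.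

Section PadicMatrix.
Variable q : primeT.
Local Notation K := (padic q).
Local Notation Q := ((val q)%:R : K).

Lemma Zq_mxM m n p (A : 'M[K]_(m, n)) (B : 'M[K]_(n, p)) :
  Zq_mx A -> Zq_mx B -> Zq_mx (A *m B).
Proof. by move=> hA hB i j; rewrite mxE; apply: in_Zq_sum => k _; apply: in_ZqM. Qed.
Lemma Zq_mxD m n (A B : 'M[K]_(m, n)) : Zq_mx A -> Zq_mx B -> Zq_mx (A + B).
Proof. by move=> hA hB i j; rewrite mxE; apply: in_ZqD. Qed.
Lemma Zq_mxN m n (A : 'M[K]_(m, n)) : Zq_mx A -> Zq_mx (- A).
Proof. by move=> hA i j; rewrite mxE; apply: in_ZqN. Qed.
Lemma Zq_mxZ m n c (A : 'M[K]_(m, n)) : in_Zq c -> Zq_mx A -> Zq_mx (c *: A).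
Proof. by move=> hc hA i j; rewrite mxE; apply: in_ZqM. Qed.
Lemma Zq_mx_unitZ (u : K) m j (A : 'M[K]_(m, j)) : Zq_unit u -> Zq_mx (u *: A) <-> Zq_mx A.
Proof.
move=> [u0 [h1 h2]]; split=> h; last exact: Zq_mxZ.
have := Zq_mxZ h2 h; by rewrite scalerA mulVf // scale1r.
Qed.
Lemma Zq_mx_tr m n (A : 'M[K]_(m, n)) : Zq_mx A -> Zq_mx A^T.
Proof. by move=> hA i j; rewrite mxE. Qed.
Lemma Zq_mx0 m n : Zq_mx (0 : 'M[K]_(m, n)).
Proof. by move=> i j; rewrite mxE; apply: in_Zq0. Qed.
Lemma Zq_mx_scalar n c : in_Zq c -> Zq_mx (c%:M : 'M[K]_n).
Proof. by move=> h i j; rewrite mxE; case: (_ == _); rewrite ?mulr0n //; exact: in_Zq0. Qed.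
Lemma Zq_mx1 n : Zq_mx (1%:M : 'M[K]_n).
Proof. exact/Zq_mx_scalar/in_Zq1. Qed.

Lemma Zq_mx_det n (A : 'M[K]_n) : Zq_mx A -> in_Zq (\det A).
Proof.
move=> hA; apply: in_Zq_sum => s _; apply: in_ZqM.
  by rewrite -signr_odd; apply/in_ZqX/in_ZqN/in_Zq1.
by apply: in_Zq_prod => i _.
Qed.

Lemma Zq_mx_adj n (A : 'M[K]_n) : Zq_mx A -> Zq_mx (\adj A).
Proof.
move=> hA i j; rewrite mxE /cofactor; apply: in_ZqM.
  by rewrite -signr_odd; apply/in_ZqX/in_ZqN/in_Zq1.
by apply: Zq_mx_det => k l; rewrite !mxE.
Qed.

Lemma GLZqP n (u : 'M[K]_n) : GLZq u <-> Zq_mx u /\ Zq_unit (\det u).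
Proof.
split=> [[uu hu hv]|[hu [d0 [hd hd']]]].
  split=> //; split; first by rewrite -unitfE -unitmxE.
  by rewrite -det_inv; split; apply: Zq_mx_det.
have uu : u \in unitmx by rewrite unitmxE unitfE.
by split=> //; rewrite /invmx uu; apply: Zq_mxZ => //; exact: Zq_mx_adj.
Qed.

Lemma GLZq1 n : GLZq (1%:M : 'M[K]_n).
Proof. by apply/GLZqP; rewrite det1; split; [exact: Zq_mx1|exact: Zq_unit1]. Qed.
Lemma GLZqM n (u v : 'M[K]_n) : GLZq u -> GLZq v -> GLZq (u *m v).
Proof.
move=> /GLZqP[hu du] /GLZqP[hv dv]; apply/GLZqP; rewrite det_mulmx.
by split; [exact: Zq_mxM|exact: Zq_unitM].
Qed.
Lemma GLZqV n (u : 'M[K]_n) : GLZq u -> GLZq (invmx u).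
Proof.
move=> [uu hu hv]; split; first by rewrite unitmx_inv.
  exact: hv.
by rewrite invmxK; exact: hu.
Qed.
Lemma GLZq_tr n (u : 'M[K]_n) : GLZq u -> GLZq u^T.
Proof.
by move=> /GLZqP[hu du]; apply/GLZqP; rewrite det_tr; split=> //; apply: Zq_mx_tr.
Qed.
Lemma GLZq_perm n (s : {perm 'I_n}) : GLZq (perm_mx s : 'M[K]_n).
Proof.
apply/GLZqP; split; last first.
  rewrite det_perm; case: (odd_perm s); rewrite ?expr1 ?expr0; last exact: Zq_unit1.
  split; first by rewrite oppr_eq0 oner_neq0.
  by rewrite invrN invr1; split; apply/in_ZqN/in_Zq1.
by move=> i j; rewrite !mxE; case: (_ == _); [exact: in_Zq1|exact: in_Zq0].
Qed.
Lemma GLZq_unit n (u : 'M[K]_n) : GLZq u -> u \in unitmx.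
Proof. by case. Qed.

Lemma GLZq_lblock m n (u : 'M[K]_m) c (v : 'M[K]_n) :
  GLZq u -> GLZq v -> Zq_mx c -> GLZq (block_mx u 0 c v).
Proof.
move=> /GLZqP[hu du] /GLZqP[hv dv] hc; apply/GLZqP.
rewrite det_lblock; split; last exact: Zq_unitM.
move=> i j; rewrite -(splitK i) -(splitK j).
case: (fintype.split i) => i'; case: (fintype.split j) => j' /=;
  rewrite ?block_mxEul ?block_mxEur ?block_mxEdl ?block_mxEdr //.
exact: Zq_mx0.
Qed.

Lemma GLZq_scalar1 c : Zq_unit c -> GLZq (c%:M : 'M[K]_1).
Proof. by move=> h; apply/GLZqP; rewrite det_scalar1; split=> //; apply: Zq_mx_scalar; case: h => ? []. Qed.

Lemma col0_neq0 n (x : 'M[K]_n.+1) : x \in unitmx -> exists i, x i ord0 != 0.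
Proof.
move=> ux; apply: contrapT => /forallNP h.
have := mulVmx ux => /matrixP/(_ ord0 ord0); rewrite !mxE eqxx big1; last first.
  by move=> i _; move/negP: (h i); rewrite negbK => /eqP ->; rewrite mulr0.
by move/eqP; rewrite eq_sym oner_eq0.
Qed.

Definition diag_exp n (a : 'I_n -> int) : 'M[K]_n := diag_mx (\row_i (Q ^ a i)).

Definition cons_exp n (m : int) (a : 'I_n -> int) (i : 'I_(1 + n)) : int :=
  match fintype.split i with inl _ => m | inr j => a j end.

Lemma cons_exp_l n m (a : 'I_n -> int) i : cons_exp m a (lshift n i) = m.
Proof. by rewrite /cons_exp (unsplitK (inl i)). Qed.
Lemma cons_exp_r n m (a : 'I_n -> int) i : cons_exp m a (rshift 1 i) = a i.
Proof. by rewrite /cons_exp (unsplitK (inr i)). Qed.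

Lemma diag_exp_cons n m (a : 'I_n -> int) :
  diag_exp (cons_exp m a) = block_mx ((Q ^ m)%:M) 0 0 (diag_exp a).
Proof.
apply/matrixP => i j; rewrite -(splitK i) -(splitK j).
case: (fintype.split i) => i'; case: (fintype.split j) => j' /=;
  rewrite ?block_mxEul ?block_mxEur ?block_mxEdl ?block_mxEdr !mxE /=
    ?(inj_eq (@lshift_inj _ _)) ?(inj_eq (@rshift_inj _ _))
    ?eq_lrshift ?eq_rlshift ?mulr0n //.
- by rewrite /cons_exp (unsplitK (inl i')).
- by rewrite /cons_exp (unsplitK (inr i')).
Qed.

Lemma block_utri n (d : 'M[K]_1) (r : 'M[K]_(1, n)) (x : 'M[K]_n) :
  (forall i j : 'I_n, (j < i)%N -> x i j = 0) ->
  forall k l : 'I_(1 + n), (l < k)%N -> block_mx d r 0 x k l = 0.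
Proof.
move=> h k l; elim/(@split_ord_ind 1 n): k => k'; elim/(@split_ord_ind 1 n): l => l';
  rewrite ?block_mxEul ?block_mxEur ?block_mxEdl ?block_mxEdr //=.
- by rewrite !ord1.
- by rewrite (ord1 k').
- by rewrite mxE.
- by rewrite ltn_add2l; exact: h.
Qed.

Lemma block_diag_exp n m (r : 'M[K]_(1, n)) (x : 'M[K]_n) (a : 'I_n -> int) :
  (forall i, x i i = Q ^ a i) ->
  forall k : 'I_(1 + n), block_mx (Q ^ m)%:M r 0 x k k = Q ^ cons_exp m a k.
Proof.
move=> h; elim/split_ord_ind => k.
  by rewrite block_mxEul cons_exp_l mxE eqxx.
by rewrite block_mxEdr cons_exp_r h.
Qed.

Lemma block_diag_mul n (d : 'M[K]_1) (u x v : 'M[K]_n) :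
  block_mx d 0 0 (u *m x *m v) =
  block_mx 1%:M 0 0 u *m block_mx d 0 0 x *m block_mx 1%:M 0 0 v.
Proof. by rewrite !mulmx_block !(mul0mx, mulmx0, mul1mx, mulmx1, addr0, add0r). Qed.

(** Induction on n. A row swap brings to the corner an entry of least valuation in the first column,
    so that the multipliers clearing this column are integral. *)
Lemma hermite n (x : 'M[K]_n) : x \in unitmx -> exists u (a : 'I_n -> int),
  [/\ GLZq u, forall i j : 'I_n, (j < i)%N -> (u *m x) i j = 0
    & forall i, (u *m x) i i = Q ^ a i].
Proof.
elim: n x => [|n IH] x ux.
  by exists 1%:M, (fun=> 0); split; [exact: GLZq1|case|case].
have [i0 xi0] := col0_neq0 ux.
have [i xi hi] := padic_pivot (x := fun i => x i ord0) xi0.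
pose y : 'M[K]_(1 + n) := perm_mx (tperm i ord0) *m x.
have y0 k : y k ord0 = x (tperm i ord0 k) ord0 by rewrite /y -row_permE mxE.
pose d := y ord0 ord0; have dE : d = x i ord0 by rewrite /d y0 tpermR.
have d0 : d != 0 by rewrite dE.
have [u0 uu0 du] := padic_valE d0.
pose c := d^-1 *: dlsubmx y.
have hc : Zq_mx c.
  move=> k l; have -> : c k l = d^-1 * y (rshift 1 k) ord0.
    by rewrite /c [LHS]mxE; congr (_ * _); rewrite mxE mxE (ord1 l); congr (y _ _); apply: val_inj.
  by rewrite y0 mulrC dE; apply: hi.
pose E : 'M[K]_(1 + n) := block_mx (u0^-1)%:M 0 (- c) 1%:M.
have hE : GLZq E.
  apply: GLZq_lblock; [exact/GLZq_scalar1/Zq_unitV|exact: GLZq1|exact: Zq_mxN].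
have ulE : ulsubmx y = d%:M.
  apply/matrixP => k l; rewrite [RHS]mxE !ord1 eqxx mulr1n [LHS]mxE mxE /d.
  by congr (y _ _); apply: val_inj.
pose x' := drsubmx y - c *m ursubmx y.
have Ey : E *m y = block_mx (Q ^ padic_val d)%:M (u0^-1 *: ursubmx y) 0 x'.
  exact: (pivot_row ulE d0 (proj1 uu0) du).
have ux' : x' \in unitmx.
  have : E *m y \in unitmx.
    by rewrite unitmx_mul (GLZq_unit hE) unitmx_mul unitmx_perm ux.
  by rewrite Ey !unitmxE det_ublock unitrM => /andP[].
have [u' [a [hu' ha da]]] := IH _ ux'.
pose u := block_mx 1%:M 0 0 u' : 'M[K]_(1 + n).
exists (u *m E *m perm_mx (tperm i ord0)), (cons_exp (padic_val d) a).
have uE : u *m E *m perm_mx (tperm i ord0) *m x =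
  block_mx (Q ^ padic_val d)%:M (u0^-1 *: ursubmx y) 0 (u' *m x') :> 'M[K]_(1 + n).
  have -> : u *m E *m perm_mx (tperm i ord0) *m x = u *m (E *m y) by rewrite /y !mulmxA.
  rewrite Ey /u mulmx_block !mul0mx !mul1mx !mulmx0 !addr0.
  by rewrite add0r.
split.
- apply/GLZqM/GLZq_perm/GLZqM/hE.
  by apply: (@GLZq_lblock 1 n); [exact: GLZq1|exact: hu'|exact: Zq_mx0].
- by rewrite uE; exact: block_utri.
- by rewrite uE; exact: block_diag_exp.
Qed.

(** As for [hermite], but the pivot has least valuation in the whole matrix, so that both its row
    and its column are cleared integrally. *)
Lemma smith n (x : 'M[K]_n) : x \in unitmx -> exists u v (a : 'I_n -> int),
  [/\ GLZq u, GLZq v, forall i j : 'I_n, (i <= j)%N -> a i <= a j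
    & x = u *m diag_exp a *m v].
Proof.
elim: n x => [|n IH] x ux.
  exists 1%:M, 1%:M, (fun=> 0); split; [exact: GLZq1|exact: GLZq1|by case|].
  by apply/matrixP; case.
have [i0 xi0] := col0_neq0 ux.
have [[i j] /= xi hi] := padic_pivot (x := fun k => x k.1 k.2) (i0 := (i0, ord0)) xi0.
pose y : 'M[K]_(1 + n) := perm_mx (tperm i ord0) *m x *m perm_mx (tperm j ord0).
have yE k l : y k l = x (tperm i ord0 k) (tperm j ord0 l).
  by rewrite /y -row_permE -{1}[tperm j ord0]tpermV -col_permE mxE mxE.
pose d := y ord0 ord0; have dE : d = x i j by rewrite /d yE !tpermR.
have d0 : d != 0 by rewrite dE.
have hy k l : in_Zq (y k l / d) by rewrite yE dE; apply: (hi (_, _)).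
have [u0 uu0 du] := padic_valE d0.
pose c := d^-1 *: dlsubmx y; pose r := d^-1 *: ursubmx y.
have hc : Zq_mx c by move=> k l; rewrite mxE mulrC mxE mxE.
have hr : Zq_mx r by move=> k l; rewrite mxE mulrC mxE mxE.
have ulE : ulsubmx y = d%:M.
  apply/matrixP => k l; rewrite [RHS]mxE !ord1 eqxx mulr1n [LHS]mxE mxE /d.
  by congr (y _ _); apply: val_inj.
pose x' := drsubmx y - d *: (c *m r).
have yF : y = block_mx u0%:M 0 (u0 *: c) 1%:M *m
   block_mx (Q ^ padic_val d)%:M 0 0 x' *m block_mx 1%:M r 0 1%:M.
  exact: (pivot_row_col ulE d0 du).
have ux' : x' \in unitmx.
  have : y \in unitmx by rewrite !unitmx_mul !unitmx_perm ux.
  by rewrite yF !unitmx_mul => /andP[/andP[_ +] _]; rewrite !unitmxE det_ublock unitrM => /andP[].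
have [u' [v' [a [hu' hv' ha xE]]]] := IH _ ux'.
have hx' k l : in_Zq (x' k l / d).
  have -> : x' k l = y (rshift 1 k) (rshift 1 l) - d * (c *m r) k l.
    rewrite [LHS]mxE; congr (_ + _); first by rewrite mxE mxE.
    by rewrite mxE; congr (- _); rewrite mxE.
  by rewrite mulrBl; apply: in_ZqB => //; rewrite mulrAC mulfV // mul1r; apply: Zq_mxM.
(* The entries of [x'] remain divisible by the pivot, and passing to its diagonal form by unimodular
   factors preserves this; hence the exponents ascend. *)
have am k : padic_val d <= a k.
  suff : in_Zq (Q ^ a k / d).
    by move/(in_Zq_quo (qz_neq0 _ _) d0); rewrite -[Q ^ a k]mulr1 padic_val_unique.
  have := hu'; rewrite -[_ / d]mulrC => -[uu' _ hiu].
  have [uv' _ hiv] := hv'.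
  have : Zq_mx (invmx u' *m (d^-1 *: x') *m invmx v').
    by apply/Zq_mxM/hiv/Zq_mxM => // k' l'; rewrite mxE mulrC.
  by rewrite (invmx_conj _ uu' uv' xE) => /(_ k k); rewrite mxE mxE eqxx mulr1n mxE.
exists (perm_mx (tperm i ord0) *m (block_mx u0%:M 0 (u0 *: c) 1%:M *m block_mx 1%:M 0 0 u')),
  ((block_mx 1%:M 0 0 v' *m block_mx 1%:M r 0 1%:M) *m perm_mx (tperm j ord0)),
  (cons_exp (padic_val d) a); split.
- apply/GLZqM/GLZqM; first exact: GLZq_perm.
    apply: (@GLZq_lblock 1 n); [exact: GLZq_scalar1|exact: GLZq1|].
    by apply: Zq_mxZ => //; case: uu0 => ? [].
  by apply: (@GLZq_lblock 1 n); [exact: GLZq1|exact: hu'|exact: Zq_mx0].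
- apply/GLZqM/GLZq_perm/GLZqM.
    by apply: (@GLZq_lblock 1 n); [exact: GLZq1|exact: hv'|exact: Zq_mx0].
  rewrite -[block_mx _ _ _ _]trmxK; apply: GLZq_tr; rewrite tr_block_mx !trmx1 trmx0.
  by apply: (@GLZq_lblock 1 n); [exact: GLZq1|exact: GLZq1|exact: Zq_mx_tr].
- move=> k l; elim/(@split_ord_ind 1 n): k => k'; elim/(@split_ord_ind 1 n): l => l';
    rewrite ?cons_exp_l ?cons_exp_r //=.
  + by rewrite (ord1 l') /= leqn0 => /eqP.
  + by rewrite leq_add2l; exact: ha.
- have -> : x = perm_mx (tperm i ord0) *m y *m perm_mx (tperm j ord0).
    rewrite /y -!mulmxA -perm_mxM tperm2 perm_mx1 mulmx1 mulmxA -perm_mxM tperm2.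
    by rewrite perm_mx1 mul1mx.
  by rewrite yF xE diag_exp_cons block_diag_mul !mulmxA.
Qed.

End PadicMatrix.

(** * Siegel parabolic, Hecke algebra and Satake transform *)

Section SpTheory.
Variables (F : fieldType) (n : nat).
Implicit Types (g h : 'M[F]_(n + n)) (a b c d v w x y : 'M[F]_n).

Lemma iota_mxK : iota_mx F n *m (- iota_mx F n) = 1%:M.
Proof.
rewrite /iota_mx opp_block_mx mulmx_block !opprK !oppr0 !mulmx0 !mul0mx.
by rewrite !mulmxN !mulmx1 opprK !addr0 !add0r -scalar_mx_block.
Qed.

Lemma Sp_unit g : @Sp F n g -> g \in unitmx.
Proof.
move=> h; have : (- iota_mx F n *m (g^T *m iota_mx F n)) *m g = 1%:M.
  by rewrite -!mulmxA (mulmxA g^T) h mulNmx -mulmxN iota_mxK.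
by case/mulmx1_unit.
Qed.

Lemma Sp1 : @Sp F n 1%:M.
Proof. by rewrite /Sp /= trmx1 mul1mx mulmx1. Qed.

Lemma SpM g h : Sp g -> Sp h -> Sp (g *m h).
Proof.
rewrite /Sp /= => hg hh.
have -> : (g *m h)^T *m iota_mx F n *m (g *m h) = h^T *m (g^T *m iota_mx F n *m g) *m h.
  by rewrite trmx_mul !mulmxA.
by rewrite hg.
Qed.

Lemma SpV g : Sp g -> Sp (invmx g).
Proof.
move=> hg; have ug := Sp_unit hg; rewrite /Sp /= in hg *.
rewrite -[in LHS]hg !mulmxA -trmx_mul mulmxV // trmx1 mul1mx.
by rewrite -mulmxA mulmxV // mulmx1.
Qed.

Lemma Sp_block a b c d : Sp (block_mx a b c d) <->
  [/\ a^T *m c = c^T *m a, b^T *m d = d^T *m b & a^T *m d - c^T *m b = 1%:M].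
Proof.
rewrite /Sp /= tr_block_mx -mulmxA /iota_mx !mulmx_block !mul0mx !mulNmx !mul1mx.
rewrite !add0r !addr0 !mulmxN.
split=> [/eq_block_mx[h1 h2 h3 h4]|[h1 h2 h3]].
  split.
  - by apply/esym/eqP; rewrite -subr_eq0 addrC h1.
  - by apply/esym/eqP; rewrite -subr_eq0 addrC h4.
  - by apply: oppr_inj; rewrite -h2 opprB addrC.
congr block_mx.
- by rewrite h1 addNr.
- by rewrite -h3 opprB addrC.
- by apply: trmx_inj; rewrite trmx1 -h3 !linearD !linearN /= !trmx_mul !trmxK addrC.
- by rewrite h2 addNr.
Qed.

Lemma Sp_invE a b c d : Sp (block_mx a b c d) ->
  invmx (block_mx a b c d) = block_mx d^T (- b^T) (- c^T) a^T.
Proof.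
move=> hg; have ug := Sp_unit hg; have /Sp_block[h1 h2 h3] := hg.
have h : block_mx d^T (- b^T) (- c^T) a^T *m block_mx a b c d = 1%:M.
  rewrite mulmx_block !mulNmx [RHS]scalar_mx_block; congr block_mx.
  - by apply: trmx_inj; rewrite trmx1 -h3 !linearD !linearN /= !trmx_mul !trmxK.
  - by rewrite h2 subrr.
  - by rewrite h1 addNr.
  - by rewrite addrC.
by rewrite -[LHS]mul1mx -h mulmxK.
Qed.

Lemma Sp_tr_block a b c d : Sp (block_mx a b c d) ->
  [/\ a *m b^T = b *m a^T, c *m d^T = d *m c^T & a *m d^T - b *m c^T = 1%:M].
Proof.
move=> hg; have := mulmxV (Sp_unit hg); rewrite (Sp_invE hg) mulmx_block !mulmxN.
rewrite [X in _ = X](@scalar_mx_block _ n n 1) => /eq_block_mx[h1 h2 h3 h4]; split.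
- by apply/esym/eqP; rewrite -subr_eq0 addrC h2.
- by apply/eqP; rewrite -subr_eq0 h3.
- by [].
Qed.

Definition ntri v : 'M[F]_(n + n) := block_mx 1%:M v 0 1%:M.
(** Coordinates on the Siegel parabolic: diag[~d, d] times the translation by the symmetric v. The
    representative alpha_{x,s} is [sg x v] with s = ~x v x^-1. For unimodular d, membership in [D0]
    becomes a condition on v alone. *)
Definition sg d v : 'M[F]_(n + n) := block_mx (tilde d) (tilde d *m v) 0 d.

Lemma tildeV d : d \in unitmx -> d^T *m tilde d = 1%:M.
Proof. by move=> ud; rewrite /tilde mulmxV ?unitmx_tr. Qed.
Lemma tildeVl d : d \in unitmx -> tilde d *m d^T = 1%:M.
Proof. by move=> ud; rewrite /tilde mulVmx ?unitmx_tr. Qed.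
Lemma tildeM d d' : d \in unitmx -> d' \in unitmx -> tilde (d *m d') = tilde d *m tilde d'.
Proof.
move=> ud ud'; rewrite /tilde.
have u : (d *m d')^T \in unitmx by rewrite unitmx_tr unitmx_mul ud.
apply: (can_inj (mulKmx u)); rewrite mulmxV // trmx_mul -mulmxA (mulmxA d^T).
by rewrite mulmxV ?unitmx_tr // mul1mx mulmxV ?unitmx_tr.
Qed.
Lemma tilde_tr d : d \in unitmx -> (tilde d)^T = invmx d.
Proof. by move=> ud; rewrite /tilde trmx_inv trmxK. Qed.
Lemma tilde_unit d : d \in unitmx -> tilde d \in unitmx.
Proof. by move=> ud; rewrite /tilde unitmx_inv unitmx_tr. Qed.
Lemma tilde1 : tilde 1%:M = 1%:M :> 'M[F]_n.
Proof. by rewrite /tilde trmx1 invmx1. Qed.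

Lemma leviE d : levi d = sg d 0.
Proof. by rewrite /levi /sg mulmx0. Qed.
Lemma ntriE v : ntri v = sg 1%:M v.
Proof. by rewrite /ntri /sg tilde1 mul1mx. Qed.
Lemma sgE d v : sg d v = levi d *m ntri v.
Proof.
by rewrite /levi /ntri mulmx_block !mulmx0 !mul0mx !mulmx1 !addr0 add0r.
Qed.

Lemma sgM d v d' v' : d \in unitmx -> d' \in unitmx ->
  sg d v *m sg d' v' = sg (d *m d') (d'^T *m v *m d' + v').
Proof.
move=> ud ud'; rewrite /sg mulmx_block !mul0mx !mulmx0 !addr0 add0r tildeM //.
congr block_mx; rewrite mulmxDr addrC -!mulmxA; congr (_ *m _ + _).
by rewrite !mulmxA (tildeVl ud') mul1mx.
Qed.

Lemma sgV d v : d \in unitmx ->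
  invmx (sg d v) = sg (invmx d) (- ((invmx d)^T *m v *m invmx d)).
Proof.
move=> ud; have ud' : invmx d \in unitmx by rewrite unitmx_inv.
have h : sg d v *m sg (invmx d) (- ((invmx d)^T *m v *m invmx d)) = 1%:M.
  by rewrite sgM // mulmxV // subrr /sg tilde1 mulmx0 -scalar_mx_block.
have [u1 _] := mulmx1_unit h.
by apply: (can_inj (mulKmx u1)); rewrite mulmxV.
Qed.

Lemma sg_inj d v d' v' : d \in unitmx -> sg d v = sg d' v' -> d = d' /\ v = v'.
Proof.
move=> ud /eq_block_mx[h1 h2 _ h4]; split=> //; rewrite -h1 in h2.
exact: (can_inj (mulKmx (tilde_unit ud))) h2.
Qed.

Lemma siegelPP g : siegelP g <-> exists d v, [/\ d \in unitmx, v^T = v & g = sg d v].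
Proof.
split.
  rewrite -[g]submxK => -[hg]; rewrite block_mxKdl => c0; rewrite c0 in hg *.
  have /Sp_block[_ h2] := hg; rewrite trmx0 mul0mx subr0 => h3.
  move: (ulsubmx g) (ursubmx g) (drsubmx g) h2 h3 {hg c0} => a b d h2 h3.
  have [_ ud] := mulmx1_unit h3.
  have aE : a = tilde d.
    apply: trmx_inj; rewrite tilde_tr //; apply: (can_inj (mulmxK ud)).
    by rewrite mulVmx.
  exists d, (d^T *m b); split=> //; first by rewrite trmx_mul trmxK h2.
  by rewrite /sg mulmxA tildeVl // mul1mx aE.
move=> [d [v [ud vv ->]]]; split; last by rewrite /sg block_mxKdl.
apply/Sp_block; rewrite trmx0 !mulmx0 !mul0mx subr0 tilde_tr // trmx_mul tilde_tr //.
split=> //; last by rewrite mulVmx.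
by rewrite vv -mulmxA mulVmx // mulmx1 mulmxA tildeV // mul1mx.
Qed.

Lemma siegelP_sg d v : d \in unitmx -> v^T = v -> siegelP (sg d v).
Proof. by move=> ud vv; apply/siegelPP; exists d, v. Qed.

Lemma sym_conj x v : v^T = v -> (x^T *m v *m x)^T = x^T *m v *m x.
Proof. by move=> vv; rewrite !trmx_mul trmxK vv mulmxA. Qed.

Lemma siegelPM g h : siegelP g -> siegelP h -> siegelP (g *m h).
Proof.
move=> /siegelPP[d [v [ud vv ->]]] /siegelPP[d' [v' [ud' vv' ->]]].
rewrite sgM //; apply: siegelP_sg; first by rewrite unitmx_mul ud.
by rewrite linearD /= sym_conj // vv'.
Qed.

Lemma siegelPV g : siegelP g -> siegelP (invmx g).
Proof.
move=> /siegelPP[d [v [ud vv ->]]]; rewrite sgV //; apply: siegelP_sg.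
  by rewrite unitmx_inv.
by rewrite linearN /= sym_conj.
Qed.

Lemma siegelP1 : @siegelP F n 1%:M.
Proof. by split; [exact: Sp1|rewrite scalar_mx_block block_mxKdl]. Qed.

Lemma siegelP_unit g : siegelP g -> g \in unitmx.
Proof. by case=> /Sp_unit. Qed.

End SpTheory.

Lemma map_sg (F F' : fieldType) (f : {rmorphism F -> F'}) n (d v : 'M[F]_n) :
  map_mx f (sg d v) = sg (map_mx f d) (map_mx f v).
Proof. by rewrite /sg map_block_mx map_mx0 map_mxM /tilde map_invmx map_trmx. Qed.

Lemma map_Sp (F F' : fieldType) (f : {rmorphism F -> F'}) n (g : 'M[F]_(n + n)) :
  Sp g -> Sp (map_mx f g).
Proof.
rewrite -[g]submxK map_block_mx => /Sp_block[h1 h2 h3]; apply/Sp_block.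
by rewrite !map_trmx -!map_mxM h1 h2 -map_mxB h3 map_mx1.
Qed.

Section D0.
Variables (n : nat) (q : primeT) (b : rat) (c : nat).
Hypothesis b0 : b != 0.
Local Notation K := (padic q).
Implicit Types (d v : 'M[K]_n).
Local Notation beta := (rq q b).

Lemma D0P g : D0 b c g <-> exists d v, [/\ GLZq d, v^T = v, Zq_mx (beta *: v) & g = sg d v].
Proof.
have bE : (ratr b^-1 : K)^-1 = beta by rewrite rqE fmorphV invrK.
split.
  move=> [[hg ha hd hb _] /siegelPP[d [v [ud vv gE]]]].
  move: ha hd hb; rewrite gE /sg block_mxKul block_mxKur block_mxKdr bE => ha hd hb.
  have hd' : Zq_mx (invmx d) by rewrite -tilde_tr //; exact: Zq_mx_tr.
  exists d, v; split=> //.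
  have -> : beta *: v = d^T *m (beta *: (tilde d *m v)).
    by rewrite -scalemxAr mulmxA tildeV // mul1mx.
  by apply: Zq_mxM => //; exact: Zq_mx_tr.
move=> [d [v [[ud hd hd'] vv hv ->]]]; have [hS h0] := siegelP_sg ud vv.
split=> //; rewrite /sg; split=> //.
- rewrite block_mxKul -[tilde d]trmxK tilde_tr //; exact: Zq_mx_tr.
- by rewrite block_mxKdr.
- rewrite block_mxKur bE scalemxAr; apply: Zq_mxM hv.
  rewrite -[tilde d]trmxK tilde_tr //; exact: Zq_mx_tr.
- rewrite block_mxKdl scaler0; exact: Zq_mx0.
Qed.

Lemma D0_sg d v : GLZq d -> v^T = v -> Zq_mx (beta *: v) -> D0 b c (sg d v).
Proof. by move=> hd vv hv; apply/D0P; exists d, v. Qed.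

Lemma D01 : D0 b c (1%:M : 'M[K]_(n + n)).
Proof.
have -> : 1%:M = sg 1%:M 0 :> 'M[K]_(n + n) by rewrite /sg tilde1 mulmx0 -scalar_mx_block.
apply: D0_sg; [exact: GLZq1|exact: trmx0|rewrite scaler0; exact: Zq_mx0].
Qed.

Lemma D0M (g h : 'M[K]_(n + n)) : D0 b c g -> D0 b c h -> D0 b c (g *m h).
Proof.
move=> /D0P[d [v [hd vv hv ->]]] /D0P[d' [v' [hd' vv' hv' ->]]].
have [ud' id' _] := hd'.
rewrite sgM ?(GLZq_unit hd) //; apply: D0_sg; first exact: GLZqM.
  by rewrite linearD /= sym_conj // vv'.
rewrite scalerDr; apply: Zq_mxD => //.
rewrite scalemxAl scalemxAr; apply: Zq_mxM => //; apply: Zq_mxM => //.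
exact: Zq_mx_tr.
Qed.

Lemma D0V (g : 'M[K]_(n + n)) : D0 b c g -> D0 b c (invmx g).
Proof.
move=> /D0P[d [v [hd vv hv ->]]]; have hd' := GLZqV hd; have [ud' id' _] := hd'.
rewrite sgV ?(GLZq_unit hd) //; apply: D0_sg => //.
  by rewrite linearN /= sym_conj.
rewrite scalerN; apply: Zq_mxN.
rewrite scalemxAl scalemxAr; apply: Zq_mxM => //; apply: Zq_mxM => //.
exact: Zq_mx_tr.
Qed.

Lemma D0_siegelP (g : 'M[K]_(n + n)) : D0 b c g -> siegelP g. Proof. by case. Qed.

End D0.

(** * Sums over cosets of a subgroup and the convolution product *)

Lemma invmx_mul (K : fieldType) N (g h : 'M[K]_N) :
  g \in unitmx -> h \in unitmx -> invmx (g *m h) = invmx h *m invmx g.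
Proof.
move=> ug uh; have u : g *m h \in unitmx by rewrite unitmx_mul ug.
apply: (can_inj (mulKmx u)); rewrite mulmxV //.
by rewrite -mulmxA (mulmxA h) mulmxV // mul1mx mulmxV.
Qed.

(** Coset sums are developed for an abstract pair, so that they serve both [D0] at a prime and
    [Hgrp] over an abstract valuation ring. *)
Record group_pair (K : fieldType) N (P H : set 'M[K]_N) : Prop := GroupPair {
  gpPM : forall g h, P g -> P h -> P (g *m h);
  gpPV : forall g, P g -> P (invmx g);
  gpPU : forall g, P g -> g \in unitmx;
  gpHP : forall g, H g -> P g;
  gpH1 : H 1%:M;
  gpHM : forall g h, H g -> H h -> H (g *m h);
  gpHV : forall g, H g -> H (invmx g) }.

Section CosetSums.
Variables (C : comNzRingType) (K : fieldType) (N : nat).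
Local Notation mx := ('M[K]_N).
Variables (siegelP D0 : set mx).
Hypothesis PH : group_pair siegelP D0.
Let siegelPM := gpPM PH.
Let siegelPV := gpPV PH.
Let siegelP_unit := gpPU PH.
Let D0_siegelP := gpHP PH.
Let D01 := gpH1 PH.
Let D0M := gpHM PH.
Let D0V := gpHV PH.
Definition coset_in g : set mx := [set d *m g | d in D0].
Definition cosets_in : set (set mx) := [set coset_in g | g in siegelP].
Definition coset_rep (X : set mx) : mx := xget 1%:M X.
Definition cmul (F G : mx -> C) : mx -> C := fun g =>
  \sum_(X \in cosets_in) F (g *m invmx (coset_rep X)) * G (coset_rep X).
Local Notation coset0 := coset_in.
Local Notation cosets0 := cosets_in.
Local Notation rep0 := coset_rep.
Local Notation S0_mul := cmul.
Implicit Types (g h d e : mx) (F G : mx -> C).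

Definition lc g h := exists2 d, D0 d & g = d *m h.

Lemma lc_refl g : lc g g.
Proof. by exists 1%:M; [exact: D01|rewrite mul1mx]. Qed.
Lemma lc_sym g h : lc g h -> lc h g.
Proof.
move=> [d hd ->]; exists (invmx d); first exact: D0V.
by rewrite mulKmx //; apply/siegelP_unit/D0_siegelP.
Qed.
Lemma lc_trans g h k : lc g h -> lc h k -> lc g k.
Proof.
by move=> [d hd ->] [e he ->]; exists (d *m e); [exact: D0M|rewrite mulmxA].
Qed.
Lemma lc_mulr g h k : lc g h -> lc (g *m k) (h *m k).
Proof. by move=> [d hd ->]; exists d => //; rewrite mulmxA. Qed.
Lemma lc_mul d g : D0 d -> lc (d *m g) g.
Proof. by move=> hd; exists d. Qed.
Lemma lc_siegelP g h : siegelP h -> lc g h -> siegelP g.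
Proof. by move=> hh [d /D0_siegelP hd ->]; exact: siegelPM. Qed.

Lemma coset0P g h : coset0 g h <-> lc h g.
Proof. by split=> [[d hd <-]|[d hd ->]]; exists d. Qed.

Lemma coset0_eq g h : coset0 g = coset0 h <-> lc g h.
Proof.
split=> [e|gh]; first by apply/coset0P; rewrite -e; apply/coset0P/lc_refl.
apply/seteqP; split=> k /coset0P kk; apply/coset0P; apply: lc_trans kk _ => //.
exact: lc_sym.
Qed.

Lemma rep0P g : lc (rep0 (coset0 g)) g.
Proof.
apply/coset0P; rewrite /rep0; apply: (@xgetPex _ _ (coset0 g)).
by exists g; apply/coset0P/lc_refl.
Qed.

Lemma rep0_siegelP g : siegelP g -> siegelP (rep0 (coset0 g)).
Proof. by move=> hg; exact: lc_siegelP hg (rep0P g). Qed.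

Definition linv F := forall d g, D0 d -> siegelP g -> F (d *m g) = F g.
Definition rinv F := forall d g, D0 d -> siegelP g -> F (g *m d) = F g.

Lemma linv_lc F g h : linv F -> siegelP h -> lc g h -> F g = F h.
Proof. by move=> hF hh [d hd ->]; rewrite hF. Qed.

Definition distinct (s : seq mx) := pairwise (fun g h => ~~ `[< lc g h >]) s.
(** Finiteness of a support is witnessed by a list meeting each of its cosets; the list may be
    redundant, and [covers_distinct] thins it out. *)
Definition covers (s : seq mx) (S : mx -> Prop) :=
  (forall h, h \in s -> siegelP h) /\
  forall g, siegelP g -> S g -> exists2 h, h \in s & lc g h.

Definition fsupp F := exists s, covers s (fun g => F g != 0).

Lemma distinct_sub (s : seq mx) : exists2 s', distinct s' &
  {subset s' <= s} /\ forall h, h \in s -> exists2 h', h' \in s' & lc h h'.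
Proof.
elim: s => [|g s [s' ds [ss hs]]]; first by exists [::].
have [[h hh gh]|no] := pselect (exists2 h, h \in s' & lc g h).
  exists s' => //; split; first by move=> k ks; rewrite inE ss ?orbT.
  by move=> k; rewrite inE => /orP[/eqP ->|/hs //]; exists h.
exists (g :: s').
  rewrite /distinct pairwise_cons [pairwise _ _]ds andbT; apply/allP => h hh.
  by apply/negP => /asboolP gh; apply: no; exists h.
split; first by move=> k; rewrite !inE => /orP[->//|/ss ->]; rewrite orbT.
move=> k; rewrite inE => /orP[/eqP ->|/hs[h' h1 h2]].
  by exists g; rewrite ?inE ?eqxx //; exact: lc_refl.
by exists h'; rewrite ?inE ?h1 ?orbT.
Qed.

Lemma covers_distinct s S : covers s S -> exists2 s', distinct s' & covers s' S.
Proof.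
move=> [sP hs]; have [s' ds [ss hs']] := distinct_sub s; exists s' => //; split.
  by move=> h /ss /sP.
move=> g gP gS; have [h hh gh] := hs _ gP gS; have [h' h1 h2] := hs' _ hh.
by exists h' => //; exact: lc_trans gh h2.
Qed.

Lemma coset_sumE (E : set mx -> C) s : distinct s ->
  covers s (fun g => E (coset0 g) != 0) ->
  \sum_(X \in cosets0) E X = \sum_(h <- s) E (coset0 h).
Proof.
move=> ds [sP hs]; rewrite (@fsbigE _ _ _ _ _ (map coset0 s)); first last.
- move=> X [g gP <-] nX; apply/eqP; apply: contraT => /(hs _ gP)[h hh gh].
  by case/negP: nX; apply/mapP; exists h => //; apply/coset0_eq.
- by move=> X /= /mapP[h hh ->]; exists h => //; exact: sP.
- elim: s ds {sP hs} => //= g s IH /andP[/allP hg /IH ->]; rewrite andbT.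
  apply/mapP => -[h hh /coset0_eq gh]; move/negP: (hg _ hh); apply.
  exact/asboolP.
rewrite big_map big_seq_cond [RHS]big_seq_cond; apply: eq_bigl => h.
rewrite andbT; case: (boolP (h \in s)) => //= hh; apply/mem_set.
by exists h => //; exact: sP.
Qed.

Definition csum F := \sum_(X \in cosets0) F (rep0 X).

Lemma csumE F s : linv F -> distinct s -> covers s (fun g => F g != 0) ->
  csum F = \sum_(h <- s) F h.
Proof.
move=> hF ds [sP hs]; rewrite /csum (@coset_sumE _ s) //.
  apply: eq_big_seq => h hh; apply: (linv_lc hF (sP _ hh)); exact: rep0P.
split=> // g gP; rewrite (linv_lc hF gP (rep0P g)); exact: hs.
Qed.

Lemma csum0 F : (forall g, siegelP g -> F g = 0) -> csum F = 0.
Proof. by move=> h; apply: fsbig1 => X [g gP <-]; apply: h; exact: rep0_siegelP. Qed.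

Lemma eq_csum F G : (forall g, siegelP g -> F g = G g) -> csum F = csum G.
Proof.
move=> h; apply: eq_fsbigr => X; rewrite inE => -[g gP <-].
by apply: h; exact: rep0_siegelP.
Qed.

Lemma covers_sub s (S S' : mx -> Prop) :
  (forall g, siegelP g -> S' g -> S g) -> covers s S -> covers s S'.
Proof. by move=> h [sP hs]; split=> // g gP /(h _ gP); exact: hs. Qed.

(** Right translation by h permutes the cosets of the group on the left; a covering list is carried
    along by h^-1. *)
Lemma csum_translate F h : linv F -> fsupp F -> siegelP h ->
  csum (fun g => F (g *m h)) = csum F.
Proof.
move=> hF [s0 /covers_distinct[s ds hs]] hP; have uh := siegelP_unit hP.
rewrite (csumE hF ds hs) (@csumE _ (map (mulmx^~ (invmx h)) s)).
- rewrite big_map; apply: eq_bigr => k _; by rewrite mulmxKV.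
- by move=> d g hd gP; rewrite -mulmxA hF //; exact: siegelPM.
- rewrite /distinct pairwise_map; apply: sub_pairwise ds => g k /=.
  by apply: contra => /asboolP /(lc_mulr h); rewrite !mulmxKV // => gk; exact/asboolP.
- case: hs => sP hs; split.
    by move=> k /mapP[k' /sP kP ->]; apply: siegelPM => //; exact: siegelPV.
  move=> g gP /(hs _ (siegelPM gP hP))[k kk gk].
  exists (k *m invmx h); first by apply/mapP; exists k.
  by rewrite -[g](mulmxK uh); exact: lc_mulr.
Qed.

Lemma csum_distr F a : linv F -> fsupp F -> csum (fun g => F g * a) = csum F * a.
Proof.
move=> hF [s0 /covers_distinct[s ds hs]]; rewrite (csumE hF ds hs) mulr_suml.
rewrite (csumE (s := s)) //; first by move=> d g hd gP; rewrite hF.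
by apply: covers_sub hs => g gP; apply: contra_neq => ->; rewrite mul0r.
Qed.

Lemma fsuppD F G : fsupp F -> fsupp G -> fsupp (fun g => F g + G g).
Proof.
move=> [s [sP hs]] [t [tP ht]]; exists (s ++ t); split.
  by move=> h; rewrite mem_cat => /orP[/sP|/tP].
move=> g gP nz; have [F0|/(hs _ gP)[h hh gh]] := eqVneq (F g) 0.
  rewrite F0 add0r in nz; have [h hh gh] := ht _ gP nz.
  by exists h => //; rewrite mem_cat hh orbT.
by exists h => //; rewrite mem_cat hh.
Qed.

Lemma fsuppZ F a : fsupp F -> fsupp (fun g => a * F g).
Proof.
move=> [s hs]; exists s; apply: covers_sub hs => g gP.
by apply: contra_neq => ->; rewrite mulr0.
Qed.

Lemma csumD F G : linv F -> linv G -> fsupp F -> fsupp G ->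
  csum (fun g => F g + G g) = csum F + csum G.
Proof.
move=> lF lG [s [sP hs]] [t [tP ht]].
have : covers (s ++ t) (fun g => F g != 0 \/ G g != 0).
  split; first by move=> h; rewrite mem_cat => /orP[/sP|/tP].
  move=> g gP [/(hs _ gP)|/(ht _ gP)] [h hh gh]; exists h => //;
    by rewrite mem_cat hh ?orbT.
move=> /covers_distinct[r dr hr].
rewrite (csumE lF dr); last by apply: covers_sub hr => g gP; left.
rewrite (csumE lG dr); last by apply: covers_sub hr => g gP; right.
rewrite (csumE (s := r)) ?big_split //.
  by move=> d g hd gP; rewrite lF // lG.
apply: covers_sub hr => g gP nz; have [F0|] := eqVneq (F g) 0; last by left.
by right; move: nz; rewrite F0 add0r.
Qed.

Lemma cmul_supp F G g : cmul F G g != 0 ->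
  exists h, [/\ siegelP h, F (g *m invmx h) != 0 & G h != 0].
Proof.
move=> nz; apply: contrapT => no; case/eqP: nz.
rewrite -[cmul F G g]/(csum (fun h => F (g *m invmx h) * G h)); apply: csum0 => h hP.
have [->|Gh] := eqVneq (G h) 0; first by rewrite mulr0.
have [->|Fh] := eqVneq (F (g *m invmx h)) 0; first by rewrite mul0r.
by case: no; exists h.
Qed.

(** Replacing k by its listed representative multiplies g k^-1 on the right by an element of the
    subgroup, which the right invariance of T absorbs. Products of the two lists thus cover the
    support of a convolution. *)
Lemma covers_mul s t (S T : mx -> Prop) : (forall d g, D0 d -> siegelP g -> T g -> T (g *m d)) ->
  covers s S -> covers t T ->
  covers [seq h *m k | h <- t, k <- s] (fun g => exists2 k, siegelP k /\ S k & T (g *m invmx k)).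
Proof.
move=> hT [sP hs] [tP ht]; split.
  by move=> h /allpairsP[[h1 k1] /= [/tP hh /sP hk ->]]; exact: siegelPM.
move=> g gP [k [kP kS] Tgk].
have [k' k's kk'] := hs _ kP kS.
have k'P := sP _ k's.
have gk'P : siegelP (g *m invmx k') by apply/siegelPM/siegelPV.
have : T (g *m invmx k').
  have [d hd kE] := kk'; have dP := D0_siegelP hd.
  have -> : g *m invmx k' = g *m invmx k *m d.
    have uk' := siegelP_unit k'P; have ud := siegelP_unit dP.
    by rewrite kE invmx_mul // mulmxA mulmxKV.
  by apply: hT => //; apply/siegelPM/siegelPV.
move=> /(ht _ gk'P)[h hh gh]; exists (h *m k').
  by apply/allpairsP; exists (h, k').
by rewrite -[g](mulmxKV (siegelP_unit k'P)); exact: lc_mulr.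
Qed.

Lemma S0_mulE F G g : S0_mul F G g = csum (fun h => F (g *m invmx h) * G h).
Proof. by []. Qed.

Section Product.
Variables (F G : mx -> C).
Hypotheses (lF : linv F) (rF : rinv F) (lG : linv G) (rG : rinv G).
Hypotheses (fF : fsupp F) (fG : fsupp G).

Lemma S0_mul_kernel_linv g : siegelP g -> linv (fun h => F (g *m invmx h) * G h).
Proof.
move=> gP d h hd hP; have dP := D0_siegelP hd; rewrite lG //; congr (_ * _).
rewrite invmx_mul ?siegelP_unit // mulmxA rF //; first exact: D0V.
by apply/siegelPM/siegelPV.
Qed.

Lemma S0_mul_linv : linv (S0_mul F G).
Proof.
move=> d g hd gP; rewrite !S0_mulE; apply: eq_csum => h hP; rewrite -mulmxA lF //.
by apply/siegelPM/siegelPV.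
Qed.

Lemma S0_mul_kernel_fsupp g : siegelP g -> fsupp (fun h => F (g *m invmx h) * G h).
Proof.
move=> gP; have [s hs] := fG; exists s; apply: covers_sub hs => h hP.
by apply: contra_neq => ->; rewrite mulr0.
Qed.

Lemma S0_mul_rinv : rinv (S0_mul F G).
Proof.
move=> d g hd gP; have dP := D0_siegelP hd; rewrite !S0_mulE.
rewrite -(@csum_translate (fun h => F (g *m d *m invmx h) * G h) d) //; last first.
- by apply: S0_mul_kernel_fsupp; exact: siegelPM.
- by apply: S0_mul_kernel_linv; exact: siegelPM.
apply: eq_csum => h hP; rewrite rG //; congr (F _ * _).
by rewrite invmx_mul ?siegelP_unit // mulmxA mulmxK ?siegelP_unit.
Qed.

Lemma S0_mul_fsupp : fsupp (S0_mul F G).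
Proof.
have [s [sP hs]] := fF; have [t [tP ht]] := fG.
have := @covers_mul t s (fun g => G g != 0) (fun g => F g != 0) _ (conj tP ht) (conj sP hs).
move=> [d g hd gP|]; first by rewrite rF.
move=> h1 h2; eexists; apply: covers_sub (conj h1 h2) => g gP; rewrite S0_mulE => nz.
apply: contrapT => no; case/eqP: nz; apply: csum0 => h hP.
have [->|Gh] := eqVneq (G h) 0; first by rewrite mulr0.
have [->|Fh] := eqVneq (F (g *m invmx h)) 0; first by rewrite mul0r.
by case: no; exists h.
Qed.

(* Sum over [Y] of [sum_X F X Phi (X Y)], reindexed by [Z = X Y]. *)
Lemma csum_cmul (Phi : mx -> C) : linv Phi ->
  csum (fun h => G h * csum (fun g => F g * Phi (g *m h))) =
  csum (fun g => S0_mul F G g * Phi g).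
Proof.
move=> lP; have [s0 /covers_distinct[s ds hs]] := fG.
have [t ht] := fF.
have [d g hd gP|hw1 hw2] := @covers_mul s t (fun g => G g != 0) (fun g => F g != 0) _ hs ht.
  by rewrite rF.
have [w dw hw] := covers_distinct (conj hw1 hw2).
have sP := hs.1.
rewrite (@csumE (fun h => G h * csum (fun g => F g * Phi (g *m h))) s) //; first last.
- by apply: covers_sub hs => g gP; apply: contra_neq => ->; rewrite mul0r.
- move=> d h hd hP; have dP := D0_siegelP hd; rewrite lG //; congr (_ * _).
  rewrite -(@csum_translate (fun g => F g * Phi (g *m (d *m h))) (invmx d)).
  + apply: eq_csum => g gP; rewrite rF //; last exact: D0V.
    by rewrite mulmxA mulmxKV ?siegelP_unit.
  + move=> e g he gP; rewrite lF //; congr (_ * _); rewrite -mulmxA lP //.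
    by apply: siegelPM => //; exact: siegelPM.
  + exists t; apply: covers_sub ht => g gP; by apply: contra_neq => ->; rewrite mul0r.
  + exact: siegelPV.
rewrite (@csumE (fun g => S0_mul F G g * Phi g) w) //; first last.
- apply: covers_sub hw => g gP nz; apply: contrapT => no; case/eqP: nz.
  rewrite S0_mulE csum0 ?mul0r // => h hP.
  have [->|Gh] := eqVneq (G h) 0; first by rewrite mulr0.
  have [->|Fh] := eqVneq (F (g *m invmx h)) 0; first by rewrite mul0r.
  by case: no; exists h.
- by move=> d g hd gP; rewrite S0_mul_linv // lP.
transitivity (\sum_(h <- s) \sum_(g <- w) F (g *m invmx h) * G h * Phi g).
  rewrite big_seq [RHS]big_seq; apply: eq_bigr => h /sP hP.
  have [G0|Gh] := eqVneq (G h) 0.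
    by rewrite G0 mul0r big1 // => g _; rewrite mulr0 mul0r.
  rewrite -(@csum_translate (fun g => F g * Phi (g *m h)) (invmx h)).
  + rewrite (@csumE _ w) //.
    * rewrite mulr_sumr; apply: eq_bigr => g _.
      by rewrite mulmxKV ?siegelP_unit // mulrA [G h * _]mulrC.
    * move=> d g hd gP; rewrite -!mulmxA lF //; last by apply/siegelPM/siegelPV.
      by congr (_ * _); rewrite lP // mulVmx ?mulmx1 ?siegelP_unit.
    * apply: covers_sub hw => g gP nz; exists h => //.
      by move: nz; apply: contra_neq => ->; rewrite mul0r.
  + move=> d g hd gP; rewrite lF // -mulmxA lP //; exact: siegelPM.
  + exists t; apply: covers_sub ht => g gP; by apply: contra_neq => ->; rewrite mul0r.
  + exact: siegelPV.
rewrite exchange_big /= big_seq [RHS]big_seq; apply: eq_bigr => g gw.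
have gP := hw.1 _ gw.
rewrite S0_mulE (@csumE _ s) //; last first.
- by apply: covers_sub hs => h hP; apply: contra_neq => ->; rewrite mulr0.
- exact: S0_mul_kernel_linv.
by rewrite mulr_suml.
Qed.

End Product.
End CosetSums.

(** The Cauchy-Binet formula before grouping: phi runs over all maps, not only the increasing ones.
    It shows that minors of a product are integral combinations of minors of one factor when the
    other is integral. *)
Lemma det_mul_rows (K : fieldType) k p (B : 'M[K]_(k, p)) (A : 'M[K]_(p, k)) :
  \det (B *m A) =
  \sum_(phi : {ffun 'I_k -> 'I_p}) (\prod_i B i (phi i)) * \det (rowsub phi A).
Proof.
transitivity (\sum_(s : {perm 'I_k}) \sum_(phi : {ffun 'I_k -> 'I_p})
   (-1) ^+ s * \prod_i (B i (phi i) * A (phi i) (s i))).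
  apply: eq_bigr => s _; rewrite -mulr_sumr; congr (_ * _).
  rewrite -(bigA_distr_bigA (fun i j => B i j * A j (s i))).
  by apply: eq_bigr => i _; rewrite mxE.
rewrite exchange_big; apply: eq_bigr => phi _; rewrite mulr_sumr.
apply: eq_bigr => s _; rewrite big_split /= mulrCA; congr (_ * (_ * _)).
by apply: eq_bigr => i _; rewrite mxE.
Qed.

Lemma mxsub_mul (K : fieldType) m n p k l (f : 'I_k -> 'I_m) (h : 'I_l -> 'I_p)
  (A : 'M[K]_(m, n)) (B : 'M[K]_(n, p)) :
  mxsub f h (A *m B) = rowsub f A *m colsub h B.
Proof. by apply/matrixP => i j; rewrite !mxE; apply: eq_bigr => t _; rewrite !mxE. Qed.

(** The inverse of the lower triangular matrix x^T is found by forward substitution, row by row. *)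
Lemma tilde_utri (K : fieldType) n (x : 'M[K]_n) : x \in unitmx ->
  (forall i j : 'I_n, (j < i)%N -> x i j = 0) ->
  (forall i, x i i != 0) /\
  (forall i j : 'I_n, (i < j)%N -> tilde x i j = 0) /\ forall i, tilde x i i = (x i i)^-1.
Proof.
move=> ux hx; have e := tildeV ux; set B := tilde x in e *.
have eE i j : \sum_l x l i * B l j = (i == j)%:R.
  by have /matrixP/(_ i j) := e; rewrite !mxE => <-; apply: eq_bigr => l _; rewrite mxE.
have d0 i : x i i != 0.
  have : \det x != 0 by rewrite -unitfE -unitmxE.
  rewrite -det_tr det_trig; last first.
    by apply/is_trig_mxP => k l kl; rewrite mxE hx.
  by move=> /prodf_neq0/(_ i isT); rewrite mxE.
have low : forall m (i j : 'I_n), (i <= m)%N -> (i < j)%N -> B i j = 0.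
  elim=> [|m IH] i j im ij.
    have := eE i j; rewrite (bigD1 i) //= big1 ?addr0; last first.
      move=> l li; rewrite hx ?mul0r //; rewrite leqn0 in im.
      by rewrite (eqP im) lt0n -(eqP im); apply: contra li => /eqP/val_inj ->.
    have -> : (i == j) = false by apply/negbTE; rewrite neq_ltn ij.
    by move/eqP; rewrite mulf_eq0 (negbTE (d0 i)) => /eqP.
  have := eE i j; rewrite (bigD1 i) //= big1 ?addr0; last first.
    move=> l li; case: (ltngtP l i) => [lt|gt|/val_inj e']; last by rewrite e' eqxx in li.
      by rewrite [B l j]IH ?mulr0 //; [rewrite -ltnS (leq_trans lt)|exact: ltn_trans ij].
    by rewrite hx ?mul0r.
  have -> : (i == j) = false by apply/negbTE; rewrite neq_ltn ij.
  by move/eqP; rewrite mulf_eq0 (negbTE (d0 i)) => /eqP.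
split=> //; split=> [i j|i]; first exact: (low i).
have := eE i i; rewrite eqxx (bigD1 i) //= big1 ?addr0; last first.
  move=> l li; case: (ltngtP l i) => [lt|gt|/val_inj e']; last by rewrite e' eqxx in li.
    by rewrite (low l) ?mulr0.
  by rewrite hx ?mul0r.
by move=> h; apply: (mulfI (d0 i)); rewrite h mulfV.
Qed.

(** * Minors and elementary divisors over a valuation ring *)

Section Valued.
Variables (K : fieldType) (O : K -> Prop) (Q : K).
Hypotheses (O0 : O 0) (O1 : O 1) (OD : forall x y, O x -> O y -> O (x + y))
  (ON : forall x, O x -> O (- x)) (OM : forall x y, O x -> O y -> O (x * y))
  (Q0 : Q != 0) (OQ : forall m : int, O (Q ^ m) <-> 0 <= m).

Definition mxO m n (A : 'M[K]_(m, n)) := forall i j, O (A i j).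
Definition GLO n (u : 'M[K]_n) := [/\ u \in unitmx, mxO u & mxO (invmx u)].
Definition diagQ n (a : 'I_n -> int) : 'M[K]_n := diag_mx (\row_i (Q ^ a i)).

Lemma O_sum I r (P : pred I) (E : I -> K) :
  (forall i, P i -> O (E i)) -> O (\sum_(i <- r | P i) E i).
Proof. by move=> h; elim/big_ind: _ => //. Qed.
Lemma O_prod I r (P : pred I) (E : I -> K) :
  (forall i, P i -> O (E i)) -> O (\prod_(i <- r | P i) E i).
Proof. by move=> h; elim/big_ind: _ => //. Qed.

Lemma mxOM m n p (A : 'M[K]_(m, n)) (B : 'M[K]_(n, p)) : mxO A -> mxO B -> mxO (A *m B).
Proof. by move=> hA hB i j; rewrite mxE; apply: O_sum => k _; apply: OM. Qed.
Lemma mxOD m n (A B : 'M[K]_(m, n)) : mxO A -> mxO B -> mxO (A + B).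
Proof. by move=> hA hB i j; rewrite mxE; apply: OD. Qed.
Lemma mxON m n (A : 'M[K]_(m, n)) : mxO A -> mxO (- A).
Proof. by move=> hA i j; rewrite mxE; apply: ON. Qed.
Lemma mxOT m n (A : 'M[K]_(m, n)) : mxO A -> mxO A^T.
Proof. by move=> hA i j; rewrite mxE. Qed.
Lemma mxOZ m n c (A : 'M[K]_(m, n)) : O c -> mxO A -> mxO (c *: A).
Proof. by move=> hc hA i j; rewrite mxE; apply: OM. Qed.
Lemma mxO_0 m n : mxO (0 : 'M[K]_(m, n)).
Proof. by move=> i j; rewrite mxE. Qed.
Lemma mxO_1 n : mxO (1%:M : 'M[K]_n).
Proof. by move=> i j; rewrite mxE; case: (_ == _). Qed.
Lemma mxO_block m1 m2 n1 n2 (A : 'M[K]_(m1, n1)) (B : 'M[K]_(m1, n2))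
    (C : 'M[K]_(m2, n1)) (D : 'M[K]_(m2, n2)) :
  mxO (block_mx A B C D) <-> [/\ mxO A, mxO B, mxO C & mxO D].
Proof.
split=> [h|[hA hB hC hD]].
  split=> i j; [have := h (lshift _ i) (lshift _ j)|have := h (lshift _ i) (rshift _ j)
   |have := h (rshift _ i) (lshift _ j)|have := h (rshift _ i) (rshift _ j)];
   by rewrite ?block_mxEul ?block_mxEur ?block_mxEdl ?block_mxEdr.
move=> i j; elim/split_ord_ind: i => i; elim/split_ord_ind: j => j;
   by rewrite ?block_mxEul ?block_mxEur ?block_mxEdl ?block_mxEdr.
Qed.

Lemma GLO1 n : GLO (1%:M : 'M[K]_n).
Proof. by split; rewrite ?unitmx1 // ?invmx1; exact: mxO_1. Qed.
Lemma GLOV n (u : 'M[K]_n) : GLO u -> GLO (invmx u).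
Proof. by move=> [uu h h']; split; rewrite ?unitmx_inv ?invmxK. Qed.
Lemma GLOM n (u v : 'M[K]_n) : GLO u -> GLO v -> GLO (u *m v).
Proof.
move=> [uu hu hu'] [uv hv hv']; split; first by rewrite unitmx_mul uu.
  exact: mxOM.
by rewrite invmx_mul //; exact: mxOM.
Qed.
Lemma GLO_tr n (u : 'M[K]_n) : GLO u -> GLO u^T.
Proof. by move=> [uu h h']; split; rewrite ?unitmx_tr -?trmx_inv //; exact: mxOT. Qed.
Lemma GLO_tilde n (u : 'M[K]_n) : GLO u -> GLO (tilde u).
Proof. by move=> hu; apply/GLOV/GLO_tr. Qed.

Lemma diagQ_unit n (a : 'I_n -> int) : diagQ a \in unitmx.
Proof.
rewrite unitmxE det_diag unitfE; apply/prodf_neq0 => i _; rewrite mxE.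
exact: expfz_neq0.
Qed.
Lemma diagQM n (a a' : 'I_n -> int) : diagQ a *m diagQ a' = diagQ (fun i => a i + a' i).
Proof.
rewrite mulmx_diag; congr diag_mx; apply/rowP => i; rewrite !mxE.
by rewrite expfzDr.
Qed.
Lemma diagQ0 n (a : 'I_n -> int) : (forall i, a i = 0) -> diagQ a = 1%:M.
Proof.
move=> h; rewrite -diag_const_mx; congr diag_mx; apply/rowP => i.
by rewrite !mxE h expr0z.
Qed.
Lemma diagQV n (a : 'I_n -> int) : invmx (diagQ a) = diagQ (fun i => - a i).
Proof.
apply: (can_inj (mulKmx (diagQ_unit a))); rewrite mulmxV ?diagQ_unit // diagQM diagQ0 //.
by move=> i; rewrite subrr.
Qed.
Lemma diagQ_tr n (a : 'I_n -> int) : (diagQ a)^T = diagQ a.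
Proof. by rewrite tr_diag_mx. Qed.
Lemma tilde_diagQ n (a : 'I_n -> int) : tilde (diagQ a) = diagQ (fun i => - a i).
Proof. by rewrite /tilde diagQ_tr diagQV. Qed.
Lemma diagQE n (a : 'I_n -> int) i j : diagQ a i j = Q ^ a i *+ (i == j).
Proof. by rewrite !mxE. Qed.

Lemma prodQ (I : Type) r (P : pred I) (a : I -> int) :
  \prod_(i <- r | P i) Q ^ a i = Q ^ (\sum_(i <- r | P i) a i).
Proof.
elim/big_rec2: _ => [|i y1 y2 _ ->]; first by rewrite expr0z.
by rewrite expfzDr.
Qed.

Section Minors.
(** A lower bound m for the valuation of the k-th determinantal divisor, without a valuation. The
    index maps need be neither injective nor increasing, a repetition giving the minor 0. *)
Definition mge k (m : int) p r (A : 'M[K]_(p, r)) :=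
  forall (f : 'I_k -> 'I_p) (h : 'I_k -> 'I_r), O (Q ^ (- m) * \det (mxsub f h A)).

Lemma mge_mull k m p p' r (U : 'M[K]_(p', p)) (A : 'M[K]_(p, r)) :
  mxO U -> mge k m A -> mge k m (U *m A).
Proof.
move=> hU hA f h; rewrite mxsub_mul det_mul_rows mulr_sumr; apply: O_sum => phi _.
rewrite mulrCA; apply: OM; first by apply: O_prod => i _; rewrite mxE.
have -> : rowsub phi (colsub h A) = mxsub phi h A by apply/matrixP => i j; rewrite !mxE.
exact: hA.
Qed.

Lemma mge_tr k m p r (A : 'M[K]_(p, r)) : mge k m A -> mge k m A^T.
Proof. by move=> hA f h; rewrite -det_tr -trmx_mxsub trmxK. Qed.

Lemma mge_mulr k m p r r' (U : 'M[K]_(r, r')) (A : 'M[K]_(p, r)) :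
  mxO U -> mge k m A -> mge k m (A *m U).
Proof.
move=> hU hA; rewrite -[_ *m _]trmxK trmx_mul; apply/mge_tr/mge_mull/mge_tr/hA.
exact: mxOT.
Qed.

Definition Msum n (k : nat) (mu : 'I_n -> int) : int := \sum_(i < n | (i < k)%N) mu i.

Lemma Msum_widen n k (le : (k <= n)%N) (mu : 'I_n -> int) :
  Msum k mu = \sum_(i < k) mu (widen_ord le i).
Proof. by rewrite /Msum (big_ord_narrow le). Qed.

Lemma MsumS n (mu : 'I_n -> int) (i : 'I_n) : Msum i.+1 mu = Msum i mu + mu i.
Proof.
rewrite /Msum (bigD1 i) ?ltnSn //= addrC; congr (_ + _); apply: eq_bigl => j.
rewrite ltnS; case: (ltngtP j i) => [lt|gt|/val_inj ->] /=.
- by rewrite -(inj_eq val_inj) neq_ltn lt.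
- by [].
- by rewrite eqxx.
Qed.

Lemma Msum0 n (mu : 'I_n -> int) : Msum 0 mu = 0.
Proof. by rewrite /Msum big1. Qed.

Lemma Msum_inj n (mu nu : 'I_n -> int) :
  (forall k, (k <= n)%N -> Msum k mu = Msum k nu) -> mu =1 nu.
Proof.
move=> h i; have := h i.+1 (ltn_ord i); rewrite !MsumS (h i) ?(ltnW (ltn_ord i)) //.
exact: addrI.
Qed.

Lemma mge_lead k m n p r (le : (k <= n)%N) (A : 'M[K]_(p, r)) (f : 'I_n -> 'I_p) (h : 'I_n -> 'I_r)
  (mu : 'I_n -> int) :
  (forall i j : 'I_n, (i < j)%N -> A (f i) (h j) = 0) -> (forall i, A (f i) (h i) = Q ^ mu i) ->
  mge k m A -> m <= Msum k mu.
Proof.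
move=> tri dA hA; have := hA (f \o widen_ord le) (h \o widen_ord le).
rewrite det_trig; last first.
  by apply/is_trig_mxP => i j ij; rewrite mxE /= tri.
under eq_bigr => i _ do rewrite mxE /= dA.
by rewrite prodQ -Msum_widen -expfzDr // OQ addrC subr_ge0.
Qed.

(* The minor on the rows [f 0, .., f (j - 1), s] and the columns [h 0, .., h (j - 1), t]. *)
Lemma mge_extend n p r (A : 'M[K]_(p, r)) (f : 'I_n -> 'I_p) (h : 'I_n -> 'I_r)
  (mu : 'I_n -> int) (j : 'I_n) s t :
  (forall i l : 'I_n, (i < l)%N -> (l < j)%N -> A (f i) (h l) = 0) ->
  (forall i : 'I_n, (i < j)%N -> A (f i) t = 0) ->
  (forall i : 'I_n, (i < j)%N -> A (f i) (h i) = Q ^ mu i) ->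
  mge j.+1 (Msum j.+1 mu) A -> O (Q ^ (- mu j) * A s t).
Proof.
move=> tri trit dA hA.
pose ext T (f : 'I_n -> T) s (i : 'I_j.+1) :=
  if (i < j)%N then f (widen_ord (ltn_ord j) i) else s.
have := hA (ext _ f s) (ext _ h t); rewrite det_trig; last first.
  apply/is_trig_mxP => i l il; rewrite mxE /ext.
  have ij : (i < j)%N by rewrite (leq_trans il) // -ltnS.
  by rewrite ij; case: ifP => lj; [rewrite tri|rewrite trit].
rewrite big_ord_recr /= mxE /ext ltnn.
rewrite (eq_bigr (fun i : 'I_j => Q ^ mu (widen_ord (ltnW (ltn_ord j)) i))); last first.
  move=> i _; rewrite mxE /= ltn_ord.
  have -> : widen_ord (ltn_ord j) (widen_ord (leqnSn j) i) = widen_ord (ltnW (ltn_ord j)) i.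
    exact: val_inj.
  by rewrite dA //= ltn_ord.
rewrite prodQ MsumS (Msum_widen (ltnW (ltn_ord j))).
by rewrite mulrA -expfzDr // opprD addrAC addNr add0r.
Qed.

(** After subtraction of a threshold t, any distinct terms add up to at least the sum of all the
    negative parts. Comparing with the k smallest values therefore requires no sorting. *)
Lemma sum_smallest (T : finType) k (e : T -> int) (f : 'I_k -> T) (t S : int) :
  injective f -> S <= \sum_x Num.min (e x - t) 0 -> S + t *+ k <= \sum_i e (f i).
Proof.
move=> fi hS; have -> : \sum_i e (f i) = \sum_i (e (f i) - t) + t *+ k.
  by rewrite sumrB sumr_const card_ord subrK.
rewrite lerD2r (le_trans hS) //.
rewrite (bigID [in (f @: [set: 'I_k])%SET]) /= -[leRHS]addr0 lerD //; last first.
  by apply: sumr_le0 => x _; rewrite ge_min lexx orbT.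
rewrite big_imset /=; last by move=> x y _ _; exact: fi.
by rewrite (eq_bigl predT) => [|x]; rewrite ?finset.in_setT //; apply: ler_sum => i _; rewrite ge_min lexx.
Qed.

Lemma asc_sum n (mu : 'I_n -> int) k (f : 'I_k -> 'I_n) :
  (forall i j : 'I_n, (i <= j)%N -> mu i <= mu j) -> (k <= n)%N -> injective f ->
  Msum k mu <= \sum_i mu (f i).
Proof.
case: k f => [|k] f mono kn fi; first by rewrite Msum0 big_ord0.
(* The largest of the k + 1 smallest exponents: relative to it the exponents are nonpositive up to
   index k and nonnegative beyond. *)
pose t := mu (Ordinal kn).
rewrite -[leLHS](subrK (t *+ k.+1)); apply: sum_smallest fi _.
rewrite (bigID (fun x : 'I_n => (x < k.+1)%N)) /= -[leLHS]addr0 lerD //; last first.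
  apply: sumr_ge0 => x; rewrite -leqNgt => kx; rewrite le_min lexx andbT subr_ge0.
  by apply: mono => /=; exact: ltnW.
rewrite /Msum [leRHS](eq_bigr (fun x => mu x - t)); last first.
  by move=> x xk; apply/min_idPl; rewrite subr_le0; apply: mono; rewrite -ltnS.
rewrite sumrB lerD2l lerN2 sumr_const.
suff -> : #|[pred x : 'I_n | (x < k.+1)%N]| = k.+1 by [].
by rewrite -sum1_card (big_ord_narrow kn) sum1_card card_ord.
Qed.

Definition sym_exp n (mu : 'I_n -> int) (i : 'I_(n + n)) : int :=
  match fintype.split i with inl j => mu j | inr j => - mu j end.

Lemma sym_exp_l n (mu : 'I_n -> int) i : sym_exp mu (lshift n i) = mu i.
Proof. by rewrite /sym_exp (unsplitK (inl i)). Qed.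
Lemma sym_exp_r n (mu : 'I_n -> int) i : sym_exp mu (rshift n i) = - mu i.
Proof. by rewrite /sym_exp (unsplitK (inr i)). Qed.

(** When mu <= 0 the opposite exponents are nonnegative, so the k smallest of the 2n exponents of a
    symplectic diagonal matrix are again the first k of mu. *)
Lemma asc_sum2 n (mu : 'I_n -> int) k (f : 'I_k -> 'I_(n + n)) :
  (forall i j : 'I_n, (i <= j)%N -> mu i <= mu j) -> (forall i, mu i <= 0) ->
  (k <= n)%N -> injective f ->
  Msum k mu <= \sum_i sym_exp mu (f i).
Proof.
case: k f => [|k] f mono mu0 kn fi; first by rewrite Msum0 big_ord0.
pose t := mu (Ordinal kn).
rewrite -[leLHS](subrK (t *+ k.+1)); apply: sum_smallest fi _.
rewrite big_split_ord /= -[leLHS]addr0 lerD //; last first.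
  apply: sumr_ge0 => x _; rewrite sym_exp_r le_min lexx andbT -opprD oppr_ge0.
  by move: (mu0 x) (mu0 (Ordinal kn)); rewrite -/t; lia.
under eq_bigr => x _ do rewrite sym_exp_l.
rewrite (bigID (fun x : 'I_n => (x < k.+1)%N)) /= -[leLHS]addr0 lerD //; last first.
  apply: sumr_ge0 => x; rewrite -leqNgt => kx; rewrite le_min lexx andbT subr_ge0.
  by apply: mono => /=; exact: ltnW.
rewrite /Msum [leRHS](eq_bigr (fun x => mu x - t)); last first.
  by move=> x xk; apply/min_idPl; rewrite subr_le0; apply: mono; rewrite -ltnS.
rewrite sumrB lerD2l lerN2 sumr_const.
suff -> : #|[pred x : 'I_n | (x < k.+1)%N]| = k.+1 by [].
by rewrite -sum1_card (big_ord_narrow kn) sum1_card card_ord.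
Qed.

Lemma mge_diagQ k p (e : 'I_p -> int) S :
  (forall f : 'I_k -> 'I_p, injective f -> S <= \sum_i e (f i)) -> mge k S (diagQ e).
Proof.
move=> hS f h; have [fi|nfi] := boolP (injectiveb f); last first.
  have [i [j ij fij]] : exists i, exists2 j, i != j & f i = f j.
    apply: contrapT => no; case/negP: nfi; apply/injectiveP => i j fij.
    by apply/eqP; apply: contraT => ij; case: no; exists i, j.
  by rewrite (determinant_alternate ij) ?mulr0 // => l; rewrite !mxE fij.
rewrite mulr_sumr; apply: O_sum => s _; rewrite mulrCA; apply: OM.
  by case: (odd_perm s); rewrite ?expr1 ?expr0 //; apply: ON.
have [/forallP hs|/forallPn[i hi]] := boolP [forall i, f i == h (s i)].
  rewrite (eq_bigr (fun i => Q ^ e (f i))); last first.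
    by move=> i _; rewrite mxE diagQE (eqP (hs i)) eqxx.
  by rewrite prodQ -expfzDr // OQ addrC subr_ge0; apply: hS; exact/injectiveP.
by rewrite (bigD1 i) //= mxE diagQE (negbTE hi) mul0r mulr0.
Qed.

Lemma levi_diagQ n (mu : 'I_n -> int) : levi (diagQ (fun i => - mu i)) = diagQ (sym_exp mu).
Proof.
rewrite /levi tilde_diagQ; apply/matrixP => i j.
elim/split_ord_ind: i => i; elim/split_ord_ind: j => j;
  rewrite ?block_mxEul ?block_mxEur ?block_mxEdl ?block_mxEdr ?diagQE
    ?sym_exp_l ?sym_exp_r ?opprK ?mxE ?(inj_eq (@lshift_inj _ _)) ?(inj_eq (@rshift_inj _ _))
    ?eq_lrshift ?eq_rlshift //.
Qed.

Lemma tilde_tilde n (x : 'M[K]_n) : tilde (tilde x) = x.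
Proof. by rewrite /tilde trmx_inv invmxK trmxK. Qed.

(** The quotient w is forced to be upper triangular, column by column, and its diagonal entries are
    Q^(a2 - a1); integrality of w is then the inequality. *)
Lemma herm_le n (y1 y2 w : 'M[K]_n) (a1 a2 : 'I_n -> int) : mxO w -> y2 = w *m y1 ->
  (forall i j : 'I_n, (j < i)%N -> y1 i j = 0) -> (forall i, y1 i i = Q ^ a1 i) ->
  (forall i j : 'I_n, (j < i)%N -> y2 i j = 0) -> (forall i, y2 i i = Q ^ a2 i) ->
  forall i, a1 i <= a2 i.
Proof.
move=> hw e t1 d1 t2 d2.
have sumE (i j : 'I_n) : (forall l : 'I_n, (l < j)%N -> w i l = 0) -> y2 i j = w i j * Q ^ a1 j.
  move=> hl; rewrite e mxE (bigD1 j) //= d1 big1 ?addr0 // => l lj.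
  case: (ltngtP l j) => [lt|gt|/val_inj e']; last by rewrite e' eqxx in lj.
    by rewrite hl ?mul0r.
  by rewrite t1 ?mulr0.
have low m : forall i j : 'I_n, (j <= m)%N -> (j < i)%N -> w i j = 0.
  elim: m => [|m IH] i j jm ji.
    have := t2 _ _ ji; rewrite sumE; last first.
      by move=> l; move: jm; rewrite leqn0 => /eqP ->.
    by move/eqP; rewrite mulf_eq0 (negbTE (expfz_neq0 _ Q0)) orbF => /eqP.
  have := t2 _ _ ji; rewrite sumE; last first.
    move=> l lj; apply: IH; first by rewrite -ltnS (leq_trans lj).
    exact: ltn_trans ji.
  by move/eqP; rewrite mulf_eq0 (negbTE (expfz_neq0 _ Q0)) orbF => /eqP.
move=> i; have := d2 i; rewrite sumE; last by move=> l li; exact: (low l).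
move=> e'; rewrite -subr_ge0 -OQ expfzDr // -e' -invr_expz mulfK ?expfz_neq0 //.
Qed.

Lemma herm_unique n (x u1 u2 : 'M[K]_n) (a1 a2 : 'I_n -> int) : x \in unitmx ->
  GLO u1 -> GLO u2 ->
  (forall i j : 'I_n, (j < i)%N -> (u1 *m x) i j = 0) -> (forall i, (u1 *m x) i i = Q ^ a1 i) ->
  (forall i j : 'I_n, (j < i)%N -> (u2 *m x) i j = 0) -> (forall i, (u2 *m x) i i = Q ^ a2 i) ->
  a1 =1 a2.
Proof.
move=> ux hu1 hu2 t1 d1 t2 d2 i; apply/eqP; rewrite eq_le.
have w2 : u2 *m x = (u2 *m invmx u1) *m (u1 *m x).
  by case: hu1 => u1u _ _; rewrite -mulmxA mulKmx.
have w1 : u1 *m x = (u1 *m invmx u2) *m (u2 *m x).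
  by case: hu2 => u2u _ _; rewrite -mulmxA mulKmx.
apply/andP; split.
  by apply: (herm_le _ w2) => //; case: (GLOM hu2 (GLOV hu1)).
by apply: (herm_le _ w1) => //; case: (GLOM hu1 (GLOV hu2)).
Qed.

Lemma smith_mge n (x u v : 'M[K]_n) (mu : 'I_n -> int) k :
  (forall i j : 'I_n, (i <= j)%N -> mu i <= mu j) -> GLO u -> GLO v ->
  x = u *m diagQ mu *m v -> (k <= n)%N -> mge k (Msum k mu) x.
Proof.
move=> mono [_ hu _] [_ hv _] -> kn; apply/mge_mulr/mge_mull => //.
by apply: mge_diagQ => f fi; exact: asc_sum.
Qed.

End Minors.

(** * The Satake transform on the parabolic and its leading terms *)

Section Satake.
Hypothesis Hherm : forall n (x : 'M[K]_n), x \in unitmx -> exists u (a : 'I_n -> int),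
  [/\ GLO u, forall i j : 'I_n, (j < i)%N -> (u *m x) i j = 0
    & forall i, (u *m x) i i = Q ^ a i].
Hypothesis Hsmith : forall n (x : 'M[K]_n), x \in unitmx -> exists u v (a : 'I_n -> int),
  [/\ GLO u, GLO v, forall i j : 'I_n, (i <= j)%N -> a i <= a j
    & x = u *m diagQ a *m v].
Variables (C : numFieldType) (n : nat) (w : 'I_n -> C).
Hypothesis w0 : forall i, w i != 0.
Local Notation mx := 'M[K]_(n + n).
Local Notation siegelP := (@siegelP K n).

(** The group [D0] at a prime where b is a unit. *)
Definition Hgrp : set mx :=
  [set g | exists d v, [/\ GLO d, v^T = v, mxO v & g = sg d v]].

Lemma Hgrp_siegelP g : Hgrp g -> siegelP g.
Proof. by move=> [d [v [[ud _ _] vv _ ->]]]; exact: siegelP_sg. Qed.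
Lemma Hgrp1 : Hgrp 1%:M.
Proof.
exists 1%:M, 0; split; [exact: GLO1|exact: trmx0|exact: mxO_0|].
by rewrite /sg tilde1 mulmx0 -scalar_mx_block.
Qed.
Lemma mxO_conj (x v : 'M[K]_n) : mxO x -> mxO v -> mxO (x^T *m v *m x).
Proof. by move=> hx hv; apply: mxOM => //; apply: mxOM => //; exact: mxOT. Qed.
Lemma HgrpM g h : Hgrp g -> Hgrp h -> Hgrp (g *m h).
Proof.
move=> [d [v [hd vv hv ->]]] [d' [v' [hd' vv' hv' ->]]].
have [ud _ _] := hd; have [ud' od' _] := hd'; rewrite sgM //.
exists (d *m d'), (d'^T *m v *m d' + v'); split=> //; first exact: GLOM.
  by rewrite linearD /= sym_conj // vv'.
by apply: mxOD => //; exact: mxO_conj.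
Qed.
Lemma HgrpV g : Hgrp g -> Hgrp (invmx g).
Proof.
move=> [d [v [hd vv hv ->]]]; have hd' := GLOV hd; have [ud' od' _] := hd'.
have [ud _ _] := hd; rewrite sgV //; eexists; eexists; split; [exact: hd'| | |reflexivity].
  by rewrite linearN /= sym_conj.
by apply/mxON/mxO_conj.
Qed.
Lemma Hgrp_levi d : GLO d -> Hgrp (levi d).
Proof.
by move=> hd; exists d, 0; rewrite leviE; split=> //; [exact: trmx0|exact: mxO_0].
Qed.
Lemma Hgrp_ntri v : v^T = v -> mxO v -> Hgrp (ntri v).
Proof. by move=> vv hv; exists 1%:M, v; rewrite ntriE; split=> //; exact: GLO1. Qed.

Lemma PH : group_pair siegelP Hgrp.
Proof.
split; [exact: siegelPM|exact: siegelPV|exact: siegelP_unit|exact: Hgrp_siegelP|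
  exact: Hgrp1|exact: HgrpM|exact: HgrpV].
Qed.
Local Notation linv := (@linv C K (n + n) siegelP Hgrp).
Local Notation rinv := (@rinv C K (n + n) siegelP Hgrp).
Local Notation fsupp := (@fsupp C K (n + n) siegelP Hgrp).
Local Notation csum := (@csum C K (n + n) siegelP Hgrp).
Local Notation cmul := (@cmul C K (n + n) siegelP Hgrp).
Implicit Types (F G : mx -> C).

Definition mono_at (a : 'I_n -> int) (X : 'I_n -> C) : C := \prod_i X i ^ a i.

(** [omega0] with arbitrary nonzero weights w in place of the powers q^-i. *)
Definition om0 (x : 'M[K]_n) (X : 'I_n -> C) : C :=
  let a := xget [ffun=> 0] [set a : {ffun 'I_n -> int} | exists2 u, GLO u &
    (forall i j : 'I_n, (j < i)%N -> (u *m x) i j = 0) /\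
    (forall i, (u *m x) i i = Q ^ a i)] in
  \prod_(i < n) (w i * X i) ^ a i.

Lemma om0E x u (a : 'I_n -> int) X : x \in unitmx -> GLO u ->
  (forall i j : 'I_n, (j < i)%N -> (u *m x) i j = 0) -> (forall i, (u *m x) i i = Q ^ a i) ->
  om0 x X = \prod_i (w i * X i) ^ a i.
Proof.
move=> ux hu t d; rewrite /om0; set S := [set _ | _]; set a' := xget _ _.
have : S a'.
  apply: (@xgetPex _ _ S); exists [ffun i => a i], u => //; split=> // i.
  by rewrite ffunE.
move=> [u' hu' [t' d']]; apply: eq_bigr => i _.
by rewrite (herm_unique ux hu' hu t' d' t d).
Qed.

Lemma om0_mull x u X : x \in unitmx -> GLO u -> om0 (u *m x) X = om0 x X.
Proof.
move=> ux hu; have [v [a [hv t d]]] := Hherm ux; have [uu _ _] := hu.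
rewrite (om0E X ux hv t d) (@om0E _ (v *m invmx u) a) //.
- by rewrite unitmx_mul uu.
- exact/GLOM/GLOV.
- by move=> i j ij; rewrite -mulmxA mulKmx // t.
- by move=> i; rewrite -mulmxA mulKmx // d.
Qed.

Lemma om0_scale x m X : x \in unitmx ->
  (forall i, X i != 0) -> om0 (x *m (Q ^ m)%:M) X = om0 x X * (\prod_i (w i * X i)) ^ m.
Proof.
move=> ux X0; have [v [a [hv t d]]] := Hherm ux.
rewrite (om0E X ux hv t d) (@om0E _ v (fun i => a i + m)) //.
- rewrite (big_morph (fun y : C => y ^ m) (fun y z => expfzMl y z m) (exp1rz C m)).
  rewrite -big_split /=; apply: eq_bigr => i _.
  by rewrite expfzDr // mulf_neq0.
- by rewrite unitmx_mul ux unitmxE det_scalar unitfE expf_neq0 // expfz_neq0.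
- by move=> i j ij; rewrite mulmxA mul_mx_scalar mxE t ?mulr0.
- by move=> i; rewrite mulmxA mul_mx_scalar mxE d -expfzDr // addrC.
Qed.

Definition satake F X := csum (fun g => F g * om0 (drsubmx g) X).

Lemma satake_linv F X : linv F -> linv (fun g => F g * om0 (drsubmx g) X).
Proof.
move=> lF h g hh gP; rewrite lF //; congr (_ * _).
case: hh => d [v [hd vv hv ->]]; case/siegelPP: gP => d' [v' [ud' vv' ->]].
have [ud _ _] := hd; rewrite sgM // /sg !block_mxKdr om0_mull //.
Qed.

(** Independence of characters. Doubling a coordinate in which two exponents differ separates their
    monomials; subtracting the scaled relation from the original one removes a term. *)
Lemma mono_independent (E : seq {ffun 'I_n -> int}) (c : {ffun 'I_n -> int} -> C) :
  uniq E ->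
  (forall X, (forall i, X i != 0) -> \sum_(a <- E) c a * mono_at a X = 0) ->
  forall a, a \in E -> c a = 0.
Proof.
have mono0 a X : (forall i, X i != 0) -> mono_at a X != 0.
  by move=> X0; apply/prodf_neq0 => i _; rewrite expfz_neq0.
have monoM a X Y : mono_at a (fun i => X i * Y i) = mono_at a X * mono_at a Y.
  by rewrite /mono_at -big_split; apply: eq_bigr => i _; rewrite expfzMl.
elim: E c => [|a0 E IH] c // /andP[a0E uE] h.
have cE a : a \in E -> c a = 0.
  move=> aE; have [i ai] : exists i, a i != a0 i.
    apply: contrapT => no; case/negP: a0E; suff -> : a0 = a by [].
    by apply/ffunP => i; apply/eqP; rewrite eq_sym; apply: contraT => ai; case: no; exists i.
  pose Y j : C := if j == i then 2 else 1.
  have Y0 j : Y j != 0 by rewrite /Y; case: ifP => _; rewrite ?pnatr_eq0 ?oner_eq0.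
  have mY a' : mono_at a' Y = 2 ^ a' i.
    rewrite /mono_at (bigD1 i) //= /Y eqxx big1 ?mulr1 // => j ji.
    by rewrite (negbTE ji) exp1rz.
  have := IH (fun a => c a * (mono_at a Y - mono_at a0 Y)) uE.
  move=> /(_ _ _ aE) => IH'.
  have : c a * (mono_at a Y - mono_at a0 Y) = 0.
    apply: IH' => X X0.
    have h1 := h X X0; have h2 := h (fun j => X j * Y j).
    have /h2 {}h2 : forall j, X j * Y j != 0 by move=> j; rewrite mulf_neq0.
    move: h1 h2; rewrite !big_cons => h1 h2.
    transitivity (\sum_(j <- E) c j * mono_at j (fun j => X j * Y j)
                  - mono_at a0 Y * \sum_(j <- E) c j * mono_at j X).
      by rewrite mulr_sumr -sumrB; apply: eq_bigr => a' _; rewrite monoM; ring.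
    move/eqP: h1; rewrite addrC addr_eq0 => /eqP ->.
    move/eqP: h2; rewrite addrC addr_eq0 => /eqP ->; rewrite monoM; ring.
  move/eqP; rewrite mulf_eq0 => /orP[/eqP //|]; rewrite subr_eq0 !mY => /eqP e.
  case/eqP: ai; apply/eqP; apply: contraT => ne; exfalso.
  have : (2 : C) ^ (a i - a0 i) = 1 by rewrite expfzDr // -invr_expz e divff // expfz_neq0.
  have : a i - a0 i != 0 by rewrite subr_eq0.
  case: (a i - a0 i) => m; first by move=> m0; rewrite -exprnP => /eqP; rewrite pexprn_eq1 // pnatr_eq1 orbF; exact/negP.
  move=> _; rewrite NegzE -exprnN => /(congr1 GRing.inv); rewrite invrK invr1 => /eqP.
  by rewrite pexprn_eq1 // pnatr_eq1.
move=> a; rewrite inE => /orP[/eqP ->|/cE //].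
have := h (fun=> 1) (fun=> oner_neq0 _); rewrite big_cons big_seq big1 ?addr0; last first.
  by move=> a' /cE ->; rewrite mul0r.
move/eqP; rewrite mulf_eq0 => /orP[/eqP //|]; rewrite (negbTE (mono0 _ _ _)) //.
Qed.

Lemma mono_collect (J : eqType) (L : seq J) (e : J -> {ffun 'I_n -> int}) (c : J -> C) :
  (forall X, (forall i, X i != 0) -> \sum_(j <- L) c j * mono_at (e j) X = 0) ->
  forall a, \sum_(j <- L | e j == a) c j = 0.
Proof.
move=> h a; have [aE|aE] := boolP (a \in map e L); last first.
  elim: L aE {h} => [|j L IH] /=; first by rewrite big_nil.
  by rewrite inE negb_or eq_sym big_cons => /andP[/negbTE -> /IH].
apply: (@mono_independent (undup (map e L)) (fun a => \sum_(j <- L | e j == a) c j));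
  rewrite ?undup_uniq ?mem_undup // => X X0; rewrite -[RHS](h X X0).
under eq_bigr => b _ do rewrite mulr_suml.
rewrite (exchange_big_dep xpredT) //= big_seq [RHS]big_seq.
apply: eq_bigr => j jL; rewrite (eq_bigl (pred1 (e j))) => [|b]; last by rewrite /= eq_sym.
rewrite -big_filter filter_pred1_uniq ?undup_uniq ?mem_undup ?big_seq1 //.
exact: map_f.
Qed.

(* If [mu] is minimal among the elementary divisors of the support of [F], then
   every coset contributing to the monomial [X ^ (- mu)] carries the same value. *)
Lemma satake_lead F (mu : 'I_n -> int) (J : eqType) (L : seq J)
    (e : J -> {ffun 'I_n -> int}) (c : J -> C) :
  linv F -> rinv F -> fsupp F ->
  (forall X, (forall i, X i != 0) -> satake F X = \sum_(j <- L) c j * mono_at (e j) X) ->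
  F (levi (diagQ (fun i => - mu i))) != 0 ->
  (forall (mu' : 'I_n -> int) v, (forall i j : 'I_n, (i <= j)%N -> mu' i <= mu' j) -> v^T = v ->
     F (sg (diagQ (fun i => - mu' i)) v) != 0 ->
     (forall k, (k <= n)%N -> Msum k mu' <= Msum k mu) -> mu' =1 mu /\ mxO v) ->
  has (fun j => e j == [ffun i => - mu i]) L.
Proof.
move=> lF rF fF FE Fmu hmin; apply: contraT => /hasPn noL.
have [s0 cs0] := fF.
have [s1 ds1 [s1P cs1]] := covers_distinct PH cs0.
pose s := [seq g <- s1 | F g != 0].
have ds : distinct Hgrp s by apply: subseq_pairwise ds1; exact: filter_subseq.
have cs : covers siegelP Hgrp s (fun g => F g != 0).
  split=> [h|g gP Fg]; first by rewrite mem_filter => /andP[_ /s1P].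
  have [h hs gh] := cs1 _ gP Fg; exists h => //; rewrite mem_filter hs andbT.
  by rewrite -(linv_lc lF (s1P _ hs) gh).
have [a ha] : exists a : mx -> {ffun 'I_n -> int}, forall g, siegelP g -> exists2 u, GLO u &
    (forall i j : 'I_n, (j < i)%N -> (u *m drsubmx g) i j = 0) /\
    (forall i, (u *m drsubmx g) i i = Q ^ a g i).
  suff /choice[a ha] : forall g : mx, exists a : {ffun 'I_n -> int},
    siegelP g -> exists2 u, GLO u &
    (forall i j : 'I_n, (j < i)%N -> (u *m drsubmx g) i j = 0) /\
    (forall i, (u *m drsubmx g) i i = Q ^ a i) by exists a.
  move=> g.
  have [gP|] := pselect (siegelP g); last by exists [ffun=> 0].
  have /siegelPP[d [v [ud vv gE]]] := gP; have [u [a [hu t da]]] := Hherm ud.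
  exists [ffun i => a i] => _; exists u => //; rewrite gE /sg block_mxKdr; split=> // i.
  by rewrite ffunE.
pose W (b : 'I_n -> int) : C := mono_at b w.
have W0 b : W b != 0 by apply/prodf_neq0 => i _; rewrite expfz_neq0.
have satE X : (forall i, X i != 0) ->
    satake F X = \sum_(g <- s) F g * W (a g) * mono_at (a g) X.
  move=> X0; rewrite /satake (csumE PH (s := s)) //.
  - rewrite big_seq [RHS]big_seq; apply: eq_bigr => g /(cs.1) gP.
    have [u hu [t da]] := ha g gP; have /siegelPP[d [v [ud vv gE]]] := gP.
    have ud' : drsubmx g \in unitmx by rewrite gE /sg block_mxKdr.
    rewrite (om0E X ud' hu t da) -mulrA; congr (_ * _).
    by rewrite /W /mono_at -big_split; apply: eq_bigr => i _; rewrite expfzMl.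
  - exact: satake_linv.
  - by apply: covers_sub cs => g gP; apply: contra_neq => ->; rewrite mul0r.
pose L2 : seq (mx + J) := map inl s ++ map inr L.
pose e2 (j : mx + J) := match j with inl g => a g | inr j => e j end.
pose c2 (j : mx + J) : C := match j with inl g => F g * W (a g) | inr j => - c j end.
have rel X : (forall i, X i != 0) -> \sum_(j <- L2) c2 j * mono_at (e2 j) X = 0.
  move=> X0; rewrite big_cat !big_map /= -satE // FE //.
  by under [X in _ + X]eq_bigr do rewrite mulNr; rewrite sumrN subrr.
pose la : {ffun 'I_n -> int} := [ffun i => - mu i].
have := mono_collect rel la; rewrite big_cat !big_map /=.
rewrite [X in _ + X]big_seq_cond [X in _ + X]big1 ?addr0; last first.
  by move=> j /andP[/noL /negbTE ->].
pose g0 := levi (diagQ (fun i => - mu i)).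
(* By the Smith form, g lies in H [sg (diagQ (- mu')) V] H. The matrix ~(u x) is lower triangular
   with diagonal Q^mu, so its leading minors bound the partial sums of mu' by those of mu;
   minimality then gives mu' = mu and V integral, and V is absorbed on the right. *)
have key g : g \in s -> a g == la -> F g * W (a g) = F g0 * W la.
  move=> gs ag0; rewrite (eqP ag0); congr (_ * _).
  have gP := cs.1 _ gs; have Fg : F g != 0 by move: gs; rewrite mem_filter => /andP[].
  have [u hu [t da]] := ha g gP; have /siegelPP[x [v [ux vv gE]]] := gP.
  rewrite gE /sg block_mxKdr -/(sg x v) in t da.
  have [uu _ _] := hu.
  have Fg1 : F g = F (sg (u *m x) v).
    rewrite gE -(lF (levi u) (sg x v)) ?leviE ?sgM //; last exact: siegelP_sg.
      by rewrite mulmx0 mul0mx add0r.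
    by rewrite -leviE; exact: Hgrp_levi.
  have ux1 : u *m x \in unitmx by rewrite unitmx_mul uu.
  have [_ [tt dt]] := tilde_utri ux1 t.
  have [u1 [v1 [mu' [hu1 hv1 mono' xE]]]] := Hsmith (tilde_unit ux1).
  have [uu1 _ _] := hu1; have [uv1 _ _] := hv1.
  have uD := diagQ_unit mu'; have uD' := diagQ_unit (fun i => - mu' i).
  pose V := (invmx (tilde v1))^T *m v *m invmx (tilde v1).
  have hv1' := GLO_tilde hv1; have hu1' := GLO_tilde hu1.
  have xE' : u *m x = tilde u1 *m diagQ (fun i => - mu' i) *m tilde v1.
    rewrite -[LHS]tilde_tilde xE !tildeM ?unitmx_mul ?uu1 ?uD //.
    by rewrite tilde_diagQ.
  have gE2 : sg (u *m x) v = levi (tilde u1) *m sg (diagQ (fun i => - mu' i)) V *m levi (tilde v1).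
    have [u1' _ _] := hu1'; have [v1' _ _] := hv1'.
    rewrite !leviE !sgM ?unitmx_mul ?u1' //= mulmx0 mul0mx add0r addr0 -xE'; congr sg.
    by rewrite /V trmx_inv !mulmxA mulmxV ?unitmx_tr // mul1mx mulmxKV.
  have VV : V^T = V by exact: sym_conj.
  have sP : siegelP (sg (diagQ (fun i => - mu' i)) V) by exact: siegelP_sg.
  have Fg2 : F g = F (sg (diagQ (fun i => - mu' i)) V).
    rewrite Fg1 gE2 rF; first last.
    - by apply: siegelPM sP; apply/Hgrp_siegelP/Hgrp_levi.
    - exact: Hgrp_levi.
    by rewrite lF //; exact: Hgrp_levi.
  have [||eqmu hV] := hmin mu' V mono' VV _ _.
  - by rewrite -Fg2.
  - move=> k kn; apply: (@mge_lead k _ n n n kn (tilde (u *m x)) id id mu).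
    + by move=> i j ij; apply: tt.
    + by move=> i; rewrite dt da -gE (eqP ag0) ffunE -invr_expz invrK.
    + exact: smith_mge mono' hu1 hv1 xE kn.
  rewrite Fg2 sgE rF; first last.
  - by rewrite leviE; apply: siegelP_sg; [exact: diagQ_unit|exact: trmx0].
  - exact: Hgrp_ntri.
  by congr (F (levi _)); congr diag_mx; apply/rowP => i; rewrite !mxE eqmu.
(* All contributions to this monomial are equal and nonzero, so in characteristic 0 their sum
   vanishes only if there are none; but the coset of [g0] contributes. *)
rewrite big_seq_cond (eq_bigr (fun=> F g0 * W la)); last by move=> g /andP[]; exact: key.
rewrite -big_seq_cond big_const_seq iter_addr_0 => /eqP.
rewrite mulrn_eq0 mulf_eq0 (negbTE Fmu) (negbTE (W0 _)) !orbF => /eqP c0.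
have g0P : siegelP g0 by rewrite /g0 leviE; apply: siegelP_sg; [exact: diagQ_unit|exact: trmx0].
have [h hs gh] := cs.2 _ g0P Fmu.
have : has (fun g => a g == la) s.
  apply/hasP; exists h => //; apply/eqP/ffunP => i; rewrite ffunE.
  have hP := cs.1 _ hs; have [u hu [t da]] := ha h hP.
  have /siegelPP[x [v [ux vv hE]]] := hP.
  rewrite hE /sg block_mxKdr -/(sg x v) in t da; rewrite -hE in da.
  case: gh => d' [d [v' [hd vv' hv' dE]]] g0E; have [ud _ _] := hd.
  have : g0 = sg d v' *m sg x v by rewrite g0E dE -hE.
  rewrite /g0 leviE sgM // => /sg_inj[|xE _]; first exact: diagQ_unit.
  apply: (herm_unique (a2 := fun i => - mu i) ux hu hd t da).
  - by move=> k l kl; rewrite -xE diagQE -(inj_eq val_inj) gtn_eqF.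
  - by move=> k; rewrite -xE diagQE eqxx.
by rewrite has_count c0.
Qed.

(* A minimal element of a finite family of exponents, first for [Msum 1] and then for the sum
   of all the partial sums. *)
Lemma exists_minimal (I : eqType) (s : seq I) (mu : I -> 'I_n -> int) : s != [::] ->
  exists2 i, i \in s & (forall j, j \in s -> Msum 1 (mu i) <= Msum 1 (mu j)) /\
   forall j, j \in s -> (0 < n)%N -> (forall k, (k <= n)%N -> Msum k (mu j) <= Msum k (mu i)) -> mu j =1 mu i.
Proof.
pose tot i := \sum_(k < n.+1) Msum k (mu i).
have amin (f : I -> int) (t : seq I) : t != [::] -> exists2 i, i \in t & forall j, j \in t -> f i <= f j.
  elim: t => // i t IH _; have [->|/IH[j jt hj]] := eqVneq t [::].
    by exists i; rewrite ?mem_head // => j; rewrite inE => /eqP ->.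
  have [fij|fji] := lerP (f i) (f j).
    exists i; rewrite ?mem_head // => l; rewrite inE => /orP[/eqP ->//|/hj]; exact: le_trans.
  exists j; rewrite ?inE ?jt ?orbT // => l; rewrite inE => /orP[/eqP ->|/hj //].
  exact: ltW.
move=> s0; have [i0 i0s hi0] := amin (fun i => Msum 1 (mu i)) s s0.
pose t := [seq i <- s | Msum 1 (mu i) <= Msum 1 (mu i0)].
have i0t : i0 \in t by rewrite mem_filter lexx.
have tn : t != [::] by apply/eqP => t0; rewrite t0 in i0t.
have [i it hi] := amin tot t tn.
move: it; rewrite mem_filter => /andP[ii0 is_].
exists i => //; split; first by move=> j /hi0; exact: le_trans.
move=> j js n0 hj; have jt : j \in t.
  by rewrite mem_filter js andbT (le_trans (hj 1%N n0)).
have := hi _ jt; rewrite /tot => le1; apply: Msum_inj => k kn.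
apply/eqP; rewrite eq_le hj //= leNgt; apply/negP => lt.
move: le1; rewrite leNgt => /negP; apply.
rewrite (bigD1 (Ordinal (kn : (k < n.+1)%N))) //= [ltRHS](bigD1 (Ordinal (kn : (k < n.+1)%N))) //=.
by apply: ltr_leD => //; apply: ler_sum => l _; apply: hj; rewrite -ltnS.
Qed.

Lemma smith_unique (x u v u' v' : 'M[K]_n) (mu mu' : 'I_n -> int) :
  (forall i j : 'I_n, (i <= j)%N -> mu i <= mu j) ->
  (forall i j : 'I_n, (i <= j)%N -> mu' i <= mu' j) ->
  GLO u -> GLO v -> GLO u' -> GLO v' ->
  x = u *m diagQ mu *m v -> x = u' *m diagQ mu' *m v' -> mu =1 mu'.
Proof.
have half (u1 v1 u1' v1' : 'M[K]_n) (nu nu' : 'I_n -> int) k :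
  (forall i j : 'I_n, (i <= j)%N -> nu i <= nu j) -> GLO u1 -> GLO v1 -> GLO u1' -> GLO v1' ->
  u1 *m diagQ nu *m v1 = u1' *m diagQ nu' *m v1' -> (k <= n)%N -> Msum k nu <= Msum k nu'.
  move=> m1 g1 g2 g1' g2' e kn; have [uu1 _ _] := g1'; have [uv1 _ _] := g2'.
  apply: (@mge_lead k _ n n n kn (diagQ nu') id id nu').
  - by move=> i j ij; rewrite diagQE -(inj_eq val_inj) ltn_eqF.
  - by move=> i; rewrite diagQE eqxx.
  apply: (smith_mge m1 (GLOM (GLOV g1') g1) (GLOM g2 (GLOV g2'))) => //.
  have := congr1 (fun y => invmx u1' *m y *m invmx v1') e.
  by rewrite -!mulmxA mulKmx // mulmxV // mulmx1 => <-.
move=> m1 m2 g1 g2 g1' g2' e e'; apply: Msum_inj => k kn; apply/eqP.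
rewrite eq_le (half u v u' v') -?e' //= (half u' v' u v) //.
by rewrite -e' -e.
Qed.

Lemma siegel_smith g : siegelP g -> exists h1 h2 (mu : 'I_n -> int) v,
  [/\ Hgrp h1, Hgrp h2, (forall i j : 'I_n, (i <= j)%N -> mu i <= mu j), v^T = v &
   g = h1 *m sg (diagQ (fun i => - mu i)) v *m h2].
Proof.
move=> /siegelPP[x [v [ux vv ->]]].
have [u1 [v1 [mu [hu1 hv1 mono xE]]]] := Hsmith (tilde_unit ux).
have [uu1 _ _] := hu1; have [uv1 _ _] := hv1.
have hu1' := GLO_tilde hu1; have hv1' := GLO_tilde hv1.
have [u1' _ _] := hu1'; have [v1' _ _] := hv1'.
have xE' : x = tilde u1 *m diagQ (fun i => - mu i) *m tilde v1.
  by rewrite -[LHS]tilde_tilde xE !tildeM ?unitmx_mul ?uu1 ?diagQ_unit // tilde_diagQ.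
exists (levi (tilde u1)), (levi (tilde v1)), mu, ((invmx (tilde v1))^T *m v *m invmx (tilde v1)).
split=> //; [exact: Hgrp_levi|exact: Hgrp_levi|exact: sym_conj|].
rewrite !leviE !sgM ?unitmx_mul ?u1' ?diagQ_unit //= mulmx0 mul0mx add0r addr0 -xE'; congr sg.
by move: (tilde v1) v1' => y uy; rewrite trmx_inv !mulmxA mulmxV ?unitmx_tr // mul1mx mulmxKV.
Qed.

Lemma biinv F h1 g h2 : linv F -> rinv F -> Hgrp h1 -> Hgrp h2 -> siegelP g ->
  F (h1 *m g *m h2) = F g.
Proof.
move=> lF rF H1 H2 gP; rewrite rF ?lF //; apply: siegelPM => //; exact: Hgrp_siegelP.
Qed.

(** A function supported on integral v is determined by its values on diagonal matrices. At an
    element minimal for the partial sums in the support, the leading monomial would survive in the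
    transform. *)
Lemma satake_eq0 F : (0 < n)%N -> linv F -> rinv F -> fsupp F ->
  (forall d v, d \in unitmx -> v^T = v -> F (sg d v) != 0 -> mxO v) ->
  (forall X, (forall i, X i != 0) -> satake F X = 0) ->
  forall g, siegelP g -> F g = 0.
Proof.
move=> n0 lF rF fF Fint F0 g gP; apply/eqP; apply: contraT => Fg.
have [s0 cs0] := fF; pose s := [seq h <- s0 | F h != 0].
have hsP h : h \in s -> siegelP h by rewrite mem_filter => /andP[_ /cs0.1].
have /choice[mu hmu] : forall h : mx, exists mu : 'I_n -> int, siegelP h -> F h != 0 ->
   (forall i j : 'I_n, (i <= j)%N -> mu i <= mu j) /\ F (levi (diagQ (fun i => - mu i))) = F h /\
   exists u v, [/\ GLO u, GLO v & tilde (drsubmx h) = u *m diagQ mu *m v].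
  move=> h; have [hP|] := pselect (siegelP h); last by exists (fun=> 0).
  have [h1 [h2 [mu [v [H1 H2 mono vv hE]]]]] := siegel_smith hP.
  exists mu => _ Fh; split=> //.
  have sP : siegelP (sg (diagQ (fun i => - mu i)) v) by apply: siegelP_sg; rewrite ?diagQ_unit.
  have e : F h = F (sg (diagQ (fun i => - mu i)) v) by rewrite hE biinv.
  split.
    rewrite e sgE rF //; last by rewrite leviE; apply: siegelP_sg; rewrite ?diagQ_unit ?trmx0.
    apply: Hgrp_ntri => //; apply: (Fint (diagQ (fun i => - mu i))); rewrite ?diagQ_unit //.
    by rewrite -e.
  move: hE; case: H1 => d1 [v1 [hd1 vv1 _ ->]]; case: H2 => d2 [v2 [hd2 vv2 _ ->]] ->.
  have [ud1 _ _] := hd1; have [ud2 _ _] := hd2.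
  exists (tilde d1), (tilde d2); split; [exact: GLO_tilde|exact: GLO_tilde|].
  rewrite !sgM ?unitmx_mul ?ud1 ?diagQ_unit // /sg block_mxKdr.
  rewrite !tildeM ?unitmx_mul ?ud1 ?diagQ_unit // tilde_diagQ.
  by congr (_ *m diag_mx _ *m _); apply/rowP => i; rewrite !mxE opprK.
have [h hs gh] := cs0.2 _ gP Fg.
have sn : s != [::].
  apply/eqP => e; have : h \in s by rewrite mem_filter hs andbT -(linv_lc lF (cs0.1 _ hs) gh).
  by rewrite e.
have [h0 h0s [_ hmin]] := exists_minimal mu sn.
have Fs k : k \in s -> F k != 0 by rewrite mem_filter => /andP[].
have [mono [Fmu _]] := hmu _ (hsP _ h0s) (Fs _ h0s).
(* [satake_lead] with an empty list of monomials: it would produce a member of the empty list. *)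
suff : has (fun=> [ffun=> 0] == [ffun i => - mu h0 i]) (Nil bool) by [].
apply: (@satake_lead F (mu h0) bool [::] (fun=> [ffun=> 0]) (fun=> 0)) => //.
- by move=> X X0; rewrite big_nil F0.
- by rewrite Fmu Fs.
move=> mu' v mono' vv Fv le; have iv := Fint _ _ (diagQ_unit _) vv Fv; split=> //.
have kP : siegelP (sg (diagQ (fun i => - mu' i)) v) by apply: siegelP_sg; rewrite ?diagQ_unit.
have [h' h's0 kh'] := cs0.2 _ kP Fv; have h'P := cs0.1 _ h's0.
have Fh' : F h' != 0 by rewrite -(linv_lc lF h'P kh').
have h's : h' \in s by rewrite mem_filter Fh'.
have [mono1 [_ [u1 [v1 [hu1 hv1 e1]]]]] := hmu _ h'P Fh'.
have eqmu : mu' =1 mu h'.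
  case: kh' => d0 [d1 [v2 [hd1 _ _ ->]]] kE; have [ud1 _ _] := hd1.
  have /siegelPP[x [v3 [ux _ h'E]]] := h'P.
  have {}e1 : tilde x = u1 *m diagQ (mu h') *m v1 by rewrite -e1 h'E /sg block_mxKdr.
  move: kE; rewrite [X in _ *m X]h'E sgM // => /(sg_inj (diagQ_unit _))[xE _].
  have hd1' := GLO_tilde hd1.
  apply: (@smith_unique (diagQ mu') 1%:M 1%:M (tilde d1 *m u1) v1 mu' (mu h')) => //.
  - exact: GLO1.
  - exact: GLO1.
  - exact: GLOM.
  - by rewrite mul1mx mulmx1.
  have -> : diagQ mu' = tilde (diagQ (fun i => - mu' i)).
    by rewrite tilde_diagQ; congr diag_mx; apply/rowP => i; rewrite !mxE opprK.
  by rewrite xE tildeM // e1 !mulmxA.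
move=> i; rewrite eqmu; apply: hmin => // k kn; apply: le_trans (le k kn).
by rewrite /Msum; under eq_bigr do rewrite -eqmu.
Qed.

Definition Dgrp_O : set mx := [set g | Sp g /\ mxO g].

Lemma Dgrp_O_levi d : GLO d -> Dgrp_O (levi d).
Proof.
move=> hd; have [ud od _] := hd; have [_ od' _] := GLO_tilde hd; split.
  by rewrite leviE; case: (siegelP_sg ud (trmx0 _ n n)).
by apply/mxO_block; split=> //; exact: mxO_0.
Qed.

(** F is only invariant under the parabolic subgroup, but its support is that of T, a union of
    double cosets of the full integral group, hence described by elementary divisors [mu y <= 0].
    The least of them contributes X^(- mu), and the bound e on exponents turns into the bound Q^-e
    on denominators. *)
Lemma satake_support (kappa T F : mx -> C) (e : int) (J : eqType) (L : seq J)
    (ex : J -> {ffun 'I_n -> int}) (c : J -> C) (s : seq 'M[K]_n) :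
  (0 < n)%N -> 0 <= e -> linv F -> rinv F -> fsupp F ->
  (forall X, (forall i, X i != 0) -> satake F X = \sum_(j <- L) c j * mono_at (ex j) X) ->
  (forall j i, j \in L -> ex j i <= e) ->
  (forall d g d', Dgrp_O d -> Dgrp_O d' -> T (d *m g *m d') = T g) ->
  (forall y, y \in s -> y \in unitmx /\ mxO y) ->
  (forall g, T g != 0 -> exists2 y, y \in s &
     exists d d', [/\ Dgrp_O d, Dgrp_O d' & g = d *m levi y *m d']) ->
  (forall g, siegelP g -> F g = kappa g * T g) ->
  (forall y, y \in unitmx -> mxO y -> kappa (levi y) != 0) ->
  forall g, siegelP g -> F g != 0 -> mxO (Q ^ e *: g).
Proof.
move=> n0 e0 lF rF fF FE exe TD sO Ts FT k0 g gP Fg.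
have Tn h : siegelP h -> F h != 0 -> T h != 0.
  by move=> hP; rewrite FT // mulf_eq0 negb_or => /andP[].
pose s' := [seq y <- s | T (levi y) != 0].
have s'O y : y \in s' -> y \in unitmx /\ mxO y by rewrite mem_filter => /andP[_ /sO].
have Ts' h : T h != 0 -> exists2 y, y \in s' &
     exists d d', [/\ Dgrp_O d, Dgrp_O d' & h = d *m levi y *m d'].
  move=> Th; have [y ys [d [d' [hd hd' hE]]]] := Ts _ Th; exists y; last by exists d, d'.
  by rewrite mem_filter ys andbT -(TD d (levi y) d' hd hd') -hE.
have /choice[mu hmu] : forall y : 'M[K]_n, exists mu : 'I_n -> int, y \in unitmx -> mxO y ->
   [/\ (forall i j : 'I_n, (i <= j)%N -> mu i <= mu j), forall i, mu i <= 0 &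
    exists u v, [/\ GLO u, GLO v & levi y = levi u *m levi (diagQ (fun i => - mu i)) *m levi v]].
  move=> y; have [uy|] := boolP (y \in unitmx); last by exists (fun=> 0).
  have [oy|] := pselect (mxO y); last by exists (fun=> 0).
  have [u [v [mu [hu hv mono yE]]]] := Hsmith (tilde_unit uy).
  have [uu _ _] := hu; have [uv _ _] := hv.
  have hu' := GLO_tilde hu; have hv' := GLO_tilde hv.
  have [uu' _ ou'] := hu'; have [uv' _ ov'] := hv'.
  have yE' : y = tilde u *m diagQ (fun i => - mu i) *m tilde v.
    by rewrite -[LHS]tilde_tilde yE !tildeM ?unitmx_mul ?uu ?diagQ_unit // tilde_diagQ.
  exists mu => _ _; split=> //.
    move=> i; rewrite -oppr_ge0 -OQ.
    have : mxO (invmx (tilde u) *m y *m invmx (tilde v)) by do 2?apply: mxOM => //.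
    rewrite yE' -!mulmxA mulKmx // mulmxV // mulmx1 => /(_ i i).
    by rewrite diagQE eqxx.
  exists (tilde u), (tilde v); split=> //.
  rewrite !leviE !sgM ?unitmx_mul ?uu' ?diagQ_unit //= -?yE'.
  by rewrite !(mulmx0, mul0mx, addr0).
have [y1 y1s' _] := Ts' _ (Tn _ gP Fg).
have s'n : s' != [::] by apply/eqP => e'; rewrite e' in y1s'.
(* Two properties of one element: its first exponent is the least in the support, which bounds all
   denominators, and its partial sums are minimal, which [satake_lead] requires. *)
have [y0 y0s' [hmin1 hmin2]] := exists_minimal mu s'n.
have bound (y : 'M[K]_n) k h d d' : (k <= n)%N -> y \in s' -> Dgrp_O d -> Dgrp_O d' ->
    h = d *m levi y *m d' -> mge k (Msum k (mu y)) h.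
  move=> kn ys' [_ hd] [_ hd'] ->; have [uy oy] := s'O _ ys'.
  have [mono mu0 [u [v [/Dgrp_O_levi[_ hu] /Dgrp_O_levi[_ hv] ->]]]] := hmu _ uy oy.
  apply: mge_mulr => //; apply: mge_mull => //; apply: mge_mulr => //; apply: mge_mull => //.
  by rewrite levi_diagQ; apply: mge_diagQ => f fi; exact: asc_sum2.
have [uy0 oy0] := s'O _ y0s'.
have [mono0 mu00 [u0 [v0 [hu0 hv0 lE0]]]] := hmu _ uy0 oy0.
have lead : has (fun j => ex j == [ffun i => - mu y0 i]) L.
  apply: (satake_lead lF rF fF FE).
    have lP : siegelP (levi (diagQ (fun i => - mu y0 i))).
      by rewrite leviE; apply: siegelP_sg; rewrite ?diagQ_unit ?trmx0.
    rewrite FT // mulf_neq0 //.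
      apply: k0; first exact: diagQ_unit.
      by move=> i j; rewrite diagQE; case: (i == j) => //; rewrite mulr1n OQ oppr_ge0.
    rewrite -(TD (levi u0) _ (levi v0)); [|exact: Dgrp_O_levi|exact: Dgrp_O_levi].
    by rewrite -lE0; move: y0s'; rewrite mem_filter => /andP[].
  move=> mu' v mono' vv Fv le.
  have sP : siegelP (sg (diagQ (fun i => - mu' i)) v) by apply: siegelP_sg; rewrite ?diagQ_unit.
  have [y ys' [d [d' [hd hd' gE]]]] := Ts' _ (Tn _ sP Fv).
  pose A := sg (diagQ (fun i => - mu' i)) v.
  have Aul i j : A (lshift n i) (lshift n j) = Q ^ mu' i *+ (i == j).
    by rewrite /A /sg block_mxEul tilde_diagQ diagQE opprK.
  have le1 k : (k <= n)%N -> Msum k (mu y) <= Msum k mu'.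
    move=> kn; apply: (@mge_lead k _ n _ _ kn A (lshift n) (lshift n) mu').
    - by move=> i j ij; rewrite Aul -(inj_eq val_inj) ltn_eqF.
    - by move=> i; rewrite Aul eqxx.
    - exact: bound kn ys' hd hd' gE.
  have eqy : mu y =1 mu y0.
    by apply: hmin2 => // k kn; apply: le_trans (le1 k kn) (le k kn).
  have MsumE k : Msum k (mu y) = Msum k (mu y0) by apply: eq_bigr => i _; rewrite eqy.
  have eqmu' : mu' =1 mu y0.
    apply: Msum_inj => k kn; apply/eqP; rewrite eq_le le //=.
    by rewrite -MsumE le1.
  split=> // j l.
  (* The bordered minor of order j + 1 joins the diagonal block to the entry Q^(mu' j) v j l of the
     upper right block. Its valuation is at least the sum of the first j + 1 exponents, which makes
     v j l integral. *)
  have := @mge_extend n _ _ A^T (lshift n) (lshift n) mu' j (rshift n l) (lshift n j).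
  rewrite mxE /A /sg block_mxEur -/(sg _ _) -/A.
  have -> : (tilde (diagQ (fun i => - mu' i)) *m v) j l = Q ^ mu' j * v j l.
    by rewrite tilde_diagQ mul_diag_mx mxE mxE opprK.
  rewrite mulrA -expfzDr // addNr mul1r; apply.
  - by move=> i l' il' _; rewrite mxE Aul -(inj_eq val_inj) gtn_eqF.
  - by move=> i ij; rewrite mxE Aul -(inj_eq val_inj) gtn_eqF.
  - by move=> i _; rewrite mxE Aul eqxx.
  - apply: mge_tr.
    have -> : Msum j.+1 mu' = Msum j.+1 (mu y) by apply: eq_bigr => i _; rewrite eqmu' eqy.
    exact: bound (ltn_ord j) ys' hd hd' gE.
have [j jL /eqP exj] := hasP lead.
pose i0 := Ordinal n0.
have Msum1 (nu : 'I_n -> int) : Msum 1 nu = nu i0 by rewrite -[RHS]add0r -(Msum0 nu) -(MsumS nu i0).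
have m0 : - e <= mu y0 i0 by have := exe j i0 jL; rewrite exj ffunE lerNl.
have [y ys' [d [d' [[_ hd] [_ hd'] gE]]]] := Ts' _ (Tn _ gP Fg).
have [uy oy] := s'O _ ys'.
have [mono mu0 [u [v [/Dgrp_O_levi[_ hu] /Dgrp_O_levi[_ hv] yE]]]] := hmu _ uy oy.
have me i : - e <= mu y i.
  apply: le_trans m0 _; apply: le_trans (mono i0 i _) => //.
  by rewrite -!Msum1; exact: hmin1.
rewrite gE yE scalemxAl; apply: mxOM => //; rewrite scalemxAr; apply: mxOM => //.
rewrite scalemxAl; apply: mxOM => //; rewrite scalemxAr; apply: mxOM => //.
rewrite levi_diagQ => i k; rewrite mxE diagQE; case: (i == k); last by rewrite mulr0.
rewrite mulr1n -expfzDr // OQ; elim/split_ord_ind: i => i; rewrite ?sym_exp_l ?sym_exp_r.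
  by rewrite -lerBlDl sub0r.
by rewrite addr_ge0 // oppr_ge0.
Qed.

(** * The operator U: cosets, degree, powers and their effect on the transform *)

Section UOperator.
Variables (M : nat) (rep : 'I_M -> K).
Hypotheses (repO : forall i, O (rep i))
  (rep_ex : forall x, O x -> exists i, O (Q ^ (- 2%:Z) * (x - rep i)))
  (rep_inj : forall i j, O (Q ^ (- 2%:Z) * (rep i - rep j)) -> i = j).

Definition dcoset (g : mx) : set mx := [set x | exists d e, [/\ Hgrp d, Hgrp e & x = d *m g *m e]].
Definition Uop : mx -> C := \1_(dcoset (levi Q%:M)).
Definition Uexp (m : nat) : mx -> C := iter m (cmul Uop) \1_Hgrp.

(** The free coordinates of a symmetric matrix; their number n (n + 1) / 2 is the exponent in the
    degree of U. *)
Definition symI := {x : 'I_n * 'I_n | (x.1 <= x.2)%N}.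

Fact sym_idx_proof (i j : 'I_n) :
  ((if (i <= j)%N then (i, j) else (j, i)).1 <= (if (i <= j)%N then (i, j) else (j, i)).2)%N.
Proof. by case: ifP => //= /negbT; rewrite -ltnNge => /ltnW. Qed.
Definition sym_idx i j : symI :=
  exist (fun x : 'I_n * 'I_n => is_true (x.1 <= x.2)%N) _ (sym_idx_proof i j).

Lemma sym_idxC i j : sym_idx i j = sym_idx j i.
Proof.
apply: val_inj => /=; case: ltngtP => // /val_inj -> //.
Qed.

Lemma sym_idxK (x : symI) : sym_idx (val x).1 (val x).2 = x.
Proof. by apply: val_inj => /=; case: x => -[i j] /= ->. Qed.

Lemma card_symI : #|{: symI}| = 'C(n.+1, 2).
Proof.
rewrite card_sig -sum1_card.
rewrite -(pair_big_dep xpredT (fun i j : 'I_n => (i <= j)%N) (fun _ _ => 1%N)) /=.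
rewrite (exchange_big_dep xpredT) //= -triangular_sum big_nat_recl //= add0n big_mkord.
apply: eq_bigr => j _; rewrite sum1_card -[RHS]card_ord.
have le : (j.+1 <= n)%N by [].
rewrite -!sum1_card (eq_bigl (fun i : 'I_n => (i < j.+1)%N)) // (big_ord_narrow le) //.
Qed.

Definition symmx (phi : {ffun symI -> 'I_M}) : 'M[K]_n :=
  \matrix_(i, j) rep (phi (sym_idx i j)).
Definition Urep phi : mx := sg Q%:M (symmx phi).

Lemma symmx_sym phi : (symmx phi)^T = symmx phi.
Proof. by apply/matrixP => i j; rewrite !mxE sym_idxC. Qed.
Lemma symmxO phi : mxO (symmx phi).
Proof. by move=> i j; rewrite mxE. Qed.

Lemma scalar_unit (x : K) : x != 0 -> (x%:M : 'M[K]_n) \in unitmx.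
Proof. by move=> x0; rewrite unitmxE det_scalar unitfE expf_neq0. Qed.

Lemma conj_scalar (x : K) (v : 'M[K]_n) : (x%:M)^T *m v *m x%:M = (x * x) *: v.
Proof. by rewrite tr_scalar_mx mul_scalar_mx mul_mx_scalar scalerA. Qed.

Lemma Urep_siegelP phi : siegelP (Urep phi).
Proof. by apply: siegelP_sg; [exact: scalar_unit|exact: symmx_sym]. Qed.

Lemma Urep_inj phi psi : lc Hgrp (Urep phi) (Urep psi) -> phi = psi.
Proof.
move=> [_ [d [v [[ud _ _] _ hv ->]]] e].
have uQ := scalar_unit Q0; move: e; rewrite /Urep sgM // => /(sg_inj uQ)[dE vE].
have {}vE : symmx phi - symmx psi = (Q * Q) *: v by rewrite vE conj_scalar addrK.
apply/ffunP => x; rewrite -(sym_idxK x); case: (val x) => i j /=.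
apply: rep_inj; have /matrixP/(_ i j) := vE; rewrite !mxE => ->.
rewrite mulrA -expr2 exprnP -expfzDr // addNr mul1r; exact: hv.
Qed.

Lemma symmx_ex (v : 'M[K]_n) : v^T = v -> mxO v ->
  exists phi w', [/\ w'^T = w', mxO w' & v = (Q * Q) *: w' + symmx phi].
Proof.
move=> vv hv.
have /choice[f hf] : forall x : symI, exists i, O (Q ^ (- 2%:Z) * (v (val x).1 (val x).2 - rep i)).
  by move=> x; apply: rep_ex.
pose phi := [ffun x => f x]; pose w' := Q ^ (- 2%:Z) *: (v - symmx phi).
have ww : w'^T = w' by rewrite linearZ linearB /= symmx_sym vv.
exists phi, w'; split=> //; last first.
  by rewrite scalerA -expr2 exprnP -expfzDr // subrr scale1r subrK.
move=> i j; wlog ij : i j / (i <= j)%N.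
  move=> H; case/orP: (leq_total i j) => [|ji]; first exact: H.
  by rewrite -ww mxE; exact: H.
by have := hf (sym_idx i j); rewrite /= ij !mxE ffunE.
Qed.

(** In the right factor [sg d v] the unimodular d commutes with the scalar Q and moves to the left;
    what remains is v, which matters only modulo Q^2. *)
Lemma Urep_cover g : dcoset (levi Q%:M) g <-> siegelP g /\ exists phi, lc Hgrp g (Urep phi).
Proof.
have uQ := scalar_unit Q0; split.
  move=> [h1 [h2 [H1 H2 ->]]]; split.
    apply: siegelPM; last exact: Hgrp_siegelP.
    apply: siegelPM; first exact: Hgrp_siegelP.
    by rewrite leviE; apply: siegelP_sg => //; exact: trmx0.
  case: H2 => d [v [hd vv hv ->]]; have [ud _ _] := hd.
  have [phi [w' [ww hw vE]]] := symmx_ex vv hv.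
  exists phi, (h1 *m levi d *m ntri w').
    apply: HgrpM; [apply: HgrpM => //; exact: Hgrp_levi|exact: Hgrp_ntri].
  rewrite -!mulmxA; congr (_ *m _).
  rewrite ntriE !leviE !sgM ?unitmx_mul ?unitmx1 ?uQ ?ud //= ?mul1mx //.
  rewrite ?mulmx0 ?mul0mx ?add0r conj_scalar -vE; congr (sg _ _).
  by rewrite mul_scalar_mx mul_mx_scalar.
move=> [gP [phi [h hh ->]]]; exists h, (ntri (symmx phi)); split=> //.
  by apply: Hgrp_ntri; [exact: symmx_sym|exact: symmxO].
by rewrite /Urep sgE mulmxA.
Qed.

Lemma Hgrp_unit h : Hgrp h -> h \in unitmx.
Proof. by move/Hgrp_siegelP/siegelP_unit. Qed.

Lemma indic_iff (A B : set mx) (g h : mx) : (A g <-> B h) -> \1_A g = \1_B h :> C.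
Proof.
move=> AB; rewrite !indicE; congr (_%:R).
by congr nat_of_bool; apply/idP/idP; rewrite !inE => /AB.
Qed.

Lemma Uop_linv : linv Uop.
Proof.
move=> d g hd gP; rewrite /Uop; apply: indic_iff; split.
  move=> [h1 [h2 [H1 H2 e]]]; exists (invmx d *m h1), h2; split=> //.
    by apply: HgrpM => //; exact: HgrpV.
  by rewrite -!mulmxA mulmxA -[LHS](mulKmx (Hgrp_unit hd)) e !mulmxA.
by move=> [h1 [h2 [H1 H2 ->]]]; exists (d *m h1), h2; split; rewrite ?mulmxA //; exact: HgrpM.
Qed.

Lemma Uop_rinv : rinv Uop.
Proof.
move=> d g hd gP; rewrite /Uop; apply: indic_iff; split.
  move=> [h1 [h2 [H1 H2 e]]]; exists h1, (h2 *m invmx d); split=> //.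
    by apply: HgrpM => //; exact: HgrpV.
  by rewrite mulmxA -e mulmxK // Hgrp_unit.
by move=> [h1 [h2 [H1 H2 ->]]]; exists h1, (h2 *m d); split; rewrite ?mulmxA //; exact: HgrpM.
Qed.

Definition Ureps := [seq Urep phi | phi <- enum {: {ffun symI -> 'I_M}}].

Lemma Ureps_distinct : distinct Hgrp Ureps.
Proof.
rewrite /distinct pairwise_map; have := enum_uniq {: {ffun symI -> 'I_M}}.
rewrite uniq_pairwise; apply: sub_pairwise.
by move=> phi psi /=; apply: contra => /asboolP /Urep_inj ->.
Qed.

Lemma Uop_neq0 g : Uop g != 0 <-> dcoset (levi Q%:M) g.
Proof.
rewrite /Uop indicE; case: (boolP (g \in _)) => h; split=> //.
- by move=> _; rewrite inE in h.
- by rewrite oner_eq0.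
- by rewrite eqxx.
- by move=> /mem_set; rewrite (negbTE h).
Qed.

Lemma Ureps_cover : covers siegelP Hgrp Ureps (fun g => Uop g != 0).
Proof.
split; first by move=> h /mapP[phi _ ->]; exact: Urep_siegelP.
move=> g gP /Uop_neq0 /Urep_cover[_ [phi hphi]]; exists (Urep phi) => //.
by apply/mapP; exists phi => //; rewrite mem_enum.
Qed.

Lemma Uop_fsupp : fsupp Uop. Proof. by exists Ureps; exact: Ureps_cover. Qed.

Lemma Uop_rep phi : Uop (Urep phi) = 1.
Proof.
rewrite /Uop indicE mem_set //; apply/Urep_cover; split; first exact: Urep_siegelP.
exists phi; exact: (lc_refl PH).
Qed.

Lemma csum_Uop (E : mx -> C) : linv E ->
  csum (fun g => Uop g * E g) = \sum_(phi : {ffun symI -> 'I_M}) E (Urep phi).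
Proof.
move=> lE; rewrite (csumE PH (s := Ureps)) ?Ureps_distinct //.
- by rewrite /Ureps big_map big_enum /=; apply: eq_bigr => phi _; rewrite Uop_rep mul1r.
- by move=> d g hd gP; rewrite Uop_linv // lE.
- by apply: covers_sub Ureps_cover => g gP; apply: contra_neq => ->; rewrite mul0r.
Qed.

Lemma deg_Uop : csum Uop = (M ^ 'C(n.+1, 2))%:R.
Proof.
transitivity (csum (fun g => Uop g * 1)); first by apply: (eq_csum PH) => g _; rewrite mulr1.
rewrite csum_Uop // sumr_const; congr (_ *+ _).
by rewrite card_ffun card_ord card_symI.
Qed.

Lemma Hgrp_indic_linv : linv \1_Hgrp.
Proof.
move=> d g hd gP; apply: indic_iff; split.
  by move=> h; rewrite -[g](mulKmx (Hgrp_unit hd)); apply: HgrpM => //; exact: HgrpV.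
exact: HgrpM.
Qed.
Lemma Hgrp_indic_rinv : rinv \1_Hgrp.
Proof.
move=> d g hd gP; apply: indic_iff; split.
  by move=> h; rewrite -[g](mulmxK (Hgrp_unit hd)); apply: HgrpM => //; exact: HgrpV.
by move=> h; exact: HgrpM.
Qed.
Lemma Hgrp_indic_cover : covers siegelP Hgrp [:: 1%:M] (fun g => \1_Hgrp g != 0 :> C).
Proof.
split=> [h|g gP]; first by rewrite inE => /eqP ->; exact: siegelP1.
rewrite indicE; case: (boolP (g \in _)) => [gH _|]; last by rewrite eqxx.
exists 1%:M; rewrite ?inE //; exists g; rewrite ?mulmx1 //; by rewrite inE in gH.
Qed.

Lemma Uexp_prop m : [/\ linv (Uexp m), rinv (Uexp m) & fsupp (Uexp m)].
Proof.
elim: m => [|m [lm rm fm]].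
  split; [exact: Hgrp_indic_linv|exact: Hgrp_indic_rinv|].
  by exists [:: 1%:M]; exact: Hgrp_indic_cover.
split.
- exact: (S0_mul_linv PH _ Uop_linv).
- exact: (S0_mul_rinv PH Uop_rinv lm rm fm).
- exact: (S0_mul_fsupp PH Uop_rinv Uop_fsupp fm).
Qed.

Lemma deg_cmul F G : linv F -> rinv F -> linv G -> fsupp F -> fsupp G ->
  csum (cmul F G) = csum F * csum G.
Proof.
move=> lF rF lG fF fG.
have := csum_cmul PH lF rF lG fF fG (Phi := fun=> 1) (fun _ _ _ _ => erefl).
have -> : csum (fun g => cmul F G g * 1) = csum (cmul F G).
  by apply: (eq_csum PH) => g _; rewrite mulr1.
move=> <-; have -> : csum (fun g => F g * 1) = csum F.
  by apply: (eq_csum PH) => g _; rewrite mulr1.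
by rewrite (csum_distr PH) // mulrC.
Qed.

Lemma deg_Uexp m : csum (Uexp m) = (M ^ 'C(n.+1, 2))%:R ^+ m.
Proof.
elim: m => [|m IH].
  rewrite (csumE PH Hgrp_indic_linv (s := [:: 1%:M])) //; last exact: Hgrp_indic_cover.
  by rewrite big_seq1 indicE mem_set //; exact: Hgrp1.
have [lm rm fm] := Uexp_prop m.
by rewrite /= deg_cmul ?deg_Uop //; [rewrite [csum _]IH exprS|exact: Uop_linv|exact: Uop_rinv|exact: Uop_fsupp].
Qed.

Lemma Uexp_supp m g : siegelP g -> Uexp m g != 0 -> exists h v, [/\ Hgrp h, v^T = v, mxO v &
  g = h *m sg (Q ^+ m)%:M v].
Proof.
elim: m g => [|m IH] g gP.
  rewrite /Uexp /= indicE; case: (boolP (g \in _)) => [gH _|]; last by rewrite eqxx.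
  exists g, 0; split; [by rewrite inE in gH|exact: trmx0|exact: mxO_0|].
  by rewrite /sg tilde1 mulmx0 -scalar_mx_block mulmx1.
move=> /(cmul_supp PH)[h [hP /Uop_neq0/Urep_cover[_ [phi [h2 H2 ghE]]] Uh]].
have [h1 [v [H1 vv hv hE]]] := IH _ hP Uh.
case: H1 => d [w1 [hd ww1 hw1 h1E]]; have [ud od _] := hd.
have uQ := scalar_unit Q0; have uQm := scalar_unit (expf_neq0 m Q0).
exists (h2 *m levi d), ((Q ^+ m * Q ^+ m) *: (d^T *m symmx phi *m d + w1) + v); split.
- by apply: HgrpM => //; exact: Hgrp_levi.
- by rewrite linearD linearZ linearD /= sym_conj ?symmx_sym // ww1 vv.
- apply: mxOD => //; apply: mxOZ.
    by rewrite -exprD exprnP OQ.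
  by apply: mxOD => //; apply: mxO_conj => //; exact: symmxO.
have uh : h \in unitmx by exact: siegelP_unit.
rewrite -[LHS](mulmxKV uh) ghE hE h1E -!(mulmxA h2); congr (_ *m _).
have uQd : Q%:M *m d \in unitmx by rewrite unitmx_mul uQ.
rewrite /Urep leviE mulmxA (sgM _ _ uQ ud) (sgM _ _ uQd uQm) (sgM _ _ ud (scalar_unit (expf_neq0 _ Q0))).
rewrite !conj_scalar linear0 add0r; congr sg.
by rewrite mul_scalar_mx -scalemxAl !mul_mx_scalar scalerA exprS.
Qed.

(** Up to the subgroup on the left, every element of the support of U^m has the scalar Q^m as lower
    right block. Multiplying by it changes [om0] by a fixed monomial, so the sum over these elements
    produces just the degree of U^m. *)
Lemma satake_cmulU F m X : linv F -> rinv F -> fsupp F -> (forall i, X i != 0) ->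
  satake (cmul F (Uexp m)) X =
  satake F X * ((M ^ 'C(n.+1, 2))%:R * \prod_i (w i * X i)) ^+ m.
Proof.
move=> lF rF fF X0; have [lm rm fm] := Uexp_prop m.
have lPhi : linv (fun g => om0 (drsubmx g) X).
  move=> d g hd gP; have lone : linv (fun=> 1) by [].
  by have := satake_linv X lone hd gP; rewrite !mul1r.
have lFPhi : linv (fun g => F g * om0 (drsubmx g) X) by exact: satake_linv.
have fFPhi : fsupp (fun g => F g * om0 (drsubmx g) X).
  have [s hs] := fF; exists s; apply: covers_sub hs => g gP; by apply: contra_neq => ->; rewrite mul0r.
rewrite /satake -(csum_cmul PH) // exprMn -deg_Uexp mulrCA -(csum_distr PH) //.
apply: (eq_csum PH) => h hP; have [->|Uh] := eqVneq (Uexp m h) 0; first by rewrite !mul0r.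
have [h1 [v [H1 vv hv hE]]] := Uexp_supp hP Uh; congr (_ * _).
pose a := (\prod_i (w i * X i)) ^+ m.
pose E1 g := F g * om0 (drsubmx g) X * a.
have lE1 : linv E1 by move=> d g hd gP; rewrite /E1 lFPhi.
have fE1 : fsupp E1.
  by have [s hs] := fFPhi; exists s; apply: covers_sub hs => g gP; apply: contra_neq => e; rewrite /E1 e mul0r.
rewrite -(csum_distr PH) // -[RHS](csum_translate PH lE1 fE1 (Hgrp_siegelP H1)).
apply: (eq_csum PH) => g gP; rewrite /E1 rF // -mulrA; congr (_ * _).
have ghP : siegelP (g *m h1) by apply: siegelPM => //; exact: Hgrp_siegelP.
rewrite hE mulmxA; move/siegelPP: ghP => [d [v' [ud vv' ->]]].
rewrite (sgM _ _ ud (scalar_unit (expf_neq0 m Q0))) /sg !block_mxKdr /a exprnP.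
exact: om0_scale.
Qed.

(** The transform of the sum vanishes by hypothesis, so [satake_eq0] applies as soon as the support
    has integral v; the bound on the denominators of [F l] is exactly what U^(N - l) can clear. *)
Lemma sum_cmulU_eq0 (N : nat) (F : nat -> mx -> C) : (0 < n)%N ->
  (forall l, (l <= N)%N -> [/\ linv (F l), rinv (F l) & fsupp (F l)]) ->
  (forall l g, (l <= N)%N -> siegelP g -> F l g != 0 -> mxO (Q ^+ (N - l) *: g)) ->
  (forall X, (forall i, X i != 0) -> \sum_(l < N.+1)
     satake (F l) X * ((M ^ 'C(n.+1, 2))%:R * \prod_i (w i * X i)) ^+ (N - l) = 0) ->
  forall g, siegelP g -> \sum_(l < N.+1) cmul (F l) (Uexp (N - l)) g = 0.
Proof.
move=> n0 HF supp sat0.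
have Hc l : (l <= N)%N -> [/\ linv (cmul (F l) (Uexp (N - l))), rinv (cmul (F l) (Uexp (N - l)))
    & fsupp (cmul (F l) (Uexp (N - l)))].
  move=> lN; have [lF rF fF] := HF _ lN; have [lm rm fm] := Uexp_prop (N - l); split.
  - exact: (S0_mul_linv PH _ lF).
  - exact: (S0_mul_rinv PH rF lm rm fm).
  - exact: (S0_mul_fsupp PH rF fF fm).
pose V k g := \sum_(l < k) cmul (F l) (Uexp (N - l)) g.
have HV k : (k <= N.+1)%N -> [/\ linv (V k), rinv (V k) , fsupp (V k) & forall X,
    satake (V k) X = \sum_(l < k) satake (cmul (F l) (Uexp (N - l))) X].
  elim: k => [_|k IH kN].
    split; [by move=> d g hd gP; rewrite /V !big_ord0|by move=> d g hd gP; rewrite /V !big_ord0| |].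
      by exists [::]; split=> // g gP; rewrite /V big_ord0 eqxx.
    by move=> X; rewrite big_ord0; apply: (csum0 PH) => g gP; rewrite /V big_ord0 mul0r.
  have [lV rV fV sV] := IH (ltnW kN); have [lc rc fc] := Hc _ kN.
  have VE : V k.+1 = fun g => V k g + cmul (F k) (Uexp (N - k)) g.
    by apply/funext => g; rewrite /V big_ord_recr.
  rewrite VE; split.
  - by move=> d g hd gP; rewrite lV // lc.
  - by move=> d g hd gP; rewrite rV // rc.
  - exact: fsuppD fV fc.
  move=> X; rewrite big_ord_recr /= -sV /satake -(csumD PH) //; first 1 last.
  - exact: satake_linv.
  - exact: satake_linv.
  - by have [s hs] := fV; exists s; apply: covers_sub hs => g gP; apply: contra_neq => ->; rewrite mul0r.
  - by have [s hs] := fc; exists s; apply: covers_sub hs => g gP; apply: contra_neq => ->; rewrite mul0r.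
  by apply: (eq_csum PH) => g gP; rewrite mulrDl.
have [lV rV fV sV] := HV _ (leqnn _).
apply: (@satake_eq0 (V N.+1)) => //; last first.
  move=> X X0; rewrite sV -[RHS](sat0 X X0); apply: eq_bigr => l _.
  have [lF rF fF] := HF _ (ltnSE (ltn_ord l)).
  exact: satake_cmulU.
move=> d v ud vv Vnz.
have [l cl] : exists l : 'I_N.+1, cmul (F l) (Uexp (N - l)) (sg d v) != 0.
  apply: contrapT => no; case/eqP: Vnz; apply: big1 => l _.
  by apply/eqP; apply: contraT => h; case: no; exists l.
have lN := ltnSE (ltn_ord l); have [lF rF fF] := HF _ lN.
have [h [hP Fg Uh]] := cmul_supp PH cl.
have [h1 [v1 [H1 vv1 hv1 hE]]] := Uexp_supp hP Uh.
set j := (N - l)%N in Uh hE *; set S := sg (Q ^+ j)%:M v1 in hE.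
have uQj := scalar_unit (expf_neq0 j Q0).
have SP : siegelP S by exact: siegelP_sg.
have uS := siegelP_unit SP.
have gP : siegelP (sg d v) by exact: siegelP_sg.
have kP : siegelP (sg d v *m invmx S) by apply: siegelPM => //; exact: siegelPV.
have Fk : F l (sg d v *m invmx S) != 0.
  by rewrite -(rF _ _ (HgrpV H1) kP) -mulmxA -(invmx_mul (Hgrp_unit H1) uS) -hE.
have := supp _ _ lN kP Fk; move/siegelPP: kP => [d' [v' [ud' vv' kE]]].
have := mulmxKV uS (sg d v); rewrite kE (sgM _ _ ud' uQj) => /esym/(sg_inj ud)[dE vE].
rewrite -/j => kO.
have d'O : mxO (Q ^+ j *: d').
  by move=> i i'; have := kO (rshift n i) (rshift n i'); rewrite mxE block_mxEdr [X in _ -> O X]mxE.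
have v'O : mxO (Q ^+ j *: (tilde d' *m v')).
  by move=> i i'; have := kO (lshift n i) (rshift n i'); rewrite mxE block_mxEur [X in _ -> O X]mxE.
(* With j = N - l one has v = Q^(2j) v' + v1, and Q^(2j) v' = (Q^j d')^T (Q^j ~d' v') is a product
   of two integral matrices. *)
rewrite vE; apply: mxOD => //; rewrite conj_scalar.
rewrite -[v'](mul1mx) -(tildeV ud') -mulmxA -scalerA scalemxAr scalemxAl.
by apply: mxOM => //; rewrite -linearZ /=; exact: mxOT.
Qed.

End UOperator.
End Satake.
End Valued.

(** * The theta series and its uniqueness as a quasi-periodic function *)

Section ComplexAbs.
Variable R : realType.
Local Notation C := R[i].
Implicit Types x y : C.

(** The modulus as an element of R, so that estimates take place in an ordered field. *)
Definition cabs x : R := complex.Re `|x|.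

Lemma cabsE x : `|x| = (cabs x)%:C.
Proof. by rewrite /cabs normc_def. Qed.
Lemma cabs_ge0 x : 0 <= cabs x.
Proof. by have := normr_ge0 x; rewrite cabsE lecR. Qed.
Lemma cabsM x y : cabs (x * y) = cabs x * cabs y.
Proof. by apply: complexI; rewrite -cabsE normrM !cabsE rmorphM. Qed.
Lemma cabsD x y : cabs (x + y) <= cabs x + cabs y.
Proof. by rewrite -lecR rmorphD -!cabsE; exact: ler_normD. Qed.
Lemma cabsN x : cabs (- x) = cabs x. Proof. by rewrite /cabs normrN. Qed.
Lemma cabs0 : cabs 0 = 0. Proof. by rewrite /cabs normr0. Qed.
Lemma cabs1 : cabs 1 = 1. Proof. by rewrite /cabs normr1. Qed.
Lemma cabsB x y : cabs (x - y) = cabs (y - x). Proof. by rewrite /cabs distrC. Qed.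
Lemma cabs_eq0 x : cabs x = 0 -> x = 0.
Proof. by move=> h; apply/eqP; rewrite -normr_eq0 cabsE h. Qed.
Lemma cabs_gt0 x : x != 0 -> 0 < cabs x.
Proof.
move=> x0; rewrite lt_neqAle cabs_ge0 andbT eq_sym.
by apply: contra x0 => /eqP/cabs_eq0 ->.
Qed.
Lemma cabsV x : cabs x^-1 = (cabs x)^-1.
Proof. by apply: complexI; rewrite -cabsE normfV cabsE fmorphV. Qed.
Lemma cabsX x n : cabs (x ^+ n) = cabs x ^+ n.
Proof. by elim: n => [|n IH]; rewrite ?expr0 ?cabs1 // !exprS cabsM IH. Qed.
Lemma cabs_sum I (r : seq I) (P : pred I) (F : I -> C) :
  cabs (\sum_(i <- r | P i) F i) <= \sum_(i <- r | P i) cabs (F i).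
Proof.
elim/big_rec2: _ => [|i y x _ h]; first by rewrite cabs0.
by apply: le_trans (cabsD _ _) _; rewrite lerD2l.
Qed.
Lemma cabsR (a : R) : cabs a%:C = `|a|.
Proof. by apply: complexI; rewrite -cabsE normc_def /= expr0n addr0 sqrtr_sqr. Qed.
Lemma cabs_nat n : cabs n%:R = n%:R.
Proof. by rewrite -[n%:R in LHS](rmorph_nat (real_complex R)) cabsR normr_nat. Qed.
Lemma cabs_i : cabs 'i%C = 1.
Proof. by apply: complexI; rewrite -cabsE normc_def /= expr0n expr1n add0r sqrtr1. Qed.
Lemma cabs_Re x : `|complex.Re x| <= cabs x.
Proof. by rewrite -lecR -cabsE; exact: normc_ge_Re. Qed.
Lemma cabs_Im x : `|complex.Im x| <= cabs x.
Proof.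
have := cabs_Re (x * 'i%C); rewrite cabsM cabs_i mulr1.
by case: x => a b /=; rewrite mulr0 mulr1 sub0r normrN.
Qed.
Lemma cabs_ReIm x : cabs x <= `|complex.Re x| + `|complex.Im x|.
Proof.
rewrite {1}[x]complexE; apply: le_trans (cabsD _ _) _.
by rewrite cabsM cabs_i mul1r !cabsR.
Qed.

Lemma cabs_small x : (forall e, 0 < e -> cabs x <= e) -> x = 0.
Proof.
move=> h; apply: cabs_eq0; apply/eqP; rewrite eq_le cabs_ge0 andbT leNgt.
apply/negP => x0; have := h (cabs x / 2) ltac:(lra); lra.
Qed.

Lemma expCD x y : expC (x + y) = expC x * expC y.
Proof.
case: x y => [a b] [c d]; rewrite /expC /= !mulrDr opprD expRD cosD sinD.
by apply/eqP; rewrite eq_complex /=; apply/andP; split; apply/eqP; ring.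
Qed.
Lemma expC0 : expC (0 : C) = 1.
Proof.
by rewrite /expC /= !mulr0 oppr0 expR0 cos0 sin0 mul1r.
Qed.
Lemma expCN x : expC (- x) = (expC x)^-1.
Proof.
have h : expC (- x) * expC x = 1 by rewrite -expCD addNr expC0.
have n0 : expC x != 0 by apply/eqP => e; move/eqP: h; rewrite e mulr0 eq_sym oner_eq0.
by apply: (mulIf n0); rewrite h mulVf.
Qed.
Lemma expC_neq0 x : expC x != 0.
Proof.
have h : expC (- x) * expC x = 1 by rewrite -expCD addNr expC0.
by apply/eqP => e; move/eqP: h; rewrite e mulr0 eq_sym oner_eq0.
Qed.
Lemma cabs_expC x : cabs (expC x) = expR (- (2 * pi * complex.Im x)).
Proof.
rewrite /expC cabsM cabsR ger0_norm ?expR_ge0 //; set t := 2 * pi * _.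
rewrite -[RHS]mulr1; congr (_ * _).
by apply: complexI; rewrite -cabsE normc_def /= cos2Dsin2 sqrtr1.
Qed.
Lemma expC_sum I (r : seq I) (P : pred I) (F : I -> C) :
  expC (\sum_(i <- r | P i) F i) = \prod_(i <- r | P i) expC (F i).
Proof. exact: (big_morph _ expCD expC0). Qed.
Lemma expC1 : expC (1 : C) = 1.
Proof.
by rewrite /expC /= mulr0 oppr0 expR0 mulr1 mulr_natl cos2pi sin2pi mul1r.
Qed.
Lemma expC_int (m : int) : expC (m%:~R : C) = 1.
Proof.
have hn (n : nat) : expC (n%:R : C) = 1.
  elim: n => [|n IH]; first exact: expC0.
  by rewrite -natr1 expCD IH expC1 mulr1.
by case: m => n; rewrite ?NegzE ?rmorphN /= ?expCN hn ?invr1.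
Qed.

End ComplexAbs.

Section ExpEstimate.
Variable R : realType.
Local Notation C := R[i].

Lemma expR_sub1 (a : R) : `|expR a - 1| <= `|a| * expR `|a|.
Proof.
have h1 := expR_ge1Dx a; have h2 := expR_ge1Dx (- a).
have e : expR (- a) * expR a = 1 by rewrite -expRD addNr expR0.
have p := expR_gt0 a; case: (lerP 0 a) => a0.
  have p1 : 1 <= expR a by lra.
  rewrite ger0_norm; last lra.
  have : (1 - a) * expR a <= 1 by rewrite -e ler_pM2r //; lra.
  rewrite ger0_norm //; lra.
have p1 : expR a <= 1 by rewrite -expR0 ler_expR ltW.
have p2 : 1 <= expR (- a) by lra.
rewrite ler0_norm; last lra.
have : - a * 1 <= - a * expR (- a) by rewrite ler_wpM2l //; lra.
rewrite (ltr0_norm a0); lra.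
Qed.

Lemma expR_sub1x (a : R) : `|expR a - 1 - a| <= a ^+ 2 * expR `|a|.
Proof.
have h1 := expR_ge1Dx a; rewrite ger0_norm; last lra.
have e : expR (- a) * expR a = 1 by rewrite -expRD addNr expR0.
have h2 := expR_ge1Dx (- a); have p := expR_gt0 a.
have h : (1 - a) * expR a <= 1 by rewrite -e ler_pM2r //; lra.
have h3 : expR a - 1 - a <= a * (expR a - 1) by lra.
apply: le_trans h3 _; apply: le_trans (ler_norm _) _.
rewrite normrM -real_normK ?num_real // expr2 -mulrA.
exact: ler_wpM2l (normr_ge0 a) _ _ (expR_sub1 a).
Qed.

Lemma MVT_sym (f df : R -> R) (x : R) : (forall t : R, is_derive t (1 : R) f (df t)) ->
  exists2 c, `|c| <= `|x| & f x - f 0 = df c * x.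
Proof.
move=> H; have cf : continuous f.
  by move=> t; apply/differentiable_continuous/derivable1_diffP; have [] := H t.
case: (ltgtP x 0) => [x0|x0|->]; last by exists 0; rewrite ?subrr ?mulr0.
- have [c] := MVT x0 (fun t _ => H t) (continuous_subspaceT cf).
  rewrite in_itv /= => /andP[h1 h2] e; exists c.
    by rewrite !ltr0_norm // lerN2 ltW.
  by rewrite -opprB e; ring.
- have [c] := MVT x0 (fun t _ => H t) (continuous_subspaceT cf).
  rewrite in_itv /= subr0 => /andP[h1 h2] e; exists c => //.
  by rewrite !gtr0_norm // ltW.
Qed.

Lemma sin_le_id (b : R) : `|sin b| <= `|b|.
Proof.
have [c _] := @MVT_sym sin cos b (fun t => is_derive_sin t).
rewrite sin0 subr0 => ->; rewrite normrM ler_piMl //; exact: cos_max.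
Qed.

Lemma cos_sub1 (b : R) : `|cos b - 1| <= b ^+ 2.
Proof.
have [c cb] := @MVT_sym cos (fun t => - sin t) b (fun t => is_derive_cos t).
rewrite cos0 => ->; rewrite normrM normrN -real_normK ?num_real // expr2.
by rewrite ler_wpM2r // (le_trans (sin_le_id c)).
Qed.

Lemma sin_subx (b : R) : `|sin b - b| <= `|b| ^+ 3.
Proof.
have d (t : R) : is_derive t (1 : R) (fun t : R => sin t - t) (cos t - 1) by exact: is_deriveB.
have [c cb] := MVT_sym b d.
rewrite sin0 !subr0 => ->; rewrite normrM exprSr ler_wpM2r //.
apply: le_trans (cos_sub1 c) _; rewrite -real_normK ?num_real //.
by rewrite lerXn2r ?nnegrE.
Qed.

(* The constant is far from optimal; only its existence matters. *)
Lemma expC_taylor : exists K : R, 0 < K /\ forall s : C,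
  cabs (expC s - 1 - (2 * pi)%:C * 'i%C * s) <= K * cabs s ^+ 2 * expR (K * cabs s).
Proof.
have pi0 : 0 < pi :> R by exact: pi_gt0.
exists (4 * (2 * pi) ^+ 2 + 4 * pi); split.
  by apply: addr_gt0; rewrite ?mulr_gt0 ?exprn_gt0 ?mulr_gt0.
move=> s; set K : R := 4 * _ + _; set r := 2 * pi * cabs s.
have r0 : 0 <= r by rewrite !mulr_ge0 ?cabs_ge0 ?ltW.
pose a := - (2 * pi * complex.Im s); pose b := 2 * pi * complex.Re s.
have pi2 : 0 <= 2 * pi :> R by lra.
have ar : `|a| <= r.
  by rewrite /a /r normrN normrM (ger0_norm pi2) ler_wpM2l // cabs_Im.
have br : `|b| <= r.
  by rewrite /b /r normrM (ger0_norm pi2) ler_wpM2l // cabs_Re.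
have Ea : expR `|a| <= expR r by rewrite ler_expR.
have Ea' : expR a <= expR r by rewrite ler_expR (le_trans (ler_norm _)).
have rE : 1 + r <= expR r by exact: expR_ge1Dx.
set x := _ - _.
have xRe : complex.Re x = expR a * (cos b - 1) + (expR a - 1 - a).
  rewrite /x /expC; case: s @a @b {ar br r r0 Ea Ea' rE x} => p q /=; ring.
have xIm : complex.Im x = expR a * (sin b - b) + (expR a - 1) * b.
  rewrite /x /expC; case: s @a @b {ar br r r0 Ea Ea' rE x xRe} => p q /=; ring.
have hb2 : b ^+ 2 <= r ^+ 2 by rewrite -real_normK ?num_real // lerXn2r ?nnegrE.
have ha2 : a ^+ 2 <= r ^+ 2 by rewrite -real_normK ?num_real // lerXn2r ?nnegrE.
have E0 := expR_ge0 r; have Ea0 := expR_ge0 a.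
have hRe : `|complex.Re x| <= 2 * (r ^+ 2 * expR r).
  rewrite xRe; apply: le_trans (ler_normD _ _) _; rewrite mulr_natl mulr2n lerD //.
    rewrite normrM (ger0_norm Ea0) mulrC; apply: ler_pM => //.
    exact: le_trans (cos_sub1 b) hb2.
  apply: le_trans (expR_sub1x a) _; apply: ler_pM => //; exact: sqr_ge0.
have hIm : `|complex.Im x| <= 2 * (r ^+ 2 * expR r * expR r).
  rewrite xIm; apply: le_trans (ler_normD _ _) _; rewrite mulr_natl mulr2n lerD //.
    rewrite normrM (ger0_norm Ea0) mulrC; apply: ler_pM => //.
    apply: le_trans (sin_subx b) _; apply: (@le_trans _ _ (r ^+ 3)); first by rewrite lerXn2r ?nnegrE.
    by rewrite exprSr; apply: ler_wpM2l; [exact: sqr_ge0|lra].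
  rewrite normrM; apply: (@le_trans _ _ (`|a| * expR `|a| * `|b|)).
    by rewrite ler_wpM2r // expR_sub1.
  apply: (@le_trans _ _ (r * expR r * r)).
    by apply: ler_pM; rewrite ?mulr_ge0 ?expR_ge0 //; apply: ler_pM => //; exact: expR_ge0.
  rewrite mulrAC -expr2 -[leLHS]mulr1; apply: ler_wpM2l; last lra.
  by rewrite mulr_ge0 // sqr_ge0.
apply: le_trans (cabs_ReIm x) _.
apply: (@le_trans _ _ (4 * (r ^+ 2 * expR r * expR r))).
  have : r ^+ 2 * expR r <= r ^+ 2 * expR r * expR r.
    by rewrite -[leLHS]mulr1; apply: ler_wpM2l; [rewrite mulr_ge0 // sqr_ge0|lra].
  lra.
rewrite -mulrA -expRD mulrA; apply: ler_pM.
- by rewrite mulr_ge0 // sqr_ge0.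
- exact: expR_ge0.
- rewrite /r exprMn mulrA; apply: ler_wpM2r; first exact: sqr_ge0.
  by rewrite /K; lra.
rewrite ler_expR /r -mulrDl; apply: ler_wpM2r; first exact: cabs_ge0.
by rewrite /K; have := sqr_ge0 (2 * pi : R); lra.
Qed.

End ExpEstimate.

Section HasSum.
Variable R : realType.
Local Notation C := R[i].

(* Unconditional summability: the partial sums over finite sets converge along inclusion. *)
Definition hasS (I : eqType) (f : I -> C) (s : C) := forall e : R, 0 < e ->
  exists A : seq I, forall B, uniq B -> {subset A <= B} ->
    cabs (\sum_(i <- B) f i - s) <= e.

Section One.
Variable I : eqType.
Implicit Types (f g : I -> C) (A B : seq I).

Lemma hasS_unique f s t : hasS f s -> hasS f t -> s = t.
Proof.
move=> hs ht; apply/eqP; rewrite -subr_eq0; apply/eqP; apply: cabs_small => e e0.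
have [A hA] := hs (e / 2) ltac:(lra); have [B hB] := ht (e / 2) ltac:(lra).
have u := undup_uniq (A ++ B).
have hA' : {subset A <= undup (A ++ B)} by move=> i h; rewrite mem_undup mem_cat h.
have hB' : {subset B <= undup (A ++ B)} by move=> i h; rewrite mem_undup mem_cat h orbT.
have := hA _ u hA'; have := hB _ u hB'; set S := \sum_(_ <- _) _ => h1 h2.
have -> : s - t = (S - t) - (S - s) by ring.
apply: le_trans (cabsD _ _) _; rewrite cabsN; lra.
Qed.

Lemma eq_hasS f g s : f =1 g -> hasS f s -> hasS g s.
Proof.
move=> fg hf e e0; have [A hA] := hf e e0; exists A => B uB AB.
by rewrite (eq_bigr f) => [|i _]; [exact: hA|rewrite fg].
Qed.

Lemma hasSD f g s t : hasS f s -> hasS g t -> hasS (fun i => f i + g i) (s + t).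
Proof.
move=> hs ht e e0.
have [A hA] := hs (e / 2) ltac:(lra); have [B hB] := ht (e / 2) ltac:(lra).
exists (A ++ B) => D uD AD.
have hA' : {subset A <= D} by move=> i h; apply: AD; rewrite mem_cat h.
have hB' : {subset B <= D} by move=> i h; apply: AD; rewrite mem_cat h orbT.
have {}hA := hA _ uD hA'; have {}hB := hB _ uD hB'.
rewrite big_split /= opprD addrACA; apply: le_trans (cabsD _ _) _; lra.
Qed.

Lemma hasSZ a f s : hasS f s -> hasS (fun i => a * f i) (a * s).
Proof.
move=> hs e e0; have c0 := cabs_ge0 a.
have p : 0 < cabs a + 1 by lra.
have [A hA] := hs (e / (cabs a + 1)) ltac:(exact: divr_gt0).
exists A => B uB AB; rewrite -mulr_sumr -mulrBr cabsM.
apply: (@le_trans _ _ ((cabs a + 1) * (e / (cabs a + 1)))).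
  by apply: ler_pM => //; [exact: cabs_ge0|lra|exact: hA].
by rewrite mulrC divfK ?gt_eqF.
Qed.

Lemma hasS0 : hasS (fun _ : I => 0) 0.
Proof. by move=> e e0; exists [::] => B _ _; rewrite big1 // subrr cabs0 ltW. Qed.

Lemma hasS_sum (T : finType) (f : T -> I -> C) (s : T -> C) : (forall j, hasS (f j) (s j)) ->
  hasS (fun i => \sum_j f j i) (\sum_j s j).
Proof.
move=> hs; suff H (r : seq T) : hasS (fun i => \sum_(j <- r) f j i) (\sum_(j <- r) s j) by exact: H.
elim: r => [|j r IH].
  by rewrite big_nil; apply: eq_hasS hasS0 => i; rewrite big_nil.
by rewrite big_cons; apply: eq_hasS (hasSD (hs j) IH) => i; rewrite big_cons.
Qed.

Lemma hasS_bound f (g : I -> R) s G : (forall i, cabs (f i) <= g i) ->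
  (forall B, uniq B -> \sum_(i <- B) g i <= G) -> hasS f s -> cabs s <= G.
Proof.
move=> fg hG hs; apply/ler_addgt0Pr => e e0.
have [A hA] := hs e e0; have u := undup_uniq A.
have AA : {subset A <= undup A} by move=> i; rewrite mem_undup.
have h1 := hA _ u AA; set S := \sum_(_ <- _) _ in h1.
have h2 : cabs S <= G.
  by apply: le_trans (cabs_sum _ _ _) _; apply: le_trans (hG _ u); apply: ler_sum.
have -> : s = S - (S - s) by ring.
apply: le_trans (cabsD _ _) _; rewrite cabsN; lra.
Qed.

Lemma ler_sum_sub (g : I -> R) A B : (forall i, 0 <= g i) -> uniq A -> uniq B ->
  {subset A <= B} -> \sum_(i <- A) g i <= \sum_(i <- B) g i.
Proof.
move=> g0 uA uB AB.
rewrite [leRHS](perm_big (A ++ [seq i <- B | i \notin A])) /=.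
  rewrite big_cat /= lerDl; exact: sumr_ge0.
apply: uniq_perm => //; first last.
  move=> i; rewrite mem_cat mem_filter; case: (boolP (i \in A)) => //= /AB ->.
  by [].
rewrite cat_uniq uA filter_uniq // andbT; apply/hasPn => i.
by rewrite mem_filter => /andP[].
Qed.

Lemma hasS_ex_nneg (g : I -> R) G : (forall i, 0 <= g i) ->
  (forall B, uniq B -> \sum_(i <- B) g i <= G) -> exists s, hasS (fun i => (g i)%:C) s%:C.
Proof.
move=> g0 hG; pose E := [set x : R | exists2 B, uniq B & x = \sum_(i <- B) g i].
have supE : has_sup E.
  split; first by exists (\sum_(i <- [::]) g i); exists [::].
  by exists G => x [B uB ->]; exact: hG.
exists (sup E) => e e0.
have [x [A uA ->] hx] := sup_adherent e0 supE.
exists A => B uB AB; rewrite -rmorph_sum -rmorphB cabsR /=.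
have h1 : \sum_(i <- B) g i <= sup E by apply: sup_upper_bound => //; exists B.
have h2 : \sum_(i <- A) g i <= \sum_(i <- B) g i by exact: ler_sum_sub.
rewrite ler0_norm; lra.
Qed.

(** Real and imaginary parts h are written as (|h| + h) - |h|, a difference of two nonnegative
    families with bounded partial sums. *)
Lemma hasS_ex f G : (forall B, uniq B -> \sum_(i <- B) cabs (f i) <= G) ->
  exists s, hasS f s.
Proof.
move=> hG.
have E (h : I -> R) : (forall i, `|h i| <= cabs (f i)) -> exists s, hasS (fun i => (h i)%:C) s.
  move=> hh.
  have [s hs] : exists s, hasS (fun i => (`|h i| + h i)%:C) s%:C.
    apply: (@hasS_ex_nneg _ (2 * G)) => [i|B uB].
      by have := ler_norm (- h i); rewrite normrN; lra.
    apply: (@le_trans _ _ (\sum_(i <- B) 2 * cabs (f i))).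
      apply: ler_sum => i _; have := hh i; have := ler_norm (h i); lra.
    by rewrite -mulr_sumr; have := hG _ uB; lra.
  have [t ht] : exists s, hasS (fun i => (`|h i|)%:C) s%:C.
    apply: (@hasS_ex_nneg _ G) => [i|B uB]; first exact: normr_ge0.
    by apply: le_trans (hG _ uB); apply: ler_sum.
  exists (s%:C + (- 1) * t%:C); apply: eq_hasS (hasSD hs (hasSZ (-1) ht)) => i.
  by rewrite mulN1r -rmorphB /=; congr (_%:C); ring.
have [s hs] := E (fun i => complex.Re (f i)) (fun i => cabs_Re _).
have [t ht] := E (fun i => complex.Im (f i)) (fun i => cabs_Im _).
exists (s + 'i%C * t); apply: eq_hasS (hasSD hs (hasSZ 'i%C ht)) => i.
by rewrite -complexE.
Qed.

Lemma hasS_cvg f s (B : nat -> seq I) : hasS f s -> (forall N, uniq (B N)) ->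
  (forall A : seq I, exists N0, forall N, (N0 <= N)%N -> {subset A <= B N}) ->
  (fun N => \sum_(i <- B N) f i : C^o) @ \oo --> (s : C^o).
Proof.
move=> hs uB exB; apply/cvgrPdist_le => e e0.
have e0' : 0 < complex.Re e by move: e0; rewrite ltcE => /andP[].
have eE : e = (complex.Re e)%:C.
  by apply/eqP; move: e0; rewrite ltcE eq_complex /= eq_sym => /andP[-> _]; rewrite eqxx.
have [A hA] := hs _ e0'; have [N0 h0] := exB A.
exists N0 => // N /= hN; rewrite distrC cabsE eE lecR.
by apply: hA; [exact: uB|exact: h0].
Qed.
End One.

Lemma hasS_reindex (I J : eqType) (h : I -> J) (f : J -> C) s : bijective h ->
  hasS f s -> hasS (f \o h) s.
Proof.
move=> [k hk kh] hs e e0; have [A hA] := hs e e0; exists (map k A) => B uB AB.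
have := hA (map h B); rewrite big_map; apply.
  by rewrite map_inj_uniq //; exact: can_inj hk.
by move=> j jA; rewrite -(kh j) map_f // AB // map_f.
Qed.

(** Reassembles a sum from finitely many classes. The tolerance is divided by [#|J| + 1], so that J
    may be empty. *)
Lemma hasS_fin (I : eqType) (J : finType) (f : J -> I -> C) (s : J -> C) :
  (forall j, hasS (f j) (s j)) -> hasS (fun x : J * I => f x.1 x.2) (\sum_j s j).
Proof.
move=> hs e e0; pose d := e / (#|J|%:R + 1).
have c1 : 0 < #|J|%:R + 1 :> R by rewrite natr1 ltr0n.
have d0 : 0 < d by exact: divr_gt0.
have /choice[A hA] : forall j, exists A : seq I, forall B, uniq B -> {subset A <= B} ->
    cabs (\sum_(i <- B) f j i - s j) <= d by move=> j; exact: hs.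
exists [seq (j, i) | j <- enum J, i <- A j] => B uB AB.
have -> : \sum_(x <- B) f x.1 x.2 = \sum_j \sum_(i <- [seq x.2 | x <- B & x.1 == j]) f j i.
  rewrite (partition_big (fun x => x.1) xpredT) //=; apply: eq_bigr => j _.
  by rewrite big_map big_filter; apply: eq_bigr => x /eqP ->.
rewrite -sumrB; apply: le_trans (cabs_sum _ _ _) _.
apply: (@le_trans _ _ (\sum_(j : J) d)).
  apply: ler_sum => j _; apply: hA.
    rewrite map_inj_in_uniq ?filter_uniq // => x y; rewrite !mem_filter.
    by case: x y => [x1 x2] [y1 y2] /= /andP[/eqP -> _] /andP[/eqP -> _] ->.
  move=> i iA; apply/mapP; exists (j, i) => //; rewrite mem_filter eqxx /=.
  by apply: AB; apply/allpairsPdep; exists j, i; rewrite mem_enum.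
rewrite sumr_const -[leRHS](divfK (lt0r_neq0 c1)) -/d -[leLHS]mulr_natr.
by apply: ler_wpM2l; [exact: ltW|rewrite lerDl].
Qed.

End HasSum.

(** * Gaussian domination of the theta series *)

Section PosDef.
Variables (R : realType) (n : nat).

Definition ssq (v : 'rV[R]_n) : R := \sum_i v 0 i ^+ 2.

Lemma quadE (K : comNzRingType) m (v w : 'rV[K]_m) (Y : 'M[K]_m) :
  (v *m Y *m w^T) 0 0 = \sum_i \sum_j v 0 i * Y i j * w 0 j.
Proof.
rewrite mxE exchange_big; apply: eq_bigr => j _; rewrite mxE mulr_suml mxE.
by apply: eq_bigr => i _.
Qed.

Lemma continuous_sum (I : Type) (r : seq I) (F : I -> 'rV[R]_n -> R) :
  (forall i, continuous (F i)) -> continuous (fun v => \sum_(i <- r) F i v).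
Proof.
move=> cF; elim: r => [|i r IH] v.
  have -> : (fun v => \sum_(i <- [::]) F i v) = fun=> 0 by apply/funext => u; rewrite big_nil.
  exact: cst_continuous.
have -> : (fun v => \sum_(i <- i :: r) F i v) = fun v => F i v + \sum_(i <- r) F i v.
  by apply/funext => u; rewrite big_cons.
by apply: continuousD; [exact: cF|exact: IH].
Qed.

Lemma continuous_quad (Y : 'M[R]_n) : continuous (fun v : 'rV[R]_n => (v *m Y *m v^T) 0 0).
Proof.
have -> : (fun v : 'rV[R]_n => (v *m Y *m v^T) 0 0) =
    (fun v : 'rV[R]_n => \sum_i \sum_j v 0 i * Y i j * v 0 j).
  by apply/funext => v; exact: quadE.
apply: continuous_sum => i; apply: continuous_sum => j v.
have c1 (k : 'I_n) : (fun u : 'rV[R]_n => u 0 k) @ v --> v 0 k by exact: coord_continuous.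
exact: cvgM (cvgM (c1 i) (cvg_cst (Y i j))) (c1 j).
Qed.

(** The form attains a positive minimum on the unit sphere, which is compact and, as n > 0, not
    empty; homogeneity does the rest. *)
Lemma posdef_lb (Y : 'M[R]_n) : (0 < n)%N ->
  (forall v : 'rV[R]_n, v != 0 -> 0 < (v *m Y *m v^T) 0 0) ->
  exists2 a : R, 0 < a & forall v, a * ssq v <= (v *m Y *m v^T) 0 0.
Proof.
move=> n0 pd; pose S := [set v : 'rV[R]_n | ssq v = 1].
have ssqE v : ssq v = (v *m 1%:M *m v^T) 0 0.
  by rewrite mulmx1 mxE; apply: eq_bigr => i _; rewrite mxE expr2.
have cS : compact S.
  apply: (@subclosed_compact _ S [set v : 'rV[R]_n | forall i, (`[-1, 1]%classic : set R) (v ord0 i)]).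
  - have -> : S = (fun v => (v *m 1%:M *m v^T) 0 0) @^-1` [set (1 : R)].
      by apply/seteqP; split=> v; rewrite /S /= ssqE.
    by apply: closed_comp; [move=> v _; exact: continuous_quad|exact: closed_eq].
  - apply: (@rV_compact R n (fun=> `[-1, 1]%classic)) => _; exact: segment_compact.
  - move=> v vS i; rewrite /= in_itv /= -ler_norml -(@ler_pXn2r _ 2) ?nnegrE // expr1n.
    rewrite real_normK ?num_real //; rewrite -vS /ssq (bigD1 i) //= lerDl.
    by apply: sumr_ge0 => j _; exact: sqr_ge0.
have S0 : S !=set0.
  exists (delta_mx 0 (Ordinal n0)); rewrite /S /= /ssq (bigD1 (Ordinal n0)) //= mxE !eqxx.
  by rewrite expr1n big1 ?addr0 // => i ii; rewrite mxE (negbTE ii) andbF expr0n.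
have [c cS' hc] := EVT_min_rV S0 cS (continuous_subspaceT (continuous_quad (Y := Y))).
rewrite inE in cS'.
have c0 : c != 0.
  by apply/eqP => c0; move: cS'; rewrite /S /= c0 /ssq big1 => [/eqP|i _]; rewrite ?mxE ?expr0n // eq_sym oner_eq0.
exists ((c *m Y *m c^T) 0 0); first exact: pd.
move=> v; have [->|v0] := eqVneq v 0.
  have -> : ssq (0 : 'rV_n) = 0 by rewrite /ssq big1 // => i _; rewrite mxE expr0n.
  by rewrite !mul0mx mulr0 [leRHS]mxE.
have sv : 0 < ssq v.
  have [i vi] : exists i, v 0 i != 0.
    apply: contrapT => /forallNP h; case/eqP: v0; apply/rowP => i; rewrite mxE.
    by apply/eqP; apply: contraT => /(h i).
  rewrite /ssq (bigD1 i) //=; apply: ltr_wpDr; last by rewrite exprn_even_gt0.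
  by apply: sumr_ge0 => j _; exact: sqr_ge0.
set t := Num.sqrt (ssq v); have tt : t ^+ 2 = ssq v by rewrite sqr_sqrtr // ltW.
have t0 : 0 < t by rewrite sqrtr_gt0.
have ti : t != 0 by rewrite gt_eqF.
have vS : (t^-1 *: v) \in S.
  rewrite inE /S /= /ssq (eq_bigr (fun i => (t ^-1) ^+ 2 * v 0 i ^+ 2)) => [|i _]; last by rewrite mxE exprMn.
  by rewrite -mulr_sumr -/(ssq v) -tt -exprMn mulVf // expr1n.
have := hc _ vS; rewrite -tt linearZ /= -scalemxAr -!scalemxAl !mxE => /(ler_wpM2l (sqr_ge0 t)).
set b := (\sum_j (v *m Y) 0 j * v^T j 0); rewrite (_ : t ^+ 2 * (t^-1 * (t^-1 * b)) = b); last by field.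
by rewrite mulrC.
Qed.
End PosDef.

Section Box.
Variables (R : realType) (n : nat).
Local Notation C := R[i].
Implicit Types x : 'rV[int]_n.

Definition boxv N (phi : {ffun 'I_n -> 'I_(2 * N).+1}) : 'rV[int]_n :=
  \row_i ((phi i)%:Z - N%:Z).
(** The cube [-N, N]^n, enumerated in the same way as in the definition of [theta], whose partial
    sums thereby become sums over [box]. *)
Definition box N : seq 'rV[int]_n := [seq boxv phi | phi <- enum {: {ffun 'I_n -> 'I_(2 * N).+1}}].

Lemma boxv_inj N : injective (@boxv N).
Proof.
move=> phi psi /rowP e; apply/ffunP => i; have := e i; rewrite !mxE => /addIr [].
by move/val_inj.
Qed.

Lemma box_uniq N : uniq (box N).
Proof. by rewrite /box map_inj_uniq ?enum_uniq //; exact: boxv_inj. Qed.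

Lemma mem_box N x : (forall i, (`|x ord0 i| <= N)%N) -> x \in box N.
Proof.
move=> h; have lt i : (`|(x ord0 i + N%:Z)%R| < (2 * N).+1)%N by have := h i; lia.
apply/mapP; exists [ffun i => Ordinal (lt i)]; first by rewrite mem_enum.
apply/rowP => i; rewrite !mxE ffunE /=; have := h i.
by rewrite -[x 0 i]/(x ord0 i); move: (x ord0 i) => m; lia.
Qed.

Lemma box_exhaust (A : seq 'rV[int]_n) : exists N0, forall N, (N0 <= N)%N -> {subset A <= box N}.
Proof.
exists (\max_(x <- A) \max_i `|x ord0 i|)%N => N hN x xA; apply: mem_box => i.
apply: leq_trans hN; apply: leq_trans (leq_bigmax_seq _ xA isT).
exact: (leq_bigmax (F := fun i => `|x ord0 i|%N)).
Qed.

Definition l1 x : R := \sum_i `|x ord0 i|%:~R.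
Definition l2 x : R := \sum_i (x ord0 i)%:~R ^+ 2.

Lemma l1_ge0 x : 0 <= l1 x. Proof. by apply: sumr_ge0 => i _; rewrite ler0z. Qed.

Lemma geom_box (r : R) N : 0 <= r < 1 ->
  \sum_(j < (2 * N).+1) r ^+ `|j%:Z - N%:Z|%N <= 2 / (1 - r).
Proof.
move=> /andP[r0 r1]; have q0 : 0 < 1 - r by lra.
have g M : \sum_(j < M) r ^+ j <= 1 / (1 - r).
  rewrite ler_pdivlMr // mulrC -opprB mulNr -subrX1 opprB gerDl oppr_le0; exact: exprn_ge0.
rewrite (_ : (2 * N).+1 = (N + N.+1)%N); last lia.
rewrite big_split_ord /= (reindex_inj rev_ord_inj) /=.
have -> : 2 / (1 - r) = 1 / (1 - r) + 1 / (1 - r) by field; lra.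
apply: lerD.
  apply: le_trans (g N); apply: ler_sum => j _.
  rewrite (_ : `|_|%N = j.+1); last by have := ltn_ord j; lia.
  by rewrite exprS ler_piMl ?exprn_ge0 // ltW.
apply: le_trans (g N.+1); apply: ler_sum => j _.
by rewrite (_ : `|_|%N = j); last lia.
Qed.

Lemma gauss_dom (a be : R) : 0 < a -> 0 <= be -> exists K : R, forall B : seq 'rV[int]_n, uniq B ->
  \sum_(x <- B) expR (- a * l2 x + be * l1 x) <= K.
Proof.
(* Completing the square gives - a t^2 + be t <= c - t, so each coordinate is dominated by a
   geometric series of ratio exp(-1). *)
move=> a0 b0; pose c := (be + 1) ^+ 2 / (4 * a).
pose r : R := expR (- 1); have r01 : 0 <= r < 1.
  by rewrite expR_ge0 /r -[ltRHS]expR0 ltr_expR; lra.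
exists (expR (c *+ n) * (2 / (1 - r)) ^+ n) => B uB.
have term x : expR (- a * l2 x + be * l1 x) <= expR (c *+ n) * \prod_i r ^+ `|x ord0 i|%N.
  have -> : \prod_i r ^+ `|x ord0 i|%N = expR (- l1 x).
    rewrite /l1 -sumrN expR_sum; apply: eq_bigr => i _; rewrite /r -expRM_natl mulrN1.
    by congr (expR (- _)); rewrite -[in LHS]mulrz_nat -abszE.
  have -> : c *+ n = \sum_(i < n) c by rewrite sumr_const card_ord.
  rewrite -expRD ler_expR /l1 /l2 !mulr_sumr -sumrN -!big_split /=.
  apply: ler_sum => i _; set m := x ord0 i.
  rewrite intr_norm; set t : R := `|m%:~R|.
  have -> : (m%:~R : R) ^+ 2 = t ^+ 2 by rewrite /t real_normK ?num_real.
  rewrite -subr_ge0.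
  have -> : c + - t - (- a * t ^+ 2 + be * t) = (2 * a * t - (be + 1)) ^+ 2 / (4 * a).
    by rewrite /c; field; lra.
  by apply: divr_ge0; [exact: sqr_ge0|lra].
have [N hN] := box_exhaust B; have {}hN := hN _ (leqnn N).
apply: (@le_trans _ _ (\sum_(x <- B) expR (c *+ n) * \prod_i r ^+ `|x ord0 i|%N)).
  by apply: ler_sum => x _; exact: term.
rewrite -mulr_sumr; apply: ler_wpM2l; first exact: expR_ge0.
have r0 : 0 <= r by case/andP: r01.
apply: (@le_trans _ _ (\sum_(x <- box N) \prod_i r ^+ `|x ord0 i|%N)).
  apply: ler_sum_sub => //; last exact: box_uniq.
  by move=> x; apply: prodr_ge0 => i _; exact: exprn_ge0.
rewrite /box big_map big_enum /=.
have -> : \sum_(phi : {ffun 'I_n -> 'I_(2 * N).+1}) \prod_i r ^+ `|boxv phi ord0 i|%N =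
    \prod_(i < n) \sum_(j < (2 * N).+1) r ^+ `|j%:Z - N%:Z|%N.
  rewrite (bigA_distr_bigA (fun (i : 'I_n) (j : 'I_(2 * N).+1) => r ^+ `|j%:Z - N%:Z|%N)).
  by apply: eq_bigr => phi _; apply: eq_bigr => i _; rewrite mxE.
rewrite prodr_const card_ord; apply: lerXn2r; rewrite ?nnegrE.
- by apply: sumr_ge0 => j _; exact: exprn_ge0.
- by apply: divr_ge0 => //; lra.
- exact: geom_box.
Qed.
End Box.

(** * The function theta(z, w) and its periods *)

Section Theta.
Variables (R : realType) (n : nat).
Hypothesis n_gt0 : (0 < n)%N.
Local Notation C := R[i].
Implicit Types (x : 'rV[int]_n) (z : 'M[C]_n) (v w h : 'rV[C]_n).

Definition dot (K : pzRingType) m (u v : 'rV[K]_m) : K := (u *m v^T) 0 0.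
Definition zC x : 'rV[C]_n := map_mx intr x.
Definition vn v : R := \sum_i cabs (v 0 i).
Definition quad z v w : C := (v *m z *m w^T) 0 0.

Lemma dotE (K : pzRingType) m (u v : 'rV[K]_m) : dot u v = \sum_i u 0 i * v 0 i.
Proof. by rewrite /dot mxE; apply: eq_bigr => i _; rewrite mxE. Qed.

Lemma vn_ge0 v : 0 <= vn v. Proof. by apply: sumr_ge0 => i _; exact: cabs_ge0. Qed.
Lemma vnD v w : vn (v + w) <= vn v + vn w.
Proof. by rewrite /vn -big_split /=; apply: ler_sum => i _; rewrite mxE cabsD. Qed.
Lemma vnZ a v : vn (a *: v) = cabs a * vn v.
Proof. by rewrite /vn mulr_sumr; apply: eq_bigr => i _; rewrite mxE cabsM. Qed.
Lemma vn0 : vn 0 = 0.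
Proof. by rewrite /vn big1 // => i _; rewrite mxE cabs0. Qed.
Lemma vn_coord v i : cabs (v 0 i) <= vn v.
Proof. by rewrite /vn (bigD1 i) //= lerDl; apply: sumr_ge0 => j _; exact: cabs_ge0. Qed.
Lemma vn_zC x : vn (zC x) = l1 R x.
Proof.
apply: eq_bigr => i _; rewrite mxE -[x 0 i]/(x ord0 i).
by rewrite -(rmorph_int (real_complex R)) cabsR intr_norm.
Qed.
Lemma dot_le v w : cabs (dot v w) <= vn v * vn w.
Proof.
rewrite dotE; apply: le_trans (cabs_sum _ _ _) _; rewrite /vn mulr_suml.
apply: ler_sum => i _; rewrite cabsM; apply: ler_wpM2l; first exact: cabs_ge0.
exact: vn_coord.
Qed.

Definition tt z w x : C := expC (2^-1 * quad z (zC x) (zC x) + dot (zC x) w).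
Definition th z w : C := xget 0 [set s | hasS (tt z w) s].

Lemma ImM_real (a : R) (s : C) : complex.Im (a%:C * s) = a * complex.Im s.
Proof. by case: s => p q /=; ring. Qed.
Lemma ImD (s t : C) : complex.Im (s + t) = complex.Im s + complex.Im t.
Proof. by case: s t => p q [p' q']. Qed.
Lemma Im_sum I (r : seq I) (P : pred I) (F : I -> C) :
  complex.Im (\sum_(i <- r | P i) F i) = \sum_(i <- r | P i) complex.Im (F i).
Proof.
apply: (big_morph (@complex.Im R)) => //; by move=> [a b] [c d].
Qed.

Lemma Im_quad z (u : 'rV[R]_n) : complex.Im (quad z (map_mx (real_complex R) u) (map_mx (real_complex R) u)) =
  (u *m map_mx (@complex.Im R) z *m u^T) 0 0.
Proof.
rewrite /quad !quadE Im_sum; apply: eq_bigr => i _; rewrite Im_sum; apply: eq_bigr => j _.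
by rewrite !mxE mulrAC -rmorphM ImM_real mulrAC.
Qed.

Lemma zC_real x : zC x = map_mx (real_complex R) (map_mx intr x).
Proof. by apply/rowP => i; rewrite !mxE rmorph_int. Qed.

Lemma tt_bound z : Hn z -> exists2 a : R, 0 < a & forall w x,
  cabs (tt z w x) <= expR (- a * l2 R x + 2 * pi * vn w * l1 R x).
Proof.
move=> [_ pd]; have [a a0 ha] := posdef_lb n_gt0 pd.
have pi0 : 0 < pi :> R := pi_gt0 R.
exists (pi * a) => [|w x]; first exact: mulr_gt0.
rewrite /tt cabs_expC ler_expR.
have -> : complex.Im (2^-1 * quad z (zC x) (zC x) + dot (zC x) w) =
  2^-1 * complex.Im (quad z (zC x) (zC x)) + complex.Im (dot (zC x) w).
  have e2 : (2^-1 : C) = (2^-1 : R)%:C by rewrite fmorphV rmorph_nat.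
  by rewrite e2 ImD ImM_real.
have h1 := ha (map_mx intr x); rewrite -Im_quad -zC_real in h1.
have h2 : - complex.Im (dot (zC x) w) <= vn w * l1 R x.
  apply: le_trans (ler_norm _) _; rewrite normrN; apply: le_trans (cabs_Im _) _.
  by rewrite mulrC -vn_zC; exact: dot_le.
have -> : l2 R x = ssq (map_mx intr x) by apply: eq_bigr => i _; rewrite mxE.
have := ler_wpM2l (ltW pi0) h1; have := ler_wpM2l (ltW pi0) h2; lra.
Qed.

Lemma tt_dom z B : Hn z -> 0 <= B -> exists K : R, forall D : seq 'rV[int]_n, uniq D -> forall w, vn w <= B ->
  \sum_(x <- D) cabs (tt z w x) * expR (B * l1 R x) <= K.
Proof.
move=> hz B0; have [a a0 ha] := tt_bound hz.
have pi0 : 0 < pi :> R := pi_gt0 R.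
have [|K hK] := @gauss_dom R n a (2 * pi * B + B) a0.
  by apply: addr_ge0 => //; rewrite !mulr_ge0 // ltW.
exists K => D uD w wB; apply: le_trans (hK D uD); apply: ler_sum => x _.
apply: (@le_trans _ _ (expR (- a * l2 R x + 2 * pi * vn w * l1 R x) * expR (B * l1 R x))).
  by apply: ler_wpM2r; [exact: expR_ge0|exact: ha].
rewrite -expRD ler_expR -addrA lerD2l (mulrDl _ B) lerD2r; apply: ler_wpM2r; first exact: l1_ge0.
by apply: ler_wpM2l => //; lra.
Qed.

Lemma thP z w : Hn z -> hasS (tt z w) (th z w).
Proof.
move=> hz; apply: (@xgetPex _ _ [set s | hasS (tt z w) s]).
have [K hK] := tt_dom hz (vn_ge0 w); apply: (@hasS_ex _ _ _ K) => B uB.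
apply: le_trans (hK B uB w (lexx _)); apply: ler_sum => x _.
rewrite -[leLHS]mulr1; apply: ler_wpM2l; first exact: cabs_ge0.
by rewrite -expR0 ler_expR; apply: mulr_ge0; [exact: vn_ge0|exact: l1_ge0].
Qed.

Lemma thE z w s : Hn z -> hasS (tt z w) s -> th z w = s.
Proof. by move=> hz hs; exact: hasS_unique (thP w hz) hs. Qed.

Lemma theta_th z : Hn z -> theta z = th z 0.
Proof.
move=> hz; rewrite /theta; apply: (@cvg_lim C^o); first exact: norm_hausdorff.
set F := (X in X @ _).
suff -> : F = (fun N => \sum_(i <- box n N) tt z 0 i).
  exact: hasS_cvg (thP 0 hz) (@box_uniq n) (@box_exhaust n).
apply/funext => N; rewrite /F /box big_map big_enum /=.
apply: eq_bigr => m _; rewrite /tt dotE big1 ?addr0; last by move=> i _; rewrite [X in _ * X]mxE mulr0.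
rewrite /quad (_ : zC _ = \row_i ((m i)%:R - N%:R)) //.
by apply/rowP => i; rewrite !mxE rmorphB.
Qed.

Lemma quadD z v w h : quad z (v + w) h = quad z v h + quad z w h.
Proof. by rewrite /quad !mulmxDl mxE. Qed.
Lemma quadDr z v w h : quad z v (w + h) = quad z v w + quad z v h.
Proof. by rewrite /quad linearD /= mulmxDr mxE. Qed.
Lemma quadZ z a v w : quad z (a *: v) w = a * quad z v w.
Proof. by rewrite /quad -!scalemxAl mxE. Qed.
Lemma quadZr z a v w : quad z v (a *: w) = a * quad z v w.
Proof. by rewrite /quad linearZ /= -scalemxAr mxE. Qed.
Lemma quadC z v w : z^T = z -> quad z v w = quad z w v.
Proof.
move=> zz; have e : (v *m z *m w^T)^T = w *m z *m v^T by rewrite !trmx_mul trmxK zz mulmxA.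
by rewrite /quad -e [RHS]mxE.
Qed.
Lemma dotD v w h : dot (v + w) h = dot v h + dot w h.
Proof. by rewrite /dot mulmxDl mxE. Qed.
Lemma dotDr v w h : dot v (w + h) = dot v w + dot v h.
Proof. by rewrite /dot linearD /= mulmxDr mxE. Qed.
Lemma dotZ a v w : dot (a *: v) w = a * dot v w.
Proof. by rewrite /dot -scalemxAl mxE. Qed.
Lemma dotZr a v w : dot v (a *: w) = a * dot v w.
Proof. by rewrite /dot linearZ /= -scalemxAr mxE. Qed.
Lemma dotC v w : dot v w = dot w v.
Proof. by rewrite !dotE; apply: eq_bigr => i _; rewrite mulrC. Qed.
Lemma dot_mulr v w (A : 'M[C]_n) : dot v (w *m A) = quad A w v.
Proof. by rewrite dotC. Qed.
Lemma zCD x y : zC (x + y) = zC x + zC y.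
Proof. by apply/rowP => i; rewrite !mxE rmorphD. Qed.
Lemma zCN x : zC (- x) = - zC x.
Proof. by apply/rowP => i; rewrite !mxE rmorphN. Qed.
Lemma dot_zC x y : dot (zC x) (zC y) = (dot x y)%:~R.
Proof.
rewrite !dotE rmorph_sum; apply: eq_bigr => i _; by rewrite !mxE rmorphM.
Qed.

Lemma th_period z w m : Hn z -> th z (w + zC m) = th z w.
Proof.
move=> hz; apply: thE => //; apply: eq_hasS (thP w hz) => x.
by rewrite /tt dotDr addrA [RHS]expCD dot_zC expC_int mulr1.
Qed.

(** The translation x -> x + m of the lattice, followed by completing the square in the exponent. *)
Lemma th_quasi z w m : Hn z ->
  th z (w + zC m *m z) = expC (- (2^-1 * quad z (zC m) (zC m) + dot (zC m) w)) * th z w.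
Proof.
move=> hz; apply: thE => //.
have bij : bijective (fun x : 'rV[int]_n => x + m).
  by exists (fun x => x - m) => x; [rewrite addrK|rewrite subrK].
have := hasSZ (expC (- (2^-1 * quad z (zC m) (zC m) + dot (zC m) w))) (hasS_reindex bij (thP w hz)).
apply: eq_hasS => x /=; rewrite /tt -expCD; congr expC.
rewrite zCD !quadD !quadDr !dotD !dotDr dot_mulr (quadC (zC x) (zC m)); last by case: hz.
by field.
Qed.

End Theta.

(** * Functions with uniform second-order expansions *)

Section Nice.
Variables (R : realType) (n : nat).
Local Notation C := R[i].
Local Notation V := 'rV[C]_n.
Implicit Types (v w h : V) (G H : V -> C).
Local Notation vn := (@vn R n).

(** The constant 2 pi i, locked so that it stays an atom in the computations. *)
Definition tpi : C := locked ((2 * pi)%:C * 'i%C).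

Lemma expC_taylor2 : exists2 k : R, 0 < k & forall s : C,
  cabs (expC s - 1 - tpi * s) <= k * cabs s ^+ 2 * expR (k * cabs s).
Proof. by rewrite /tpi -lock; have [k [k0 hk]] := @expC_taylor R; exists k. Qed.

(* A substitute for holomorphy of [G] on C^n, with gradient [dG]. *)
Definition nice_with (dG : V -> V) G := forall B : R, 0 <= B -> exists2 K : R, 0 <= K &
  forall w h, vn w <= B -> vn h <= B -> [/\ cabs (G w) <= K, vn (dG w) <= K &
    cabs (G (w + h) - G w - dot h (dG w)) <= K * vn h ^+ 2].
Definition nice G := exists dG, nice_with dG G.

Lemma cabsD4 (a b c d : C) : cabs (a + b + c + d) <= cabs a + cabs b + cabs c + cabs d.
Proof.
have h1 := cabsD (a + b + c) d; have h2 := cabsD (a + b) c; have h3 := cabsD a b; lra.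
Qed.

Lemma nice_mul G H : nice G -> nice H -> nice (fun w => G w * H w).
Proof.
move=> [dG nG] [dH nH]; exists (fun w => G w *: dH w + H w *: dG w) => B B0.
have B20 : 0 <= B + B by lra.
have [K K0 hK] := nG _ B20; have [L L0 hL] := nH _ B20.
exists (K * L * 4 + K * L * (2 * B) + K * L) => [|w h wB hB].
  by rewrite !addr_ge0 // !mulr_ge0 //; lra.
have KL : 0 <= K * L by rewrite mulr_ge0.
have KLB : 0 <= K * L * (2 * B) by rewrite mulr_ge0 //; lra.
have wB2 : vn w <= B + B by lra.
have hB2 : vn h <= B + B by lra.
have hB3 : vn h <= 2 * B by lra.
have whB2 : vn (w + h) <= B + B by apply: le_trans (vnD _ _) _; lra.
have [g1 g2 g3] := hK w h wB2 hB2; have [h1 h2 h3] := hL w h wB2 hB2.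
have [g1' _ _] := hK (w + h) h whB2 hB2.
have v0 := vn_ge0 h; have cg := cabs_ge0 (G w); have ch := cabs_ge0 (H w).
split.
- rewrite cabsM; have := ler_pM cg ch g1 h1; lra.
- apply: le_trans (vnD _ _) _; rewrite !vnZ.
  have := ler_pM cg (vn_ge0 _) g1 h2; have := ler_pM ch (vn_ge0 _) h1 g2; lra.
(* Three of the four terms contain a remainder; the last one, a product of two linear parts, is
   itself quadratic in h. *)
have -> : G (w + h) * H (w + h) - G w * H w - dot h (G w *: dH w + H w *: dG w) =
   G (w + h) * (H (w + h) - H w - dot h (dH w)) + (G (w + h) - G w - dot h (dG w)) * H w
   + (G (w + h) - G w - dot h (dG w)) * dot h (dH w) + dot h (dG w) * dot h (dH w).
  by rewrite dotDr !dotZr; ring.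
have dg : cabs (dot h (dG w)) <= vn h * K.
  by apply: le_trans (dot_le _ _) _; apply: ler_wpM2l.
have dh : cabs (dot h (dH w)) <= vn h * L.
  by apply: le_trans (dot_le _ _) _; apply: ler_wpM2l.
apply: le_trans (cabsD4 _ _ _ _) _; rewrite !cabsM.
have a1 := ler_pM (cabs_ge0 _) (cabs_ge0 _) g1' h3.
have a2 := ler_pM (cabs_ge0 _) ch g3 h1.
have a3 := ler_pM (cabs_ge0 _) (cabs_ge0 _) g3 dh.
have a4 := ler_pM (cabs_ge0 _) (cabs_ge0 _) dg dh.
have a5 : K * vn h ^+ 2 * (vn h * L) <= K * L * (2 * B) * vn h ^+ 2.
  have -> : K * vn h ^+ 2 * (vn h * L) = K * L * vn h * vn h ^+ 2 by ring.
  apply: ler_wpM2r; first exact: sqr_ge0.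
  by apply: ler_wpM2l.
have a6 : vn h * K * (vn h * L) = K * L * vn h ^+ 2 by ring.
have a7 : 0 <= K * L * vn h ^+ 2 by rewrite mulr_ge0 // sqr_ge0.
rewrite a6 in a4.
apply: le_trans (lerD (lerD (lerD a1 a2) (le_trans a3 a5)) a4) _; rewrite -subr_ge0.
set X := _ - _; have -> : X = 2 * (K * L * vn h ^+ 2) by rewrite /X; ring.
by rewrite mulr_ge0.
Qed.

Lemma vn_mulmx (A : 'M[C]_n) : exists2 M : R, 0 <= M & forall w, vn (w *m A) <= M * vn w.
Proof.
exists (\sum_j \sum_i cabs (A i j)) => [|w].
  by apply: sumr_ge0 => i _; apply: sumr_ge0 => j _; exact: cabs_ge0.
rewrite {1}/vn mulr_suml; apply: ler_sum => j _; rewrite mxE mulr_suml.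
apply: le_trans (cabs_sum _ _ _) _; apply: ler_sum => i _; rewrite cabsM mulrC.
by apply: ler_wpM2l; [exact: cabs_ge0|exact: vn_coord].
Qed.

Lemma nice_lin G (A : 'M[C]_n) : nice G -> nice (fun w => G (w *m A)).
Proof.
move=> [dG nG]; have [M M0 hM] := vn_mulmx A; have [N N0 hN] := vn_mulmx A^T.
exists (fun w => dG (w *m A) *m A^T) => B B0.
have [|K K0 hK] := nG (M * B); first exact: mulr_ge0.
have le h : vn h <= B -> vn (h *m A) <= M * B.
  by move=> hB; apply: le_trans (hM _) _; exact: ler_wpM2l.
exists (K + N * K + K * M ^+ 2) => [|w h wB hB].
  by rewrite !addr_ge0 // mulr_ge0 // sqr_ge0.
have [g1 g2 g3] := hK _ _ (le _ wB) (le _ hB).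
have p1 : 0 <= N * K by rewrite mulr_ge0.
have p2 : 0 <= K * M ^+ 2 by rewrite mulr_ge0 // sqr_ge0.
split; first lra.
  by apply: le_trans (hN _) _; have := ler_wpM2l N0 g2; lra.
rewrite mulmxDl; have -> : dot h (dG (w *m A) *m A^T) = dot (h *m A) (dG (w *m A)).
  by rewrite /dot trmx_mul trmxK mulmxA.
apply: le_trans g3 _; apply: (@le_trans _ _ (K * (M * vn h) ^+ 2)).
  apply: ler_wpM2l => //; apply: lerXn2r; rewrite ?nnegrE ?vn_ge0 ?mulr_ge0 ?vn_ge0 //.
rewrite exprMn mulrA; apply: ler_wpM2r; first exact: sqr_ge0.
by lra.
Qed.

Lemma cabs_tpi : cabs tpi = 2 * pi.
Proof.
rewrite /tpi -lock cabsM cabs_i mulr1 cabsR ger0_norm // mulr_ge0 // ltW //; exact: pi_gt0.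
Qed.

Lemma quad_le (Q : 'M[C]_n) : exists2 M : R, 0 <= M & forall v w, cabs (quad Q v w) <= M * vn v * vn w.
Proof.
have [M M0 hM] := vn_mulmx Q; exists M => // v w.
apply: le_trans (dot_le (v *m Q) w) _.
by apply: ler_wpM2r; [exact: vn_ge0|exact: hM].
Qed.

Lemma nice_gauss (Q : 'M[C]_n) : Q^T = Q -> nice (fun w => expC (quad Q w w)).
Proof.
move=> QQ; have [M M0 hM] := quad_le Q; have [N N0 hN] := vn_mulmx Q.
have [k k0 hk] := expC_taylor2.
exists (fun w => (expC (quad Q w w) * tpi * 2) *: (w *m Q)) => B B0.
have pi0 : 0 < pi :> R := pi_gt0 R.
pose E := expR (2 * pi * (M * B * B)).
pose s := 3 * M * B.
have E1 w : vn w <= B -> cabs (expC (quad Q w w)) <= E.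
  move=> wB; rewrite cabs_expC ler_expR -mulrN; apply: ler_wpM2l; first lra.
  apply: le_trans (ler_norm _) _; rewrite normrN; apply: le_trans (cabs_Im _) _.
  apply: le_trans (hM _ _) _; apply: ler_pM => //; rewrite ?mulr_ge0 ?vn_ge0 //.
  exact: ler_wpM2l.
have E0 : 0 <= E by exact: expR_ge0.
have s0 : 0 <= s by rewrite !mulr_ge0.
pose K1 := E * (2 * pi) * 2 * (N * B).
pose K2 := E * (k * s ^+ 2 * expR (k * (s * B)) + 2 * pi * M).
have K10 : 0 <= K1 by rewrite !mulr_ge0 //; lra.
have K20 : 0 <= K2.
  apply: mulr_ge0 => //; apply: addr_ge0; rewrite ?mulr_ge0 ?sqr_ge0 ?expR_ge0 //; lra.
exists (E + K1 + K2) => [|w h wB hB]; first by rewrite !addr_ge0.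
have v0 := vn_ge0 h; have w0 := vn_ge0 w.
have eE := E1 w wB.
split; first lra.
  rewrite vnZ (cabsM _ 2) (cabsM _ tpi) cabs_tpi cabs_nat.
  have h1 : vn (w *m Q) <= N * B by apply: le_trans (hN _) _; exact: ler_wpM2l.
  suff : cabs (expC (quad Q w w)) * (2 * pi) * 2 * vn (w *m Q) <= K1 by lra.
  apply: ler_pM => //; rewrite ?mulr_ge0 ?cabs_ge0 ?vn_ge0 //; try lra.
  rewrite -!mulrA; apply: ler_wpM2r => //; lra.
set q := quad Q w w.
pose u := 2 * quad Q h w + quad Q h h.
have -> : quad Q (w + h) (w + h) = q + u.
  by rewrite !quadD !quadDr (quadC w h QQ) /u /q; ring.
rewrite expCD dotZr dot_mulr (quadC w h QQ).
have -> : expC q * expC u - expC q - expC q * tpi * 2 * quad Q h w =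
  expC q * ((expC u - 1 - tpi * u) + tpi * quad Q h h) by rewrite /u; ring.
rewrite cabsM.
have uB : cabs u <= s * vn h.
  apply: le_trans (cabsD _ _) _; rewrite cabsM cabs_nat.
  have h1 := hM h w; have h2 := hM h h.
  have h3 : M * vn h * vn w <= M * vn h * B by apply: ler_wpM2l => //; exact: mulr_ge0.
  have h4 : M * vn h * vn h <= M * vn h * B by apply: ler_wpM2l => //; exact: mulr_ge0.
  rewrite /s; lra.
have uB2 : cabs u <= s * B by apply: le_trans uB _; exact: ler_wpM2l.
have t1 : cabs (expC u - 1 - tpi * u) <= k * s ^+ 2 * expR (k * (s * B)) * vn h ^+ 2.
  apply: le_trans (hk u) _.
  have -> : k * s ^+ 2 * expR (k * (s * B)) * vn h ^+ 2 = k * (s * vn h) ^+ 2 * expR (k * (s * B)) by ring.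
  apply: ler_pM; rewrite ?expR_ge0 ?mulr_ge0 ?sqr_ge0 ?(ltW k0) ?cabs_ge0 //.
    apply: ler_wpM2l; first exact: ltW.
    by apply: lerXn2r; rewrite ?nnegrE ?cabs_ge0 ?mulr_ge0.
  by rewrite ler_expR; apply: ler_wpM2l => //; exact: ltW.
have t2 : cabs (tpi * quad Q h h) <= 2 * pi * M * vn h ^+ 2.
  rewrite cabsM cabs_tpi -(mulrA (2 * pi)); apply: ler_wpM2l; first lra.
  by apply: le_trans (hM _ _) _; rewrite -mulrA.
have t3 := cabsD (expC u - 1 - tpi * u) (tpi * quad Q h h).
apply: (@le_trans _ _ (K2 * vn h ^+ 2)); last first.
  by apply: ler_wpM2r; [exact: sqr_ge0|lra].
rewrite /K2 -mulrA; apply: ler_pM => //; rewrite ?cabs_ge0 //; lra.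
Qed.

(** The gradient is the series differentiated term by term, and the remainder is estimated term by
    term through [expC_taylor2]. *)
Lemma nice_th (z : 'M[C]_n) : (0 < n)%N -> Hn z -> nice (th z).
Proof.
move=> n0 hz; have [k k0 hk] := expC_taylor2.
have pi0 : 0 < pi :> R := pi_gt0 R.
have l1e (x : 'rV[int]_n) : l1 R x <= expR (l1 R x).
  by apply: le_trans (expR_ge1Dx _); have := l1_ge0 R x; lra.
have /choice[dG hdG] : forall w, exists d : V, forall i, hasS (fun x => tt z w x * (tpi * zC R x 0 i)) (d 0 i).
  move=> w; have /choice[d hd] : forall i, exists d, hasS (fun x => tt z w x * (tpi * zC R x 0 i)) d.
    move=> i; have B0 : 0 <= vn w + 1 by have := vn_ge0 w; lra.
    have [K hK] := tt_dom n0 hz B0.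
    apply: (@hasS_ex _ _ _ (2 * pi * K)) => D uD.
    apply: le_trans (_ : _ <= 2 * pi * \sum_(x <- D) cabs (tt z w x) * expR ((vn w + 1) * l1 R x)) _; last first.
      by apply: ler_wpM2l; [lra|apply: hK => //; lra].
    rewrite mulr_sumr; apply: ler_sum => x _; rewrite (cabsM (tt z w x)) (cabsM tpi) cabs_tpi mulrCA.
    apply: ler_wpM2l; first lra; apply: ler_wpM2l; first exact: cabs_ge0.
    apply: le_trans (vn_coord _ _) _; rewrite vn_zC; apply: le_trans (l1e x) _.
    by rewrite ler_expR ler_peMl ?l1_ge0 //; have := vn_ge0 w; lra.
  by exists (\row_i d i) => i; rewrite mxE.
(* The budget for the exponent: 2 for the factor |x|^2, [k * B] for the remainder of the
   exponential, and B + 1 left over. *)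
exists dG => B B0; pose B' := B + k * B + 3.
have kB : 0 <= k * B by rewrite mulr_ge0 // ltW.
have B'0 : 0 <= B' by rewrite /B'; lra.
have [K hK] := tt_dom n0 hz B'0.
have K0 : 0 <= K by have := hK [::] isT 0; rewrite big_nil vn0; apply; exact: B'0.
have le1 w x c e : e <= B' -> 0 <= c -> c <= expR (e * l1 R x) ->
    cabs (tt z w x) * c <= cabs (tt z w x) * expR (B' * l1 R x).
  move=> eB c0 ce; apply: ler_wpM2l; first exact: cabs_ge0.
  apply: le_trans ce _; rewrite ler_expR; apply: ler_wpM2r => //; exact: l1_ge0.
exists (K + n%:R * (2 * pi * K) + k * K) => [|w h wB hB].
  have : 0 <= n%:R * (2 * pi * K) by rewrite !mulr_ge0 //; lra.
  have : 0 <= k * K by rewrite mulr_ge0 // ltW.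
  lra.
have p1 : 0 <= n%:R * (2 * pi * K) by rewrite !mulr_ge0 //; lra.
have p2 : 0 <= k * K by rewrite mulr_ge0 // ltW.
have wB' : vn w <= B' by rewrite /B'; lra.
have v0 := vn_ge0 h.
split.
- suff : cabs (th z w) <= K by lra.
  apply: (hasS_bound (g := fun x => cabs (tt z w x) * 1)) (thP n0 w hz) => [x|D uD]; first by rewrite mulr1.
  apply: le_trans (hK D uD w wB'); apply: ler_sum => x _; apply: (@le1 _ _ _ 0) => //.
  by rewrite mul0r expR0.
- suff : vn (dG w) <= n%:R * (2 * pi * K) by lra.
  have -> : n%:R * (2 * pi * K) = \sum_(i < n) (2 * pi * K) by rewrite sumr_const card_ord mulr_natl.
  apply: ler_sum => i _.
  apply: (hasS_bound (g := fun x => 2 * pi * (cabs (tt z w x) * l1 R x))) (hdG w i) => [x|D uD].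
    rewrite (cabsM (tt z w x)) (cabsM tpi) cabs_tpi mulrCA; apply: ler_wpM2l; first lra; apply: ler_wpM2l; first exact: cabs_ge0.
    by apply: le_trans (vn_coord _ _) _; rewrite vn_zC.
  rewrite -mulr_sumr; apply: ler_wpM2l; first lra.
  apply: le_trans (hK D uD w wB'); apply: ler_sum => x _; apply: (@le1 _ _ _ 1) => //.
  - by rewrite /B'; lra.
  - exact: l1_ge0.
  - by rewrite mul1r.
suff H : cabs (th z (w + h) - th z w - dot h (dG w)) <= vn h ^+ 2 * (k * K).
  apply: le_trans H _; rewrite mulrC; apply: ler_wpM2r; first exact: sqr_ge0.
  by lra.
have S : hasS (fun x => tt z w x * (expC (dot (zC R x) h) - 1 - tpi * dot (zC R x) h))
    (th z (w + h) - th z w - dot h (dG w)).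
  have s1 := thP n0 (w + h) hz; have s2 := hasSZ (-1) (thP n0 w hz).
  have s3 := hasSZ (-1) (hasS_sum (fun i => hasSZ (h 0 i) (hdG w i))).
  have := hasSD (hasSD s1 s2) s3.
  rewrite !mulN1r -dotE; apply: eq_hasS => x.
  rewrite !mulN1r /tt dotDr addrA expCD -/(tt z w x) mulrBr mulrBr mulr1; congr (_ - _ - _).
  rewrite dotE !mulr_sumr; apply: eq_bigr => i _; ring.
apply: (hasS_bound (g := fun x => vn h ^+ 2 * (k * (cabs (tt z w x) * expR (B' * l1 R x))))) S => [x|D uD]; last first.
  rewrite -!mulr_sumr; apply: ler_wpM2l; first exact: sqr_ge0.
  by apply: ler_wpM2l; [exact: ltW|exact: hK].
rewrite cabsM.
set l := l1 R x; have l0 : 0 <= l by exact: l1_ge0.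
have dl : cabs (dot (zC R x) h) <= l * vn h by apply: le_trans (dot_le _ _) _; rewrite vn_zC.
have -> : vn h ^+ 2 * (k * (cabs (tt z w x) * expR (B' * l))) =
   cabs (tt z w x) * (k * vn h ^+ 2 * expR (B' * l)) by ring.
apply: ler_wpM2l; first exact: cabs_ge0.
apply: le_trans (hk _) _.
have -> : B' * l = 2 * l + (k * (B * l) + (B + 1) * l) by rewrite /B'; ring.
rewrite !expRD.
have e1 : l ^+ 2 <= expR (2 * l).
  rewrite -[2]/(2%:R) mulr_natl mulr2n expRD -expr2; apply: lerXn2r; rewrite ?nnegrE ?expR_ge0 //.
  exact: l1e.
have e2 : 1 <= expR ((B + 1) * l).
  by rewrite -[leLHS]expR0 ler_expR mulr_ge0 //; lra.
have e3 : expR (k * cabs (dot (zC R x) h)) <= expR (k * (B * l)).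
  rewrite ler_expR; apply: ler_wpM2l; first exact: ltW.
  by apply: le_trans dl _; rewrite mulrC; exact: ler_wpM2r.
have e4 : cabs (dot (zC R x) h) ^+ 2 <= l ^+ 2 * vn h ^+ 2.
  by rewrite -exprMn; apply: lerXn2r; rewrite ?nnegrE ?cabs_ge0 ?mulr_ge0.
apply: (@le_trans _ _ (k * (l ^+ 2 * vn h ^+ 2) * expR (k * (B * l)))).
  apply: ler_pM; rewrite ?expR_ge0 ?mulr_ge0 ?sqr_ge0 ?(ltW k0) ?cabs_ge0 //.
  by apply: ler_wpM2l => //; exact: ltW.
have -> : k * (l ^+ 2 * vn h ^+ 2) * expR (k * (B * l)) = k * vn h ^+ 2 * (l ^+ 2 * expR (k * (B * l))) by ring.
apply: ler_wpM2l; first by rewrite mulr_ge0 ?sqr_ge0 // ltW.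
apply: ler_pM; rewrite ?sqr_ge0 ?expR_ge0 //.
by rewrite -[leLHS]mulr1; apply: ler_wpM2l; rewrite ?expR_ge0.
Qed.

End Nice.

(** * The Fejer kernel, on the circle and on the points j / N *)

Section FejerKernel.
Variable R : realType.
Local Notation C := R[i].

Lemma expC_real (t : R) : expC (t%:C : C) = cos (2 * pi * t) +i* sin (2 * pi * t).
Proof. by rewrite /expC /= mulr0 oppr0 expR0 mul1r. Qed.

Lemma conj_expC (t : R) : (expC (t%:C : C))^* = expC ((- t)%:C : C).
Proof. by rewrite !expC_real mulrN cosN sinN. Qed.

Lemma cabs_sqr (s : C) : ((cabs s) ^+ 2)%:C = s * s^*.
Proof. by rewrite -sqr_normc cabsE rmorphXn. Qed.

Lemma cos_lt1 (d t : R) : 0 < d -> d <= `|t| -> `|t| <= 2^-1 -> cos (2 * pi * t) <= cos (2 * pi * d) /\ cos (2 * pi * d) < 1.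
Proof.
move=> d0 dt t2; have pi0 : 0 < pi :> R := pi_gt0 R.
have e : cos (2 * pi * t) = cos (2 * pi * `|t|).
  by case: (lerP 0 t) => h; rewrite ?(ger0_norm h) // (ltr0_norm h) mulrN cosN.
have p (x : R) : 0 <= x -> x <= 2^-1 -> 2 * pi * x \in `[0, pi].
  move=> x0 x2; rewrite in_itv /=; apply/andP; split; first by rewrite !mulr_ge0 // ltW.
  by have := ler_wpM2l (ltW pi0) x2; lra.
split.
  rewrite e le_eqVlt; have [->|ne] := eqVneq d `|t|; first by rewrite eqxx.
  apply/orP; right; rewrite ltr_cos; [|by apply: p; lra|by apply: p; lra].
  by rewrite ltr_pM2l ?mulr_gt0 // lt_neqAle ne.
rewrite -[ltRHS]cos0 ltr_cos; first by rewrite !mulr_gt0.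
- by rewrite in_itv /= lexx ltW.
- by apply: p; lra.
Qed.

Lemma cabs_1expC (t : R) : cabs (1 - expC (t%:C : C)) ^+ 2 = 2 - 2 * cos (2 * pi * t).
Proof.
apply: (@complexI R); rewrite cabs_sqr expC_real; set c := cos _; set s := sin _.
have h : c ^+ 2 + s ^+ 2 = 1 by exact: cos2Dsin2.
apply/eqP; rewrite eq_complex /=; apply/andP; split; apply/eqP; last by ring.
have -> : 2 - 2 * c = 1 + (c ^+ 2 + s ^+ 2) - 2 * c by rewrite h; ring.
by ring.
Qed.

Lemma expC_ne1 (t : R) : 0 < `|t| -> `|t| < 1 -> expC (t%:C : C) != 1.
Proof.
have H (u : R) : 0 < `|u| -> `|u| <= 2^-1 -> expC (u%:C : C) != 1.
  move=> u0 u2; have [h1 h2] := cos_lt1 u0 (lexx _) u2.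
  apply/eqP => e; have := cabs_1expC u; rewrite e subrr cabs0 expr0n /=; lra.
move=> t0 t1; have [h|h] := lerP `|t| 2^-1; first exact: H.
have E : expC (((t - Num.sg t) : R)%:C : C) = expC (t%:C : C).
  rewrite rmorphB -[RHS]mulr1 expCD; congr (_ * _).
  by case: sgrP => _; rewrite ?rmorphN ?rmorph1 ?rmorph0 ?opprK ?oppr0 ?expC0 ?expCN ?expC1 ?invr1.
have T0 : t != 0 by rewrite -normr_gt0.
have [t1' t1''] : - 1 < t /\ t < 1 by move: t1; rewrite ltr_norml => /andP[].
rewrite -E; apply: H; case: (ltgtP t 0) T0 => // t' _; rewrite ?(ltr0_sg t') ?(gtr0_sg t').
- by rewrite gtr0_norm; lra.
- by rewrite ltr0_norm; lra.
- by rewrite (ltr0_norm t') in h; rewrite gtr0_norm; lra.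
- by rewrite (gtr0_norm t') in h; rewrite ltr0_norm; lra.
Qed.

(** For |t| below d the first summand suffices; otherwise |1 - e(t)| is at least its value at d, so
    the second exceeds |t|. This avoids cutting sums into a near and a far part. *)
Lemma small_or_far (d : R) : 0 < d -> exists2 L : R, 0 <= L & forall t : R, `|t| <= 2^-1 ->
  `|t| <= d + L * cabs (1 - expC (t%:C : C)) ^+ 2.
Proof.
move=> d0; have [d2|d2] := lerP d 2^-1; last first.
  by exists 0 => // t t2; rewrite mul0r; lra.
have [_ c1] := @cos_lt1 d d d0 (ler_norm _) ltac:(by rewrite ger0_norm // ltW).
set c := cos _ in c1; exists ((2 - 2 * c)^-1) => [|t t2].
  by rewrite invr_ge0; lra.
have [h|h] := lerP d `|t|; last first.
  have : 0 <= (2 - 2 * c)^-1 * cabs (1 - expC t%:C) ^+ 2.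
    by apply: mulr_ge0; [rewrite invr_ge0; lra|exact: sqr_ge0].
  lra.
have [h1 _] := cos_lt1 d0 h t2; rewrite cabs_1expC.
have : 1 <= (2 - 2 * c)^-1 * (2 - 2 * cos (2 * pi * t)).
  by rewrite mulrC ler_pdivlMr ?mul1r; rewrite -/c in h1; lra.
lra.
Qed.

Definition fejer M (t : R) : R := cabs (\sum_(a < M) expC ((a%:R * t)%:C : C)) ^+ 2 / M%:R.

Lemma fejer_ge0 M t : 0 <= fejer M t.
Proof. by rewrite /fejer divr_ge0 // sqr_ge0. Qed.

Lemma fejerE M t : (fejer M t)%:C =
  M%:R^-1 * \sum_(a < M) \sum_(b < M) expC (((a%:R - b%:R) * t)%:C : C).
Proof.
rewrite /fejer rmorphM /= fmorphV rmorph_nat mulrC; congr (_ * _).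
rewrite cabs_sqr (rmorph_sum (@conjc R)) mulr_suml; apply: eq_bigr => a _.
rewrite mulr_sumr; apply: eq_bigr => b _; rewrite [X in _ * X]conj_expC -expCD; congr expC.
by rewrite -rmorphD -mulrBl.
Qed.

Lemma sum_expC M (t : R) : (1 - expC (t%:C : C)) * \sum_(a < M) expC ((a%:R * t)%:C : C) =
  1 - expC ((M%:R * t)%:C : C).
Proof.
have E a : expC ((a%:R * t)%:C : C) = expC (t%:C : C) ^+ a.
  elim: a => [|a IH]; first by rewrite mul0r rmorph0 expC0 expr0.
  by rewrite exprS -IH -expCD -rmorphD -natr1 mulrDl mul1r addrC.
rewrite E (eq_bigr (fun a : 'I_M => expC (t%:C : C) ^+ a)) => [|a _]; last exact: E.
by rewrite -opprB mulNr -subrX1 opprB.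
Qed.

(** By the geometric sum, 1 - e(t) times the sum of the e(a t) is 1 - e(M t), of modulus at most
    2. *)
Lemma fejer_far M t : fejer M t * cabs (1 - expC (t%:C : C)) ^+ 2 <= 4 / M%:R.
Proof.
rewrite /fejer mulrAC -exprMn -cabsM mulrC [X in cabs X]mulrC sum_expC cabs_1expC mulrC.
apply: ler_wpM2r; first by rewrite invr_ge0.
by have := cos_geN1 (2 * pi * (M%:R * t)); lra.
Qed.

(** Discrete orthogonality. Since M <= N, a nonzero difference a - b is not divisible by N, and only
    the M diagonal terms survive. *)
Lemma fejer_avg M N : (0 < M)%N -> (M <= N)%N -> \sum_(j < N) fejer M (j%:R / N%:R) = N%:R.
Proof.
move=> M0 MN; have N0 : (0 < N)%N by exact: leq_trans MN.
have Nr : N%:R != 0 :> R by rewrite pnatr_eq0 -lt0n.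
apply: (@complexI R); rewrite rmorph_sum rmorph_nat /=.
under eq_bigr do rewrite fejerE.
rewrite -mulr_sumr exchange_big /=.
under eq_bigr do rewrite exchange_big /=.
have orth (a b : 'I_M) : \sum_(j < N) expC (((a%:R - b%:R) * (j%:R / N%:R))%:C : C) = N%:R *+ (a == b).
  have [->|ab] := eqVneq a b.
    under eq_bigr do rewrite subrr mul0r rmorph0 expC0.
    by rewrite sumr_const card_ord.
  pose t : R := (a%:R - b%:R) / N%:R.
  have aN : (a < N)%N by exact: leq_trans (ltn_ord a) MN.
  have bN : (b < N)%N by exact: leq_trans (ltn_ord b) MN.
  have NR : 0 < N%:R :> R by rewrite ltr0n.
  have ne : expC (t%:C : C) != 1.
    apply: expC_ne1; rewrite /t normrM normfV normr_nat.
      rewrite divr_gt0 // normr_gt0 subr_eq0 eqr_nat; exact: ab.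
    rewrite ltr_pdivrMr // mul1r ltr_norml.
    have : (a%:R : R) < N%:R by rewrite ltr_nat.
    have : (b%:R : R) < N%:R by rewrite ltr_nat.
    have : 0 <= (a%:R : R) by []. have : 0 <= (b%:R : R) by [].
    lra.
  have := sum_expC N t; have -> : N%:R * t = ((a%:Z - b%:Z)%:~R : R).
    by rewrite /t mulrC divfK // rmorphB.
  rewrite (rmorph_int (real_complex R)) expC_int subrr => /eqP.
  rewrite mulf_eq0 subr_eq0 eq_sym (negbTE ne) /= => /eqP e; rewrite mulr0n -[RHS]e.
  by apply: eq_bigr => j _; congr (expC _%:C); rewrite /t mulrCA mulrA.
under eq_bigr do under eq_bigr do rewrite orth.
rewrite (eq_bigr (fun=> N%:R : C)) => [|a _]; last first.
  rewrite (bigD1 a) //= eqxx big1 ?addr0 // => b ba; by rewrite eq_sym (negbTE ba).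
by rewrite sumr_const card_ord -[X in _ * X]mulr_natl mulKf // pnatr_eq0 -lt0n.
Qed.

End FejerKernel.

(** * Averages of a periodic function over a grid *)

Section Averages.
Variables (R : realType) (n N : nat).
Hypothesis N_gt0 : (0 < N)%N.
Local Notation C := R[i].
Local Notation V := 'rV[C]_n.
Local Notation J := {ffun 'I_n -> 'I_N}.
Implicit Types (v w h : V) (G : V -> C).
Local Notation vn := (@vn R n).

Let Nn0 : N%:R != 0 :> R. Proof. by rewrite pnatr_eq0 -lt0n. Qed.
Let NC0 : N%:R != 0 :> C. Proof. by rewrite pnatr_eq0 -lt0n. Qed.
Let NR : 0 < N%:R :> R. Proof. by rewrite ltr0n. Qed.

Definition gridv (j : J) : V := \row_i ((j i)%:R / N%:R).
Definition avg (F : J -> C) : C := (N%:R ^+ n)^-1 * \sum_j F j.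
Definition avgv G w : C := avg (fun j => G (w + gridv j)).

Lemma avgD F1 F2 : avg (fun j => F1 j + F2 j) = avg F1 + avg F2.
Proof. by rewrite /avg big_split mulrDr. Qed.
Lemma avgZ a F : avg (fun j => a * F j) = a * avg F.
Proof. by rewrite /avg -mulr_sumr mulrCA. Qed.
Lemma avgB F1 F2 : avg (fun j => F1 j - F2 j) = avg F1 - avg F2.
Proof. by rewrite /avg sumrB mulrBr. Qed.

Lemma cabs_avg F : cabs (avg F) <= (N%:R ^+ n)^-1 * \sum_j cabs (F j).
Proof.
rewrite /avg cabsM cabsV cabsX cabs_nat; apply: ler_wpM2l; last exact: cabs_sum.
by rewrite invr_ge0 exprn_ge0.
Qed.

Lemma cabs_avg_le F K : (forall j, cabs (F j) <= K) -> cabs (avg F) <= K.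
Proof.
move=> FK; apply: le_trans (cabs_avg F) _.
rewrite mulrC ler_pdivrMr ?exprn_gt0 //.
have -> : K * N%:R ^+ n = \sum_(j : J) K by rewrite sumr_const card_ffun !card_ord -[RHS]mulr_natr natrX.
exact: ler_sum.
Qed.

Lemma vn_gridv (j : J) : vn (gridv j) <= n%:R.
Proof.
have -> : n%:R = \sum_(i < n) (1 : R) by rewrite sumr_const card_ord.
apply: ler_sum => i _; rewrite mxE cabsM cabsV !cabs_nat ler_pdivrMr // mul1r ler_nat.
exact: ltnW.
Qed.

Definition estep (i : 'I_n) : V := N%:R^-1 *: delta_mx 0 i.

(** A shift by 1 / N permutes the grid cyclically; the point that leaves the unit cube is brought
    back by a period, the integral vector [m] below. *)
Lemma avg_shift G w i : (forall v m, G (v + zC R m) = G v) ->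
  avgv G (w + estep i) = avgv G w.
Proof.
move=> per; rewrite /avgv /avg; congr (_ * _).
pose s (j : J) : J := [ffun l => if l == i then ordS (j l) else j l].
have bs : bijective s.
  exists (fun j : J => [ffun l => if l == i then ord_pred (j l) else j l] : J) => j; apply/ffunP => l; rewrite !ffunE;
    by case: eqP => // _; rewrite ?ordSK ?ord_predK.
rewrite [RHS](reindex s) /=; last exact: onW_bij.
apply: eq_bigr => j _; pose m : 'rV[int]_n := if ((j i).+1 < N)%N then 0 else - delta_mx 0 i.
rewrite -[LHS](per _ m); congr G; rewrite -!addrA; congr (_ + _); apply/rowP => l.
rewrite !mxE ffunE eqxx /=; have [->|li] := eqVneq l i; last first.
  rewrite /m; case: ifP => _; rewrite !mxE ?(negbTE li) ?andbF ?mulr0 ?oppr0 ?rmorph0 ?add0r ?addr0 //.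
rewrite /= /m; case: ltnP => jN; rewrite !mxE ?eqxx /=.
  by rewrite modn_small // rmorph0 addr0 mulr1 -natr1 mulrDl mul1r addrC.
have -> : (j i).+1 = N by apply/eqP; rewrite eqn_leq ltn_ord.
rewrite modnn mul0r mulr1 rmorphN rmorph1.
have -> : (j i)%:R = N%:R - 1 :> C.
  by rewrite -[in RHS](_ : (j i).+1 = N) -?natr1 ?addrK //; apply/eqP; rewrite eqn_leq ltn_ord.
by field.
Qed.

Section NiceAvg.
Variables (G : V -> C) (dG : V -> V) (B K : R).
Hypotheses (per : forall v m, G (v + zC R m) = G v) (K0 : 0 <= K) (Bn : n%:R + 1 <= B)
  (hK : forall w h, vn w <= B -> vn h <= B -> [/\ cabs (G w) <= K, vn (dG w) <= K &
    cabs (G (w + h) - G w - dot h (dG w)) <= K * vn h ^+ 2]).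

(** A discrete form of the vanishing of the integral of a derivative over a period: a step of length
    1 / N leaves the average unchanged, while to first order it changes it by the average gradient
    over N. *)
Lemma avg_grad w i : vn w <= B - n%:R -> cabs (avg (fun j => dG (w + gridv j) 0 i)) <= K / N%:R.
Proof.
move=> wB.
have ve : vn (estep i) = N%:R^-1.
  rewrite /estep vnZ cabsV cabs_nat /vn (bigD1 i) //= big1 => [|l li].
    by rewrite mxE !eqxx cabs1 addr0 mulr1.
  by rewrite mxE (negbTE li) andbF cabs0.
have N1 : N%:R^-1 <= 1 :> R by rewrite invf_le1 // ler1n.
have n0 : 0 <= n%:R :> R by [].
have B1 : 1 <= B by apply: le_trans Bn; rewrite lerDr.
have E : N%:R^-1 * avg (fun j => dG (w + gridv j) 0 i) =
   - avg (fun j => G (w + gridv j + estep i) - G (w + gridv j) - dot (estep i) (dG (w + gridv j))).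
  rewrite !avgB.
  have -> : avg (fun j => G (w + gridv j + estep i)) = avg (fun j => G (w + gridv j)).
    rewrite -[RHS](avg_shift w i per); congr avg; apply/funext => j; congr G.
    by rewrite addrAC.
  rewrite subrr sub0r opprK -avgZ; congr avg; apply/funext => j.
  rewrite /estep dotZ dotE (bigD1 i) //= big1 => [|l li]; first by rewrite mxE !eqxx mul1r addr0.
  by rewrite mxE (negbTE li) andbF mul0r.
have : cabs (N%:R^-1 * avg (fun j => dG (w + gridv j) 0 i)) <= K * N%:R^-1 ^+ 2.
  rewrite E cabsN; apply: cabs_avg_le => j; rewrite -ve.
  have [||_ _] // := hK (w := w + gridv j) (h := estep i).
  - by apply: le_trans (vnD _ _) _; have := vn_gridv j; lra.
  - by rewrite ve; apply: le_trans N1 B1.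
rewrite cabsM cabsV cabs_nat expr2 mulrA mulrC ler_pM2r //.
by rewrite invr_gt0.
Qed.

Lemma avgv_diff w h : vn w <= B - n%:R -> vn h <= B ->
  cabs (avgv G (w + h) - avgv G w) <= vn h * (K / N%:R) + K * vn h ^+ 2.
Proof.
move=> wB hB.
have -> : avgv G (w + h) - avgv G w =
   avg (fun j => G (w + gridv j + h) - G (w + gridv j) - dot h (dG (w + gridv j))) +
   avg (fun j => dot h (dG (w + gridv j))).
  rewrite -avgD /avgv -avgB; congr avg; apply/funext => j.
  by rewrite subrK addrAC.
rewrite [leRHS]addrC; apply: le_trans (cabsD _ _) _; apply: lerD.
  apply: cabs_avg_le => j; have [||_ _] // := hK (w := w + gridv j) (h := h).
  by apply: le_trans (vnD _ _) _; have := vn_gridv j; lra.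
have -> : avg (fun j => dot h (dG (w + gridv j))) =
   \sum_i h 0 i * avg (fun j => dG (w + gridv j) 0 i).
  rewrite /avg mulr_sumr (eq_bigr (fun j => \sum_i h 0 i * ((N%:R ^+ n)^-1 * dG (w + gridv j) 0 i))).
    rewrite exchange_big /=; apply: eq_bigr => i _; by rewrite -!mulr_sumr.
  by move=> j _; rewrite dotE mulr_sumr; apply: eq_bigr => i _; rewrite mulrCA.
apply: le_trans (cabs_sum _ _ _) _; rewrite /vn mulr_suml; apply: ler_sum => i _.
by rewrite cabsM; apply: ler_wpM2l; [exact: cabs_ge0|exact: avg_grad].
Qed.

(** Stands for the fact that the constant Fourier coefficient of a holomorphic periodic function
    does not depend on the imaginary part of the base point. The way from w to w + h is covered in N
    steps, each with an error of order 1 / N^2. *)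
Lemma avgv_const w h : vn w + vn h <= B - n%:R ->
  cabs (avgv G (w + h) - avgv G w) <= (vn h * K + K * vn h ^+ 2) / N%:R.
Proof.
move=> wh; have v0 := vn_ge0 h; have w0 := vn_ge0 w; have n0 : 0 <= n%:R :> R by [].
have step (k : nat) : (k <= N)%N ->
  cabs (avgv G (w + (k%:R / N%:R) *: h) - avgv G w) <=
  k%:R * ((vn h * K + K * vn h ^+ 2) / N%:R / N%:R).
  elim: k => [_|k IH kN]; first by rewrite mul0r scale0r addr0 subrr cabs0 mul0r.
  have {}IH := IH (ltnW kN).
  have -> : w + (k.+1%:R / N%:R) *: h = (w + (k%:R / N%:R) *: h) + N%:R^-1 *: h.
    by rewrite -addrA -scalerDl -natr1 mulrDl mul1r.
  have vs : vn (N%:R^-1 *: h) = vn h / N%:R by rewrite vnZ cabsV cabs_nat mulrC.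
  have N1 : N%:R^-1 <= 1 :> R by rewrite invf_le1 // ler1n.
  have h1 : vn (w + (k%:R / N%:R) *: h) <= B - n%:R.
    apply: le_trans (vnD _ _) _; rewrite vnZ cabsM cabsV !cabs_nat.
    suff : k%:R / N%:R * vn h <= vn h by lra.
    by rewrite ler_piMl // ler_pdivrMr // mul1r ler_nat ltnW.
  have h2 : vn (N%:R^-1 *: h) <= B.
    rewrite vs; apply: (@le_trans _ _ (vn h)); last lra.
    by rewrite ler_piMr.
  have := avgv_diff h1 h2; rewrite vs => h3.
  set X := avgv G (_ + N%:R^-1 *: h) in h3 *; set Y := avgv G (w + (k%:R / N%:R) *: h) in h3 IH *.
  have -> : X - avgv G w = (X - Y) + (Y - avgv G w) by ring.
  apply: le_trans (cabsD _ _) _; apply: le_trans (lerD h3 IH) _.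
  rewrite -[k.+1%:R]natr1 le_eqVlt; apply/orP; left; apply/eqP.
  by field.
have := step N (leqnn N); rewrite divff // scale1r => le.
by apply: le_trans le _; rewrite mulrC divfK.
Qed.
End NiceAvg.
End Averages.

(** * Uniqueness of quasi-periodic functions through Fejer means *)

Section OneDimensional.
Variables (R : realType) (n : nat) (z : 'M[R[i]]_n).
Local Notation C := R[i].
Local Notation V := 'rV[C]_n.
Implicit Types (v w h : V) (G : V -> C).
Local Notation vn := (@vn R n).

Definition quasi_periodic G := (forall v m, G (v + zC R m) = G v) /\
  forall v m, G (v + zC R m *m z) =
    expC (- (2^-1 * quad z (zC R m) (zC R m) + dot (zC R m) v)) * G v.

Definition fweight M N (j : {ffun 'I_n -> 'I_N}) : R := \prod_i fejer M ((j i)%:R / N%:R).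
Definition fdiff M (c : {ffun 'I_n -> 'I_M * 'I_M}) : 'rV[int]_n :=
  \row_i ((c i).1%:Z - (c i).2%:Z).
(** A Cesaro mean of the theta series itself: the frequency k occurs with weight prod_i (1 - |k_i| /
    M), up to the sign of k. It does not depend on the function being expanded. *)
Definition fsum M w : C := (M%:R ^+ n)^-1 * \sum_(c : {ffun 'I_n -> 'I_M * 'I_M})
  expC (2^-1 * quad z (zC R (fdiff c)) (zC R (fdiff c)) - dot (zC R (fdiff c)) w).

Lemma fweight_ge0 M N (j : {ffun 'I_n -> 'I_N}) : 0 <= fweight M j.
Proof. by apply: prodr_ge0 => i _; exact: fejer_ge0. Qed.

Lemma fweightE M N (j : {ffun 'I_n -> 'I_N}) : (fweight M j)%:C =
  (M%:R ^+ n)^-1 * \sum_(c : {ffun 'I_n -> 'I_M * 'I_M}) expC (dot (zC R (fdiff c)) (gridv R j)).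
Proof.
rewrite /fweight rmorph_prod /=.
rewrite (eq_bigr (fun i => (M%:R^-1 : C) * \sum_(c : 'I_M * 'I_M)
  expC (((c.1%:R - c.2%:R) * ((j i)%:R / N%:R))%:C : C))); last first.
  by move=> i _; rewrite fejerE pair_bigA.
rewrite big_split /= prodr_const card_ord exprVn; congr (_ * _).
rewrite bigA_distr_bigA; apply: eq_bigr => c _; rewrite -expC_sum dotE; congr expC.
apply: eq_bigr => i _; rewrite !mxE rmorphM /= rmorphB /= !rmorph_nat rmorphB /=.
by rewrite rmorphM /= fmorphV !rmorph_nat.
Qed.

Lemma fweight_sum M N : (0 < M)%N -> (M <= N)%N ->
  \sum_(j : {ffun 'I_n -> 'I_N}) fweight M j = N%:R ^+ n.
Proof.
move=> M0 MN; rewrite -(bigA_distr_bigA (fun i (a : 'I_N) => fejer M (a%:R / N%:R))).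
by under eq_bigr do rewrite fejer_avg //; rewrite prodr_const card_ord.
Qed.

Lemma fweight_far M N i : (0 < M)%N -> (M <= N)%N ->
  \sum_(j : {ffun 'I_n -> 'I_N}) fweight M j * cabs (1 - expC (((j i)%:R / N%:R : R)%:C : C)) ^+ 2
  <= N%:R ^+ n * (4 / M%:R).
Proof.
move=> M0 MN.
pose g l (a : 'I_N) := fejer M (a%:R / N%:R) *
  (if l == i then cabs (1 - expC ((a%:R / N%:R : R)%:C : C)) ^+ 2 else 1).
have -> : \sum_(j : {ffun 'I_n -> 'I_N}) fweight M j * cabs (1 - expC (((j i)%:R / N%:R : R)%:C : C)) ^+ 2
    = \sum_(j : {ffun 'I_n -> 'I_N}) \prod_l g l (j l).
  apply: eq_bigr => j _; rewrite big_split /= -/(fweight M j); congr (_ * _).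
  by rewrite -big_mkcond big_pred1_eq.
rewrite -(bigA_distr_bigA g) (bigD1 i) //=.
rewrite [X in _ * X](eq_bigr (fun=> N%:R)) => [|l li]; last first.
  by rewrite -(fejer_avg R M0 MN); apply: eq_bigr => a _; rewrite /g (negbTE li) mulr1.
rewrite prodr_const; have -> : #|[pred l | l != i]| = n.-1.
  by rewrite -[in RHS](card_ord n) -(cardC1 i).
have n0 : (0 < n)%N := leq_ltn_trans (leq0n i) (ltn_ord i).
rewrite -[in leRHS](prednK n0) exprS [X in _ <= X]mulrAC; apply: ler_wpM2r; first exact: exprn_ge0.
have -> : N%:R * (4 / M%:R) = \sum_(a < N) (4 / M%:R) :> R by rewrite sumr_const card_ord mulr_natl.
by apply: ler_sum => a _; rewrite /g eqxx fejer_far.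
Qed.

Section Approx.
Variable G : V -> C.
Hypotheses (nG : nice G) (qG : quasi_periodic G).
Let per := qG.1.

(** Multiplying G by the real character e(k .) amounts, by quasi-periodicity, to translating it by -
    k z. The Fejer mean thus becomes a combination of grid averages of G at translated points, which
    are all nearly the same number. *)
Lemma fejer_main M N w : 
  avg (fun j : {ffun 'I_n -> 'I_N} => (fweight M j)%:C * G (w + gridv R j)) =
  (M%:R ^+ n)^-1 * \sum_(c : {ffun 'I_n -> 'I_M * 'I_M})
    expC (2^-1 * quad z (zC R (fdiff c)) (zC R (fdiff c)) - dot (zC R (fdiff c)) w) *
    avgv N G (w - zC R (fdiff c) *m z).
Proof.
rewrite /avg (eq_bigr (fun j => (M%:R ^+ n)^-1 * \sum_(c : {ffun 'I_n -> 'I_M * 'I_M})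
   expC (2^-1 * quad z (zC R (fdiff c)) (zC R (fdiff c)) - dot (zC R (fdiff c)) w) *
   G (w - zC R (fdiff c) *m z + gridv R j))).
  rewrite -mulr_sumr mulrCA; congr (_ * _); rewrite exchange_big mulr_sumr; apply: eq_bigr => c _.
  by rewrite -mulr_sumr mulrCA.
move=> j _; rewrite fweightE -mulrA; congr (_ * _); rewrite mulr_suml; apply: eq_bigr => c _.
set k := fdiff c; set v := w + gridv R j.
have -> : w - zC R k *m z + gridv R j = v + zC R (- k) *m z.
  by rewrite /v zCN mulNmx addrAC.
rewrite (qG.2) mulrA -expCD; congr (expC _ * _).
have eN : - zC R k = (-1) *: zC R k by rewrite scaleN1r.
rewrite zCN eN /v quadZ quadZr !dotZ dotDr.
move: (dot _ _) (dot _ _) (quad _ _ _) => a b e; ring.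
Qed.

Lemma fejer_close w e : 0 < e -> exists M0, forall M N, (M0 <= M)%N -> (0 < M)%N -> (M <= N)%N ->
  cabs (avg (fun j : {ffun 'I_n -> 'I_N} => (fweight M j)%:C * G (w + gridv R j)) - G w) <= e.
Proof.
move=> e0; have [dG hG] := nG.
have [|K K0 hK] := hG (vn w + n%:R); first by rewrite addr_ge0 // vn_ge0.
pose A := K + K * n%:R; have A0 : 0 <= A by rewrite /A addr_ge0 // mulr_ge0.
pose An := A * n%:R; have An0 : 0 <= An by rewrite mulr_ge0.
(* Half of the tolerance e goes to the grid points near 0, through d; the other half to the far
   ones, through the choice of [M0]. *)
pose d := e / (2 * (An + 1)); have d0 : 0 < d by rewrite divr_gt0 // mulr_gt0 //; lra.
have [L L0 hL] := small_or_far d0.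
have [M0 hM0] : exists M0 : nat, 8 * An * L / e < M0%:R.
  by exists (Num.Def.truncn (8 * An * L / e)).+1; exact: truncnS_gt.
exists M0 => M N MM M1 MN; have N0 : (0 < N)%N by exact: leq_trans MN.
have NR : 0 < N%:R :> R by rewrite ltr0n.
have near (j : {ffun 'I_n -> 'I_N}) : cabs (G (w + gridv R j) - G w) <=
    A * \sum_i (d + L * cabs (1 - expC (((j i)%:R / N%:R : R)%:C : C)) ^+ 2).
  pose t i : R := (j i)%:R / N%:R.
  (* Coordinates above 1/2 are moved down by a period; all are then at most 1/2 in absolute value,
     the range of [small_or_far]. *)
  pose m : 'rV[int]_n := \row_i (if t i <= 2^-1 then 0 else -1).
  rewrite -(per _ m) -addrA; set h := gridv R j + zC R m.
  have hE i : h 0 i = ((t i + (m 0 i)%:~R : R)%:C : C).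
    by rewrite !mxE rmorphD /= rmorph_int rmorphM /= fmorphV !rmorph_nat.
  have t01 i : 0 <= t i < 1.
    by rewrite /t divr_ge0 //= ltr_pdivrMr // mul1r ltr_nat.
  have tm i : `|t i + (m 0 i)%:~R| <= 2^-1.
    have /andP[] := t01 i; rewrite mxE; case: (lerP (t i) 2^-1) => h1 h2 h3.
      by rewrite addr0 ger0_norm.
    rewrite ler_norml rmorphN; lra.
  have vh : vn h <= \sum_i (d + L * cabs (1 - expC ((t i)%:C : C)) ^+ 2).
    apply: ler_sum => i _; rewrite hE cabsR; apply: le_trans (hL _ (tm i)) _.
    rewrite rmorphD /= expCD rmorph_int expC_int mulr1 //.
  have vn1 : vn h <= n%:R.
    have -> : n%:R = \sum_(i < n) (1 : R) by rewrite sumr_const card_ord.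
    by apply: ler_sum => i _; rewrite hE cabsR; apply: le_trans (tm i) _; lra.
  have vw := vn_ge0 w; have vh0 := vn_ge0 h.
  have [||_ g2 g3] := hK w h; [by rewrite lerDl|lra|].
  have g4 : cabs (dot h (dG w)) <= vn h * K.
    by apply: le_trans (dot_le _ _) _; exact: ler_wpM2l.
  have -> : G (w + h) - G w = (G (w + h) - G w - dot h (dG w)) + dot h (dG w) by ring.
  apply: le_trans (cabsD _ _) _; apply: (@le_trans _ _ (A * vn h)); last exact: ler_wpM2l.
  have : K * vn h * vn h <= K * vn h * n%:R by apply: ler_wpM2l => //; exact: mulr_ge0.
  rewrite /A; lra.
have -> : avg (fun j : {ffun 'I_n -> 'I_N} => (fweight M j)%:C * G (w + gridv R j)) - G w =
   avg (fun j : {ffun 'I_n -> 'I_N} => (fweight M j)%:C * (G (w + gridv R j) - G w)).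
  rewrite -[RHS]/(avg _) /avg; under [in RHS]eq_bigr do rewrite mulrBr.
  rewrite sumrB mulrBr -mulr_suml -rmorph_sum /= fweight_sum // rmorphXn rmorph_nat mulrA mulVf ?mul1r //.
  by rewrite expf_neq0 // pnatr_eq0 -lt0n.
apply: le_trans (cabs_avg _) _.
rewrite mulrC ler_pdivrMr ?exprn_gt0 //.
apply: (@le_trans _ _ (\sum_(j : {ffun 'I_n -> 'I_N}) \sum_(i < n) (A * d * fweight M j +
    A * L * (fweight M j * cabs (1 - expC (((j i)%:R / N%:R : R)%:C : C)) ^+ 2)))).
  apply: ler_sum => j _; rewrite cabsM cabsR ger0_norm ?fweight_ge0 //.
  apply: le_trans (ler_wpM2l (fweight_ge0 _ _) (near j)) _.
  rewrite mulrCA !mulr_sumr; apply: ler_sum => i _.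
  by rewrite le_eqVlt; apply/orP; left; apply/eqP; ring.
rewrite exchange_big /=.
apply: (@le_trans _ _ (\sum_(i < n) (A * d * N%:R ^+ n + A * L * (N%:R ^+ n * (4 / M%:R))))).
  apply: ler_sum => i _; rewrite big_split /= -!mulr_sumr fweight_sum // lerD2l.
  by apply: ler_wpM2l; [exact: mulr_ge0|exact: fweight_far].
rewrite sumr_const card_ord -[leLHS]mulr_natl.
have -> : n%:R * (A * d * N%:R ^+ n + A * L * (N%:R ^+ n * (4 / M%:R))) =
   (An * d + An * L * 4 / M%:R) * N%:R ^+ n by rewrite /An; ring.
apply: ler_wpM2r; first exact: exprn_ge0.
have h1 : An * d <= e / 2.
  have -> : e / 2 = (An + 1) * d by rewrite /d; field; lra.
  by apply: ler_wpM2r; [exact: ltW|lra].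
have MR : 0 < M%:R :> R by rewrite ltr0n.
have h2 : An * L * 4 / M%:R <= e / 2.
  rewrite ler_pdivrMr //.
  have : 8 * An * L <= M%:R * e.
    rewrite -ler_pdivrMr //; apply: le_trans (ltW hM0) _; by rewrite ler_nat.
  lra.
lra.
Qed.

Lemma avgv_to_const h : exists2 D : R, 0 <= D & forall N, (0 < N)%N -> cabs (avgv N G h - avgv N G 0) <= D / N%:R.
Proof.
have [dG hG] := nG; have [|K K0 hK] := hG (vn h + n%:R + 1).
  by rewrite !addr_ge0 // vn_ge0.
exists (vn h * K + K * vn h ^+ 2) => [|N N0].
  by rewrite addr_ge0 // mulr_ge0 ?vn_ge0 // sqr_ge0.
rewrite -[h in avgv N G h]add0r; apply: (avgv_const N0 per _ hK).
  by rewrite lerD2r lerDr vn_ge0.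
by rewrite vn0; lra.
Qed.

Lemma fejer_limit w e M : 0 < e -> exists N0, forall N, (N0 <= N)%N -> (0 < N)%N ->
  cabs (avg (fun j : {ffun 'I_n -> 'I_N} => (fweight M j)%:C * G (w + gridv R j)) -
        avgv N G 0 * fsum M w) <= e.
Proof.
move=> e0.
pose E (c : {ffun 'I_n -> 'I_M * 'I_M}) := expC (2^-1 * quad z (zC R (fdiff c)) (zC R (fdiff c)) - dot (zC R (fdiff c)) w).
have /choice[D hD] : forall c : {ffun 'I_n -> 'I_M * 'I_M}, exists D : R, 0 <= D /\
    forall N, (0 < N)%N -> cabs (avgv N G (w - zC R (fdiff c) *m z) - avgv N G 0) <= D / N%:R.
  by move=> c; have [D D0 hD] := avgv_to_const (w - zC R (fdiff c) *m z); exists D.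
pose S := cabs ((M%:R ^+ n)^-1 : C) * \sum_c cabs (E c) * D c.
have [N0 hN0] : exists N0 : nat, S / e < N0%:R.
  by exists (Num.Def.truncn (S / e)).+1; exact: truncnS_gt.
exists N0 => N NN N1; have NR : 0 < N%:R :> R by rewrite ltr0n.
rewrite fejer_main /fsum -/E mulrCA -mulrBr mulr_sumr -sumrB cabsM.
apply: (@le_trans _ _ (S / N%:R)); last first.
  rewrite ler_pdivrMr // mulrC -ler_pdivrMr //; apply: le_trans (ltW hN0) _; by rewrite ler_nat.
rewrite /S -mulrA; apply: ler_wpM2l; first exact: cabs_ge0.
apply: le_trans (cabs_sum _ _ _) _; rewrite mulr_suml; apply: ler_sum => c _.
rewrite -/(E c) [avgv N G 0 * _]mulrC -mulrBr cabsM -mulrA; apply: ler_wpM2l; first exact: cabs_ge0.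
exact: (hD c).2.
Qed.

(** G is close to a constant, its grid average, times the universal function [fsum M]. The
    thresholds for M and then N are only lower bounds, so several functions and points can share
    them. *)
Lemma fejer_approx w e : 0 < e -> exists M0, forall M, (M0 <= M)%N -> (0 < M)%N ->
  exists N0, forall N, (N0 <= N)%N -> (0 < N)%N -> cabs (G w - avgv N G 0 * fsum M w) <= e.
Proof.
move=> e0; have [M0 hM] := fejer_close w (e := e / 2) ltac:(lra).
exists M0 => M MM M1; have [N0 hN] := fejer_limit w M (e := e / 2) ltac:(lra).
exists (maxn N0 M) => N; rewrite geq_max => /andP[NN MN] N1.
have h1 := hM M N MM M1 MN; have h2 := hN N NN N1.
set X := avg _ in h1 h2; have -> : G w - avgv N G 0 * fsum M w = (X - avgv N G 0 * fsum M w) - (X - G w) by ring.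
apply: le_trans (cabsD _ _) _; rewrite cabsN; lra.
Qed.
End Approx.

Lemma bound4 (a b c d : nat) : exists M, [/\ (a <= M)%N, (b <= M)%N, (c <= M)%N, (d <= M)%N & (0 < M)%N].
Proof. by exists (a + b + c + d).+1; split; lia. Qed.

Lemma bound4R (a b c d : R) : 0 <= a -> 0 <= b -> 0 <= c -> 0 <= d ->
  exists B, [/\ 1 <= B, a <= B - 1, b <= B - 1, c <= B - 1 & d <= B - 1].
Proof. by move=> a0 b0 c0 d0; exists (a + b + c + d + 1); split; lra. Qed.

Lemma cabs_mul_close (u v u0 v0 : C) (d B : R) : d <= 1 -> cabs (u - u0) <= d -> cabs (v - v0) <= d ->
  cabs u <= B - 1 -> cabs v <= B - 1 -> cabs (u * v - u0 * v0) <= d * (2 * B).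
Proof.
move=> d1 hu hv uB vB; have v0B : cabs v0 <= B.
  have -> : v0 = v - (v - v0) by ring.
  by apply: le_trans (cabsD _ _) _; rewrite cabsN; lra.
have -> : u * v - u0 * v0 = u * (v - v0) + (u - u0) * v0 by ring.
apply: le_trans (cabsD _ _) _; rewrite !cabsM.
have := ler_pM (cabs_ge0 _) (cabs_ge0 _) uB hv; have := ler_pM (cabs_ge0 _) (cabs_ge0 _) hu v0B.
have : 0 <= d by apply: le_trans hu; exact: cabs_ge0.
lra.
Qed.

(** Both products are close to the same number: the two grid averages times [fsum] at w times [fsum]
    at w'. *)
Lemma quasi_periodic_unique G1 G2 w w' : nice G1 -> nice G2 ->
  quasi_periodic G1 -> quasi_periodic G2 -> G1 w * G2 w' = G1 w' * G2 w.
Proof.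
move=> n1 n2 q1 q2; apply/eqP; rewrite -subr_eq0; apply/eqP; apply: cabs_small => e e0.
have [B [B1 b1 b2 b3 b4]] := bound4R (cabs_ge0 (G1 w)) (cabs_ge0 (G2 w')) (cabs_ge0 (G1 w')) (cabs_ge0 (G2 w)).
have [d [d0 d1 d2]] : exists d : R, [/\ 0 < d, d <= 1 & d * (4 * B) <= e].
  have B0 : 0 < 4 * B by lra.
  exists (Num.min 1 (e / (4 * B))); split.
  - by rewrite lt_min ltr01 divr_gt0.
  - by rewrite ge_min lexx.
  - by rewrite -ler_pdivlMr // ge_min lexx orbT.
have [M1 h1] := fejer_approx n1 q1 w d0; have [M2 h2] := fejer_approx n2 q2 w' d0.
have [M3 h3] := fejer_approx n1 q1 w' d0; have [M4 h4] := fejer_approx n2 q2 w d0.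
have [M [m1 m2 m3 m4 mp]] := bound4 M1 M2 M3 M4.
have {h1}[N1 k1] := h1 M m1 mp; have {h2}[N2 k2] := h2 M m2 mp.
have {h3}[N3 k3] := h3 M m3 mp; have {h4}[N4 k4] := h4 M m4 mp.
have [N [n_1 n_2 n_3 n_4 np]] := bound4 N1 N2 N3 N4.
move: (k1 N n_1 np) (k2 N n_2 np) (k3 N n_3 np) (k4 N n_4 np) => {k1 k2 k3 k4} k1 k2 k3 k4.
move: k1 k2 k3 k4; set a1 := avgv N G1 0; set a2 := avgv N G2 0.
set s := fsum M w; set s' := fsum M w'; set x := G1 w; set y := G2 w'; set x' := G1 w'; set y' := G2 w.
move=> k1 k2 k3 k4.
have p1 := cabs_mul_close d1 k1 k2 b1 b2.
have p2 := cabs_mul_close d1 k3 k4 b3 b4.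
have -> : x * y - x' * y' = (x * y - a1 * s * (a2 * s')) - (x' * y' - a1 * s' * (a2 * s)) by ring.
apply: le_trans (cabsD _ _) _; rewrite cabsN; apply: le_trans (lerD p1 p2) _.
have -> : d * (2 * B) + d * (2 * B) = d * (4 * B) by ring.
exact: d2.
Qed.

End OneDimensional.

(** * The Siegel upper half-space and the transformation of theta *)

Section SiegelSpace.
Variables (R : realType) (n : nat).
Local Notation C := R[i].
Implicit Types (z : 'M[C]_n) (g h : 'M[rat]_(n + n)).

Definition rC m k (A : 'M[rat]_(m, k)) : 'M[C]_(m, k) := map_mx ratr A.
Definition cj m k (A : 'M[C]_(m, k)) : 'M[C]_(m, k) := map_mx conjc A.

Lemma rCM m k l (A : 'M[rat]_(m, k)) (B : 'M[rat]_(k, l)) : rC (A *m B) = rC A *m rC B.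
Proof. exact: map_mxM. Qed.
Lemma rCD m k (A B : 'M[rat]_(m, k)) : rC (A + B) = rC A + rC B.
Proof. exact: map_mxD. Qed.
Lemma rCB m k (A B : 'M[rat]_(m, k)) : rC (A - B) = rC A - rC B.
Proof. exact: map_mxB. Qed.
Lemma rC_tr m k (A : 'M[rat]_(m, k)) : rC A^T = (rC A)^T.
Proof. by rewrite /rC map_trmx. Qed.
Lemma rC1 : rC (1%:M : 'M[rat]_n) = 1%:M. Proof. exact: map_mx1. Qed.
Lemma cjM m k l (A : 'M[C]_(m, k)) (B : 'M[C]_(k, l)) : cj (A *m B) = cj A *m cj B.
Proof. exact: (map_mxM (@conjc R)). Qed.
Lemma cjD m k (A B : 'M[C]_(m, k)) : cj (A + B) = cj A + cj B.
Proof. exact: (map_mxD (@conjc R)). Qed.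
Lemma cj_tr m k (A : 'M[C]_(m, k)) : cj A^T = (cj A)^T.
Proof. by rewrite /cj map_trmx. Qed.
Lemma conjc_ratr (x : rat) : conjc (ratr x : C) = ratr x.
Proof. exact: (fmorph_rat (@conjc R)). Qed.
Lemma cj_rC m k (A : 'M[rat]_(m, k)) : cj (rC A) = rC A.
Proof. by apply/matrixP => i j; rewrite !mxE conjc_ratr. Qed.

Lemma Sp_blocks g : Sp g -> let a := ulsubmx g in let b := ursubmx g in
  let c := dlsubmx g in let d := drsubmx g in
  [/\ a^T *m c = c^T *m a, b^T *m d = d^T *m b & a^T *m d - c^T *m b = 1%:M].
Proof. by move=> hg; apply/Sp_block; rewrite submxK. Qed.

Lemma Sp_blocks_tr g : Sp g -> let a := ulsubmx g in let b := ursubmx g in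
  let c := dlsubmx g in let d := drsubmx g in
  [/\ a *m b^T = b *m a^T, c *m d^T = d *m c^T & a *m d^T - b *m c^T = 1%:M].
Proof. by move=> hg; apply: Sp_tr_block; rewrite submxK. Qed.

Definition num_mx g z : 'M[C]_n := rC (ulsubmx g) *m z + rC (ursubmx g).

Lemma cd_mxE g z : cd_mx g z = rC (dlsubmx g) *m z + rC (drsubmx g).
Proof. by []. Qed.
Lemma actE g z : act g z = num_mx g z *m invmx (cd_mx g z).
Proof. by []. Qed.

(* [(z' C^T + D^T)(A z + B) - (z' A^T + B^T)(C z + D) = z - z'] *)
Lemma Sp_pairing g z w : Sp g -> w^T = w ->
  (cd_mx g w)^T *m num_mx g z - (num_mx g w)^T *m cd_mx g z = z - w.
Proof.
move=> hg ww; have [h1 h2 h3] := Sp_blocks hg.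
move/(congr1 (@rC n n)): h1; move/(congr1 (@rC n n)): h2; move/(congr1 (@rC n n)): h3.
rewrite rCB !rCM !rC_tr rC1 /num_mx !cd_mxE.
move: (rC (ulsubmx g)) (rC (ursubmx g)) (rC (dlsubmx g)) (rC (drsubmx g)) => a b c d h3 h2 h1.
have h3' : d^T *m a - b^T *m c = 1%:M.
  by rewrite -[RHS]trmx1 -h3 linearB /= !trmx_mul !trmxK.
rewrite !linearD /= !trmx_mul ww !mulmxDl.
have -> : w *m a^T *m (c *m z) = w *m c^T *m (a *m z).
  by rewrite -!mulmxA [X in w *m X]mulmxA h1 -!mulmxA.
have -> : b^T *m d = d^T *m b by [].
have e1 : w *m a^T *m d - w *m c^T *m b = w.
  by rewrite -!mulmxA -mulmxBr h3 mulmx1.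
have e2 : d^T *m (a *m z) - b^T *m (c *m z) = z.
  by rewrite !mulmxA -mulmxBl h3' mul1mx.
set p := w *m c^T *m (a *m z); set q := w *m c^T *m b; set r := d^T *m (a *m z).
set s := d^T *m b; set t := w *m a^T *m d; set u := b^T *m (c *m z).
transitivity ((r - u) - (t - q)); last by rewrite e1 e2.
by apply/matrixP => i j; rewrite !mxE; ring.
Qed.
Definition imp z : 'M[R]_n := map_mx (@complex.Im R) z.
Definition herm z (u : 'cV[C]_n) : C := ((cj u)^T *m map_mx (real_complex R) (imp z) *m u) 0 0.

Lemma subcj z : z - cj z = (2 * 'i)%C *: map_mx (real_complex R) (imp z).
Proof.
apply/matrixP => i j; rewrite !mxE; case: (z i j) => x y.
by apply/eqP; rewrite eq_complex /=; apply/andP; split; apply/eqP; ring.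
Qed.

(** The cross terms between the real and imaginary parts of u cancel by symmetry of Im z, which
    leaves the real form at Re u plus the real form at Im u. *)
Lemma herm_gt0 z u : Hn z -> u != 0 -> 0 < herm z u.
Proof.
move=> [zz pd] u0; set Y := imp z.
pose x : 'rV[R]_n := \row_i complex.Re (u i 0); pose y : 'rV[R]_n := \row_i complex.Im (u i 0).
have YY : Y^T = Y by rewrite /Y /imp -[in RHS]zz map_trmx.
have -> : herm z u = ((x *m Y *m x^T) 0 0 + (y *m Y *m y^T) 0 0)%:C.
  rewrite /herm -/Y !quadE.
  transitivity (\sum_i \sum_j (u i 0)^*%C * (Y i j)%:C * u j 0).
    rewrite mxE exchange_big; apply: eq_bigr => j _; rewrite mxE mulr_suml.
    by apply: eq_bigr => i _; rewrite !mxE.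
  have e i j : (u i 0)^*%C * (Y i j)%:C * u j 0 =
     (x 0 i * Y i j * x 0 j + y 0 i * Y i j * y 0 j)%:C +
      'i%C * (x 0 i * Y i j * y 0 j - y 0 i * Y i j * x 0 j)%:C.
    rewrite !mxE; case: (u i 0) (u j 0) => p q [r s].
    by apply/eqP; rewrite eq_complex /=; apply/andP; split; apply/eqP; ring.
  under eq_bigr do under eq_bigr do rewrite e.
  under eq_bigr do rewrite big_split /=; rewrite big_split /=.
  rewrite [X in _ + X](_ : _ = 0) ?addr0; last first.
    under eq_bigr do rewrite -mulr_sumr -rmorph_sum sumrB.
    rewrite -mulr_sumr -rmorph_sum sumrB /=.
    rewrite [X in X - _]exchange_big /= (_ : _ - _ = 0) ?rmorph0 ?mulr0 //.
    apply/eqP; rewrite subr_eq0; apply/eqP; apply: eq_bigr => i _; apply: eq_bigr => j _.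
    by rewrite -[in LHS]YY [Y^T _ _]mxE; ring.
  under eq_bigr do rewrite -rmorph_sum big_split /=.
  by rewrite -rmorph_sum big_split.
have : (x != 0) || (y != 0).
  apply: contraT; rewrite negb_or !negbK => /andP[/eqP/rowP x0 /eqP/rowP y0].
  case/eqP: u0; apply/colP => i; rewrite mxE; have := x0 i; have := y0 i.
  by rewrite !mxE; case: (u i 0) => p q /= -> ->.
have nn (v : 'rV[R]_n) : 0 <= (v *m Y *m v^T) 0 0.
  have [->|v0] := eqVneq v 0; first by rewrite !mul0mx mxE.
  exact/ltW/pd.
by case/orP => h; rewrite ltcR; [apply: ltr_pwDl|apply: ltr_wpDl] => //; exact: pd.
Qed.

Lemma Im_Hn z : Hn z -> (cj z)^T = cj z.
Proof. by move=> [zz _]; rewrite -cj_tr zz. Qed.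

(** If (c z + d) u = 0, then [Sp_pairing] with w the conjugate of z, taken between u^* and u, shows
    that the hermitian form of Im z vanishes at u. *)
Lemma cd_unit g z : Sp g -> Hn z -> cd_mx g z \in unitmx.
Proof.
move=> hg hz; rewrite -unitmx_tr; apply: contraT => nu.
have [v v0 hv] : exists2 v : 'rV[C]_n, v != 0 & v *m (cd_mx g z)^T = 0.
  move: nu; rewrite unitmxE unitfE negbK => /det0P[v v0 e]; by exists v.
pose u := v^T; have u0 : u != 0 by rewrite trmx_eq0.
have Mu : cd_mx g z *m u = 0 by rewrite /u -[cd_mx g z]trmxK -trmx_mul hv trmx0.
have := Sp_pairing z hg (Im_Hn hz); rewrite subcj => e.
have cMu : (cj u)^T *m (cd_mx g (cj z))^T = 0.
  have -> : cd_mx g (cj z) = cj (cd_mx g z) by rewrite !cd_mxE cjD cjM !cj_rC.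
  by rewrite -trmx_mul -cjM Mu /cj map_mx0 trmx0.
have : (cj u)^T *m ((2 * 'i)%C *: map_mx (real_complex R) (imp z)) *m u = 0.
  by rewrite -e mulmxBr mulmxBl (mulmxA (cj u)^T) cMu !mul0mx -(mulmxA (cj u)^T) -(mulmxA _ _ u) Mu !mulmx0 subr0.
rewrite -scalemxAr -scalemxAl => /matrixP/(_ 0 0); rewrite mxE [RHS]mxE -/(herm z u) => /eqP.
have i0 : (2 * 'i)%C != 0 :> C.
  by rewrite mulf_eq0 pnatr_eq0 /=; apply/eqP => -[/eqP]; rewrite oner_eq0.
by rewrite mulf_eq0 (negbTE i0) (gt_eqF (herm_gt0 hz u0)).
Qed.

Lemma act_sym g z : Sp g -> Hn z -> (act g z)^T = act g z.
Proof.
move=> hg hz; have uM := cd_unit hg hz; have [zz _] := hz.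
have := Sp_pairing z hg zz; rewrite (subrr z) => /eqP; rewrite subr_eq0 => /eqP e.
rewrite actE trmx_mul trmx_inv.
have uMt : (cd_mx g z)^T \in unitmx by rewrite unitmx_tr.
by rewrite -[LHS](mulmxK uM) -(mulmxA (invmx _)) -e mulKmx.
Qed.

(** From [Sp_pairing] with w the conjugate of z: M^* Im(g z) M = Im z for M = c z + d, so positivity
    is transported by M. *)
Lemma act_Hn g z : Sp g -> Hn z -> Hn (act g z).
Proof.
move=> hg hz; have uM := cd_unit hg hz; split; first exact: act_sym.
move=> v v0; set Z := act g z.
have e := Sp_pairing z hg (Im_Hn hz).
have cM : cd_mx g (cj z) = cj (cd_mx g z) by rewrite !cd_mxE cjD cjM !cj_rC.
have cN : num_mx g (cj z) = cj (num_mx g z) by rewrite /num_mx cjD cjM !cj_rC.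
have NE : num_mx g z = Z *m cd_mx g z by rewrite /Z actE (mulmxKV uM).
have ZZ : Z^T = Z by exact: act_sym.
have {}e : (cj (cd_mx g z))^T *m (Z - cj Z) *m cd_mx g z = z - cj z.
  by rewrite -e cM cN NE cjM trmx_mul -(cj_tr Z) ZZ mulmxBr mulmxBl !mulmxA.
rewrite !subcj -scalemxAr -scalemxAl in e.
have i0 : (2 * 'i)%C != 0 :> C.
  by rewrite mulf_eq0 pnatr_eq0 /=; apply/eqP => -[/eqP]; rewrite oner_eq0.
have {}e : (cj (cd_mx g z))^T *m map_mx (real_complex R) (imp Z) *m cd_mx g z = map_mx (real_complex R) (imp z).
  by apply/matrixP => i j; move/matrixP/(_ i j): e; rewrite mxE [RHS]mxE => /(mulfI i0).
pose u : 'cV[C]_n := invmx (cd_mx g z) *m (map_mx (real_complex R) v)^T.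
have vu : (map_mx (real_complex R) v)^T = cd_mx g z *m u by rewrite /u mulKVmx.
have u0 : u != 0.
  apply/eqP => u0; move: vu; rewrite u0 mulmx0 => /eqP; rewrite trmx_eq0 map_mx_eq0.
  by rewrite (negbTE v0).
have E2 : (cj u)^T *m map_mx (real_complex R) (imp z) *m u =
    (cj (cd_mx g z *m u))^T *m map_mx (real_complex R) (imp Z) *m (cd_mx g z *m u).
  by rewrite -e cjM trmx_mul !mulmxA.
have := herm_gt0 hz u0; rewrite /herm E2 -vu.
have -> : (cj (map_mx (real_complex R) v)^T)^T = map_mx (real_complex R) v.
  rewrite cj_tr trmxK; apply/matrixP => i j; rewrite !mxE /=; congr (_ +i* _).
  by rewrite oppr0.
by rewrite map_trmx -!map_mxM mxE ltcR.
Qed.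

Lemma act_cocycle g h z : Sp g -> Sp h -> Hn z ->
  cd_mx (g *m h) z = cd_mx g (act h z) *m cd_mx h z /\ act (g *m h) z = act g (act h z).
Proof.
move=> hg hh hz; have uh := cd_unit hh hz; have uM := cd_unit hg (act_Hn hh hz).
have gh : Sp (g *m h) by exact: SpM.
have E : g *m h = block_mx (ulsubmx g *m ulsubmx h + ursubmx g *m dlsubmx h)
   (ulsubmx g *m ursubmx h + ursubmx g *m drsubmx h)
   (dlsubmx g *m ulsubmx h + drsubmx g *m dlsubmx h)
   (dlsubmx g *m ursubmx h + drsubmx g *m drsubmx h).
  by rewrite -[in LHS](submxK g) -[in LHS](submxK h) mulmx_block.
have zE : act h z *m cd_mx h z = num_mx h z by rewrite actE (mulmxKV uh).
have c1 : cd_mx (g *m h) z = cd_mx g (act h z) *m cd_mx h z.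
  rewrite [RHS]mulmxDl -mulmxA -/(rC _) zE {1}cd_mxE E block_mxKdl block_mxKdr cd_mxE /num_mx.
  rewrite !rCD !rCM !mulmxDr !mulmxDl !mulmxA -/(rC _).
  exact: addrACA.
have c2 : num_mx (g *m h) z = num_mx g (act h z) *m cd_mx h z.
  rewrite [RHS]mulmxDl -mulmxA -/(rC _) zE /num_mx E block_mxKul block_mxKur cd_mxE.
  rewrite !rCD !rCM !mulmxDr !mulmxDl !mulmxA.
  exact: addrACA.
split; first exact: c1.
by rewrite [LHS]actE c1 c2 (invmx_mul uM uh) mulmxA (mulmxK uh).
Qed.

End SiegelSpace.

Section SpVectors.
Variables (K : fieldType) (n : nat) (a b c d z Z : 'M[K]_n).
Local Notation V := 'rV[K]_n.
Implicit Types (u v w l m : V).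
Hypotheses (h1 : a^T *m c = c^T *m a) (h2 : b^T *m d = d^T *m b) (h3 : a^T *m d - c^T *m b = 1%:M)
  (h4 : c *m d^T = d *m c^T) (zz : z^T = z) (ZZ : Z^T = Z).
Local Notation M := (c *m z + d).
Hypotheses (uM : M \in unitmx) (ZM : Z *m M = a *m z + b).

Let h3' : d^T *m a - b^T *m c = 1%:M.
Proof. by rewrite -[RHS]trmx1 -h3 linearB /= !trmx_mul !trmxK. Qed.

(** The symmetric matrix (c z + d)^-1 c which occurs in the exponent of the transformation law of
    theta(z, w). *)
Definition autQ : 'M[K]_n := invmx M *m c.

Lemma autQ_sym : autQ^T = autQ.
Proof.
have e : c *m M^T = M *m c^T.
  by rewrite linearD /= trmx_mul zz mulmxDr mulmxDl h4 mulmxA.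
rewrite /autQ trmx_mul trmx_inv; apply: (can_inj (mulKmx uM)).
by rewrite (mulKVmx uM) mulmxA -e (mulmxK _) // unitmx_tr.
Qed.

(** [inv1] and [inv2] are the two halves of the row vector (l, m) g^-1, for g with blocks a, b, c,
    d. *)
Definition inv1 l m := l *m d^T - m *m c^T.
Definition inv2 l m := m *m a^T - l *m b^T.

Lemma inv_back l m : inv1 l m *m a + inv2 l m *m c = l /\ inv1 l m *m b + inv2 l m *m d = m.
Proof.
rewrite /inv1 /inv2 !mulmxBl -!mulmxA h1 h2; split.
  rewrite addrACA -opprD [X in - X]addrC opprD addrACA subrr addr0.
  by rewrite -mulmxBr h3' mulmx1.
rewrite addrACA -opprD [X in - X]addrC opprD addrACA subrr add0r.
by rewrite -mulmxBr h3 mulmx1.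
Qed.

Lemma inv_fwd l m : a *m b^T = b *m a^T -> a *m d^T - b *m c^T = 1%:M -> inv1 (l *m a + m *m c) (l *m b + m *m d) = l /\ inv2 (l *m a + m *m c) (l *m b + m *m d) = m.
Proof.
move=> h5 h6; have h6' : d *m a^T - c *m b^T = 1%:M.
  by rewrite -[RHS]trmx1 -h6 linearB /= !trmx_mul !trmxK.
rewrite /inv1 /inv2 !mulmxDl -!mulmxA h4 h5; split.
  rewrite opprD addrACA subrr addr0; by rewrite -mulmxBr h6 mulmx1.
rewrite opprD addrACA subrr add0r; by rewrite -mulmxBr h6' mulmx1.
Qed.

Lemma autv l m : l *m z + m = (inv1 l m *m Z + inv2 l m) *m M.
Proof.
have [e1 e2] := inv_back l m.
rewrite mulmxDl -mulmxA ZM mulmxDr (mulmxDr (inv2 l m)) !mulmxA addrACA -mulmxDl e1 e2.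
by [].
Qed.

Lemma autQ_dot w l m : dot (w *m autQ) (l *m z + m) + dot (w *m invmx M) (inv1 l m) = dot w l.
Proof.
transitivity ((w *m invmx M *m (c *m (l *m z + m)^T + (inv1 l m)^T)) 0 0).
  by rewrite mulmxDr [RHS]mxE /dot /autQ !mulmxA.
have -> : c *m (l *m z + m)^T + (inv1 l m)^T = M *m l^T.
  rewrite /inv1 linearB linearD /= !trmx_mul !trmxK zz mulmxDr mulmxDl -!mulmxA.
  by rewrite [X in _ + X]addrC addrA addrK.
by rewrite -mulmxA (mulKmx uM).
Qed.

(** Compares the exponents on the two sides of the transformation law at a period. With (l', m') =
    (l, m) g^-1 the defect l m - l' m' is free of z; characteristics compensate it exactly. *)
Lemma autQ_quad l m :
  dot ((l *m z + m) *m autQ) (l *m z + m) + dot (inv1 l m *m Z) (inv1 l m) - dot (l *m z) l =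
  dot l m - dot (inv1 l m) (inv2 l m).
Proof.
have := autQ_dot (l *m z + m) l m; rewrite {3}autv mulmxK //.
have dD (x y t : V) : dot (x + y) t = dot x t + dot y t by rewrite /dot mulmxDl mxE.
have dC (x y : V) : dot x y = dot y x by rewrite !dotE; apply: eq_bigr => i _; rewrite mulrC.
rewrite (dD (inv1 l m *m Z)) (dD (l *m z) m l) (dC (inv2 l m)) (dC m l).
move: (dot _ _) (dot (inv1 l m *m Z) _) (dot (inv1 l m) (inv2 l m)) (dot (l *m z) l) (dot l m) => A B D E F h.
have -> : A + B = E + F - D by rewrite -h; ring.
by ring.
Qed.
End SpVectors.

(** * Transformation of theta with characteristics *)

Section ThetaTransform.
Variables (R : realType) (n : nat).
Hypothesis n_gt0 : (0 < n)%N.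
Local Notation C := R[i].
Local Notation V := 'rV[C]_n.
Implicit Types (z : 'M[C]_n) (g : 'M[rat]_(n + n)) (w l m : V) (x y : 'rV[int]_n).

Definition iC s k (A : 'M[int]_(s, k)) : 'M[C]_(s, k) := map_mx intr A.
Definition iQ s k (A : 'M[int]_(s, k)) : 'M[rat]_(s, k) := map_mx intr A.

Lemma rC_iQ s k (A : 'M[int]_(s, k)) : rC R (iQ A) = iC A.
Proof. by apply/matrixP => i j; rewrite !mxE ratr_int. Qed.
Lemma iCM s k r (A : 'M[int]_(s, k)) (B : 'M[int]_(k, r)) : iC (A *m B) = iC A *m iC B.
Proof. exact: map_mxM. Qed.
Lemma iCD s k (A B : 'M[int]_(s, k)) : iC (A + B) = iC A + iC B.
Proof. exact: map_mxD. Qed.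
Lemma iCB s k (A B : 'M[int]_(s, k)) : iC (A - B) = iC A - iC B.
Proof. exact: map_mxB. Qed.
Lemma iC_tr s k (A : 'M[int]_(s, k)) : iC A^T = (iC A)^T.
Proof. by rewrite /iC map_trmx. Qed.
Lemma iC_inj s k (A B : 'M[int]_(s, k)) : iC A = iC B -> A = B.
Proof. by move/matrixP => h; apply/matrixP => i j; have := h i j; rewrite !mxE => /intr_inj. Qed.
Lemma expC_mul2 (s t r : C) : expC s * (expC t * r) = expC (s + t) * r.
Proof. by rewrite expCD (mulrA (expC s) (expC t) r). Qed.
Lemma expC_addint (s : C) (e : int) : expC (s + e%:~R) = expC s.
Proof. by rewrite expCD expC_int mulr1. Qed.
(** Theta with characteristics (l, m). Thanks to the factor e(l m / 2), a symplectic g acts on the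
    characteristics alone, apart from the quotient theta(g z) / theta(z). *)
Definition thK z l m : C := expC (2^-1 * quad z l l + 2^-1 * dot l m) * th z (l *m z + m).

Section Element.
Variables (g : 'M[rat]_(n + n)) (A B Cc D : 'M[int]_n).
Hypotheses (hg : Sp g) (gA : ulsubmx g = iQ A) (gB : ursubmx g = iQ (2%:Z *: B))
  (gC : dlsubmx g = iQ (2%:Z *: Cc)) (gD : drsubmx g = iQ D).
Local Notation a := (iC A).
Local Notation b := (iC (2%:Z *: B)).
Local Notation c := (iC (2%:Z *: Cc)).
Local Notation d := (iC D).

Lemma C_ids : [/\ a^T *m c = c^T *m a, b^T *m d = d^T *m b, a^T *m d - c^T *m b = 1%:M & c *m d^T = d *m c^T].
Proof.
have [h1 h2 h3] := Sp_blocks hg; have [_ h4 _] := Sp_blocks_tr hg.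
rewrite -!rC_iQ -gA -gB -gC -gD -!rC_tr -!rCM -rCB h1 h2 h3 h4 rC1; by split.
Qed.
Lemma C_ids_tr : a *m b^T = b *m a^T /\ a *m d^T - b *m c^T = 1%:M.
Proof.
have [h1 _ h3] := Sp_blocks_tr hg.
rewrite -!rC_iQ -gA -gB -gC -gD -!rC_tr -!rCM -rCB h1 h3 rC1; by split.
Qed.

Lemma cd_iC z : cd_mx g z = c *m z + d.
Proof. by rewrite cd_mxE gC gD !rC_iQ. Qed.

Variable z : 'M[C]_n.
Hypothesis hz : Hn z.
Local Notation M := (c *m z + d).
Local Notation Z := (act g z).
Let uM : M \in unitmx. Proof. by rewrite -cd_iC; exact: cd_unit. Qed.
Let hZ : Hn Z. Proof. exact: act_Hn. Qed.
Let zz : z^T = z. Proof. by case: hz. Qed.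
Let ZM : Z *m M = a *m z + b.
Proof. by rewrite -cd_iC actE mulmxKV ?cd_unit // /num_mx gA gB !rC_iQ. Qed.

(** The transform of theta(g z, .) in the classical law; it is compared with theta(z, .) through its
    quasi-periodicity. *)
Definition autG w : C := expC (quad (- 2^-1 *: autQ c d z) w w) * th Z (w *m invmx M).

Lemma autG_nice : nice autG.
Proof.
have [_ _ _ h4] := C_ids.
apply: nice_mul.
  apply: nice_gauss; rewrite linearZ /= autQ_sym //.
exact/nice_lin/nice_th.
Qed.

Lemma autG_quasi w x y : let l := zC R x in let m := zC R y in
  autG (w + (l *m z + m)) = expC (- (2^-1 * quad z l l + dot l w)) * autG w.
Proof.
move=> l m; have [h1 h2 h3 h4] := C_ids.
pose x1 := x *m D^T - y *m (2%:Z *: Cc)^T; pose y1 := y *m A^T - x *m (2%:Z *: B)^T.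
have l1 : inv1 c d l m = zC R x1 by rewrite /inv1 /x1 [zC R _]iCB !iCM !iC_tr.
have m1 : inv2 a b l m = zC R y1 by rewrite /inv2 /y1 [zC R _]iCB !iCM !iC_tr.
set v := l *m z + m.
have vE : v *m invmx M = inv1 c d l m *m Z + inv2 a b l m.
  by rewrite /v (autv h1 h2 h3 ZM) (mulmxK uM).
have e1 := autQ_dot zz uM w l m.
have e2 := autQ_quad h1 h2 h3 zz uM ZM l m.
rewrite -/v in e1 e2; clearbody v.
(* Both off-diagonal blocks are even, so this defect is an even integer and its half disappears
   under e(.); otherwise a sign would enter the quasi-periodicity. *)
have [e He] : exists e : int, dot l m - dot (zC R x1) (zC R y1) = 2 * e%:~R.
  have k3 : D^T *m A = 1%:M + (2%:Z *: B)^T *m (2%:Z *: Cc).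
    apply: iC_inj.
    rewrite iCM iCD iCM !iC_tr (_ : iC 1%:M = 1%:M); last exact: map_mx1.
    by rewrite -[X in X + _]trmx1 -h3 linearB /= !trmx_mul !trmxK subrK.
  pose P := x *m B^T; pose Qv := y *m Cc^T.
  exists (dot (x *m D^T) P + dot Qv (y *m A^T) - 2%:Z * dot P Qv - 2%:Z * dot Qv P).
  rewrite -[2]/(2%:~R) -rmorphM !dot_zC -rmorphB; congr (_%:~R).
  have dZ (t : int) (u u' : 'rV[int]_n) : dot u (t *: u') = t * dot u u'.
    by rewrite /dot linearZ /= -scalemxAr mxE.
  have dZl (t : int) (u u' : 'rV[int]_n) : dot (t *: u) u' = t * dot u u'.
    by rewrite /dot -scalemxAl mxE.
  have dB (u u' u'' : 'rV[int]_n) : dot u (u' - u'') = dot u u' - dot u u''.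
    by rewrite /dot linearB /= mulmxBr !mxE.
  have dBl (u u' u'' : 'rV[int]_n) : dot (u' - u'') u = dot u' u - dot u'' u.
    by rewrite /dot mulmxBl !mxE.
  have E : dot (x *m D^T) (y *m A^T) = dot x y + dot (x *m (2%:Z *: B)^T) (y *m (2%:Z *: Cc)^T).
    rewrite /dot !trmx_mul !trmxK !mulmxA -(mulmxA x) k3 mulmxDr mulmx1 !mulmxDl mxE.
    by rewrite !mulmxA.
  rewrite /x1 /y1 dB !dBl E.
  have eP : x *m (2%:Z *: B)^T = 2%:Z *: P by rewrite linearZ /= -scalemxAr.
  have eQ : y *m (2%:Z *: Cc)^T = 2%:Z *: Qv by rewrite linearZ /= -scalemxAr.
  by rewrite eP eQ !dZ !dZl; ring.
rewrite -l1 -m1 in He; rewrite He in e2.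
have qs : forall (k : C) (X : 'M[C]_n) (u u' : V), quad (k *: X) u u' = k * quad X u u'.
  by move=> k X u u'; rewrite /quad -scalemxAr -scalemxAl mxE.
rewrite /autG mulmxDl vE l1 m1 (addrA (w *m invmx M)) (th_period n_gt0 _ _ hZ) (th_quasi n_gt0 _ _ hZ) !qs.
rewrite !quadD !quadDr (quadC v w); last exact: autQ_sym.
rewrite !expC_mul2; congr (_ * _).
rewrite l1 in e1 e2.
rewrite -[quad _ w v]/(dot (w *m autQ c d z) v) -[quad _ v v]/(dot (v *m autQ c d z) v).
rewrite -[quad Z _ _]/(dot (zC R x1 *m Z) (zC R x1)) -[quad z l l]/(dot (l *m z) l).
rewrite (dotC (zC R x1)) (dotC l w) -e1.
have -> : dot (v *m autQ c d z) v = 2 * e%:~R - dot (zC R x1 *m Z) (zC R x1) + dot (l *m z) l.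
  have aux (X Y W E : C) : X + Y - W = E -> X = E - Y + W by move=> <-; ring.
  exact: aux e2.
rewrite -[RHS](expC_addint _ (- e)); congr expC; rewrite rmorphN /=.
move: (dot _ v) (dot _ (zC R x1)) (quad _ w w) (dot _ (zC R x1)) (dot _ l) (e%:~R : C) => X1 X2 X3 X4 X5 X6.
by field.
Qed.

(** Proportionality of two functions with the same quasi-periodicity, the constant being read off at
    w = 0. *)
Lemma theta_unique w : th z w * th Z 0 = th z 0 * autG w.
Proof.
have h0 : autG 0 = th Z 0.
  by rewrite /autG mul0mx /quad !mul0mx mxE expC0 mul1r.
rewrite -h0; apply: (@quasi_periodic_unique _ _ z); [exact: nice_th|exact: autG_nice| |].
  by split=> v m; [exact: th_period|exact: th_quasi].
have z0 : zC R (0 : 'rV[int]_n) = 0 by apply/rowP => i; rewrite !mxE.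
split=> v m.
  by have := autG_quasi v 0 m; rewrite /= z0 mul0mx add0r /quad /dot !mul0mx mxE mulr0 addr0 oppr0 expC0 mul1r.
by have := autG_quasi v m 0; rewrite /= z0 addr0.
Qed.

Lemma thK_transform l m : thK z l m * th Z 0 = th z 0 * thK Z (inv1 c d l m) (inv2 a b l m).
Proof.
have [h1 h2 h3 h4] := C_ids.
have vM : (l *m z + m) *m invmx M = inv1 c d l m *m Z + inv2 a b l m.
  by rewrite (autv h1 h2 h3 ZM) (mulmxK uM).
have H := theta_unique (l *m z + m); rewrite [autG _]/autG vM in H.
rewrite /thK; set k := 2^-1 * quad z l l + _.
transitivity (expC k * (th z (l *m z + m) * th Z 0)); first exact: esym (mulrA _ _ _).
pose T := th Z (inv1 c d l m *m Z + inv2 a b l m).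
pose k' := quad (- 2^-1 *: autQ c d z) (l *m z + m) (l *m z + m).
transitivity (expC k * (th z 0 * (expC k' * T))); first by congr (_ * _); exact: H.
transitivity (th z 0 * (expC k * (expC k' * T))); first exact: mulrCA.
rewrite expC_mul2; congr (_ * (expC _ * _)); rewrite /k /k' {k k' H}.
have := autQ_quad h1 h2 h3 zz uM ZM l m; set v := l *m z + m.
have qs : forall (k : C) (X : 'M[C]_n) (u u' : V), quad (k *: X) u u' = k * quad X u u'.
  by move=> k X u u'; rewrite /quad -scalemxAr -scalemxAl mxE.
rewrite qs -[quad _ v v]/(dot (v *m autQ c d z) v) -[quad z l l]/(dot (l *m z) l).
rewrite -[quad Z _ _]/(dot (inv1 c d l m *m Z) (inv1 c d l m)).
have aux (X1 X2 X3 X4 X5 : C) : X1 + X2 - X3 = X4 - X5 ->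
    2^-1 * X3 + 2^-1 * X4 + - 2^-1 * X1 = 2^-1 * X2 + 2^-1 * X5.
  move=> e; have -> : X1 = X4 - X5 - X2 + X3 by rewrite -e; ring.
  by field.
exact: aux.
Qed.

Lemma thK_fwd l m : th z 0 * thK Z l m = thK z (l *m a + m *m c) (l *m b + m *m d) * th Z 0.
Proof.
have [_ _ _ h4] := C_ids; have [h5 h6] := C_ids_tr.
by rewrite thK_transform; have [-> ->] := inv_fwd h4 l m h5 h6.
Qed.
End Element.

Section Scaling.
Variables (p : nat) (z : 'M[C]_n) (U : 'M[int]_n).
Hypotheses (p0 : (0 < p)%N) (hz : Hn z) (UU : U^T = U).
Local Notation u := (iC (2%:Z *: U)).
(** The point alpha z for a representative alpha of U_p, with 2U the translation part. *)
Definition scaled : 'M[C]_n := (p%:R ^+ 2)^-1 *: (z + u).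
Hypothesis hs : Hn scaled.
Local Notation J := {ffun 'I_n -> 'I_p}.

Let pC0 : p%:R != 0 :> C. Proof. by rewrite pnatr_eq0 -lt0n. Qed.
Let pZ0 : p%:Z != 0. Proof. by rewrite eqz_nat -lt0n. Qed.

Fact modp_lt (e : int) : (`|(e %% p%:Z)%Z| < p)%N.
Proof. by have := modz_ge0 e pZ0; have := ltz_pmod e (p0 : 0 < p%:Z); lia. Qed.
Definition digits x : J * 'rV[int]_n :=
  ([ffun i => Ordinal (modp_lt (x 0 i))], \row_i divz (x 0 i) p%:Z).
Definition jint (j : J) : 'rV[int]_n := \row_i (j i)%:Z.

Lemma digitsK x : jint (digits x).1 + p%:Z *: (digits x).2 = x.
Proof.
apply/rowP => i; rewrite !mxE ffunE /=.
by rewrite gez0_abs ?modz_ge0 // addrC mulrC -divz_eq.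
Qed.

Lemma digits_bij : bijective digits.
Proof.
exists (fun jy => jint jy.1 + p%:Z *: jy.2); first exact: digitsK.
move=> [j y]; congr pair; [apply/ffunP => i|apply/rowP => i]; rewrite ?ffunE !mxE /=.
  apply: val_inj; rewrite /= addrC [p%:Z * _]mulrC modzMDl modz_small //.
  by rewrite ltz_nat ltn_ord.
rewrite mulrC addrC divzMDl // divz_small ?addr0 //.
by rewrite ltz_nat ltn_ord.
Qed.

Lemma zC_digits x : zC R x = p%:R *: (gridv R (digits x).1 + zC R (digits x).2).
Proof.
rewrite -[x in LHS]digitsK; apply/rowP => i; rewrite !mxE rmorphD rmorphM /= mulrDr.
by rewrite mulrCA mulfV // mulr1.
Qed.

(** Writing the lattice vector as j + p y with 0 <= j < p coordinatewise turns each class modulo p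
    into a theta series with characteristics (j / p, (j / p) u). The part of the quadratic phase in
    y alone is trivial because u = 2U is even. *)
Lemma theta_scaled : th scaled 0 = \sum_(j : J) thK z (gridv R j) (gridv R j *m u).
Proof.
have [zz _] := hz.
have uu : u^T = u by rewrite -iC_tr linearZ /= UU.
apply: thE => //.
have H := hasS_fin (fun j : J => hasSZ (expC (2^-1 * quad z (gridv R j) (gridv R j) +
  2^-1 * dot (gridv R j) (gridv R j *m u))) (thP n_gt0 (gridv R j *m z + gridv R j *m u) hz)).
have := hasS_reindex digits_bij H; apply: eq_hasS => x; rewrite /comp.
move: (zC_digits x); case: (digits x) => j yi /= hx; rewrite /tt hx; set l := gridv R _; set y := zC R _.
have -> : dot (p%:R *: (l + y)) 0 = 0 by rewrite /dot trmx0 mulmx0 mxE.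
rewrite addr0 -expCD.
have -> : quad scaled (p%:R *: (l + y)) (p%:R *: (l + y)) = quad z (l + y) (l + y) + quad u (l + y) (l + y).
  rewrite quadZ quadZr /scaled.
  have -> : quad ((p%:R ^+ 2)^-1 *: (z + u)) (l + y) (l + y) = (p%:R ^+ 2)^-1 * (quad z (l + y) (l + y) + quad u (l + y) (l + y)).
    by rewrite /quad -scalemxAr -scalemxAl mulmxDr mulmxDl !mxE.
  by field.
rewrite !quadD !quadDr (quadC y l uu) (quadC y l zz) dotDr !dot_mulr.
have [e He] : exists e : int, quad u y y = 2 * e%:~R.
  exists (dot (yi *m U) yi).
  rewrite /quad /y (_ : u = 2 *: iC U); last by apply/matrixP => i0 j0; rewrite !mxE rmorphM.
  rewrite -scalemxAr -scalemxAl mxE; congr (_ * _).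
  transitivity (dot (zC R (yi *m U)) (zC R yi)); last exact: dot_zC.
  by rewrite /dot [zC R (yi *m U)]iCM.
rewrite He.
rewrite -[LHS](expC_addint _ e); congr expC.
move: (quad z l l) (quad u l l) (quad z y y) (quad z l y) (quad u l y) (e%:~R : C) => X1 X2 X3 X4 X5 X6.
by field.
Qed.
End Scaling.

Lemma th_mul_period z l m x y : Hn z ->
  thK z (l + zC R x) (m + zC R y) =
  expC (2^-1 * (dot l (zC R y) - dot (zC R x) m + dot (zC R x) (zC R y))) * thK z l m.
Proof.
move=> hz; have [zz _] := hz; rewrite /thK.
have -> : (l + zC R x) *m z + (m + zC R y) = (l *m z + m + zC R x *m z) + zC R y.
  by rewrite mulmxDl addrACA addrA.
rewrite (th_period n_gt0 _ _ hz) (th_quasi n_gt0 _ _ hz) !expC_mul2; congr (expC _ * _).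
rewrite !quadD !quadDr !dotD !dotDr dot_mulr (quadC l (zC R x) zz).
move: (quad z l l) (quad z (zC R x) l) (quad z (zC R x) (zC R x)) (dot l m) (dot l (zC R y)) => X1 X2 X3 X4 X5.
move: (dot (zC R x) m) (dot (zC R x) (zC R y)) => X6 X7.
by field.
Qed.

Lemma congr_small (p r s : nat) (T : int) : (r < p)%N -> (s < p)%N -> r%:Z - s%:Z = p%:Z * T -> r = s.
Proof. by move=> rp sp e; case: (ltgtP T 0) => h; nia. Qed.

Section ScaledTransform.
Variables (p : nat) (g : 'M[rat]_(n + n)) (A B Cp D U U' S : 'M[int]_n) (z : 'M[C]_n).
Hypotheses (p0 : (0 < p)%N) (hg : Sp g) (gA : ulsubmx g = iQ A) (gB : ursubmx g = iQ (2%:Z *: B))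
  (gC : dlsubmx g = iQ (2%:Z *: (p%:Z *: Cp))) (gD : drsubmx g = iQ D)
  (UU : U^T = U) (UU' : U'^T = U')
  (US : 2%:Z *: B + (2%:Z *: U) *m D =
        (A + (2%:Z *: U) *m (2%:Z *: (p%:Z *: Cp))) *m (2%:Z *: U') + (2 * p%:Z ^+ 2) *: S)
  (hz : Hn z) (hs : Hn (scaled p (act g z) U)) (hs' : Hn (scaled p z U')).
Local Notation J := {ffun 'I_n -> 'I_p}.
Local Notation E := (A + (2%:Z *: U) *m (2%:Z *: (p%:Z *: Cp))).

Let sg_ (j : J) : J := (digits p0 (jint j *m E)).1.
Let kk_ (j : J) : 'rV[int]_n := (digits p0 (jint j *m E)).2.

(** As the lower left block is divisible by p, E D^T is congruent to 1 modulo p, so j -> j E is a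
    permutation modulo p. *)
Lemma sg_inj_ : injective sg_.
Proof.
have [h5 h6] := C_ids_tr hg gA gB gC gD.
have AD : A *m D^T = 1%:M + (2%:Z *: B) *m (2%:Z *: (p%:Z *: Cp))^T.
  apply: iC_inj; rewrite iCM iCD iCM !iC_tr (_ : iC 1%:M = 1%:M); last exact: map_mx1.
  by rewrite -h6 subrK.
have [W HW] : exists W, E *m D^T = 1%:M + p%:Z *: W.
  exists ((2%:Z *: B) *m (2%:Z *: Cp)^T + (2%:Z *: U) *m (2%:Z *: Cp) *m D^T).
  rewrite mulmxDl AD scalerDr addrA; congr (_ + _ + _).
    by rewrite scalerA mulrC -scalerA linearZ /= -scalemxAr.
  by rewrite [in LHS]scalerA [2 * _]mulrC -scalerA -scalemxAr -!scalemxAl.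
move=> j1 j2 e.
have e1 := digitsK p0 (jint j1 *m E); have e2 := digitsK p0 (jint j2 *m E).
have [y Hy] : exists y : 'rV[int]_n, (jint j1 - jint j2) *m E = p%:Z *: y.
  exists (kk_ j1 - kk_ j2); rewrite mulmxBl -e1 -e2 -/(sg_ j1) -/(sg_ j2) e.
  by rewrite opprD addrACA subrr add0r scalerBr.
have {}Hy : jint j1 - jint j2 = p%:Z *: (y *m D^T - (jint j1 - jint j2) *m W).
  have := congr1 (fun X => X *m D^T) Hy; rewrite -mulmxA HW mulmxDr mulmx1 -scalemxAl -scalemxAr => H.
  by rewrite scalerBr -H addrK.
apply/ffunP => i; apply: val_inj; have /rowP/(_ i) := Hy; rewrite !mxE.
by apply: congr_small.
Qed.

(** The characteristics (l, l u) are sent by g to (l E, l (b + u d)), and by [US] this is (l', l'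
    u') up to an integral vector, with l' the class of l E. So g permutes the terms of
    [theta_scaled]. *)
Lemma theta_scaled_transform : th (scaled p (act g z) U) 0 * th z 0 = th (act g z) 0 * th (scaled p z U') 0.
Proof.
have hZ := act_Hn hg hz.
rewrite (theta_scaled p0 hZ UU hs) (theta_scaled p0 hz UU' hs') mulr_suml mulr_sumr.
rewrite [RHS](reindex_inj sg_inj_) /=; apply: eq_bigr => j _.
have H := thK_fwd hg gA gB gC gD hz (gridv R j) (gridv R j *m iC (2%:Z *: U)).
etransitivity; first exact: mulrC.
etransitivity; first exact: H.
etransitivity; first exact: mulrC.
apply: (congr1 (fun t => th (act g z) 0 * t)).
have pC0 : p%:R != 0 :> C by rewrite pnatr_eq0 -lt0n.
have gE (i : J) : gridv R i = p%:R^-1 *: zC R (jint i).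
  by apply/rowP => t; rewrite !mxE mulrC.
pose l := gridv R (sg_ j).
have e1 : gridv R j *m iC E = l + zC R (kk_ j).
  transitivity (p%:R^-1 *: (p%:R *: (l + zC R (kk_ j)))); last by rewrite scalerA mulVf // scale1r.
  rewrite (gE j) -(scalemxAl p%:R^-1); congr (_ *: _).
  by rewrite -[RHS](zC_digits p0) -[LHS]iCM.
have -> : gridv R j *m iC A + gridv R j *m iC (2%:Z *: U) *m iC (2%:Z *: (p%:Z *: Cp)) = l + zC R (kk_ j).
  by rewrite -e1 iCD iCM mulmxDr mulmxA.
have eS : gridv R j *m iC ((2 * p%:Z ^+ 2) *: S) = zC R (2%:Z *: (p%:Z *: (jint j *m S))).
  rewrite gE (_ : iC ((2 * p%:Z ^+ 2) *: S) = (2 * p%:R ^+ 2) *: iC S); last first.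
    by apply/matrixP => s t; rewrite !mxE !rmorphM /= expr2.
  have -> : zC R (2%:Z *: (p%:Z *: (jint j *m S))) = 2 *: (p%:R *: (zC R (jint j) *m iC S)).
    rewrite -[zC R (jint j) *m _]iCM; by apply/matrixP => s t; rewrite !mxE !rmorphM.
  rewrite -scalemxAr -scalemxAl !scalerA; congr (_ *: _); by field.
have -> : gridv R j *m iC (2%:Z *: B) + gridv R j *m iC (2%:Z *: U) *m iC D =
    l *m iC (2%:Z *: U') + zC R (kk_ j *m (2%:Z *: U') + 2%:Z *: (p%:Z *: (jint j *m S))).
  rewrite -mulmxA -iCM -mulmxDr -iCD US iCD mulmxDr eS iCM mulmxA e1 mulmxDl -addrA; congr (_ + _).
  by rewrite -[zC R (kk_ j) *m _]iCM -zCD.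
etransitivity; first exact: (th_mul_period _ _ _ _ hz).
(* The terms pairing l with k u' cancel by symmetry of u'; the others are even integers, since u'
   and the correction S carry a factor 2, so the multiplier of this integral shift is 1. *)
set r := 2^-1 * _; suff -> : expC r = 1 by exact: mul1r.
rewrite /r {r}.
rewrite zCD !dotDr [zC R (kk_ j *m _)]iCM.
set k := kk_ j; set u := iC (2%:Z *: U').
have uu : u^T = u by rewrite -iC_tr linearZ /= UU'.
have d1 : dot l (iC k *m u) = dot (zC R k) (l *m u) by rewrite !dot_mulr quadC.
rewrite d1.
have [t1 Ht1] : exists t : int, dot l (zC R (2%:Z *: (p%:Z *: (jint j *m S)))) = 2 * t%:~R.
  exists (dot (jint (sg_ j)) (jint j *m S)).
  rewrite -(dot_zC R) /l gE dotZ (_ : zC R (2%:Z *: _) = (2 * p%:R) *: zC R (jint j *m S)); last first.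
    by apply/rowP => s; rewrite !mxE !rmorphM /= mulrA.
  by rewrite dotZr; field.
have [t2 Ht2] : exists t : int, dot (zC R k) (iC k *m u) = 2 * t%:~R.
  exists (dot k (k *m U')); rewrite -(dot_zC R) [zC R (k *m U')]iCM dot_mulr dot_mulr.
  rewrite (_ : u = 2 *: iC U'); last by apply/matrixP => s t; rewrite !mxE rmorphM.
  by rewrite /quad -scalemxAr -scalemxAl mxE.
have [t3 Ht3] : exists t : int, dot (zC R k) (zC R (2%:Z *: (p%:Z *: (jint j *m S)))) = 2 * t%:~R.
  exists (dot k (p%:Z *: (jint j *m S))); rewrite -(dot_zC R).
  rewrite (_ : zC R (2%:Z *: _) = 2 *: zC R (p%:Z *: (jint j *m S))) ?dotZr //.
  by apply/rowP => s; rewrite !mxE rmorphM.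
rewrite Ht1 Ht2 Ht3 (_ : 2^-1 * _ = (t1 + t2 + t3)%:~R) ?expC_int //.
rewrite !rmorphD /=; move: (dot _ (l *m u)) (t1%:~R : C) (t2%:~R : C) (t3%:~R : C) => X1 X2 X3 X4.
by field.
Qed.
End ScaledTransform.
End ThetaTransform.

(** * Identity principle for a power series on a real interval *)

Section PowerSeries.
Variables (R : realType) (I : eqType) (c : I -> R[i]) (N : I -> nat) (d M : R).
Local Notation C := R[i].
Hypotheses (d0 : 0 < d) (M0 : 0 <= M)
  (dom : forall B : seq I, uniq B -> \sum_(i <- B) cabs (c i) * (1 + d) ^+ N i <= M).
Variable P : R -> C.
Hypothesis hP : forall y, 0 <= y -> y <= 1 -> hasS (fun i => c i * (y%:C) ^+ N i) (P y).

Definition binterm (y : R) k i : R := (-1) ^+ k * y ^+ (N i - k) *+ 'C(N i, k).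

Lemma binterm_sum y s i : (y - s) ^+ N i = \sum_(k < (N i).+1) binterm y k i * s ^+ k.
Proof.
rewrite exprDn; apply: eq_bigr => k _; rewrite /binterm -[- s]mulN1r exprMn.
by rewrite -[in LHS]mulr_natr -[in RHS]mulr_natr; ring.
Qed.

Lemma binterm_le y k i : 0 <= y -> y <= 1 -> `|binterm y k i| * d ^+ k <= (1 + d) ^+ N i.
Proof.
move=> y0 y1; case: (leqP k (N i)) => kN; last first.
  by rewrite /binterm bin_small // mulr0n normr0 mul0r exprn_ge0 // addr_ge0 // ltW.
rewrite /binterm normrMn normrM normrX normrN normr1 expr1n mul1r.
rewrite exprDn (bigD1 (Ordinal (kN : (k < (N i).+1)%N))) //= expr1n mul1r mulrnAl.
apply: (@le_trans _ _ (d ^+ k *+ 'C(N i, k))).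
  rewrite ler_wMn2r // ler_piMl ?exprn_ge0 ?(ltW d0) // ger0_norm ?exprn_ge0 //.
  by rewrite exprn_ile1.
rewrite lerDl; apply: sumr_ge0 => j _; rewrite expr1n mul1r mulrn_wge0 // exprn_ge0 //; exact: ltW.
Qed.

Lemma binterm_tail y s i K : 0 <= y -> y <= 1 -> 0 <= s -> s <= d ->
  `|(y - s) ^+ N i - \sum_(k < K) binterm y k i * s ^+ k| <= (s / d) ^+ K * (1 + d) ^+ N i.
Proof.
move=> y0 y1 s0 sd; have sd1 : s / d <= 1 by rewrite ler_pdivrMr // mul1r.
have sd0 : 0 <= s / d by rewrite divr_ge0 // ltW.
have S : \sum_(k < (N i).+1) `|binterm y k i| * d ^+ k <= (1 + d) ^+ N i.
  have -> : \sum_(k < (N i).+1) `|binterm y k i| * d ^+ k = (y + d) ^+ N i.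
    rewrite exprDn; apply: eq_bigr => k _; rewrite /binterm normrMn normrM normrX normrN normr1 expr1n mul1r.
    by rewrite ger0_norm ?exprn_ge0 // mulrnAl.
  apply: lerXn2r; rewrite ?nnegrE; lra.
have E : (y - s) ^+ N i - \sum_(k < K) binterm y k i * s ^+ k =
    \sum_(k < (N i).+1 | (K <= k)%N) binterm y k i * s ^+ k.
  rewrite binterm_sum.
  have -> : \sum_(k < K) binterm y k i * s ^+ k = \sum_(k < (N i).+1 | (k < K)%N) binterm y k i * s ^+ k.
    have z k : (N i < k)%N -> binterm y k i * s ^+ k = 0.
      by move=> h; rewrite /binterm bin_small // mulr0n mul0r.
    rewrite -(big_mkord xpredT (fun k => binterm y k i * s ^+ k)).
    rewrite -(big_mkord (fun k => (k < K)%N) (fun k => binterm y k i * s ^+ k)).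
    pose L := (K + (N i).+1)%N.
    rewrite (big_nat_widen 0 K L) ?leq_addr // (big_nat_widen 0 (N i).+1 L) ?leq_addl //=.
    rewrite [LHS](bigID (fun k => (k < (N i).+1)%N)) /= [X in _ + X]big1 ?addr0.
      by apply: eq_bigl => k.
    by move=> k /andP[_ h]; apply: z; rewrite -leqNgt in h.
  rewrite [X in X - _](bigID (fun k : 'I_(N i).+1 => (k < K)%N)) /= addrAC subrr add0r.
  by apply: eq_bigl => k; rewrite -leqNgt.
rewrite E; apply: le_trans (ler_norm_sum _ _ _) _.
apply: (@le_trans _ _ ((s / d) ^+ K * \sum_(k < (N i).+1) `|binterm y k i| * d ^+ k)); last first.
  by apply: ler_wpM2l => //; exact: exprn_ge0.
rewrite mulr_sumr; rewrite [leRHS](bigID (fun k : 'I_(N i).+1 => (K <= k)%N)) /= -[leLHS]addr0.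
apply: lerD; last first.
  by apply: sumr_ge0 => k _; rewrite !mulr_ge0 // exprn_ge0 // ltW.
apply: ler_sum => k Kk; rewrite normrM (ger0_norm (exprn_ge0 _ s0)) mulrCA.
apply: ler_wpM2l => //.
have -> : s ^+ k = (s / d) ^+ k * d ^+ k by rewrite -exprMn divfK // gt_eqF.
apply: ler_wpM2r; first by rewrite exprn_ge0 // ltW.
exact: ler_wiXn2l.
Qed.

(** The bound [dom] makes the series converge beyond 1. Around every y in [0, 1] the Taylor
    remainder is then controlled with the same d and M, so a continuation argument can proceed by
    equal steps. *)
Lemma series_taylor y : 0 <= y -> y <= 1 -> exists b : nat -> C, forall K s, 0 <= s -> s <= d -> s <= y ->
  cabs (P (y - s) - \sum_(k < K) b k * (s%:C) ^+ k) <= M * (s / d) ^+ K.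
Proof.
move=> y0 y1.
have /choice[b hb] : forall k, exists b, hasS (fun i => c i * (binterm y k i)%:C) b.
  move=> k; apply: (@hasS_ex _ _ _ (d ^- k * M)) => B uB.
  apply: (@le_trans _ _ (\sum_(i <- B) d ^- k * (cabs (c i) * (1 + d) ^+ N i))).
    apply: ler_sum => i _; rewrite cabsM cabsR mulrCA; apply: ler_wpM2l; first exact: cabs_ge0.
    by rewrite mulrC ler_pdivlMr ?exprn_gt0 // binterm_le.
  rewrite -mulr_sumr; apply: ler_wpM2l; last exact: dom.
  by rewrite invr_ge0 exprn_ge0 // ltW.
exists b => K s s0 sd sy.
have ys0 : 0 <= y - s by lra. have ys1 : y - s <= 1 by lra.
have h1 := hP ys0 ys1.
have h2 := hasSZ (-1) (hasS_sum (fun k : 'I_K => hasSZ ((s%:C) ^+ k) (hb k))).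
have h := hasSD h1 h2; rewrite mulN1r in h.
under eq_bigr do rewrite mulrC.
apply: (hasS_bound (g := fun i => (s / d) ^+ K * (cabs (c i) * (1 + d) ^+ N i))) h => [i|B uB]; last first.
  rewrite -mulr_sumr mulrC; apply: ler_wpM2r; last exact: dom.
  by rewrite exprn_ge0 // divr_ge0 // ltW.
have -> : c i * ((y - s)%:C) ^+ N i + -1 * (\sum_(k < K) (s%:C) ^+ k * (c i * (binterm y k i)%:C)) =
   c i * ((y - s) ^+ N i - \sum_(k < K) binterm y k i * s ^+ k)%:C.
  rewrite mulN1r [in RHS](rmorphB (real_complex R)) [in RHS](rmorphXn (real_complex R)) mulrBr; congr (_ - _); rewrite (rmorph_sum (real_complex R)) mulr_sumr /=.
  by apply: eq_bigr => k _; rewrite rmorphM rmorphXn /= mulrCA [X in _ * X]mulrC.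
rewrite cabsM cabsR mulrCA; apply: ler_wpM2l; first exact: cabs_ge0.
exact: binterm_tail.
Qed.

(** Vanishing on a short interval to the left of y kills the Taylor coefficients one after the
    other; the remainder at distance at most d / 2 is then bounded by M / 2^K for every K. *)
Lemma vanish_step y e : 0 <= y -> y <= 1 -> 0 < e -> e <= y ->
  (forall s, 0 <= s -> s <= e -> P (y - s) = 0) ->
  forall s, 0 <= s -> s <= d / 2 -> s <= y -> P (y - s) = 0.
Proof.
move=> y0 y1 e0 ey Z; have [b hb] := series_taylor y0 y1.
have b0 K : b K = 0.
  have [m] := ubnP K; elim: m K => // m IH K Km.
  have {}IH (k : 'I_K) : b k = 0 by apply: IH; apply: leq_trans (ltn_ord k) _.
  apply: cabs_small => t t0.
  pose A := M / d ^+ K.+1; have A0 : 0 <= A by rewrite divr_ge0 // exprn_ge0 // ltW.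
  pose s := Num.min (Num.min e d) (t / (A + 1)).
  have A1 : 0 < A + 1 by lra.
  have s0 : 0 < s by rewrite !lt_min e0 d0 divr_gt0.
  have se : s <= e by rewrite !ge_min lexx.
  have sd : s <= d by rewrite !ge_min lexx orbT.
  have st : s <= t / (A + 1) by rewrite ge_min lexx orbT.
  have := hb K.+1 s (ltW s0) sd (le_trans se ey); rewrite Z ?(ltW s0) // big_ord_recr /= big1 => [|k _]; last first.
    by rewrite IH mul0r.
  rewrite !add0r cabsN cabsM cabsX cabsR (gtr0_norm s0) => h.
  have sK : 0 < s ^+ K by exact: exprn_gt0.
  have {}h : cabs (b K) <= A * s.
    rewrite -(ler_pM2r sK); apply: le_trans h _; rewrite expr_div_n exprSr /A.
    by move: (d ^+ K.+1)^-1 (s ^+ K) => u v; have -> : M * (v * s * u) = M * u * s * v by ring.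
  apply: le_trans h _; apply: (@le_trans _ _ ((A + 1) * (t / (A + 1)))).
    by apply: ler_pM => //; [exact: ltW|lra].
  by rewrite mulrC divfK // gt_eqF.
move=> s s0 sd sy; apply: cabs_small => t t0.
have sd' : s <= d by lra.
have H K : cabs (P (y - s)) <= M * 2^-1 ^+ K.
  have := hb K s s0 sd' sy; rewrite big1 => [|k _]; last by rewrite b0 mul0r.
  rewrite subr0 => h; apply: le_trans h _; apply: ler_wpM2l => //.
  apply: lerXn2r; rewrite ?nnegrE ?divr_ge0 ?(ltW d0) //.
  by rewrite ler_pdivrMr // mulrC.
have [K hK] : exists K, M * 2^-1 ^+ K <= t.
  pose K := (Num.Def.truncn (M / t)).+1; exists K.
  have h1 : M / t < K%:R by exact: truncnS_gt.
  have h2 : K%:R <= 2 ^+ K :> R by rewrite -natrX ler_nat ltnW // ltn_expl.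
  rewrite exprVn ler_pdivrMr ?exprn_gt0 // mulrC -ler_pdivrMr //.
  exact: le_trans (ltW h1) h2.
exact: le_trans (H K) hK.
Qed.

(** The step d / 2 is uniform, so finitely many applications of [vanish_step] lead from b down to
    0. *)
Lemma vanish_all a b : 0 <= a -> a < b -> b <= 1 -> (forall y, a <= y -> y <= b -> P y = 0) ->
  forall y, 0 <= y -> y <= b -> P y = 0.
Proof.
move=> a0 ab b1 Z; have h0 : 0 < d / 2 by rewrite divr_gt0.
have H j : forall y, 0 <= y -> b - j.+1%:R * (d / 2) < y -> y <= b -> P y = 0.
  elim: j => [|j IH] y y0 yj yb.
    have -> : y = b - (b - y) by ring.
    apply: (@vanish_step b (b - a)) => //; rewrite ?mul1r in yj *; try lra.
    by move=> s s0 sb; apply: Z; lra.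
  case: (ltrP (b - j.+1%:R * (d / 2)) y) => [|yj']; first by move=> h; exact: IH.
  rewrite -[j.+2%:R]natr1 mulrDl mul1r in yj.
  have j1 : d / 2 <= j.+1%:R * (d / 2) by rewrite ler_peMl ?ler1n // ltW.
  pose y' := y + d / 2; pose e := Num.min (d / 2) ((y' - (b - j.+1%:R * (d / 2))) / 2).
  have -> : y = y' - d / 2 by rewrite /y'; ring.
  have y'b : y' <= b by rewrite /y'; lra.
  have e0 : 0 < e by rewrite lt_min h0 /y'; lra.
  have e1 : e <= d / 2 by rewrite ge_min lexx.
  have e2 : e <= (y' - (b - j.+1%:R * (d / 2))) / 2 by rewrite ge_min lexx orbT.
  apply: (@vanish_step y' e) => //; rewrite ?/y'; try lra.
  move=> s s0 se; apply: IH; rewrite -/y'; lra.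
move=> y y0 yb; pose j := Num.Def.truncn (b / (d / 2)).
apply: (H j) => //.
have : b / (d / 2) < j.+1%:R by exact: truncnS_gt.
rewrite ltr_pdivrMr //; lra.
Qed.

Lemma nonvanishing i0 a b : N i0 = 0%N -> (forall i, N i = 0%N -> i = i0) -> c i0 != 0 ->
  0 <= a -> a < b -> b <= 1 -> exists2 y, a <= y <= b & P y != 0.
Proof.
move=> N0 Nu c0 a0 ab b1; apply: contrapT => no.
have Z : forall y, a <= y -> y <= b -> P y = 0.
  by move=> y h1 h2; apply/eqP; apply: contraT => h; case: no; exists y => //; rewrite h1.
have P0 : P 0 = 0 by apply: (vanish_all a0 ab b1 Z); lra.
have h : hasS (fun i => c i * (0%:C) ^+ N i) (c i0).
  move=> e e0; exists [:: i0] => B uB iB.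
  have iB' : i0 \in B by apply: iB; rewrite inE.
  rewrite (bigD1_seq i0) //= N0 expr0 mulr1 big1 => [|i ii]; first by rewrite addr0 subrr cabs0 ltW.
  rewrite rmorph0 expr0n; case: (N i =P 0%N) => [/Nu e'|_]; last by rewrite mulr0.
  by rewrite e' eqxx in ii.
have := hasS_unique h (hP (lexx 0) ler01); rewrite P0 => /eqP.
by rewrite (negbTE c0).
Qed.
End PowerSeries.

(** * The half-integral factor of automorphy *)

Section RightContinuity.
Variable R : realType.
Local Notation C := R[i].
Implicit Types F G : R -> C.

(** Continuity at 0 from the right: functions are followed along rays z + i t with t >= 0, which
    stay in H_n. *)
Definition rcont F := forall e : R, 0 < e ->
  exists2 d : R, 0 < d & forall t, 0 <= t -> t <= d -> cabs (F t - F 0) <= e.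

Lemma eq_rcont F G : F =1 G -> rcont F -> rcont G.
Proof. by move=> /funext ->. Qed.

Lemma rcont_cst (a : C) : rcont (fun=> a).
Proof. by move=> e e0; exists 1 => // t _ _; rewrite subrr cabs0 ltW. Qed.

Lemma rcontD F G : rcont F -> rcont G -> rcont (fun t => F t + G t).
Proof.
move=> hF hG e e0; have e2 : 0 < e / 2 by exact: divr_gt0.
have [d d0 hd] := hF _ e2; have [d' d0' hd'] := hG _ e2.
exists (Num.min d d') => [|t t0]; first by rewrite lt_min d0.
rewrite le_min => /andP[td td']; rewrite opprD addrACA; apply: le_trans (cabsD _ _) _.
have := hd t t0 td; have := hd' t t0 td'; lra.
Qed.

Lemma rcontM F G : rcont F -> rcont G -> rcont (fun t => F t * G t).
Proof.
move=> hF hG e e0; pose A := cabs (F 0) + 1; pose B := cabs (G 0) + 1.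
have A0 : 0 < A by apply: ltr_wpDl => //; exact: cabs_ge0.
have B0 : 0 < B by apply: ltr_wpDl => //; exact: cabs_ge0.
have [d d0 hd] := hF (e / (2 * B)) (divr_gt0 e0 (mulr_gt0 (ltr0Sn _ 1) B0)).
have [d' d0' hd'] := hG (e / (2 * A)) (divr_gt0 e0 (mulr_gt0 (ltr0Sn _ 1) A0)).
have [d'' d0'' hd''] := hG 1 ltr01.
exists (Num.min d (Num.min d' d'')) => [|t t0]; first by rewrite !lt_min d0 d0'.
rewrite !le_min => /and3P[td td' td''].
have -> : F t * G t - F 0 * G 0 = (F t - F 0) * G t + F 0 * (G t - G 0) by ring.
apply: le_trans (cabsD _ _) _; rewrite !cabsM.
have GB : cabs (G t) <= B.
  rewrite -[G t](subrK (G 0)); apply: le_trans (cabsD _ _) _; rewrite addrC lerD2l; exact: hd''.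
have h1 : cabs (F t - F 0) * cabs (G t) <= e / (2 * B) * B.
  by apply: ler_pM; rewrite ?cabs_ge0 //; exact: hd.
have h2 : cabs (F 0) * cabs (G t - G 0) <= A * (e / (2 * A)).
  by apply: ler_pM; rewrite ?cabs_ge0 ?lerDl //; exact: hd'.
have e1 : e / (2 * B) * B = e / 2 by field; rewrite gt_eqF.
have e2 : A * (e / (2 * A)) = e / 2 by field; rewrite gt_eqF.
rewrite e1 in h1; rewrite e2 in h2; clear -h1 h2; lra.
Qed.

Lemma rcontV F : F 0 != 0 -> rcont F -> rcont (fun t => (F t)^-1).
Proof.
move=> F0 hF e e0; pose a := cabs (F 0); have a0 : 0 < a by exact: cabs_gt0.
have m0 : 0 < Num.min (a / 2) (e * a ^+ 2 / 2).
  by rewrite lt_min !divr_gt0 // mulr_gt0 // exprn_gt0.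
have [d d0 hd] := hF _ m0.
exists d => // t t0 td; have := hd t t0 td; rewrite le_min => /andP[h1 h2].
  have Fa : a / 2 <= cabs (F t).
    have := cabsD (F t) (F 0 - F t); rewrite addrC subrK cabsB -/a => h.
    by clear -h h1; lra.
  have a20 : 0 < a / 2 by exact: divr_gt0.
  have Ft : F t != 0.
    by apply/eqP => z; move: Fa; rewrite z cabs0 leNgt a20.
  have -> : (F t)^-1 - (F 0)^-1 = (F 0 - F t) / (F t * F 0) by field; rewrite Ft F0.
  rewrite cabsM cabsV cabsM cabsB -/a ler_pdivrMr; last by rewrite mulr_gt0 // (lt_le_trans a20 Fa).
  apply: le_trans h2 _; rewrite -mulrA; apply: ler_wpM2l; first exact: ltW.
  rewrite expr2 mulrAC; apply: ler_wpM2r => //; exact: ltW.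
Qed.

Lemma rcont_sum (I : Type) (r : seq I) (P : pred I) (F : I -> R -> C) :
  (forall i, rcont (F i)) -> rcont (fun t => \sum_(i <- r | P i) F i t).
Proof.
move=> h; elim: r => [|i r IH]; first by apply: eq_rcont (rcont_cst 0) => t; rewrite big_nil.
case Pi : (P i); last by apply: eq_rcont IH => t; rewrite big_cons Pi.
by apply: eq_rcont (rcontD (h i) IH) => t; rewrite big_cons Pi.
Qed.

Lemma rcont_prod (I : Type) (r : seq I) (P : pred I) (F : I -> R -> C) :
  (forall i, rcont (F i)) -> rcont (fun t => \prod_(i <- r | P i) F i t).
Proof.
move=> h; elim: r => [|i r IH]; first by apply: eq_rcont (rcont_cst 1) => t; rewrite big_nil.
case Pi : (P i); last by apply: eq_rcont IH => t; rewrite big_cons Pi.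
by apply: eq_rcont (rcontM (h i) IH) => t; rewrite big_cons Pi.
Qed.

Definition rcont_mx m k (A : R -> 'M[C]_(m, k)) := forall i j, rcont (fun t => A t i j).

Lemma rcont_mxM m k l (A : R -> 'M[C]_(m, k)) (B : R -> 'M[C]_(k, l)) :
  rcont_mx A -> rcont_mx B -> rcont_mx (fun t => A t *m B t).
Proof.
move=> hA hB i j; apply: (@eq_rcont (fun t => \sum_x A t i x * B t x j)) => [t|]; first by rewrite mxE.
by apply: rcont_sum => x; exact: rcontM.
Qed.

Lemma rcont_mxD m k (A B : R -> 'M[C]_(m, k)) :
  rcont_mx A -> rcont_mx B -> rcont_mx (fun t => A t + B t).
Proof.
move=> hA hB i j; apply: (@eq_rcont (fun t => A t i j + B t i j)) => [t|]; first by rewrite mxE.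
exact: rcontD.
Qed.

Lemma rcont_mx_cst m k (A : 'M[C]_(m, k)) : rcont_mx (fun=> A).
Proof. by move=> i j; exact: rcont_cst. Qed.

Lemma rcont_det m (A : R -> 'M[C]_m) : rcont_mx A -> rcont (fun t => \det (A t)).
Proof.
move=> hA; apply: rcont_sum => s; apply: rcontM; first exact: rcont_cst.
by apply: rcont_prod.
Qed.

Lemma rcont_invmx m (A : R -> 'M[C]_m) : (forall t, 0 <= t -> A t \in unitmx) ->
  rcont_mx A -> rcont_mx (fun t => invmx (A t)).
Proof.
move=> uA hA i j.
have h : rcont (fun t => (\det (A t))^-1 * ((-1) ^+ (j + i) * \det (row' j (col' i (A t))))).
  apply: rcontM; first by apply: rcontV; [rewrite -unitfE -unitmxE; exact: uA|exact: rcont_det].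
  apply: rcontM; first exact: rcont_cst.
  apply: rcont_det => k l; apply: (@eq_rcont (fun t => A t (lift j k) (lift i l))) => // t.
  by rewrite !mxE.
move=> e e0; have [d d0 hd] := h e e0; exists d => // t t0 td.
have E s : 0 <= s -> invmx (A s) i j = (\det (A s))^-1 * ((-1) ^+ (j + i) * \det (row' j (col' i (A s)))).
  by move=> s0; rewrite /invmx (uA s s0) mxE mxE.
have := hd t t0 td; by rewrite -(E t t0) -(E 0 (lexx 0)).
Qed.
End RightContinuity.

(** * Theta is not identically zero near the origin of a ray *)

Section ThetaDensity.
Variables (R : realType) (n : nat).
Hypothesis n_gt0 : (0 < n)%N.
Local Notation C := R[i].
Implicit Types (z w : 'M[C]_n).

Definition up (t : R) z : 'M[C]_n := z + (t%:C * 'i%C)%:M.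

Lemma up_Hn t z : 0 <= t -> Hn z -> Hn (up t z).
Proof.
move=> t0 [zz pd]; split; first by rewrite /up linearD /= zz tr_scalar_mx.
move=> v v0; have -> : map_mx (@complex.Im R) (up t z) = map_mx (@complex.Im R) z + t%:M.
  apply/matrixP => i j; rewrite !mxE ImD; congr (_ + _).
  by case: (i == j); rewrite ?mulr1n ?mulr0n //= mulr1 mul0r addr0.
rewrite mulmxDr mulmxDl mxE; apply: ltr_wpDr; last exact: pd.
rewrite mul_mx_scalar -scalemxAl mxE mulr_ge0 // mxE; apply: sumr_ge0 => i _.
by rewrite mxE -expr2 sqr_ge0.
Qed.

Lemma up0 z : up 0 z = z.
Proof. by rewrite /up rmorph0 mul0r raddf0 addr0. Qed.

Definition nsq (x : 'rV[int]_n) : nat := (\sum_i `|x ord0 i| ^ 2)%N.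

Lemma nsqE x : (nsq x)%:R = l2 R x.
Proof.
rewrite /nsq /l2 natr_sum; apply: eq_bigr => i _; rewrite natrX -[RHS]real_normK ?num_real // -intr_norm; congr (_ ^+ 2).
Qed.

Lemma tt_up z t x : tt (up t z) 0 x = tt z 0 x * (expR (- (pi * t)))%:C ^+ nsq x.
Proof.
have d0 : dot (zC R x) 0 = 0 by rewrite /dot trmx0 mulmx0 mxE.
rewrite /tt d0 !addr0.
have -> : quad (up t z) (zC R x) (zC R x) = quad z (zC R x) (zC R x) + (t * l2 R x)%:C * 'i%C.
  rewrite /quad /up mulmxDr mulmxDl mxE; congr (_ + _).
  rewrite mul_mx_scalar -scalemxAl mxE -/(dot _ _) dot_zC rmorphM /= -mulrA mulrAC mulrA; congr (_ * _ * _).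
  rewrite dotE /l2 rmorph_sum rmorph_sum /=; apply: eq_bigr => i _.
  by rewrite rmorphXn /= rmorph_int expr2 rmorphM.
rewrite mulrDr expCD; congr (_ * _).
rewrite -rmorphXn /= -expRM_natl nsqE.
have e2 : (2^-1 : C) = (2^-1 : R)%:C by rewrite fmorphV rmorph_nat.
rewrite e2 mulrA -rmorphM /=; set a := 2^-1 * (t * l2 R x).
rewrite /expC.
have -> : complex.Im (a%:C * 'i%C) = a by rewrite /= mulr1 mul0r addr0.
have -> : complex.Re (a%:C * 'i%C) = 0 by rewrite /= mulr0 mul0r subr0.
rewrite mulr0 cos0 sin0 [X in _ * X](_ : _ = 1) // mulr1; congr (expR _)%:C.
by rewrite /a; field.
Qed.

Lemma theta_dense z e : Hn z -> 0 < e -> exists t, [/\ 0 <= t, t <= e & theta (up t z) != 0].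
Proof.
move=> hz e0; have [a a0 ha] := tt_bound n_gt0 hz.
have [|K hK] := @gauss_dom R n (a / 2) 0 (divr_gt0 a0 (ltr0Sn _ 1)) => //.
(* (1 + d)^(|x|^2) = exp(a |x|^2 / 2) uses up half of the Gaussian decay, and the other half remains
   summable. *)
pose d := expR (a / 2) - 1.
have d0 : 0 < d by rewrite subr_gt0 -expR0 ltr_expR divr_gt0.
have dom (B : seq 'rV[int]_n) : uniq B -> \sum_(x <- B) cabs (tt z 0 x) * (1 + d) ^+ nsq x <= `|K|.
  move=> uB; apply: le_trans (le_trans (hK B uB) (ler_norm _)).
  apply: ler_sum => x _; rewrite mul0r addr0 /d addrC subrK -expRM_natl nsqE.
  apply: (@le_trans _ _ (expR (- a * l2 R x) * expR (l2 R x * (a / 2)))).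
    apply: ler_wpM2r; first exact: expR_ge0.
    by have := ha 0 x; rewrite vn0 mulr0 mul0r addr0.
  by rewrite -expRD ler_expR; lra.
pose P (y : R) := xget 0 [set s | hasS (fun x => tt z 0 x * y%:C ^+ nsq x) s].
have hP y : 0 <= y -> y <= 1 -> hasS (fun x => tt z 0 x * y%:C ^+ nsq x) (P y).
  move=> y0 y1; apply: (@xgetPex _ _ [set s | hasS _ s]).
  apply: (@hasS_ex _ _ _ `|K|) => B uB; apply: le_trans (dom B uB).
  apply: ler_sum => x _; rewrite cabsM; apply: ler_wpM2l; first exact: cabs_ge0.
  rewrite cabsX cabsR ger0_norm //; apply: lerXn2r; rewrite ?nnegrE //; last by clear -y1 d0; lra.
  by rewrite addr_ge0 // ltW.
have pi0 : 0 < pi :> R := pi_gt0 R.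
have [||||||y /andP[ya y1] Py] := @nonvanishing _ _ (tt z 0) nsq d `|K| d0 (normr_ge0 _) dom P hP 0
   (expR (- (pi * e))) 1 => //.
- by rewrite /nsq big1 // => i _; rewrite mxE.
- move=> x /eqP; rewrite /nsq sum_nat_eq0 => /forallP h; apply/rowP => i; rewrite mxE.
  by have := h i; rewrite expn_eq0 /= andbT absz_eq0 => /eqP.
- exact: expC_neq0.
- by rewrite -[ltRHS]expR0 ltr_expR oppr_lt0 mulr_gt0.
have y0 : 0 < y by apply: lt_le_trans ya; exact: expR_gt0.
exists (- ln y / pi); split.
- by rewrite divr_ge0 ?(ltW pi0) // oppr_ge0 ln_le0.
- by rewrite ler_pdivrMr // lerNl -ler_expR lnK // mulrC.
have t0 : 0 <= - ln y / pi by rewrite divr_ge0 ?(ltW pi0) // oppr_ge0 ln_le0.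
rewrite theta_th ?(thE n_gt0 (s := P y)) //; try exact: up_Hn.
apply: eq_hasS (hP y (ltW y0) y1) => x; rewrite tt_up; congr (_ * (_)%:C ^+ _).
by rewrite mulrC divfK ?gt_eqF // opprK lnK.
Qed.
End ThetaDensity.

(** * Continuity of theta and transport of the factor of automorphy *)

Section ThetaContinuity.
Variables (R : realType) (n : nat).
Hypothesis n_gt0 : (0 < n)%N.
Local Notation C := R[i].
Implicit Types (z w : 'M[C]_n).

Lemma expC_sub1 : exists K1 K2 : R, [/\ 0 < K1, 0 < K2 & forall s : C,
  cabs (expC s - 1) <= K1 * cabs s * expR (K2 * cabs s)].
Proof.
have [k k0 hk] := @expC_taylor2 R; exists (cabs (tpi R) + 1), (2 * k); split.
- by apply: ltr_wpDl => //; exact: cabs_ge0.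
- exact: mulr_gt0.
move=> s; have := hk s; set u := cabs s => h; have u0 : 0 <= u := cabs_ge0 s.
have h1 : cabs (expC s - 1) <= cabs (tpi R) * u + k * u ^+ 2 * expR (k * u).
  have -> : expC s - 1 = tpi R * s + (expC s - 1 - tpi R * s) by ring.
  by apply: le_trans (cabsD _ _) _; rewrite cabsM lerD2l.
have ku : k * u <= expR (k * u) by apply: le_trans (expR_ge1Dx _); rewrite lerDr.
have e1 : 1 <= expR (2 * k * u).
  by rewrite -[leLHS]expR0 ler_expR !mulr_ge0 // ltW.
have ee : expR (2 * k * u) = expR (k * u) * expR (k * u) by rewrite -expRD; congr expR; ring.
apply: le_trans h1 _; rewrite mulrDl mul1r mulrDl; apply: lerD.
  by rewrite ler_peMr // mulr_ge0 // cabs_ge0.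
rewrite ee expr2 !mulrA; apply: ler_wpM2r; first exact: expR_ge0.
rewrite mulrAC; apply: le_trans (_ : expR (k * u) * u <= _); first exact: ler_wpM2r.
by rewrite mulrC.
Qed.

(** Within the radius a / (4 K2) the perturbation of a term costs a factor exp(a |x|^2 / 4), and a
    second such factor pays for |x|^2; half of the decay exp(- a |x|^2) is left. *)
Lemma theta_diff z : Hn z -> exists2 M : R, 0 < M & exists2 e : R, 0 < e & forall w, Hn w ->
  \sum_i \sum_j cabs (w i j - z i j) <= e ->
  cabs (theta w - theta z) <= M * \sum_i \sum_j cabs (w i j - z i j).
Proof.
move=> hz; have [a a0 ha] := tt_bound n_gt0 hz.
have [K1 [K2 [K10 K20 hK]]] := expC_sub1.
have [|K hK'] := @gauss_dom R n (a / 2) 0 (divr_gt0 a0 (ltr0Sn _ 1)) => //.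
have K'0 : 0 < `|K| + 1 by rewrite ltr_wpDl.
exists (K1 * (4 / a) * (`|K| + 1)).
  by apply: mulr_gt0 => //; apply: mulr_gt0 => //; exact: divr_gt0.
exists (a / (4 * K2)); first by rewrite divr_gt0 // mulr_gt0.
move=> w hw; set dl := \sum_i _ => dle.
have dl0 : 0 <= dl by apply: sumr_ge0 => i _; apply: sumr_ge0 => j _; exact: cabs_ge0.
rewrite (theta_th n_gt0 hw) (theta_th n_gt0 hz).
have H := hasSD (thP n_gt0 0 hw) (hasSZ (-1) (thP n_gt0 0 hz)); rewrite mulN1r in H.
apply: (hasS_bound (g := fun x => K1 * (4 / a) * dl * expR (- (a / 2) * l2 R x + 0 * l1 R x))) H => [x|B uB]; last first.
  rewrite -mulr_sumr -[leRHS]mulrA [X in _ <= _ * X]mulrC [leRHS]mulrA; apply: ler_wpM2l.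
    apply: mulr_ge0 => //; apply: mulr_ge0; first exact: ltW.
    by rewrite ltW // divr_gt0.
  apply: le_trans (hK' B uB) _.
  by apply: le_trans (ler_norm _) _; rewrite lerDl.
rewrite mul0r addr0 mulN1r.
have d0 : dot (zC R x) 0 = 0 by rewrite /dot trmx0 mulmx0 mxE.
set s : C := 2^-1 * quad (w - z) (zC R x) (zC R x).
have E : tt w 0 x - tt z 0 x = tt z 0 x * (expC s - 1).
  rewrite mulrBr mulr1; congr (_ - _); rewrite /tt d0 !addr0 -expCD; congr expC.
  by rewrite /s /quad mulmxBr mulmxBl [X in _ = _ + 2^-1 * X]mxE [X in _ = _ + 2^-1 * (_ + X)]mxE; ring.
have l20 : 0 <= l2 R x by apply: sumr_ge0 => i _; exact: sqr_ge0.
have hs : cabs s <= dl * l2 R x.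
  rewrite /s cabsM cabsV (cabs_nat R 2).
  apply: le_trans (_ : cabs (quad (w - z) (zC R x) (zC R x)) <= _).
    by apply: ler_piMl; [exact: cabs_ge0|rewrite invf_le1 ?ler1n].
  rewrite /quad quadE; apply: le_trans (cabs_sum _ _ _) _; rewrite mulr_suml; apply: ler_sum => i _.
  apply: le_trans (cabs_sum _ _ _) _; rewrite mulr_suml; apply: ler_sum => j _.
  rewrite !cabsM mulrAC mulrC [(w - z) i j]mxE [(- z) i j]mxE; apply: ler_wpM2l; first exact: cabs_ge0.
  have cx t : cabs (zC R x 0 t) ^+ 2 <= l2 R x.
    rewrite mxE -(rmorph_int (real_complex R)) cabsR real_normK ?num_real //.
    by rewrite /l2 (bigD1 t) //= lerDl; apply: sumr_ge0 => j' _; exact: sqr_ge0.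
  have := cx i; have := cx j; move: (cabs _) (cabs _) (l2 R x) => p q r h1 h2.
  by have := sqr_ge0 (p - q); clear -h1 h2; nra.
rewrite E cabsM.
have e1 : cabs (tt z 0 x) <= expR (- a * l2 R x).
  by have := ha 0 x; rewrite vn0 mulr0 mul0r addr0.
have e2 : cabs (expC s - 1) <= K1 * (dl * l2 R x) * expR (a / 4 * l2 R x).
  apply: le_trans (hK s) _; apply: ler_pM; rewrite ?mulr_ge0 ?cabs_ge0 ?expR_ge0 ?(ltW K10) //.
    by apply: ler_wpM2l => //; exact: ltW.
  rewrite ler_expR; apply: le_trans (_ : K2 * (dl * l2 R x) <= _).
    by apply: ler_wpM2l => //; exact: ltW.
  rewrite mulrA; apply: ler_wpM2r => //.
  by move: dle; rewrite ler_pdivlMr ?mulr_gt0 // ler_pdivlMr // => h; clear -h; lra.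
have e3 : l2 R x <= 4 / a * expR (a / 4 * l2 R x).
  rewrite -[4 / a]invf_div mulrC ler_pdivlMr ?divr_gt0 // mulrC.
  by apply: le_trans (expR_ge1Dx _); rewrite lerDr.
apply: le_trans (ler_pM (cabs_ge0 _) (cabs_ge0 _) e1 e2) _.
apply: le_trans (_ : expR (- a * l2 R x) * (K1 * (dl * (4 / a * expR (a / 4 * l2 R x))) * expR (a / 4 * l2 R x)) <= _).
  apply: ler_wpM2l; first exact: expR_ge0.
  apply: ler_wpM2r; first exact: expR_ge0.
  by apply: ler_wpM2l; [exact: ltW|exact: ler_wpM2l].
have -> : expR (- (a / 2) * l2 R x) = expR (- a * l2 R x) * expR (a / 4 * l2 R x) * expR (a / 4 * l2 R x).
  by rewrite -!expRD; congr expR; field.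
rewrite le_eqVlt; apply/orP; left; apply/eqP.
by move: (expR _) (expR _) (4 / a) => u v t; ring.
Qed.

Lemma theta_rcont (Z : R -> 'M[C]_n) : (forall t, 0 <= t -> Hn (Z t)) -> rcont_mx Z ->
  rcont (fun t => theta (Z t)).
Proof.
move=> hZ cZ e e0; have [M M0 [d d0 hd]] := theta_diff (hZ 0 (lexx _)).
have c : rcont (fun t => \sum_i \sum_j (cabs (Z t i j - Z 0 i j))%:C).
  apply: rcont_sum => i; apply: rcont_sum => j e' e'0; have [d' d'0 h] := cZ i j e' e'0.
  by exists d' => // t t0 td; rewrite [Z 0 i j - _]subrr cabs0 rmorph0 subr0 cabsR ger0_norm ?cabs_ge0 //; exact: h.
have m0 : 0 < Num.min d (e / M) by rewrite lt_min d0 divr_gt0.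
have [d' d'0 h] := c _ m0; exists d' => // t t0 td.
have := h t t0 td; rewrite [X in _ - X]big1 => [|i _]; last first.
  by rewrite big1 // => j _; rewrite subrr cabs0.
rewrite subr0; have -> : \sum_i \sum_j (cabs (Z t i j - Z 0 i j))%:C =
   (\sum_i \sum_j cabs (Z t i j - Z 0 i j))%:C.
  by rewrite rmorph_sum; apply: eq_bigr => i _; rewrite rmorph_sum.
rewrite cabsR ger0_norm; last by apply: sumr_ge0 => i _; apply: sumr_ge0 => j _; exact: cabs_ge0.
rewrite le_min => /andP[h1 h2]; apply: le_trans (hd _ (hZ t t0) h1) _.
by rewrite mulrC -ler_pdivlMr.
Qed.

Lemma up_rcont z : rcont_mx (fun t => up t z).
Proof.
apply: rcont_mxD; first exact: rcont_mx_cst.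
move=> i j e e0; exists e => // t t0 te; rewrite !mxE.
apply: le_trans te; rewrite rmorph0 mul0r mul0rn subr0.
case: (i == j); last by rewrite mulr0n cabs0.
by rewrite mulr1n cabsM cabs_i mulr1 cabsR ger0_norm.
Qed.

Lemma act_rcont g (Z : R -> 'M[C]_n) : Sp g -> (forall t, 0 <= t -> Hn (Z t)) -> rcont_mx Z ->
  rcont_mx (fun t => act g (Z t)).
Proof.
move=> hg hZ cZ; have aff (A B : 'M[C]_n) : rcont_mx (fun t => A *m Z t + B).
  by apply: rcont_mxD (rcont_mx_cst _); apply: rcont_mxM => //; exact: rcont_mx_cst.
apply: rcont_mxM; first exact: aff.
apply: rcont_invmx; last exact: aff.
by move=> t t0; apply: cd_unit => //; exact: hZ.
Qed.

Lemma rcont_eq0 (F : R -> C) : rcont F -> (forall e : R, 0 < e -> exists t, [/\ 0 <= t, t <= e & F t = 0]) -> F 0 = 0.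
Proof.
move=> cF h; apply: cabs_small => e e0; have [d d0 hd] := cF e e0.
have [t [t0 td Ft]] := h d d0; by have := hd t t0 td; rewrite Ft sub0r cabsN.
Qed.

Lemma pos_real (r : C) : 0 < r -> r = (complex.Re r)%:C.
Proof. by case: r => a b; rewrite ltcE /= => /andP[/eqP e _]; rewrite e. Qed.

Lemma holomorphic_rcont (h : 'M[C]_n -> C) z : holomorphic h -> Hn z -> rcont (fun t => h (up t z)).
Proof.
move=> hh hz e e0; have := hh z hz => /differentiable_continuous.
set F := fun w : 'M[C]_n => _ => cF.
have FE t : 0 <= t -> F (up t z) = h (up t z).
  move=> t0; rewrite /F; have [-> _] := up_Hn t0 hz; congr h.
  by move: (up t z) => w; apply/matrixP => i j; rewrite !mxE; field.
have e0' : 0 < e%:C by rewrite ltcR.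
have := cF; rewrite /prop_for /continuous_at => /cvgrPdist_le/(_ _ e0')/nbhs_ballP[r /= r0 hr].
have rE : r = (complex.Re r)%:C by exact: pos_real.
have r0' : 0 < complex.Re r by rewrite rE ltcR in r0.
exists (complex.Re r / 2) => [|t t0 td]; first exact: divr_gt0.
have : `|F z - F (up t z)| <= e%:C.
  apply: hr; split=> // i j; rewrite /ball /= /up !mxE opprD addNKr normrN.
  rewrite cabsE rE ltcR; case: (i == j); last by rewrite mulr0n cabs0.
  rewrite mulr1n cabsM cabs_i mulr1 cabsR ger0_norm //; apply: le_lt_trans td _.
  by rewrite ltr_pdivrMr // ltr_pMr // ltr1n.
rewrite FE // -[z in F z](up0 z) FE // cabsE lecR.
by rewrite cabsB up0.
Qed.

Lemma differentiable_linmx (V : normedModType C) (L : {linear 'M[C]_n -> V}) (z : 'M[C]_n) :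
  differentiable (L : ('M[C]_n : normedModType C) -> V) (z : ('M[C]_n : normedModType C)).
Proof.
have -> : (L : ('M[C]_n : normedModType C) -> V) =
    \sum_i \sum_j (fun w : ('M[C]_n : normedModType C) => w i j *: L (delta_mx i j)).
  apply/funext => w; rewrite fct_sumE [in LHS](matrix_sum_delta w) linear_sum; apply: eq_bigr => i _.
  by rewrite fct_sumE linear_sum; apply: eq_bigr => j _; rewrite linearZ.
apply: differentiable_sum => i; apply: differentiable_sum => j.
by apply: differentiableZl; exact: differentiable_coord.
Qed.

(** An affine map preserving symmetric matrices absorbs the projection w -> (w + w^T) / 2 through
    which holomorphy is stated, so the composite is a function on matrix space composed with an
    affine map. *)
Lemma holomorphic_affine (P Q S : 'M[C]_n) (h : 'M[C]_n -> C) :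
  (forall z, Hn z -> Hn (P *m z *m Q + S)) -> (forall z, z^T = z -> (P *m z *m Q + S)^T = P *m z *m Q + S) ->
  holomorphic h -> holomorphic (fun z => h (P *m z *m Q + S)).
Proof.
move=> hH hS hh z hz; pose A (w : ('M[C]_n : normedModType C)) : ('M[C]_n : normedModType C) :=
  P *m (2^-1 *: (w + w^T)) *m Q + S.
pose F (w : ('M[C]_n : normedModType C)) : C^o := h (2^-1 *: (w + w^T)).
have sym (w : 'M[C]_n) : w^T = w -> 2^-1 *: (w + w^T) = w.
  by move=> ->; apply/matrixP => i j; rewrite !mxE; field.
have -> : (fun w : 'M[C]_n => h (P *m (2^-1 *: (w + w^T)) *m Q + S) : C^o) = F \o A.
  apply/funext => w; rewrite /F /A /= [RHS](congr1 h (sym _ _)) //; apply: hS.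
  by rewrite linearZ linearD /= trmxK; congr (_ *: _); exact: addrC.
have dA : differentiable A (z : ('M[C]_n : normedModType C)).
  pose L (w : 'M[C]_n) : 'M[C]_n := P *m (2^-1 *: (w + w^T)) *m Q.
  have linL : linear L.
    move=> a u v; rewrite /L.
    have -> : 2^-1 *: ((a *: u + v) + (a *: u + v)^T) = a *: (2^-1 *: (u + u^T)) + 2^-1 *: (v + v^T).
      by apply/matrixP => i j; rewrite !mxE; ring.
    by rewrite mulmxDr -scalemxAr mulmxDl -scalemxAl.
  pose L' : {linear 'M[C]_n -> 'M[C]_n} := HB.pack L (GRing.isLinear.Build _ _ _ _ L linL).
  have := differentiableD (@differentiable_linmx ('M[C]_n : normedModType C) L' z) (differentiable_cst (S : ('M[C]_n : normedModType C)) z).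
  by congr (differentiable _ _).
apply: differentiable_comp dA _.
have [zz _] := hz.
have -> : A z = P *m z *m Q + S by rewrite /A sym.
exact: (hh _ (hH z hz)).
Qed.

Lemma holomorphic_cst (a : C) : holomorphic (fun _ : 'M[C]_n => a).
Proof. by move=> z _; exact: differentiable_cst. Qed.

Lemma holomorphicD (h h' : 'M[C]_n -> C) : holomorphic h -> holomorphic h' -> holomorphic (fun z => h z + h' z).
Proof. by move=> H H' z hz; exact: (differentiableD (H z hz) (H' z hz)). Qed.

Lemma holomorphicZ a (h : 'M[C]_n -> C) : holomorphic h -> holomorphic (fun z => a * h z).
Proof. by move=> H z hz; exact: (differentiableZ a (H z hz)). Qed.

Lemma holomorphic_sum (I : Type) (r : seq I) (h : I -> 'M[C]_n -> C) :
  (forall i, holomorphic (h i)) -> holomorphic (fun z => \sum_(i <- r) h i z).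
Proof.
move=> H; elim: r => [|i r IH].
  rewrite (_ : (fun _ => _) = fun=> 0); first exact: holomorphic_cst.
  by apply/funext => z; rewrite big_nil.
rewrite (_ : (fun _ => _) = fun z => h i z + \sum_(i <- r) h i z); first exact: holomorphicD.
by apply/funext => z; rewrite big_cons.
Qed.

(** The set from which [hfac] is chosen. *)
Definition hset (g : 'M[rat]_(n + n)) : set ('M[C]_n -> C) := [set h | holomorphic h /\
   forall z, Hn z -> h z * theta z = theta (act g z)].

Lemma hfacP g h : hset g h -> hset g (hfac g).
Proof. by move=> hh; apply: (@xgetPex _ _ (hset g)); exists h. Qed.

(* [theta] may vanish at [z], but not on a whole initial segment of the ray [up t z]. *)
Lemma cancel_theta (F G : 'M[C]_n -> C) z : Hn z ->
  rcont (fun t => F (up t z)) -> rcont (fun t => G (up t z)) ->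
  (forall w, Hn w -> theta w != 0 -> F w = G w) -> F z = G z.
Proof.
move=> hz cF cG h; apply/eqP; rewrite -subr_eq0 -[z](up0 z); apply/eqP.
apply: (@rcont_eq0 (fun t => F (up t z) - G (up t z))).
  apply: rcontD => //; apply: (@eq_rcont _ (fun t => -1 * G (up t z))) => [t|]; first by rewrite mulN1r.
  by apply: rcontM => //; exact: rcont_cst.
move=> e e0; have [t [t0 te nt]] := theta_dense n_gt0 hz e0.
by exists t; split=> //; rewrite h ?subrr //; exact: up_Hn.
Qed.

Lemma hset_uniq g h h' z : hset g h -> hset g h' -> Hn z -> h z = h' z.
Proof.
move=> [H e] [H' e'] hz; apply: cancel_theta => //; try exact: holomorphic_rcont.
by move=> w hw nw; apply: (mulIf nw); rewrite e // e'.
Qed.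

Lemma up_rcont_act g z : Sp g -> Hn z -> rcont (fun t => theta (act g (up t z))).
Proof.
move=> hg hz; apply: theta_rcont; last first.
  by apply: act_rcont => //; [move=> t t0; exact: up_Hn|exact: up_rcont].
by move=> t t0; apply: act_Hn => //; exact: up_Hn.
Qed.

(* The hypothesis [star] is the identity theta(A' g z) theta(z) = theta(g z) theta(A z) for the affine maps *)
(* A' and A given by the Siegel parabolic elements s and s'; it determines hfac of [s g s'^-1] from that of g. *)
Lemma hfac_transfer g g' s' (a : R) (S : 'M[C]_n) : Sp g -> Sp g' -> Sp s' -> 0 < a -> S^T = S ->
  (forall z, Hn z -> act s' z = a%:C *: (z + S)) ->
  (forall z, Hn z -> Hn (a%:C *: (z + S)) /\ Hn (a%:C^-1 *: z - S)) ->
  (forall z, Hn z -> theta (act g' (act s' z)) * theta z = theta (act g z) * theta (act s' z)) ->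
  forall z, Hn z -> hfac g' (act s' z) = hfac g z.
Proof.
move=> hg hg' hs a0 SS sE hA star; have aC0 : a%:C != 0 by rewrite fmorph_eq0 gt_eqF.
pose A z := a%:C *: (z + S); pose B z := a%:C^-1 *: z - S.
have AK z : A (B z) = z by rewrite /A /B addrNK scalerA mulfV // scale1r.
have BK z : B (A z) = z by rewrite /A /B scalerA mulVf // scale1r addrK.
have holoA h : holomorphic h -> holomorphic (h \o A).
  move=> hh; have e z : A z = a%:C%:M *m z *m 1%:M + a%:C *: S.
    by rewrite mulmx1 mul_scalar_mx -scalerDr.
  rewrite (_ : h \o A = fun z => h (a%:C%:M *m z *m 1%:M + a%:C *: S)); last first.
    by apply/funext => z; rewrite /= e.
  apply: holomorphic_affine => // z hz; rewrite -e; first by have [] := hA z hz.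
  by rewrite /A linearZ linearD /= hz SS.
have holoB h : holomorphic h -> holomorphic (h \o B).
  move=> hh; have e z : B z = (a%:C^-1)%:M *m z *m 1%:M - S.
    by rewrite mulmx1 mul_scalar_mx.
  rewrite (_ : h \o B = fun z => h ((a%:C^-1)%:M *m z *m 1%:M - S)); last first.
    by apply/funext => z; rewrite /= e.
  apply: holomorphic_affine => // z hz; rewrite -e; first by have [] := hA z hz.
  by rewrite /B linearB linearZ /= hz SS.
(* Solutions are carried from g to g' by the inverse affine map B, and back by A in [T2]; the
   identity is first proved where theta does not vanish and extended by [cancel_theta]. *)
have T1 h : hset g h -> hset g' (h \o B).
  move=> [hh e]; split; first exact: holoB.
  move=> w hw /=; have hz : Hn (B w) by have [] := hA w hw.
  have wE : w = act s' (B w) by rewrite sE // -/(A _) AK.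
  rewrite {2 3}wE; apply: (@cancel_theta (fun z => h z * theta (act s' z)) (fun z => theta (act g' (act s' z)))) => //.
  - by apply: rcontM; [exact: holomorphic_rcont|exact: up_rcont_act].
  - apply: theta_rcont => [t t0|]; first exact: (act_Hn hg' (act_Hn hs (up_Hn t0 hz))).
    have h' t : 0 <= t -> Hn (act s' (up t (B w))) by move=> t0; apply: act_Hn => //; exact: up_Hn.
    apply: act_rcont => //; apply: act_rcont => //; [by move=> t t0; exact: up_Hn|exact: up_rcont].
  - move=> z hz' nz; apply: (mulIf nz); etransitivity; last exact: (esym (star z hz')).
    etransitivity; first exact: (mulrAC (h z) (theta (act s' z)) (theta z)).
    exact: (congr1 (fun u => u * theta (act s' z)) (e z hz')).
  have T2 h : hset g' h -> hset g (h \o A).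
  move=> [hh e]; split; first exact: holoA.
  move=> z hz; rewrite -[z]BK; have hw : Hn (A z) by have [] := hA z hz.
  have : forall w, Hn w -> Hn (B w) by move=> w hw'; have [] := hA w hw'.
  move: (A z) hw => w hw hB.
  have BA : rcont_mx (fun t => B (up t w)).
    apply: rcont_mxD (rcont_mx_cst _) => i j.
    apply: (@eq_rcont _ (fun t => a%:C^-1 * up t w i j)) => [t|]; first by rewrite [RHS]mxE.
    by apply: rcontM; [exact: rcont_cst|exact: up_rcont].
  have hBt t : 0 <= t -> Hn (B (up t w)) by move=> t0; apply: hB; exact: up_Hn.
  apply: (@cancel_theta (fun w => h (A (B w)) * theta (B w)) (fun w => theta (act g (B w)))) => //.
  - apply: rcontM; last exact: theta_rcont.
    apply: (@eq_rcont _ (fun t => h (up t w))) => [t|]; first by rewrite AK.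
    exact: holomorphic_rcont.
  - apply: theta_rcont => [t t0|]; first by apply: act_Hn => //; exact: hBt.
    exact: act_rcont.
  - move=> v hv nv; apply: (mulIf nv).
    have := star _ (hB v hv); rewrite (sE _ (hB v hv)) (AK v : a%:C *: (B v + S) = v) => E.
    have -> : A (B v) = v := AK v.
    etransitivity; last exact: E.
    etransitivity; first exact: (mulrAC (h v) (theta (B v)) (theta v)).
    exact: (congr1 (fun u => u * theta (B v)) (e v hv)).
move=> z hz; rewrite sE // -/(A z).
(* If there is no solution for g there is none for g', and both factors take the default value 1. *)
have [[h hh]|no] := pselect (exists h, hset g h).
  have H := T1 _ (hfacP hh); rewrite (hset_uniq (hfacP H) H); last by have [] := hA z hz.
  by rewrite /= BK.
have n1 : forall h, ~ hset g h by move=> h hh; apply: no; exists h.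
have n2 : forall h, ~ hset g' h by move=> h /T2; exact: n1.
by rewrite (xgetPN (fun=> 1) n1 : hfac g = _) (xgetPN (fun=> 1) n2 : hfac g' = _).
Qed.

Lemma hfac_theta_invariant g z : Hn z -> (forall w, Hn w -> theta (act g w) = theta w) -> hfac g z = 1.
Proof.
move=> hz e; have H : hset g (fun=> 1).
  by split=> [|w hw]; [exact: holomorphic_cst|rewrite mul1r e].
exact: hset_uniq (hfacP H) H hz.
Qed.
End ThetaContinuity.

(** * Strong approximation and the action of the Hecke algebra *)

Section Adeles.
Variable R : realType.
Local Notation C := R[i].
Variable psi : adele_tuple R -> C.
Hypothesis psi_hecke : hecke_character psi.

Lemma at_prime_idele (q : primeT) (x : padic q) : x != 0 -> is_idele (at_prime R x).
Proof.
move=> x0; split=> /=; first exact: oner_neq0.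
  move=> l; case: (dfwithP (fun l : primeT => (1 : padic l)) x) => // j _; exact: oner_neq0.
apply: (@sub_finite_set _ _ [set q]); last exact: finite_set1.
move=> l /= h; apply: contrapT => ne; apply: h; rewrite dfwithout; first exact: Zq_unit1.
by apply/eqP => e; apply: ne.
Qed.

Lemma at_primeM (q : primeT) (x y : padic q) :
  at_prime R (x * y) = idele_mul (at_prime R x) (at_prime R y).
Proof.
rewrite /at_prime /idele_mul /= mulr1; congr (_, _); apply/functional_extensionality_dep => l.
have [e|ne] := eqVneq q l.
  by subst l; rewrite !dfwithin.
by rewrite !dfwithout // mulr1.
Qed.

Lemma psi_at_primeM (q : primeT) (x y : padic q) : x != 0 -> y != 0 ->
  psi (at_prime R (x * y)) = psi (at_prime R x) * psi (at_prime R y).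
Proof.
by move=> x0 y0; have [h _ _ _] := psi_hecke; rewrite at_primeM h //; exact: at_prime_idele.
Qed.

Lemma psi_at_prime_neq0 (q : primeT) (x : padic q) : x != 0 -> psi (at_prime R x) != 0.
Proof.
move=> x0; have [_ h _ _] := psi_hecke; rewrite -normr_eq0 h ?oner_neq0 //; exact: at_prime_idele.
Qed.

Lemma ratr_padic_neq0 (q : primeT) (x : rat) : x != 0 -> (ratr x : padic q) != 0.
Proof. by move=> x0; rewrite (fmorph_eq0 (rq q)). Qed.

Lemma psi_idealM (c : nat) (x y : rat) : x != 0 -> y != 0 ->
  psi_ideal psi c (x * y) = psi_ideal psi c x * psi_ideal psi c y.
Proof.
move=> x0 y0; rewrite /psi_ideal -big_split /=; apply: eq_bigr => q _.
by rewrite (rmorphM (rq q)) psi_at_primeM //; exact: ratr_padic_neq0.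
Qed.

Lemma psi_ideal_neq0 (c : nat) (x : rat) : x != 0 -> psi_ideal psi c x != 0.
Proof.
move=> x0; rewrite /psi_ideal; apply: (big_ind (fun u => u != 0)) => [|u v|q _]; first exact: oner_neq0.
  exact: mulf_neq0.
by apply: psi_at_prime_neq0; exact: ratr_padic_neq0.
Qed.
End Adeles.

Lemma scaled_conj (F : fieldType) n (t : F) (x A : 'M[F]_n) :
  (t *: x)^T *m A *m (t *: x) = (t * t) *: (x^T *m A *m x).
Proof.
have -> : (t *: x)^T = t *: x^T by apply/matrixP => i j; rewrite !mxE.
by rewrite -!scalemxAl -scalemxAr scalerA.
Qed.

Lemma approx_mulV (F : fieldType) n (s : F) (x y : 'M[F]_n) : s != 0 -> x \in unitmx ->
  y *m invmx x = 1%:M + (s^-1 *: (y - x)) *m (s *: invmx x).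
Proof.
move=> s0 ux; rewrite -scalemxAl -scalemxAr scalerA mulVf // scale1r mulmxBl mulmxV //.
by rewrite addrC subrK.
Qed.

Lemma sym_approx_entry (F : fieldType) (s t u r x : F) : s != 0 -> t != 0 -> u != 0 ->
  s^-1 * (u^-1 * r - x) = - ((u * x - r) / (s * t) * (t / u)).
Proof. by move=> s0 t0 u0; field; rewrite s0 t0 u0. Qed.

Section GlobalParabolic.
Variables (n : nat) (q : primeT) (b : rat) (c : nat).
Hypothesis b0 : b != 0.
Local Notation K := (padic q).
Local Notation Q := ((val q)%:R : K).
Local Notation mx := 'M[rat]_(n + n).

Definition loc (l : primeT) m k (A : 'M[rat]_(m, k)) : 'M[padic l]_(m, k) := map_mx (rq l) A.

Lemma locM (l : primeT) m k j (A : 'M[rat]_(m, k)) (B : 'M[rat]_(k, j)) : loc l (A *m B) = loc l A *m loc l B.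
Proof. exact: map_mxM. Qed.
Lemma locV (l : primeT) m (A : 'M[rat]_m) : loc l (invmx A) = invmx (loc l A).
Proof. exact: map_invmx. Qed.
Lemma loc1 (l : primeT) m : loc l (1%:M : 'M[rat]_m) = 1%:M.
Proof. exact: map_mx1. Qed.
Lemma loc_sym (l : primeT) m (A : 'M[rat]_m) : A^T = A -> (loc l A)^T = loc l A.
Proof. by move=> AA; apply/matrixP => i j; rewrite !mxE -[in RHS]AA mxE. Qed.
Lemma loc_siegelP (l : primeT) (g : mx) : siegelP g -> siegelP (loc l g).
Proof.
move=> [hg g0]; split; first exact: map_Sp.
by rewrite /loc -map_dlsubmx g0 map_mx0.
Qed.

Definition GP : set mx := [set g | siegelP g /\ forall l : primeT, l != q -> D0 b c (loc l g)].

Lemma GPM g h : GP g -> GP h -> GP (g *m h).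
Proof.
move=> [hg lg] [hh lh]; split; first exact: siegelPM.
by move=> l lq; rewrite locM; apply: D0M => //; [exact: lg|exact: lh].
Qed.

Lemma GPV g : GP g -> GP (invmx g).
Proof.
move=> [hg lg]; split; first exact: siegelPV.
by move=> l lq; rewrite locV; apply: D0V => //; exact: lg.
Qed.

Lemma prime_ndvd (l : primeT) : l != q -> ~~ (val l %| val q)%N.
Proof. by move=> lq; rewrite dvdn_prime2 ?(valP l) ?(valP q). Qed.

Lemma in_Zq_pden (l : primeT) (r : rat) k : l != q -> r * (val q)%:R ^+ k \is a Num.int -> in_Zq (rq l r).
Proof.
move=> /prime_ndvd ql /intrP[m e].
have u : Zq_unit ((val q)%:R ^+ k : padic l).
  by elim: k {e} => [|k IH]; rewrite ?expr0 // exprS; apply: Zq_unitM => //; exact: in_Zq_unitN.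
have -> : rq l r = m%:~R * ((val q)%:R ^+ k)^-1.
  have := congr1 (rq l) e; rewrite rmorphM rmorphXn /= rmorph_nat rmorph_int => <-.
  by rewrite mulfK //; case: u.
by apply: in_ZqM; [exact: in_Zq_int|case: u => _ []].
Qed.

(** The powers of q on the diagonal are kept exactly and the entries above it are approximated in
    Z[1/q], to the precision q^k that clears T^-1. The quotient is then integral with determinant 1,
    and away from q the matrix is unimodular. *)
Lemma utri_approx (T : 'M[K]_n) (a : 'I_n -> int) :
  (forall i j : 'I_n, (j < i)%N -> T i j = 0) -> (forall i, T i i = Q ^ a i) ->
  exists T' : 'M[rat]_n, [/\ T' \in unitmx, exists2 e, GLZq e & loc q T' = e *m T
    & forall l : primeT, l != q -> GLZq (loc l T')].
Proof.
move=> up dg.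
have detT : \det T = \prod_i Q ^ a i.
  rewrite -det_tr det_trig; last by apply/is_trig_mxP => i j ij; rewrite mxE up.
  by apply: eq_bigr => i _; rewrite mxE dg.
have uT : T \in unitmx.
  rewrite unitmxE unitfE detT; apply/prodf_neq0 => i _; exact: qz_neq0.
have [k hk] : exists k, Zq_mx (Q ^+ k *: invmx T).
  have /choice[f hf] : forall ij : 'I_n * 'I_n, exists k, in_Zq (Q ^+ k * invmx T ij.1 ij.2).
    by move=> ij; exact: padic_den.
  exists (\sum_ij f ij)%N => i j; rewrite mxE (bigD1 (i, j)) //= addnC exprD -mulrA.
  by apply: in_ZqM; [exact/in_ZqX/in_Zq_nat|exact: hf (i, j)].
have /choice[f hf] : forall ij : 'I_n * 'I_n, exists r : rat,
    (exists l : nat, r * (val q)%:R ^+ l \is a Num.int) /\ in_Zq ((T ij.1 ij.2 - rq q r) / Q ^+ k).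
  by move=> ij; exact: padic_rat_approx.
pose T' : 'M[rat]_n := \matrix_(i, j) if (i < j)%N then f (i, j) else if i == j then (val q)%:R ^ a i else 0.
have up' (i j : 'I_n) : (j < i)%N -> T' i j = 0.
  by move=> ji; rewrite mxE ltnNge ltnW //= -val_eqE gtn_eqF.
have detT' : \det T' = \prod_i (val q)%:R ^ a i.
  rewrite -det_tr det_trig; last by apply/is_trig_mxP => i j ij; rewrite mxE up'.
  by apply: eq_bigr => i _; rewrite !mxE ltnn eqxx.
have q0 : (val q)%:R != 0 :> rat by rewrite pnatr_eq0 -lt0n prime_gt0 ?(valP q).
have uT' : T' \in unitmx.
  by rewrite unitmxE unitfE detT'; apply/prodf_neq0 => i _; exact: expfz_neq0.
have rqz (l : primeT) m : rq l ((val q)%:R ^ m) = (val q)%:R ^ m.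
  by rewrite (fmorphXz (rq l)) rmorph_nat.
exists T'; split => //.
- pose E := Q ^- k *: (loc q T' - T).
  have EO : Zq_mx E.
    move=> i j; rewrite !mxE; case: ltngtP => ij.
    + by have [_ h] := hf (i, j); rewrite mulrC -opprB mulNr; exact: in_ZqN.
    + have -> : (i == j) = false by apply/eqP => e; rewrite e ltnn in ij.
      rewrite up // rmorph0 subr0 mulr0; exact: in_Zq0.
    + rewrite (val_inj ij) eqxx rqz dg subrr mulr0; exact: in_Zq0.
  have eE : loc q T' *m invmx T = 1%:M + E *m (Q ^+ k *: invmx T).
    exact: approx_mulV (qX_neq0 q k) uT.
  exists (loc q T' *m invmx T); last by rewrite mulmxKV.
  apply/GLZqP; split.
    by rewrite eE; apply: Zq_mxD; [exact: Zq_mx1|exact: Zq_mxM].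
  rewrite det_mulmx det_inv det_map_mx detT' (rmorph_prod (rq q)) detT.
  rewrite (eq_bigr (fun i => Q ^ a i)) => [|i _]; last exact: rqz.
  by rewrite mulfV //; apply/prodf_neq0 => i _; exact: qz_neq0.
- move=> l lq; have uq : Zq_unit ((val q)%:R : padic l).
    by apply: in_Zq_unitN; exact: prime_ndvd.
  have uqz m : Zq_unit ((val q)%:R ^ m : padic l).
    have ux j : Zq_unit ((val q)%:R ^+ j : padic l).
      by elim: j => [|j IH]; rewrite ?expr0 // exprS; exact: Zq_unitM.
    by case: m => m; [exact: ux|rewrite NegzE -exprnN; apply: Zq_unitV; exact: ux].
  apply/GLZqP; split.
    move=> i j; rewrite !mxE; case: ltnP => ij.
      by have [[k' h] _] := hf (i, j); exact: in_Zq_pden h.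
    case: eqP => _; last by rewrite rmorph0; exact: in_Zq0.
    by rewrite rqz; have [_ []] := uqz (a i).
  rewrite det_map_mx detT' (rmorph_prod (rq l)).
  by apply: (big_ind (fun x => Zq_unit x)) => [||i _]; [exact: Zq_unit1|exact: Zq_unitM|rewrite -[Zq_unit _]/(Zq_unit (rq l _)) rqz].
Qed.

(** It is b v, not v, that is approximated in Z[1/q]: dividing by b afterwards gives the integrality
    of b v' at the other primes. Reading each entry from its ordered index pair keeps v'
    symmetric. *)
Lemma sym_approx (v : 'M[K]_n) k : v^T = v -> exists v' : 'M[rat]_n, [/\ v'^T = v',
  Zq_mx (Q ^- k *: (loc q v' - v)) & forall l : primeT, l != q -> Zq_mx (rq l b *: loc l v')].
Proof.
move=> vv.
have bK : rq q b != 0 by rewrite fmorph_eq0.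
have [e he] : exists e, in_Zq (Q ^+ e * (rq q b)^-1) by exact: padic_den.
have /choice[f hf] : forall ij : 'I_n * 'I_n, exists r : rat,
    (exists l : nat, r * (val q)%:R ^+ l \is a Num.int) /\ in_Zq ((rq q b * v ij.1 ij.2 - rq q r) / Q ^+ (k + e)).
  by move=> ij; exact: padic_rat_approx.
pose g (i j : 'I_n) := if (i <= j)%N then (i, j) else (j, i).
have gC i j : g i j = g j i by rewrite /g; case: ltngtP => // /val_inj ->.
have vg i j : v (g i j).1 (g i j).2 = v i j.
  by rewrite /g; case: leqP => //= _; rewrite -[in RHS]vv mxE.
exists (\matrix_(i, j) (b^-1 * f (g i j))); split.
- by apply/matrixP => i j; rewrite !mxE gC.
- move=> i j; rewrite !mxE rmorphM fmorphV -vg; have [_ h] := hf (g i j).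
  rewrite -[_ (f (g i j))]/(rq q (f (g i j))) -[_ b]/(rq q b).
  set r := rq q (f _); set x := v _ _.
  have -> : Q ^- k * ((rq q b)^-1 * r - x) = - (((rq q b * x - r) / Q ^+ (k + e)) * (Q ^+ e * (rq q b)^-1)).
    rewrite exprD; exact: sym_approx_entry (qX_neq0 q k) (qX_neq0 q e) bK.
  by apply: in_ZqN; exact: in_ZqM.
- move=> l lq i j; rewrite !mxE rmorphM fmorphV mulrA mulfV ?fmorph_eq0 // mul1r.
  by have [[k' h] _] := hf (g i j); exact: in_Zq_pden h.
Qed.

(** The Hermite form reduces the Levi part to a triangular matrix; both parts are then approximated
    at q by matrices integral elsewhere. *)
Lemma strong_approx (g : 'M[K]_(n + n)) : siegelP g -> exists2 g', GP g' & lc (D0 b c) (loc q g') g.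
Proof.
move=> /siegelPP[d [v [ud vv ->]]].
have [u [a [GLu up dg]]] := hermite ud.
have [d' [ud' [e GLe ee] dl]] := utri_approx up dg.
pose e' := e *m u; have GLe' : GLZq e' by exact: GLZqM.
have de : loc q d' = e' *m d by rewrite ee mulmxA.
(* A precision sufficient for the error in v to lie in b^-1 Z_q after conjugation by d^-1. *)
have [k hk] : exists k, forall A : 'M[K]_n, Zq_mx A -> Zq_mx (rq q b *: (Q ^+ k *: ((invmx d)^T *m A *m invmx d))).
  have [k hk] : exists k, Zq_mx (Q ^+ k *: invmx d).
    have /choice[f hf] : forall ij : 'I_n * 'I_n, exists k, in_Zq (Q ^+ k * invmx d ij.1 ij.2).
      by move=> ij; exact: padic_den.
    exists (\sum_ij f ij)%N => i j; rewrite mxE (bigD1 (i, j)) //= addnC exprD -mulrA.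
    by apply: in_ZqM; [exact/in_ZqX/in_Zq_nat|exact: hf (i, j)].
  have [m hm] := padic_den (rq q b).
  exists (m + (k + k))%N => A AO.
  have -> : rq q b *: (Q ^+ (m + (k + k)) *: ((invmx d)^T *m A *m invmx d)) =
     (Q ^+ m * rq q b) *: ((Q ^+ k *: invmx d)^T *m A *m (Q ^+ k *: invmx d)).
    rewrite scaled_conj !scalerA; congr (_ *: _).
    by rewrite !exprD; move: (Q ^+ m) (Q ^+ k) (rq q b) => x y t; ring.
  by apply: Zq_mxZ => //; apply: Zq_mxM => //; apply: Zq_mxM => //; exact: Zq_mx_tr.
have [v' [vv' hv' lv']] := sym_approx k vv.
exists (sg d' v').
  split; first exact: siegelP_sg.
  by move=> l lq; rewrite /loc map_sg; apply: D0_sg => //; [exact: dl|exact: loc_sym|exact: lv'].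
pose w := (invmx d)^T *m (loc q v' - v) *m invmx d.
have vvd : (loc q v' - v)^T = loc q v' - v by rewrite linearB /= vv (loc_sym _ vv').
exists (sg e' w).
  apply: D0_sg => //; first exact: sym_conj.
  have -> : rq q b *: w = rq q b *: (Q ^+ k *: ((invmx d)^T *m (Q ^- k *: (loc q v' - v)) *m invmx d)).
    rewrite -scalemxAr -scalemxAl [Q ^+ k *: _]scalerA mulfV ?scale1r //; exact: qX_neq0.
  exact: hk.
rewrite (sgM w v (GLZq_unit GLe') ud).
rewrite /loc map_sg -/(loc q d') -/(loc q v') de; congr sg.
rewrite /w !mulmxA -trmx_mul mulVmx // trmx1 mul1mx -mulmxA mulVmx // mulmx1.
by rewrite subrK.
Qed.
End GlobalParabolic.

(** * Action of a Hecke ring through global representatives *)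

Section AbstractHecke.
Variables (C : comNzRingType) (K : fieldType) (N : nat).
Local Notation mx := ('M[K]_N).
Variables (P H : set mx).
Hypothesis PH : group_pair P H.
Variables (G : Type) (mulG : G -> G -> G) (loc : G -> mx) (Gl : set G) (gr : mx -> G).
Variables (Z : Type) (Hn : set Z) (act : G -> Z -> Z) (cf : G -> C).
Hypothesis gr_lc : forall g h, P h -> lc H g h -> gr g = gr h.
Hypothesis grP : forall g, P g -> Gl (gr g) /\ lc H (loc (gr g)) g.
Hypothesis GlM : forall g h, Gl g -> Gl h -> Gl (mulG g h).
Hypothesis loc_P : forall g, Gl g -> P (loc g).
Hypothesis locM : forall g h, Gl g -> Gl h -> loc (mulG g h) = loc g *m loc h.
Hypothesis Gl_div : forall g h, Gl g -> Gl h -> exists2 e, Gl e & g = mulG e h.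
Hypothesis cfM : forall g h, Gl g -> Gl h -> cf (mulG g h) = cf g * cf h.
Hypothesis actM : forall g h z, Gl g -> Gl h -> Hn z -> act (mulG g h) z = act g (act h z).
Hypothesis act_Hn : forall g z, Gl g -> Hn z -> Hn (act g z).
Local Notation linv := (@linv C K N P H).
Local Notation rinv := (@rinv C K N P H).
Local Notation fsupp := (@fsupp C K N P H).
Local Notation csum := (@csum C K N P H).
Local Notation cmul := (@cmul C K N P H).
Implicit Types (F : mx -> C) (phi : Z -> C) (z : Z).

(** The invariance that makes the action independent of the global representatives: two
    representatives of the same coset differ by an element of [Gl] whose local component is in H. *)
Definition par_inv phi := forall g z, Gl g -> H (loc g) -> Hn z -> cf g * phi (act g z) = phi z.
Definition orbit_fun phi z (g : mx) : C := cf (gr g) * phi (act (gr g) z).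
Local Notation Phi := orbit_fun.
Definition hecke F phi z : C := csum (fun g => F g * Phi phi z g).

Lemma Phi_linv phi z : linv (Phi phi z).
Proof. by move=> d g Hd Pg; rewrite /Phi (gr_lc Pg (lc_mul g Hd)). Qed.

Lemma Phi_loc phi z g : par_inv phi -> Gl g -> Hn z -> Phi phi z (loc g) = cf g * phi (act g z).
Proof.
move=> hphi hg hz; have [h1 h2] := grP (loc_P hg); rewrite /Phi; move: (gr _) h1 h2 => g1 h1 h2.
have [e he ge] := Gl_div h1 hg; have He : H (loc e).
  move: h2; rewrite ge locM // => -[d Hd /(congr1 (fun x => x *m invmx (loc g)))].
  by rewrite !(mulmxK (gpPU PH (loc_P hg))) => ->.
rewrite ge cfM // actM // -[in RHS](hphi e) //; last exact: act_Hn.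
by rewrite mulrA [cf e * _]mulrC.
Qed.

Lemma kernel_linv F phi z : linv F -> linv (fun g => F g * Phi phi z g).
Proof. by move=> lF d g Hd Pg; rewrite (lF d g Hd Pg) (Phi_linv phi z Hd Pg). Qed.

Lemma fsupp_mull F F' : fsupp F -> fsupp (fun g => F g * F' g).
Proof.
move=> [s hs]; exists s; apply: covers_sub hs => g Pg; apply: contra_neq => ->; exact: mul0r.
Qed.

Lemma hecke_fin F : linv F -> fsupp F -> exists s : seq (C * G), (forall j, (j < size s)%N -> forall x, Gl (nth x s j).2) /\
  forall phi z, hecke F phi z = \sum_(x <- s) x.1 * phi (act x.2 z).
Proof.
move=> lF [s0 hs0]; have [s ds hs] := covers_distinct PH hs0.
exists [seq (F h * cf (gr h), gr h) | h <- s]; split.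
  move=> j; rewrite size_map => js x; rewrite (nth_map 0) //=.
  by have [h' _] := hs; have [] := grP (h' _ (mem_nth 0 js)).
move=> phi z; rewrite /hecke (csumE PH (s := s)) ?big_map //.
- by apply: eq_bigr => h _; rewrite /Phi mulrA.
- exact: kernel_linv.
- by apply: covers_sub hs => g Pg; apply: contra_neq => ->; exact: mul0r.
Qed.

Lemma eq_hecke F phi phi' z : linv F -> fsupp F -> (forall z, Hn z -> phi z = phi' z) -> Hn z ->
  hecke F phi z = hecke F phi' z.
Proof.
move=> lF fF e hz; apply: (eq_csum PH) => g Pg; congr (_ * _); rewrite /Phi e //.
by apply: act_Hn => //; have [] := grP Pg.
Qed.

Lemma eq_hecke_coef F F' phi z : (forall g, P g -> F g = F' g) -> hecke F phi z = hecke F' phi z.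
Proof. by move=> e; apply: (eq_csum PH) => g Pg; rewrite e. Qed.

Lemma hecke_coef0 F phi z : (forall g, P g -> F g = 0) -> hecke F phi z = 0.
Proof. by move=> e; apply: (csum0 PH) => // g Pg; rewrite e // mul0r. Qed.

Lemma hecke_coefD F F' phi z : linv F -> fsupp F -> linv F' -> fsupp F' ->
  hecke (fun g => F g + F' g) phi z = hecke F phi z + hecke F' phi z.
Proof.
move=> lF fF lF' fF'; rewrite /hecke -(csumD PH); try exact: kernel_linv; try exact: fsupp_mull.
by apply: (eq_csum PH) => g Pg; rewrite mulrDl.
Qed.

Lemma hecke_coefZ F a phi z : linv F -> fsupp F ->
  hecke (fun g => a * F g) phi z = a * hecke F phi z.
Proof.
move=> lF fF; rewrite /hecke mulrC -(csum_distr PH); [|exact: kernel_linv|exact: fsupp_mull].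
by apply: (eq_csum PH) => g Pg; rewrite -mulrA mulrC.
Qed.

Lemma hecke_coef_sum m (a : nat -> C) (F : nat -> mx -> C) phi z : (forall i, (i < m)%N -> linv (F i)) ->
  (forall i, (i < m)%N -> fsupp (F i)) ->
  hecke (fun g => \sum_(i < m) a i * F i g) phi z = \sum_(i < m) a i * hecke (F i) phi z.
Proof.
elim: m => [|m IH] lF fF.
  by rewrite big_ord0; apply: hecke_coef0 => g _; rewrite big_ord0.
have lS : linv (fun g => \sum_(i < m) a i * F i g).
  by move=> d g Hd Pg; apply: eq_bigr => i _; rewrite (lF _ (leqW (ltn_ord i)) d g Hd Pg).
have fS : fsupp (fun g => \sum_(i < m) a i * F i g).
  elim: m fF {IH lF lS} => [|m IH] fF.
    by exists [::]; split=> // g _; rewrite big_ord0 eqxx.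
  have [s hs] := fsuppD (IH (fun i im => fF i (leqW im))) (fsuppZ (a m) (fF m (ltnW (ltnSn m.+1)))).
  by exists s; apply: covers_sub hs => g Pg; rewrite big_ord_recr.
rewrite big_ord_recr /= -(IH (fun i im => lF i (leqW im)) (fun i im => fF i (leqW im))).
rewrite -(hecke_coefZ (a m) phi z (lF m (ltnSn m)) (fF m (ltnSn m))) -hecke_coefD //.
- by apply: eq_hecke_coef => g Pg; rewrite big_ord_recr.
- by move=> d g Hd Pg; rewrite (lF m (ltnSn m) d g Hd Pg).
- exact: fsuppZ (fF m (ltnSn m)).
Qed.

Lemma hecke_linear F (I : Type) (r : seq I) (a : I -> C) (phi : I -> Z -> C) z : linv F -> fsupp F ->
  hecke F (fun z => \sum_(i <- r) a i * phi i z) z = \sum_(i <- r) a i * hecke F (phi i) z.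
Proof.
move=> lF fF; have [s [_ Hs]] := hecke_fin lF fF; rewrite Hs.
rewrite [RHS](eq_bigr (fun i => \sum_(x <- s) a i * (x.1 * phi i (act x.2 z)))) => [|i _]; last by rewrite Hs mulr_sumr.
rewrite exchange_big; apply: eq_bigr => x _; rewrite mulr_sumr; apply: eq_bigr => i _; exact: mulrCA.
Qed.

Lemma csum_Phi_shift F phi z (g g' : mx) : linv F -> rinv F -> fsupp F -> P g' -> lc H g g' ->
  csum (fun h => F h * Phi phi z (h *m g)) = csum (fun h => F h * Phi phi z (h *m g')).
Proof.
move=> lF rF fF Pg' [d Hd ->]; have Pd := gpHP PH Hd.
have lE : linv (fun h => F h * Phi phi z (h *m g')).
  move=> e h He Ph; rewrite (lF e h He Ph) -mulmxA; congr (_ * _).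
  by apply: Phi_linv => //; exact: (gpPM PH).
rewrite -(csum_translate PH lE (fsupp_mull _ fF) Pd).
by apply: (eq_csum PH) => h Ph; rewrite (rF d h Hd Ph) mulmxA.
Qed.

(** Moving the argument by g translates the summation on the right by the local component of g;
    invariance of phi then only requires this translation to permute cosets. *)
Lemma hecke_shift F phi z g : linv F -> fsupp F -> par_inv phi -> Gl g -> Hn z ->
  cf g * hecke F phi (act g z) = csum (fun h => F h * Phi phi z (h *m loc g)).
Proof.
move=> lF fF hphi hg hz; have hgz := act_Hn hg hz.
rewrite /hecke mulrC -(csum_distr PH); [|exact: kernel_linv|exact: fsupp_mull].
apply: (eq_csum PH) => h Ph; rewrite -mulrA; congr (_ * _).
have [h1 h2] := grP Ph; rewrite /Phi.
have -> : gr (h *m loc g) = gr (loc (mulG (gr h) g)).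
  apply: gr_lc; first exact/loc_P/GlM.
  by rewrite locM //; apply: lc_mulr; exact: (lc_sym PH).
rewrite -[RHS]/(Phi phi z (loc (mulG (gr h) g))) Phi_loc //; last exact: GlM.
by rewrite cfM // actM // mulrC mulrA [cf g * _]mulrC.
Qed.

Lemma hecke_pinv F phi : linv F -> rinv F -> fsupp F -> par_inv phi -> par_inv (hecke F phi).
Proof.
move=> lF rF fF hphi g z hg Hg hz; rewrite hecke_shift //.
rewrite (@csum_Phi_shift F phi z (loc g) 1%:M) //; last 2 first.
- exact: (gpHP PH (gpH1 PH)).
- by exists (loc g) => //; rewrite mulmx1.
by apply: (eq_csum PH) => h Ph; rewrite mulmx1.
Qed.

(** The left factor acts first, as [csum_cmul] reindexes pairs of cosets by their product. *)
Lemma hecke_cmul F F' phi z : linv F -> rinv F -> fsupp F -> linv F' -> fsupp F' ->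
  par_inv phi -> Hn z -> hecke (cmul F F') phi z = hecke F' (hecke F phi) z.
Proof.
move=> lF rF fF lF' fF' hphi hz.
rewrite /hecke -(csum_cmul PH lF rF lF' fF fF' (Phi_linv phi z)).
apply: (eq_csum PH) => h Ph; congr (_ * _); have [h1 h2] := grP Ph.
rewrite -[RHS]/(cf (gr h) * hecke F phi (act (gr h) z)) hecke_shift //.
by rewrite (csum_Phi_shift phi z lF rF fF Ph h2).
Qed.
End AbstractHecke.

(** * The Hecke action on functions on the half-space *)

Section HeckeLayer.
Variables (R : realType) (n : nat) (k : int) (b : rat) (c : nat) (psi : adele_tuple R -> R[i]) (q : primeT).
Hypotheses (b0 : b != 0) (psi_hecke : hecke_character psi).
Local Notation C := R[i].
Local Notation K := (padic q).
Local Notation mx := 'M[rat]_(n + n).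
Local Notation H := (@D0 n q b c).
Local Notation P := (@siegelP K n).
Implicit Types (F G : 'M[K]_(n + n) -> C) (phi : 'M[C]_n -> C) (z : 'M[C]_n).

Lemma D0_pair : group_pair P H.
Proof.
split.
- move=> g h; exact: siegelPM.
- move=> g; exact: siegelPV.
- move=> g; exact: siegelP_unit.
- move=> g; exact: D0_siegelP.
- exact: D01.
- move=> g h; exact: D0M.
- move=> g; exact: D0V.
Qed.
Local Notation PH := D0_pair.

(** All three factors are multiplicative on the parabolic, which is why no metaplectic cocycle
    enters the composition of operators. *)
Definition cf (g : mx) : C := (psi_ideal psi c (\det (ulsubmx g)))^-1 *
  ((Num.sqrt `|ratr (\det (drsubmx g))|)%:C)^-1 * ratr (\det (drsubmx g)) ^ (- k).
Definition grep (g : 'M[K]_(n + n)) : mx := global_rep b c (coset_in H g).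

Lemma siegelP_det (g : mx) : siegelP g -> \det (ulsubmx g) != 0 /\ \det (drsubmx g) != 0.
Proof.
move=> hg; have := siegelP_unit hg; case: hg => _ g0.
by rewrite unitmxE unitfE -[g in \det g]submxK g0 det_ublock mulf_eq0 negb_or => /andP[].
Qed.

Lemma cfM (g h : mx) : siegelP g -> siegelP h -> cf (g *m h) = cf g * cf h.
Proof.
move=> sg_ sh_; have [a1 d1] := siegelP_det sg_; have [a2 d2] := siegelP_det sh_.
case: sg_ sh_ => _ g0 [_ h0].
have E : g *m h = block_mx (ulsubmx g *m ulsubmx h)
   (ulsubmx g *m ursubmx h + ursubmx g *m drsubmx h) 0 (drsubmx g *m drsubmx h).
  rewrite -[in LHS](submxK g) -[in LHS](submxK h) mulmx_block g0 h0.
  by rewrite !mulmx0 !mul0mx !addr0 !add0r.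
rewrite /cf E block_mxKul block_mxKdr !det_mulmx psi_idealM // !rmorphM /= normrM sqrtrM //.
rewrite rmorphM /= expfzMl !invfM.
move: (psi_ideal _ _ _)^-1 (psi_ideal _ _ _)^-1 => x y.
move: ((Num.sqrt _)%:C^-1) ((Num.sqrt _)%:C^-1) => u v.
by move: (_ ^ (- k)) (_ ^ (- k)) => s t; ring.
Qed.

Definition Pinv := @par_inv C K (n + n) H mx (loc q (m:=_) (k:=_)) (GP q b c) 'M[C]_n (@Hn R n) (@act R n) cf.
Local Notation heckeA := (@hecke C K (n + n) P H mx grep 'M[C]_n (@act R n) cf).

Fact xget_prop (T : choiceType) (x0 : T) (A : set T) x : A x -> A (xget x0 A).
Proof. by move=> Ax; apply: xgetPex; exists x. Qed.

Lemma grepP (g : 'M[K]_(n + n)) : P g -> GP q b c (grep g) /\ lc H (loc q (grep g)) g.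
Proof.
move=> Pg; have [g' [s1 s2] [d Hd e]] := strong_approx c b0 Pg.
have Cg : coset_in H g (loc q g') by exists d.
have [h1 [d' Hd' e'] h3] := @xget_prop _ 1%:M [set g1 : mx | [/\ siegelP g1, coset_in H g (map_mx ratr g1)
    & forall l : primeT, l != q -> D0 b c (map_mx ratr g1 : 'M[padic l]_(n + n))]] g' (And3 s1 Cg s2).
split; first exact: conj h1 h3.
exists d'; first exact: Hd'.
exact: (esym e').
Qed.

Lemma grep_lc (g h : 'M[K]_(n + n)) : P h -> lc H g h -> grep g = grep h.
Proof.
move=> Ph gh; have e : coset_in H g = coset_in H h by apply/(coset0_eq PH).
by rewrite /grep e.
Qed.

Lemma GP_siegelP (g : mx) : GP q b c g -> siegelP g. Proof. by case. Qed.
Lemma GP_Sp (g : mx) : GP q b c g -> Sp g. Proof. by case => -[]. Qed.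
Lemma GP_loc (g : mx) : GP q b c g -> P (loc q g).
Proof. move=> hg; apply: loc_siegelP; exact: GP_siegelP hg. Qed.
Lemma GP_div (g h : mx) : GP q b c g -> GP q b c h -> exists2 e, GP q b c e & g = e *m h.
Proof.
move=> hg hh; exists (g *m invmx h).
  apply: GPM => //; exact: GPV.
by rewrite (mulmxKV (siegelP_unit (GP_siegelP hh))).
Qed.

Lemma GP_cfM (g h : mx) : GP q b c g -> GP q b c h -> cf (g *m h) = cf g * cf h.
Proof. move=> hg hh; exact: (cfM (GP_siegelP hg) (GP_siegelP hh)). Qed.
Lemma GP_actM (g h : mx) z : GP q b c g -> GP q b c h -> Hn z -> act (g *m h) z = act g (act h z).
Proof. move=> hg hh hz; exact: (act_cocycle (GP_Sp hg) (GP_Sp hh) hz).2. Qed.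
Lemma GP_Hn (g : mx) z : GP q b c g -> Hn z -> Hn (act g z).
Proof. move=> hg hz; exact: (act_Hn (GP_Sp hg) hz). Qed.
Lemma GP_locM (g h : mx) : GP q b c g -> GP q b c h -> loc q (g *m h) = loc q g *m loc q h.
Proof. move=> _ _; exact: locM. Qed.

Lemma hecke_actE F phi z : linv P H F -> hecke_act k b c psi F phi z = heckeA F phi z.
Proof.
move=> lF; apply: eq_fsbigr => X; rewrite inE => -[g Pg <-].
have [h1 h2] := grepP Pg.
have r1 := rep0P PH g; have Pr := rep0_siegelP PH Pg.
have e1 : coset_in H (coset_rep (coset_in H g)) = coset_in H g by apply/(coset0_eq PH).
have e2 : grep (coset_rep (coset_in H g)) = global_rep b c (coset_in H g) by rewrite /grep e1.
have e3 : F (loc q (grep g)) = F (coset_rep (coset_in H g)).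
  exact: (linv_lc lF Pr (lc_trans PH h2 (lc_sym PH r1))).
have e4 : orbit_fun grep (@act R n) cf phi z (coset_rep (coset_in H g)) = cf (grep g) * phi (act (grep g) z).
  by rewrite /orbit_fun e2.
etransitivity; last exact: (congr1 (fun t => F (coset_rep (coset_in H g)) * t) (esym e4)).
etransitivity; last exact: (congr1 (fun t => t * (cf (grep g) * phi (act (grep g) z))) e3).
rewrite /cf !mulrA; by [].
Qed.

Lemma hecke_act_cmul F F' phi z : linv P H F -> rinv P H F -> fsupp P H F -> linv P H F' -> fsupp P H F' ->
  Pinv phi -> Hn z ->
  hecke_act k b c psi (cmul P H F F') phi z = hecke_act k b c psi F' (hecke_act k b c psi F phi) z.
Proof.
move=> lF rF fF lF' fF' hphi hz.
rewrite (hecke_actE _ _ (S0_mul_linv PH F' lF)) (hecke_actE _ _ lF').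
rewrite (_ : hecke_act k b c psi F phi = heckeA F phi); last by apply/funext => w; exact: hecke_actE.
exact: (hecke_cmul PH grep_lc grepP (@GPM n q b c) GP_loc GP_locM GP_div GP_cfM GP_actM GP_Hn lF rF fF lF' fF' hphi hz).
Qed.

Lemma hecke_act_fun F phi : linv P H F -> hecke_act k b c psi F phi = heckeA F phi.
Proof. by move=> lF; apply/funext => z; exact: hecke_actE. Qed.

Lemma hecke_act_Pinv F phi : linv P H F -> rinv P H F -> fsupp P H F -> Pinv phi ->
  Pinv (hecke_act k b c psi F phi).
Proof.
move=> lF rF fF hphi; rewrite hecke_act_fun //.
exact: (hecke_pinv PH grep_lc grepP (@GPM n q b c) GP_loc GP_locM GP_div GP_cfM GP_actM GP_Hn lF rF fF hphi).
Qed.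

Lemma hecke_act_fin F : linv P H F -> fsupp P H F -> exists s : seq (C * mx),
  (forall j, (j < size s)%N -> forall x, GP q b c (nth x s j).2) /\
  (forall phi z, hecke_act k b c psi F phi z = \sum_(x <- s) x.1 * phi (act x.2 z)).
Proof.
move=> lF fF; have [s [h1 h2]] := hecke_fin PH (@act R n) cf grep_lc grepP lF fF.
by exists s; split=> // phi z; rewrite hecke_actE.
Qed.

Lemma eq_hecke_act F phi phi' z : linv P H F -> fsupp P H F -> (forall z, Hn z -> phi z = phi' z) -> Hn z ->
  hecke_act k b c psi F phi z = hecke_act k b c psi F phi' z.
Proof.
move=> lF fF e hz; rewrite !hecke_actE //.
exact: (eq_hecke PH cf grepP GP_Hn lF fF e hz).
Qed.

Lemma hecke_act_coef0 F phi z : linv P H F -> (forall g, P g -> F g = 0) -> hecke_act k b c psi F phi z = 0.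
Proof. by move=> lF F0; rewrite hecke_actE //; exact: (hecke_coef0 PH). Qed.

Lemma hecke_act_coef_sum m (a : nat -> C) (F : nat -> 'M[K]_(n + n) -> C) phi z :
  (forall i, (i < m)%N -> linv P H (F i)) -> (forall i, (i < m)%N -> fsupp P H (F i)) ->
  hecke_act k b c psi (fun g => \sum_(i < m) a i * F i g) phi z =
  \sum_(i < m) a i * hecke_act k b c psi (F i) phi z.
Proof.
move=> lF fF; rewrite hecke_actE; last first.
  by move=> d g Hd Pg; apply: eq_bigr => i _; rewrite (lF i (ltn_ord i) d g Hd Pg).
rewrite (hecke_coef_sum PH (@act R n) cf grep_lc a phi z lF fF).
by apply: eq_bigr => i _; rewrite (hecke_actE _ _ (lF i (ltn_ord i))).
Qed.

Lemma hecke_act_linear F (I : Type) (r : seq I) (a : I -> C) (phi : I -> 'M[C]_n -> C) z :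
  linv P H F -> fsupp P H F ->
  hecke_act k b c psi F (fun z => \sum_(i <- r) a i * phi i z) z =
  \sum_(i <- r) a i * hecke_act k b c psi F (phi i) z.
Proof.
move=> lF fF; rewrite hecke_actE // (hecke_linear PH (@act R n) cf grep_lc grepP) //.
by apply: eq_bigr => i _; rewrite hecke_actE.
Qed.

Lemma hecke_act_csum F phi z : linv P H F -> Pinv phi -> Hn z -> forall (I : Type) (r : seq I) (E : I -> mx),
  (forall i, GP q b c (E i)) ->
  (forall G : 'M[K]_(n + n) -> C, linv P H G -> csum P H (fun g => F g * G g) = \sum_(i <- r) G (loc q (E i))) ->
  hecke_act k b c psi F phi z = \sum_(i <- r) cf (E i) * phi (act (E i) z).
Proof.
move=> lF hphi hz I r E hE hF; rewrite hecke_actE // /hecke hF; last exact: (Phi_linv (@act R n) cf grep_lc).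
apply: eq_bigr => i _.
exact: (Phi_loc PH grepP GP_loc GP_locM GP_div GP_cfM GP_actM GP_Hn hphi (hE i) hz).
Qed.

Lemma act_siegel (g : mx) (z : 'M[C]_n) : siegelP g ->
  act g z = rC R (ulsubmx g) *m z *m (rC R (ulsubmx g))^T + rC R (ursubmx g) *m (rC R (ulsubmx g))^T /\
  (rC R (ursubmx g) *m (rC R (ulsubmx g))^T)^T = rC R (ursubmx g) *m (rC R (ulsubmx g))^T.
Proof.
move=> [hg g0]; have [e1 _ e3] := Sp_blocks_tr hg.
move: e3; rewrite g0 trmx0 mulmx0 subr0 => /(congr1 (@rC R n n)); rewrite rCM rC_tr rC1 => e3.
have e3' : (rC R (drsubmx g)) *m (rC R (ulsubmx g))^T = 1%:M.
  by rewrite -[RHS]trmx1 -e3 trmx_mul trmxK.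
have [uD _] : rC R (drsubmx g) \in unitmx /\ (rC R (ulsubmx g))^T \in unitmx by exact: mulmx1_unit.
split; last first.
  by rewrite -rC_tr -rCM -rC_tr trmx_mul trmxK e1 rCM rC_tr.
rewrite actE /num_mx cd_mxE g0 [rC R 0]map_mx0 mul0mx add0r.
have -> : invmx (rC R (drsubmx g)) = (rC R (ulsubmx g))^T.
  by rewrite -[LHS]mulmx1 -e3' mulKmx.
by rewrite mulmxDl.
Qed.

Lemma holomorphic_act (g : mx) phi : siegelP g -> holomorphic phi -> holomorphic (fun z => phi (act g z)).
Proof.
move=> hg hphi; have [hS _] := hg.
have S0 := (act_siegel 0 hg).2.
have -> : (fun z => phi (act g z)) = fun z => phi (rC R (ulsubmx g) *m z *m (rC R (ulsubmx g))^T + rC R (ursubmx g) *m (rC R (ulsubmx g))^T).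
  by apply/funext => z; rewrite (act_siegel z hg).1.
apply: holomorphic_affine => // [z hz|z zz].
  by rewrite -(act_siegel z hg).1; exact: act_Hn.
by rewrite linearD /= S0 !trmx_mul trmxK zz mulmxA.
Qed.

Lemma hecke_act_holomorphic F phi : linv P H F -> fsupp P H F -> holomorphic phi ->
  holomorphic (hecke_act k b c psi F phi).
Proof.
move=> lF fF hphi; have [s [hs Hs]] := hecke_act_fin lF fF.
have -> : hecke_act k b c psi F phi = fun z => \sum_(j < size s) (nth (0, 1%:M) s j).1 * phi (act (nth (0, 1%:M) s j).2 z).
  apply/funext => z; rewrite Hs (big_nth (0, 1%:M)) big_mkord; by [].
apply: holomorphic_sum => j; apply: holomorphicZ; apply: holomorphic_act => //.
exact: GP_siegelP (hs j (ltn_ord j) _).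
Qed.

Lemma sqr_sum_le (m : nat) (a : 'I_m -> R) : (\sum_j a j) ^+ 2 <= m%:R * \sum_j a j ^+ 2.
Proof.
have -> : m%:R * \sum_j a j ^+ 2 = \sum_i \sum_j (2^-1 * a i ^+ 2 + 2^-1 * a j ^+ 2).
  rewrite exchange_big /= [RHS](eq_bigr (fun j => 2^-1 * \sum_i a i ^+ 2 + m%:R * (2^-1 * a j ^+ 2))).
    by rewrite big_split /= sumr_const card_ord -mulr_sumr -mulr_sumr -mulr_natl; field.
  by move=> j _; rewrite big_split /= -mulr_sumr sumr_const card_ord mulr_natl.
rewrite expr2 mulr_suml; apply: ler_sum => i _; rewrite mulr_sumr; apply: ler_sum => j _.
by have := sqr_ge0 (a i - a j); move: (a i) (a j) => x y; nra.
Qed.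

Lemma cabs_sqr_sum (m : nat) (x : 'I_m -> C) : cabs (\sum_j x j) ^+ 2 <= m%:R * \sum_j cabs (x j) ^+ 2.
Proof.
apply: le_trans (sqr_sum_le _); apply: lerXn2r; rewrite ?nnegrE ?cabs_ge0 ?cabs_sum //.
by apply: sumr_ge0 => j _; exact: cabs_ge0.
Qed.

Lemma cabs_expz (x : C) (m : int) : `|x| ^ m = (cabs x ^ m)%:C.
Proof. by rewrite cabsE (fmorphXz (real_complex R)). Qed.

(** Growth at g of the term of alpha is growth of phi at alpha g, and j(alpha, .) is constant for
    alpha in the parabolic. The square of the sum is handled by the Cauchy-Schwarz inequality. *)
Lemma hecke_act_cusps F phi : linv P H F -> fsupp P H F ->
  holomorphic_at_cusps k phi -> holomorphic_at_cusps k (hecke_act k b c psi F phi).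
Proof.
move=> lF fF hphi g hg; have [s [hs Hs]] := hecke_act_fin lF fF.
pose x0 : C * mx := (0, 1%:M); pose ns j := nth x0 s j.
have /choice[A hA] : forall j : 'I_(size s), exists AB : R * R, forall z : 'M[C]_n, Hn z -> AB.1 <= complex.Im (\tr z) ->
    cabs (phi (act ((ns j).2 *m g) z)) ^+ 2 <= AB.2 * cabs (jfac ((ns j).2 *m g) z) ^ (2 * k + 1).
  move=> j; have [A [B hAB]] := hphi ((ns j).2 *m g) (SpM (GP_Sp (hs j (ltn_ord j) x0)) hg).
  exists (A, B) => z hz hA; have := hAB z hz hA.
  by rewrite cabs_expz cabsE -rmorphXn -rmorphM lecR.
pose M : R := \sum_j `|(A j).1|.
have MA j : (A j).1 <= M.
  apply: le_trans (ler_norm _) _; rewrite /M (bigD1 j) //= lerDl.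
  by apply: sumr_ge0 => i _; exact: normr_ge0.
pose dj (j : 'I_(size s)) : R := cabs (ratr (\det (drsubmx (ns j).2)) : C) ^ (2 * k + 1).
exists M, ((size s)%:R * \sum_(j < size s) (cabs (ns j).1 ^+ 2 * ((A j).2 * dj j))) => z hz hM.
rewrite cabs_expz cabsE -rmorphXn -rmorphM lecR /= Hs (big_nth x0) big_mkord.
apply: le_trans (cabs_sqr_sum _) _; rewrite -mulrA; apply: ler_wpM2l => //.
rewrite mulr_suml; apply: ler_sum => j _; rewrite cabsM exprMn -[leRHS]mulrA; apply: ler_wpM2l.
  by rewrite exprn_ge0 // cabs_ge0.
have Gj := hs j (ltn_ord j) x0; have Sj := GP_Sp Gj.
have [c1 c2] := act_cocycle Sj hg hz.
rewrite -c2; apply: le_trans (hA j z hz (le_trans (MA j) hM)) _.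
rewrite /jfac c1 det_mulmx cabsM expfzMl /dj.
have -> : cd_mx (ns j).2 (act g z) = rC R (drsubmx (ns j).2).
  have [[_ h0] _] := Gj; rewrite cd_mxE h0 [rC R 0]map_mx0 mul0mx add0r; by [].
by rewrite det_map_mx mulrA.
Qed.
End HeckeLayer.

(** * Behaviour of the level under U_p *)

Lemma Zq_unit_int (l : primeT) (y : int) : ~~ (val l %| `|y|)%N -> Zq_unit (y%:~R : padic l).
Proof.
move=> h; have u := in_Zq_unitN h.
have ZN (x : padic l) : Zq_unit x -> Zq_unit (- x).
  by move=> [x0 [h1 h2]]; rewrite /Zq_unit oppr_eq0 invrN; split=> //; split; exact: in_ZqN.
case: y u {h} => m u; first exact: u.
by rewrite NegzE rmorphN; apply: ZN.
Qed.

Lemma unit_mod (l : primeT) (c : nat) (y e : int) : (val l %| c)%N -> (c%:Z %| y * e - 1)%Z ->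
  Zq_unit (y%:~R : padic l).
Proof.
move=> lc h; apply: Zq_unit_int; apply/negP => ly.
have : ((val l)%:Z %| y * e - (y * e - 1))%Z.
  apply: rpredB; first by apply: dvdz_mulr; rewrite dvdzE.
  by apply: dvdz_trans h; rewrite dvdzE.
have -> : y * e - (y * e - 1) = 1 by ring.
by rewrite dvdzE /= Euclid_dvd1 ?(valP l).
Qed.

Lemma dvdz_prod (I : Type) (r : seq I) (d : int) (f g : I -> int) :
  (forall i, (d %| f i - g i)%Z) -> (d %| \prod_(i <- r) f i - \prod_(i <- r) g i)%Z.
Proof.
move=> h; elim: r => [|i r IH]; first by rewrite !big_nil subrr dvdz0.
rewrite !big_cons.
have -> : f i * \prod_(j <- r) f j - g i * \prod_(j <- r) g j =
  (f i - g i) * \prod_(j <- r) f j + g i * (\prod_(j <- r) f j - \prod_(j <- r) g j) by ring.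
by apply: rpredD; [exact: dvdz_mulr|exact: dvdz_mull].
Qed.

Lemma dvdz_det m (d : int) (X Y : 'M[int]_m) : (forall i j, (d %| X i j - Y i j)%Z) -> (d %| \det X - \det Y)%Z.
Proof.
move=> h; rewrite /determinant -sumrB; apply: rpred_sum => s _.
by rewrite -mulrBr; apply: dvdz_mull; exact: dvdz_prod.
Qed.

Lemma div_sub1 (F : fieldType) (x y c : F) : y != 0 -> (x / y - 1) / c = (x - y) / c / y.
Proof. by move=> y0; rewrite [RHS]mulrAC [(x - y) / y]mulrBl mulfV. Qed.

Section PsiCongruence.
Variables (R : realType) (c : nat) (psi : adele_tuple R -> R[i]).
Hypothesis psi_hecke : hecke_character psi.
Hypothesis psi_cond : forall (q : primeT) (a : padic q), Zq_unit a ->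
  in_Zq ((a - 1) / c%:R) -> psi (at_prime R a) = 1.
Hypothesis c_gt0 : (0 < c)%N.

Lemma in_Zq_div (l : primeT) (x : int) : (c%:Z %| x)%Z -> in_Zq (x%:~R / c%:R : padic l).
Proof.
move=> /dvdzP[t ->]; rewrite intrM -pmulrn mulfK; first exact: in_Zq_int.
exact: padic_natr_neq0.
Qed.

(** The integer y is a unit at the primes of c, so x / y is a local unit congruent to 1 modulo c
    there, and psi is trivial on it. *)
Lemma psi_ideal_congr (x y e : int) : (c%:Z %| x - y)%Z -> (c%:Z %| y * e - 1)%Z ->
  psi_ideal psi c x%:~R = psi_ideal psi c y%:~R.
Proof.
move=> h1 h2; rewrite /psi_ideal big_seq [RHS]big_seq; apply: eq_bigr => l.
rewrite mem_pmap_sub => lc; have {}lc : (val l %| c)%N.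
  by move: lc; rewrite mem_primes => /and3P[].
have uy := unit_mod lc h2.
have ux : Zq_unit (x%:~R : padic l).
  apply: (unit_mod (e := e) lc); have -> : x * e - 1 = (x - y) * e + (y * e - 1) by ring.
  by apply: rpredD => //; exact: dvdz_mulr.
have ri (t : int) : ratr (t%:~R) = t%:~R :> padic l by exact: (rmorph_int (rq l)).
rewrite !ri; have [y0 [_ yi]] := uy; have [x0 _] := ux.
rewrite -[x%:~R : padic l](divfK y0) (psi_at_primeM psi_hecke) //; last first.
  by rewrite mulf_neq0 ?invr_eq0.
rewrite psi_cond ?mul1r //; first by apply: Zq_unitM => //; exact: Zq_unitV.
have -> : (x%:~R / y%:~R - 1) / c%:R = ((x - y)%:~R / c%:R) * (y%:~R)^-1 :> padic l.
  by rewrite intrB; exact: div_sub1.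
by apply: in_ZqM => //; exact: in_Zq_div.
Qed.

(** The two products differ by the factor at p. There c is a unit, so the congruence condition is
    empty and psi is trivial on all units of Z_p. *)
Lemma psi_ideal_level (p : primeT) (m : nat) (x e : int) : ~~ (val p %| c)%N -> (0 < m)%N ->
  ((c * val p ^ m)%N%:Z %| x * e - 1)%Z ->
  psi_ideal psi (c * val p ^ m) x%:~R = psi_ideal psi c x%:~R.
Proof.
move=> pc m0 h; have pp := valP p.
have pm0 : (0 < val p ^ m)%N by rewrite expn_gt0 prime_gt0.
have perm : perm_eq (primes (c * val p ^ m)) (val p :: primes c).
  apply: uniq_perm; rewrite ?primes_uniq //=.
    by rewrite primes_uniq andbT mem_primes (negbTE pc) !andbF.
  move=> l; rewrite primesM // primesX // (primes_prime pp) inE orbC; by [].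
have perm2 : perm_eq (pmap (insub : nat -> option primeT) (primes (c * val p ^ m))) (p :: pmap insub (primes c)).
  have := perm_pmap (insub : nat -> option primeT) perm; by rewrite /= (valK p).
rewrite /psi_ideal (perm_big _ perm2) big_cons /= -[RHS]mul1r; congr (_ * _).
have ri (t : int) : ratr (t%:~R) = t%:~R :> padic p by exact: (rmorph_int (rq p)).
rewrite ri; apply: psi_cond.
  by apply: unit_mod h; apply: dvdn_mull; rewrite dvdn_exp.
apply: in_ZqM; last by have [_ []] := in_Zq_unitN pc.
by apply: in_ZqB; [exact: in_Zq_int|exact: in_Zq1].
Qed.
End PsiCongruence.

(** * Integral blocks and reduction of the translation part modulo p^2 *)

Section IntegralGamma.
Variables (n : nat).
Implicit Types (A B C D S W X : 'M[int]_n).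

Lemma iQM m k r (A : 'M[int]_(m, k)) (B : 'M[int]_(k, r)) : iQ (A *m B) = iQ A *m iQ B.
Proof. exact: map_mxM. Qed.
Lemma iQD m k (A B : 'M[int]_(m, k)) : iQ (A + B) = iQ A + iQ B.
Proof. exact: map_mxD. Qed.
Lemma iQB m k (A B : 'M[int]_(m, k)) : iQ (A - B) = iQ A - iQ B.
Proof. exact: map_mxB. Qed.
Lemma iQZ m k (a : int) (A : 'M[int]_(m, k)) : iQ (a *: A) = a%:~R *: iQ A.
Proof. exact: map_mxZ. Qed.
Lemma iQ_tr m k (A : 'M[int]_(m, k)) : iQ A^T = (iQ A)^T.
Proof. by rewrite /iQ map_trmx. Qed.
Lemma iQ_inj m k (A B : 'M[int]_(m, k)) : iQ A = iQ B -> A = B.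
Proof. by move/matrixP => h; apply/matrixP => i j; have := h i j; rewrite !mxE => /intr_inj. Qed.

Lemma int_mxP m k (A : 'M[rat]_(m, k)) : (forall l : primeT, Zq_mx (loc l A)) -> exists X : 'M[int]_(m, k), A = iQ X.
Proof.
move=> h; have /choice[f hf] : forall ij : 'I_m * 'I_k, exists a : int, A ij.1 ij.2 = a%:~R.
  move=> [i j] /=; apply/intrP; apply: rat_int_local => l; have := h l i j; by rewrite mxE.
by exists (\matrix_(i, j) f (i, j)); apply/matrixP => i j; rewrite !mxE -hf.
Qed.

Lemma Zq_iQ (l : primeT) m k (A : 'M[int]_(m, k)) : Zq_mx (loc l (iQ A)).
Proof. by move=> i j; rewrite !mxE (rmorph_int (rq l)); exact: in_Zq_int. Qed.

Lemma locZ (l : primeT) m k (a : rat) (A : 'M[rat]_(m, k)) : loc l (a *: A) = rq l a *: loc l A.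
Proof. exact: map_mxZ. Qed.

Lemma GammaP (x y : rat) (g : 'M[rat]_(n + n)) : x != 0 -> y != 0 -> Gamma n x y g <->
  Sp g /\ exists A B C D, [/\ ulsubmx g = iQ A, ursubmx g = x *: iQ B, dlsubmx g = y *: iQ C & drsubmx g = iQ D].
Proof.
move=> x0 y0; split=> [[hg h]|[hg [A [B [C [D [eA eB eC eD]]]]]]].
  split=> //.
  have [A eA] : exists A, ulsubmx g = iQ A.
    by apply: int_mxP => l; have [_ h1 _ _ _] := h l; rewrite /loc map_ulsubmx.
  have [D eD] : exists D, drsubmx g = iQ D.
    by apply: int_mxP => l; have [_ _ h1 _ _] := h l; rewrite /loc map_drsubmx.
  have [B eB] : exists B, x^-1 *: ursubmx g = iQ B.
    apply: int_mxP => l; have [_ _ _ h1 _] := h l; rewrite locZ fmorphV /loc map_ursubmx; exact: h1.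
  have [C eC] : exists C, y^-1 *: dlsubmx g = iQ C.
    apply: int_mxP => l; have [_ _ _ _ h1] := h l; rewrite locZ fmorphV /loc map_dlsubmx; exact: h1.
  by exists A, B, C, D; split=> //; [rewrite -eB|rewrite -eC]; rewrite scalerA mulfV // scale1r.
split=> // l.
have E m k (a : rat) (X : 'M[int]_(m, k)) : a != 0 -> (rq l a)^-1 *: loc l (a *: iQ X) = loc l (iQ X).
  by move=> a0; rewrite locZ scalerA mulVf ?scale1r // fmorph_eq0.
split.
- exact: (map_Sp (rq l) hg).
- rewrite -map_ulsubmx eA; exact: Zq_iQ.
- rewrite -map_drsubmx eD; exact: Zq_iQ.
- rewrite -map_ursubmx eB -[Zq_mx _]/(Zq_mx ((rq l x)^-1 *: loc l (x *: iQ B))) (E _ _ _ _ x0); exact: Zq_iQ.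
- rewrite -map_dlsubmx eC -[Zq_mx _]/(Zq_mx ((rq l y)^-1 *: loc l (y *: iQ C))) (E _ _ _ _ y0); exact: Zq_iQ.
Qed.

Section Blocks.
Variables (x y : rat) (m : int) (g : 'M[rat]_(n + n)) (A B C D : 'M[int]_n).
Hypotheses (x0 : x != 0) (y0 : y != 0) (xy : x * y = m%:~R) (hg : Sp g) (eA : ulsubmx g = iQ A)
  (eB : ursubmx g = x *: iQ B) (eC : dlsubmx g = y *: iQ C) (eD : drsubmx g = iQ D).

Lemma int_blocks : [/\ A *m D^T = 1%:M + m *: (B *m C^T), C *m D^T = D *m C^T & B^T *m D = D^T *m B].
Proof.
have [_ h2 _] := Sp_blocks hg; have [_ h5 h6] := Sp_blocks_tr hg.
move: h2 h5 h6; rewrite eA eB eC eD ![(_ *: iQ _)^T]linearZ /= -!scalemxAl -!scalemxAr -!iQ_tr -!iQM => h2 h5 h6.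
split.
- apply: iQ_inj; rewrite iQD iQZ; have -> : iQ (1%:M : 'M[int]_n) = 1%:M by exact: map_mx1.
  by rewrite -h6 scalerA xy subrK.
- by apply: iQ_inj; apply: (scalerI y0).
- by apply: iQ_inj; apply: (scalerI x0).
Qed.

Lemma det_congr_unit : (m %| \det A * \det D - 1)%Z.
Proof.
have [h _ _] := int_blocks; have -> : \det A * \det D = \det (A *m D^T) by rewrite det_mulmx det_tr.
rewrite -(det1 int n); apply: dvdz_det => i j; rewrite h; move: (1%:M) (B *m C^T) => I0 X.
rewrite !mxE [X in X - _]addrC addrK; exact: dvdz_mulr.
Qed.
End Blocks.

Section Reduction.
Variables (c q : int) (A B C D : 'M[int]_n).
Hypotheses (h1 : A *m D^T = 1%:M + (c * q) *: (B *m C^T)) (h2 : C *m D^T = D *m C^T) (h3 : B^T *m D = D^T *m B).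
Local Notation E S := (D^T *m B + D^T *m S *m D).

Lemma E_sym S : S^T = S -> (E S)^T = E S.
Proof. by move=> SS; rewrite linearD /= !trmx_mul !trmxK SS h3 mulmxA. Qed.

(** Solves Y S' = X modulo q for Y = A + c q S C and X = B + S D: as Y D^T is congruent to 1, the
    solution is D^T X. Taken in this form it is visibly symmetric, by [E_sym]. *)
Lemma reduction_identity S S' W : E S = S' + q *: W ->
  B + S *m D - (A + (c * q) *: (S *m C)) *m S' =
  q *: ((A + (c * q) *: (S *m C)) *m W - c *: ((B *m C^T + S *m C *m D^T) *m (B + S *m D))).
Proof.
move=> e; set X := B + S *m D; set Y := A + _.
have EX : E S = D^T *m X by rewrite /X mulmxDr mulmxA.
have YD : Y *m D^T = 1%:M + (c * q) *: (B *m C^T + S *m C *m D^T).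
  by rewrite /Y mulmxDl h1 -scalemxAl scalerDr addrA.
have -> : S' = D^T *m X - q *: W by rewrite -EX e addrK.
clearbody X Y.
rewrite mulmxBr (mulmxA Y D^T X) YD mulmxDl mul1mx -!scalemxAl -!scalemxAr scalerBr scalerA [q * c]mulrC.
set u := (c * q) *: _; set v := q *: _.
by rewrite opprB addrC opprD -addrA [- X - u + X]addrAC addNr add0r.
Qed.

(** D is invertible modulo q with inverse A^T, so S -> D^T S D is undone modulo q by A on the left
    and A^T on the right. *)
Lemma reduction_inj S1 S2 W : E S1 - E S2 = q *: W -> exists W', S1 - S2 = q *: W'.
Proof.
move=> e; pose d := S1 - S2.
have ed : D^T *m d *m D = q *: W.
  by rewrite -e /d mulmxBr mulmxBl opprD addrACA subrr add0r.
have h1' : D *m A^T = 1%:M + (c * q) *: (C *m B^T).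
  have := congr1 trmx h1; rewrite trmx_mul trmxK linearD linearZ /= trmx1 trmx_mul trmxK; exact.
pose u := c *: (B *m C^T); pose v := c *: (C *m B^T).
have hu : A *m D^T = 1%:M + q *: u by rewrite h1 scalerA [q * c]mulrC.
have hv : D *m A^T = 1%:M + q *: v by rewrite h1' scalerA [q * c]mulrC.
have : A *m (D^T *m d *m D) *m A^T = q *: (A *m W *m A^T) by rewrite ed -scalemxAr -scalemxAl.
have -> : A *m (D^T *m d *m D) *m A^T = (A *m D^T) *m d *m (D *m A^T) by rewrite !mulmxA.
rewrite hu hv => H.
exists (A *m W *m A^T - (u *m d + (1%:M + q *: u) *m d *m v)).
rewrite scalerBr -H mulmxDr mulmx1 -scalemxAr {1}mulmxDl mul1mx -scalemxAl scalerDr.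
by rewrite -[X in _ = X - _]addrA addrK.
Qed.

Definition redmx (S : 'M[int]_n) : 'M[int]_n := \matrix_(i, j) (E S i j %% q)%Z.

Lemma redmxE S : E S = redmx S + q *: \matrix_(i, j) (E S i j %/ q)%Z.
Proof. by rewrite /redmx; move: (E S) => F; apply/matrixP => i j; rewrite !mxE [LHS](divz_eq _ q) addrC mulrC. Qed.

End Reduction.
End IntegralGamma.

Lemma prep_sub_aux (F : fieldType) (Q u x i : F) : u != 0 ->
  Q^-1 ^+ 2 * (x - u^-1 * i) = u^-1 * ((u * x - i) / Q ^+ 2).
Proof. by move=> u0; rewrite exprVn [RHS]mulrA [u^-1 * (u * x - i)]mulrBr mulKf // mulrC. Qed.

Lemma absz_mod_lt (N : nat) (e : int) : (0 < N)%N -> (`|(e %% N%:Z)%Z| < N)%N.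
Proof.
move=> N0; have q0 : N%:Z != 0 by rewrite eqz_nat -lt0n.
by have := modz_ge0 e q0; have := ltz_pmod e (N0 : 0 < N%:Z); lia.
Qed.

Lemma sym_entry (T : Type) j (X : 'M[T]_j) : X^T = X -> forall i k, X k i = X i k.
Proof. by move=> e i k; rewrite -{2}e mxE. Qed.

(** * The operator U_p and the level c p^2 *)

Section Level.
Variables (R : realType) (n : nat) (k : int) (b : rat) (c : nat) (psi : adele_tuple R -> R[i]) (p : primeT).
Hypotheses (n_gt0 : (0 < n)%N) (b_gt0 : 0 < b) (c_gt0 : (0 < c)%N)
    (b_even : b^-1 / 2 \is a Num.int) (bc_even : b * c%:R / 2 \is a Num.int)
    (psi_hecke : hecke_character psi)
    (psi_cond : forall (q : primeT) (a : padic q), Zq_unit a ->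
       in_Zq ((a - 1) / c%:R) -> psi (at_prime R a) = 1)
    (p_ndiv_c : ~~ (val p %| c)%N).
Local Notation C := R[i].
Local Notation K := (padic p).
Local Notation mx := 'M[rat]_(n + n).
Local Notation pQ := ((val p)%:R : K).
Local Notation P := (@siegelP K n).
Local Notation H := (@D0 n p b c).
Implicit Types (phi : 'M[C]_n -> C) (z : 'M[C]_n).

Lemma b_neq0 : b != 0. Proof. by rewrite gt_eqF. Qed.
Local Notation b0 := b_neq0.

Lemma level_numbers : exists M L : nat, [/\ (0 < M)%N, (0 < L)%N, b^-1 = (2 * M)%:R, b * c%:R = (2 * L)%:R & c = (4 * L * M)%N].
Proof.
have ex (x : rat) : 0 < x -> x / 2 \is a Num.int -> exists2 m : nat, (0 < m)%N & x = (2 * m)%:R.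
  move=> x0 /intrP[m e]; have m0 : 0 < m by rewrite -(ltr0z rat) -e divr_gt0.
  exists `|m|%N; first by rewrite absz_gt0 gt_eqF.
  by rewrite natrM natr_absz gtr0_norm // -e mulrC divfK.
have bi : 0 < b^-1 by rewrite invr_gt0.
have [M M0 eM] := ex _ bi b_even.
have bc : 0 < b * c%:R by rewrite mulr_gt0 // ltr0n.
have [L L0 eL] := ex _ bc bc_even.
exists M, L; split=> //; apply/eqP; rewrite -(eqr_nat rat) -[c%:R](mulKf b0) eL eM -natrM.
by apply/eqP; congr (_%:R); lia.
Qed.

Lemma p_ndiv2 : ~~ (val p %| 2)%N.
Proof.
have [M [L [_ _ _ _ e]]] := level_numbers; apply: contra p_ndiv_c => h; rewrite e.
by rewrite -mulnA -[4%N]/(2 * 2)%N -mulnA; apply: dvdn_mulr.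
Qed.

Lemma b_unit : Zq_unit (rq p b).
Proof.
have [M [L [_ _ eM _ e]]] := level_numbers; rewrite -[b]invrK fmorphV; apply: Zq_unitV.
rewrite eM rmorph_nat; apply: in_Zq_unitN; rewrite Euclid_dvdM ?(valP p) // negb_or p_ndiv2.
by apply: contra p_ndiv_c => h; rewrite e; exact: dvdn_mull.
Qed.

Lemma D0_Hgrp : H = Hgrp (@in_Zq p) (n:=n).
Proof.
apply/seteqP; split=> g.
  move=> /D0P[d [v [h1 h2 h3 h4]]]; exists d, v; split=> //.
  by apply/(Zq_mx_unitZ v b_unit).
move=> [d [v [h1 h2 h3 h4]]]; apply/D0P; exists d, v; split=> //.
by apply/(Zq_mx_unitZ v b_unit).
Qed.

(** Representatives of Z_p modulo p^2 scaled by b^-1, so that the corresponding global matrices [al]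
    lie in D_0 at every other prime. *)
Definition prep (i : 'I_(val p ^ 2)) : K := rq p (b^-1 * (i : nat)%:R).

Let O0 : in_Zq (0 : K) := in_Zq0 p.
Let O1 : in_Zq (1 : K) := in_Zq1 p.
Let OD : forall x y : K, in_Zq x -> in_Zq y -> in_Zq (x + y) := @in_ZqD p.
Let ON : forall x : K, in_Zq x -> in_Zq (- x) := @in_ZqN p.
Let OM : forall x y : K, in_Zq x -> in_Zq y -> in_Zq (x * y) := @in_ZqM p.
Let Q0 : pQ != 0 := padic_q_neq0 p.

Lemma prepO i : in_Zq (prep i).
Proof.
rewrite /prep rmorphM fmorphV rmorph_nat; apply: OM; last exact: in_Zq_nat.
by have [_ []] := b_unit.
Qed.

Lemma prep_sub (x : K) (i : nat) : pQ ^ (- 2%:Z) * (x - rq p (b^-1 * i%:R)) = (rq p b)^-1 * ((rq p b * x - i%:R) / pQ ^+ 2).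
Proof.
have b1 : rq p b != 0 by case: b_unit.
rewrite rmorphM fmorphV rmorph_nat -[X in X^-1 * i%:R]/(rq p b) -exprnN -exprVn.
by rewrite (prep_sub_aux _ _ _ b1) exprVn.
Qed.

Lemma prep_ex (x : K) : in_Zq x -> exists i, in_Zq (pQ ^ (- 2%:Z) * (x - prep i)).
Proof.
move=> hx; have [b1 [h1 h2]] := b_unit.
have [i ip hi] := in_Zq_approx 2 (OM h1 hx).
exists (Ordinal ip); rewrite /prep prep_sub; exact: OM.
Qed.

Lemma prep_inj i j : in_Zq (pQ ^ (- 2%:Z) * (prep i - prep j)) -> i = j.
Proof.
rewrite {1}/prep /prep prep_sub => h; have [b1 [h1 h2]] := b_unit.
have {h} : in_Zq (((i : nat)%:Z - (j : nat)%:Z)%:~R / pQ ^+ 2 : K).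
  have := OM h1 h; rewrite mulVKf // rmorphM fmorphV rmorph_nat mulVKf // intrB; exact.
move=> /in_Zq_intP h; apply: val_inj => /=.
have := ltn_ord i; have := ltn_ord j; move: (i : nat) (j : nat) h => u v.
rewrite -PoszX => /dvdzP[t e] hv hu.
move: (val p ^ 2)%N e hu hv => N e hu hv; rewrite mulrC in e.
exact: (congr_small n_gt0 hu hv e).
Qed.

Lemma U_opE : U_op R b c = Uop (@in_Zq p) pQ C (n:=n).
Proof. by rewrite /U_op D0_Hgrp. Qed.
Lemma U_linv : linv P H (U_op R b c).
Proof. rewrite U_opE D0_Hgrp; exact: (Uop_linv pQ O0 OD ON OM). Qed.
Lemma U_rinv : rinv P H (U_op R b c).
Proof. rewrite U_opE D0_Hgrp; exact: (Uop_rinv pQ O0 OD ON OM). Qed.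
Lemma U_fsupp : fsupp P H (U_op R b c).
Proof. rewrite U_opE D0_Hgrp; exact: (Uop_fsupp O0 O1 OD OM Q0 C n prepO prep_ex). Qed.

Local Notation digit := {ffun symI n -> 'I_(val p ^ 2)}.
Definition Smx (d : digit) : 'M[int]_n := \matrix_(i, j) (d (sym_idx i j) : nat)%:Z.
Definition al (d : digit) : mx := sg ((val p)%:R%:M) (b^-1 *: iQ (Smx d)).

Lemma Smx_sym (d : digit) : (Smx d)^T = Smx d.
Proof. by apply/matrixP => i j; rewrite !mxE sym_idxC. Qed.
Let p0 : (0 < val p)%N. Proof. by rewrite prime_gt0 ?(valP p). Qed.
Let pr0 : (val p)%:R != 0 :> rat. Proof. by rewrite pnatr_eq0 -lt0n. Qed.
Lemma pM_unit : ((val p)%:R%:M : 'M[rat]_n) \in unitmx.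
Proof. exact: scalar_unit. Qed.

Lemma al_siegelP (d : digit) : siegelP (al d).
Proof.
apply: siegelP_sg; first exact: pM_unit.
by rewrite linearZ /= -iQ_tr Smx_sym.
Qed.

Lemma al_loc (d : digit) : loc p (al d) = Urep pQ prep d.
Proof.
rewrite /loc /al map_sg /Urep; congr sg; apply/matrixP => i j; rewrite !mxE.
  by case: (i == j); rewrite ?mulr1n ?mulr0n ?rmorph0 // rmorph_nat.
by rewrite /prep -pmulrn.
Qed.

Lemma al_GP (d : digit) : GP p b c (al d).
Proof.
split; first exact: al_siegelP.
move=> l lp; rewrite /loc /al map_sg; apply: D0_sg.
- have u : Zq_unit ((val p)%:R : padic l) by apply: in_Zq_unitN; exact: (prime_ndvd lp).
  have -> : map_mx (rq l) ((val p)%:R%:M : 'M[rat]_n) = (val p)%:R%:M.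
    by rewrite map_scalar_mx; congr (_%:M); exact: rmorph_nat.
  apply/GLZqP; split; first by apply: Zq_mx_scalar; exact: in_Zq_nat.
  rewrite det_scalar; elim: (n) => [|m IH]; rewrite ?expr0 ?exprS; first exact: Zq_unit1.
  exact: Zq_unitM.
- by apply: (loc_sym l); rewrite linearZ /= -iQ_tr Smx_sym.
- have -> : rq l b *: map_mx (rq l) (b^-1 *: iQ (Smx d)) = loc l (iQ (Smx d)).
    rewrite -[map_mx _ _]/(loc l _) locZ scalerA fmorphV mulfV ?scale1r // fmorph_eq0; exact: b0.
  exact: Zq_iQ.
Qed.

Definition cU : C := cf k c psi (levi ((val p)%:R%:M : 'M[rat]_n)).
Lemma cf_al d : cf k c psi (al d) = cU.
Proof. by rewrite /cU /cf /al /sg /levi !block_mxKul !block_mxKdr. Qed.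

Lemma hecke_U phi z : @Pinv R n k b c psi p phi -> Hn z ->
  hecke_act k b c psi (@U_op R n p b c) phi z = \sum_(d : digit) cU * phi (act (al d) z).
Proof.
move=> hphi hz; rewrite (hecke_act_csum b0 psi_hecke U_linv hphi hz (r := index_enum _) (E := al)).
- by apply: eq_bigr => d _; rewrite cf_al.
- exact: al_GP.
- move=> G; rewrite U_opE D0_Hgrp => lG.
  rewrite (csum_Uop O0 O1 OD ON OM Q0 prepO prep_ex prep_inj lG).
  by apply: eq_bigr => d _; rewrite al_loc.
Qed.

Lemma tilde_scalar (F : fieldType) j (a : F) : tilde (a%:M : 'M[F]_j) = (a^-1)%:M.
Proof. by rewrite /tilde tr_scalar_mx invmx_scalar. Qed.

Lemma al_block (d : digit) : al d = block_mx ((val p)%:R^-1%:M) ((val p)%:R^-1 *: (b^-1 *: iQ (Smx d))) 0 ((val p)%:R%:M).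
Proof. by rewrite /al /sg tilde_scalar mul_scalar_mx. Qed.

Lemma act1 z : act 1%:M z = z.
Proof.
rewrite actE /num_mx cd_mxE scalar_mx_block block_mxKul block_mxKur block_mxKdl block_mxKdr.
by rewrite rC1 [rC R 0]map_mx0 mul0mx add0r mul1mx addr0 invmx1 mulmx1.
Qed.

Section Transform.
Variables (M L : nat).
Hypotheses (eM : b^-1 = (2 * M)%:R) (eL : b * c%:R = (2 * L)%:R) (ec : c = (4 * L * M)%N).

Lemma rCZ (a : rat) (X : 'M[rat]_n) : rC R (a *: X) = ratr a *: rC R X.
Proof. exact: map_mxZ. Qed.

Lemma act_al (d : digit) z : act (al d) z = scaled (val p) z (M%:Z *: Smx d).
Proof.
have pC : (val p)%:R != 0 :> C by rewrite pnatr_eq0 -lt0n.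
have e1 : ratr ((val p)%:R^-1) = (val p)%:R^-1 :> C by rewrite fmorphV rmorph_nat.
rewrite (act_siegel z (al_siegelP d)).1 al_block block_mxKul block_mxKur eM.
have -> : rC R ((val p)%:R^-1%:M : 'M[rat]_n) = ((val p)%:R^-1)%:M.
  by rewrite /rC map_scalar_mx; congr (_%:M).
rewrite !rCZ rC_iQ e1 ratr_nat tr_scalar_mx !mul_mx_scalar mul_scalar_mx /scaled.
apply/matrixP => i j; rewrite !mxE natrM !intrM -!pmulrn.
by move: (z i j) ((d _ : nat)%:R) => u v; field.
Qed.

Section Step.
Variables (A B Cm D : 'M[int]_n) (g : mx).
Local Notation q := ((val p ^ 2)%N%:Z).
Local Notation y := (b * (c * val p ^ 2)%N%:R).
Local Notation m := (c%:Z * q).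
Hypotheses (hg : Sp g) (eA : ulsubmx g = iQ A) (eB : ursubmx g = b^-1 *: iQ B)
  (eC : dlsubmx g = y *: iQ Cm) (eD : drsubmx g = iQ D).

Let y0 : y != 0. Proof. by rewrite mulf_neq0 ?b0 // pnatr_eq0 muln_eq0 negb_or -!lt0n c_gt0 expn_gt0 p0. Qed.
Let xy : b^-1 * y = m%:~R. Proof. by rewrite mulKf ?b0 // natrM intrM -!pmulrn. Qed.
Let x0 : b^-1 != 0. Proof. by rewrite invr_eq0 b0. Qed.

Lemma step_blocks : [/\ A *m D^T = 1%:M + m *: (B *m Cm^T), Cm *m D^T = D *m Cm^T & B^T *m D = D^T *m B].
Proof. exact: (int_blocks x0 y0 xy hg eA eB eC eD). Qed.

Let mod_lt (e : int) : (`|(e %% q)%Z| < val p ^ 2)%N.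
Proof. by apply: absz_mod_lt; rewrite expn_gt0 p0. Qed.

(** The permutation of the representatives for which alpha_d g = g' alpha_{sigma d}; on translation
    parts it is S -> D^T B + D^T S D modulo p^2. *)
Definition sigma (d : digit) : digit :=
  [ffun s : symI n => Ordinal (mod_lt ((D^T *m B + D^T *m Smx d *m D) (val s).1 (val s).2))].

Lemma Smx_sigma (d : digit) : Smx (sigma d) = redmx q B D (Smx d).
Proof.
have [_ _ h3] := step_blocks; have ES := E_sym h3 (Smx_sym d).
have q0 : q != 0 by rewrite eqz_nat -lt0n expn_gt0 p0.
apply/matrixP => i j; rewrite [LHS]mxE [RHS]mxE ffunE /= gez0_abs ?modz_ge0 //; congr (_ %% _)%Z.
by case: leqP => //= _; exact: sym_entry ES i j.
Qed.

Lemma sigma_inj : injective sigma.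
Proof.
move=> d1 d2 e; have [h1 h2 h3] := step_blocks.
have e1 := redmxE q B D (Smx d1); have e2 := redmxE q B D (Smx d2).
rewrite -!Smx_sigma in e1 e2; rewrite e in e1.
set W1 := \matrix_(i, j) _ in e1; set W2 := \matrix_(i, j) _ in e2.
have E12 : (D^T *m B + D^T *m Smx d1 *m D) - (D^T *m B + D^T *m Smx d2 *m D) = q *: (W1 - W2).
  by rewrite e1 e2 scalerBr opprD addrACA subrr add0r.
have [W HW] := reduction_inj h1 E12.
apply/ffunP => s; apply: val_inj => /=; have /matrixP/(_ (val s).1 (val s).2) := HW.
rewrite !mxE sym_idxK; exact: (congr_small n_gt0 (ltn_ord _) (ltn_ord _)).
Qed.

(** In alpha_d g alpha_{sigma d}^-1 the lower left block is multiplied by p^2 and the upper right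
    one divided by it; [reduction_identity] supplies this missing factor. *)
Lemma step (d : digit) : exists g' : mx, [/\ Gamma n b^-1 y g', g' *m al (sigma d) = al d *m g,
  ulsubmx g' = iQ (A + m *: (Smx d *m Cm)) &
  exists V : 'M[int]_n, B + Smx d *m D - (A + m *: (Smx d *m Cm)) *m Smx (sigma d) = q *: V].
Proof.
have [h1 h2 h3] := step_blocks.
have e1 := redmxE q B D (Smx d); rewrite -Smx_sigma in e1.
have HV := reduction_identity h1 e1.
move: HV; set V := (_ *m _ - _) => HV; set S := Smx d in HV *; set S' := Smx (sigma d) in HV *.
pose A' := A + m *: (S *m Cm).
pose g' : mx := block_mx (iQ A') (b^-1 *: iQ V) (y *: iQ (q *: Cm)) (iQ (D - m *: (Cm *m S'))).
have E : g' *m al (sigma d) = al d *m g.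
  rewrite -[g in RHS]submxK eA eB eC eD !al_block mulmx_block [in RHS]mulmx_block.
  rewrite !mulmx0 !mul0mx !addr0 !add0r !mul_mx_scalar !mul_scalar_mx -/S -/S'.
  have qE : q%:~R = (val p)%:R * (val p)%:R :> rat by rewrite -pmulrn natrX.
  have xyZ (X : 'M[rat]_n) : b^-1 *: (y *: X) = m%:~R *: X by rewrite scalerA xy.
  have HQ : iQ B + iQ S *m iQ D = iQ A' *m iQ S' + q%:~R *: iQ V.
    by rewrite -!iQM -iQZ -!iQD -HV [X in _ = iQ X]addrC subrK.
  have pZ (X : 'M[rat]_n) : (val p)%:R^-1 *: (q%:~R *: X) = (val p)%:R *: X.
    by rewrite scalerA qE mulKf.
  have sCA (u v : rat) (X : 'M[rat]_n) : u *: (v *: X) = v *: (u *: X) by rewrite !scalerA mulrC.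
  congr block_mx.
  - by rewrite -!scalemxAl -scalemxAr xyZ -scalerDr -iQM -iQZ -iQD.
  - rewrite -!scalemxAl -!scalemxAr -!scalerDr HQ scalerDr scalerDr; congr (_ + _).
    by rewrite [b^-1 *: (q%:~R *: _)]scalerA [b^-1 * _]mulrC -scalerA pZ.
  - by rewrite iQZ (sCA y) pZ.
  - rewrite iQB !iQZ iQM scalerBr -!scalemxAr -!scalemxAl (sCA y) (sCA b^-1) pZ xyZ addrC.
    exact: subrK.
have hal (e : digit) : Sp (al e) by case: (al_siegelP e).
have Eg : g' = al d *m g *m invmx (al (sigma d)).
  by rewrite -E mulmxK //; exact: Sp_unit (hal _).
exists g'; split=> //; last by exists V.
- apply/(GammaP _ x0 y0); split.
    by rewrite Eg; apply: SpM; [exact: SpM|exact: SpV].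
  exists A', V, (q *: Cm), (D - m *: (Cm *m S')).
  by rewrite /g' block_mxKul block_mxKur block_mxKdl block_mxKdr.
- by rewrite /g' block_mxKul.
Qed.

Lemma scaled_Hn (d : digit) z : Hn z -> Hn (scaled (val p) z (M%:Z *: Smx d)).
Proof. by move=> hz; rewrite -act_al; apply: act_Hn => //; case: (al_siegelP d). Qed.

(** The integral factor follows from the cocycle, since alpha_d and alpha_{sigma d} have the same
    constant j. The character is unchanged because the upper left blocks agree modulo c. The
    half-integral factor goes through [hfac_transfer]. *)
Lemma step_forms (d : digit) : exists g' : mx, [/\ Gamma n b^-1 y g',
  forall z : 'M[C]_n, Hn z -> act (al d) (act g z) = act g' (act (al (sigma d)) z),
  forall z : 'M[C]_n, Hn z -> hfac g' (act (al (sigma d)) z) = hfac g z,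
  forall z : 'M[C]_n, Hn z -> jfac g' (act (al (sigma d)) z) = jfac g z &
  psi_ideal psi c (\det (ulsubmx g')) = psi_ideal psi c (\det (ulsubmx g))].
Proof.
have [h1 h2 h3] := step_blocks; have [g' [Gg' E eA' [V HV]]] := step d.
have hal (e : digit) : Sp (al e) by case: (al_siegelP e).
have [Sg' _] := Gg'.
have EA z : Hn z -> act (al d) (act g z) = act g' (act (al (sigma d)) z).
  move=> hz; rewrite -(act_cocycle (hal _) hg hz).2 -E; exact: (act_cocycle Sg' (hal _) hz).2.
exists g'; split; [exact: Gg'|exact: EA| | |].
- move=> z hz.
  pose a : R := ((val p)%:R ^+ 2)^-1; pose S : 'M[C]_n := iC R (2%:Z *: (M%:Z *: Smx (sigma d))).
  have aC : a%:C = ((val p)%:R ^+ 2)^-1 by rewrite /a fmorphV rmorphXn rmorph_nat.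
  have a0 : 0 < a by rewrite invr_gt0 exprn_gt0 // ltr0n.
  have SS : S^T = S by rewrite -iC_tr !linearZ /= Smx_sym.
  have sE w : Hn w -> act (al (sigma d)) w = a%:C *: (w + S) by rewrite aC act_al.
  have hA (w : 'M[C]_n) : Hn w -> Hn (a%:C *: (w + S)) /\ Hn (a%:C^-1 *: w - S).
    move=> hw; split; first by rewrite -(sE w hw); exact: (act_Hn (hal _) hw).
    have hv := act_Hn (SpV (hal (sigma d))) hw.
    have e1 := (act_cocycle (hal (sigma d)) (SpV (hal (sigma d))) hw).2.
    rewrite (mulmxV (Sp_unit (hal (sigma d)))) act1 (sE _ hv) in e1.
    rewrite {1}e1 scalerA mulVf ?scale1r ?addrK //.
    by rewrite fmorph_eq0 gt_eqF.
  have star (w : 'M[C]_n) : Hn w -> theta (act g' (act (al (sigma d)) w)) * theta w = theta (act g w) * theta (act (al (sigma d)) w); last first.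
    exact: (hfac_transfer n_gt0 hg Sg' (hal (sigma d)) a0 SS sE hA star hz).
  move=> hw; rewrite -(EA w hw) !act_al.
  have hgw := act_Hn hg hw; have hs := scaled_Hn d hgw; have hs' := scaled_Hn (sigma d) hw.
  rewrite (theta_th n_gt0 hs) (theta_th n_gt0 hw) (theta_th n_gt0 hgw) (theta_th n_gt0 hs').
  have gB : ursubmx g = iQ (2%:Z *: (M%:Z *: B)).
    by rewrite eB eM scalerA iQZ intrM natrM -!pmulrn.
  (* One of the two factors p is split off: it makes the permutation of characteristics of
     denominator p well behaved. *)
  have gC : dlsubmx g = iQ (2%:Z *: ((val p)%:Z *: ((L * val p)%N%:Z *: Cm))).
    rewrite eC natrM mulrA eL !scalerA iQZ; congr (_ *: _).
    by rewrite -!PoszM -pmulrn -natrM; congr (_%:R); rewrite -mulnn; lia.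
  apply: (theta_scaled_transform n_gt0 p0 hg eA gB gC eD _ _ _ hw hs hs').
  - by rewrite linearZ /= Smx_sym.
  - by rewrite linearZ /= Smx_sym.
  - have -> : (2%:Z *: (M%:Z *: Smx d)) *m (2%:Z *: ((val p)%:Z *: ((L * val p)%N%:Z *: Cm))) = m *: (Smx d *m Cm).
      rewrite -!scalemxAl -!scalemxAr !scalerA; congr (_ *: _).
      by rewrite [in RHS]ec -!PoszM; congr Posz; rewrite -mulnn; lia.
    have HV' : B + Smx d *m D = (A + m *: (Smx d *m Cm)) *m Smx (sigma d) + q *: V.
      by rewrite -HV [RHS]addrC subrK.
    rewrite -!scalemxAl -!scalemxAr -!scalerDr HV' !scalerDr; congr (_ + _).
    instantiate (1 := M%:Z *: V); rewrite !scalerA; congr (_ *: _).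
    by rewrite PoszX; ring.
- move=> z hz; have := (act_cocycle Sg' (hal (sigma d)) hz).1; rewrite E.
  rewrite (act_cocycle (hal d) hg hz).1 => /(congr1 determinant); rewrite !det_mulmx.
  have cal (e : digit) w : cd_mx (al e) w = (ratr (val p)%:R : C)%:M.
    by rewrite cd_mxE al_block block_mxKdl block_mxKdr [rC R 0]map_mx0 mul0mx add0r /rC map_scalar_mx.
  rewrite !cal mulrC => /mulIf h; symmetry; apply: h.
  by rewrite det_scalar expf_neq0 // ratr_nat pnatr_eq0 -lt0n.
- rewrite eA' eA !det_map_mx.
  apply: (psi_ideal_congr psi_hecke psi_cond c_gt0 (e := \det D)).
    apply: dvdz_det => i j; rewrite mxE addrAC subrr add0r mxE -mulrA; exact: dvdz_mulr.
  apply: dvdz_trans (det_congr_unit x0 y0 xy hg eA eB eC eD); exact: dvdz_mulr.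
Qed.
End Step.
End Transform.

Definition mod_inv (N : nat) phi := forall g z, Gamma n b^-1 (b * N%:R) g -> Hn z ->
  slash k phi g z = psi_ideal psi c (\det (ulsubmx g)) * phi z.

Lemma Gamma_sub (N N' : nat) g : (0 < N)%N -> (0 < N')%N -> (N %| N')%N ->
  Gamma n b^-1 (b * N'%:R) g -> Gamma n b^-1 (b * N%:R) g.
Proof.
move=> N0 N0' /dvdnP[t e].
have x0 : b^-1 != 0 by rewrite invr_eq0 b0.
have y0 (j : nat) : (0 < j)%N -> b * j%:R != 0 by move=> j0; rewrite mulf_neq0 ?b0 // pnatr_eq0 -lt0n.
move=> /(GammaP _ x0 (y0 _ N0'))[hg [A [B [Cm [D [eA eB eC eD]]]]]].
apply/(GammaP _ x0 (y0 _ N0)); split=> //; exists A, B, (t%:Z *: Cm), D; split=> //.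
by rewrite eC e iQZ scalerA natrM -!pmulrn mulrA mulrAC.
Qed.

Lemma mod_inv_sub (N N' : nat) phi : (0 < N)%N -> (0 < N')%N -> (N %| N')%N -> mod_inv N phi -> mod_inv N' phi.
Proof. by move=> N0 N0' d h g z hg hz; exact: (h g z (Gamma_sub N0 N0' d hg) hz). Qed.

Lemma p2_gt0 : (0 < c * val p ^ 2)%N. Proof. by rewrite muln_gt0 c_gt0 expn_gt0 p0. Qed.

Lemma U_mod_inv phi : mod_inv (c * val p ^ 2) phi -> @Pinv R n k b c psi p phi ->
  mod_inv (c * val p ^ 2) (hecke_act k b c psi (@U_op R n p b c) phi).
Proof.
move=> hm hphi g z hg hz; have [M [L [_ _ eM eL ec]]] := level_numbers.
have x0 : b^-1 != 0 by rewrite invr_eq0 b0.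
have y0 : b * (c * val p ^ 2)%N%:R != 0 by rewrite mulf_neq0 ?b0 // pnatr_eq0 -lt0n p2_gt0.
have [Sg [A [B [Cm [D [eA eB eC eD]]]]]] := (GammaP g x0 y0).1 hg.
have hgz : Hn (act g z) by exact: act_Hn.
rewrite /slash (hecke_U hphi hgz) (hecke_U hphi hz) mulr_sumr mulr_sumr.
have sinj : injective (sigma B D) by exact: sigma_inj Sg eA eB eC eD.
rewrite [RHS](reindex_inj sinj) /=; apply: eq_bigr => d _.
have [g' [Gg' E1 E2 E3 E4]] := step_forms eM eL ec Sg eA eB eC eD d.
have hal : Sp (al (sigma B D d)) by case: (al_siegelP (sigma B D d)).
have hw : Hn (act (al (sigma B D d)) z) by exact: act_Hn.
have := hm g' _ Gg' hw; rewrite /slash /jk (E2 z hz) (E3 z hz) E4 -(E1 z hz) -/(jk k g z) => E.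
by rewrite mulrCA E mulrCA.
Qed.

(** x -> x A permutes Z^n, and the translation contributes e of an integer because b^-1 is even. *)
Lemma theta_siegel (g : mx) (A B D : 'M[int]_n) z : siegelP g -> Sp g -> ulsubmx g = iQ A -> ursubmx g = b^-1 *: iQ B ->
  drsubmx g = iQ D -> Hn z -> theta (act g z) = theta z.
Proof.
move=> Pg Sg eA eB eD hz; have [M [L [_ _ eM eL ec]]] := level_numbers.
have hgz : Hn (act g z) by exact: act_Hn.
rewrite (theta_th n_gt0 hgz) (theta_th n_gt0 hz); apply: (thE n_gt0 hgz).
have [E1 E2] := act_siegel z Pg; case: Pg => _ g0.
have [_ _ AD] := Sp_blocks_tr Sg; rewrite g0 trmx0 mulmx0 subr0 eA eD -iQ_tr -iQM in AD.
have {}AD : A *m D^T = 1%:M by apply: iQ_inj; rewrite AD [iQ 1%:M]map_mx1.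
have DA : D^T *m A = 1%:M by exact: mulmx1C.
have bij : bijective (fun x : 'rV[int]_n => x *m A).
  by exists (fun x => x *m D^T) => x; rewrite -mulmxA ?AD ?DA mulmx1.
have H := hasS_reindex bij (thP n_gt0 0 hz); apply: eq_hasS H => x; rewrite /comp /tt.
have d0 v : dot v (0 : 'rV[C]_n) = 0 by rewrite /dot trmx0 mulmx0 mxE.
rewrite !d0 !addr0 E1 eA eB rC_iQ -[zC R (x *m A)]/(iC R (x *m A)) iCM -[iC R x]/(zC R x).
set X := zC R x.
have eS : rC R (b^-1 *: iQ B) *m (iC R A)^T = iC R (2%:Z *: (M%:Z *: (B *m A^T))).
  rewrite rCZ rC_iQ eM ratr_nat -scalemxAl -iC_tr -iCM; apply/matrixP => i j; rewrite !mxE.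
  by rewrite natrM !intrM -!pmulrn mulrA.
rewrite eS.
have [e He] : exists e : int, quad (iC R (2%:Z *: (M%:Z *: (B *m A^T)))) X X = 2 * e%:~R.
  exists (dot (x *m (M%:Z *: (B *m A^T))) x).
  have -> : iC R (2%:Z *: (M%:Z *: (B *m A^T))) = 2 *: iC R (M%:Z *: (B *m A^T)) by exact: map_mxZ.
  rewrite /quad -scalemxAr -scalemxAl [LHS]mxE; congr (_ * _).
  by rewrite -[X]/(iC R x) -iC_tr -!iCM mxE.
have -> : quad (iC R A *m z *m (iC R A)^T + iC R (2%:Z *: (M%:Z *: (B *m A^T)))) X X =
    quad z (X *m iC R A) (X *m iC R A) + 2 * e%:~R.
  by rewrite -He /quad mulmxDr mulmxDl mxE trmx_mul !mulmxA.
have -> : 2^-1 * (quad z (X *m iC R A) (X *m iC R A) + 2 * e%:~R) = 2^-1 * quad z (X *m iC R A) (X *m iC R A) + e%:~R.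
  by move: (quad _ _ _) (e%:~R : C) => u v; field.
by rewrite expC_addint.
Qed.

(** An integral element of the parabolic belongs to the group of every level; there theta is
    invariant, so h = 1, and det d = 1 or -1. The modular law thus becomes invariance under [cf]. *)
Lemma mod_Pinv (N : nat) phi : (0 < N)%N -> mod_inv N phi -> @Pinv R n k b c psi p phi.
Proof.
move=> N0 hm g z [Pg lg] Hg hz.
have x0 : b^-1 != 0 by rewrite invr_eq0 b0.
have y0 : b * N%:R != 0 by rewrite mulf_neq0 ?b0 // pnatr_eq0 -lt0n.
have [Sg g0] := Pg.
have lall (l : primeT) : D0 b c (loc l g).
  by have [->|lp] := eqVneq l p; [exact: Hg|exact: lg].
have ya : b * c%:R != 0 by rewrite mulf_neq0 ?b0 // pnatr_eq0 -lt0n.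
have Gc : Gamma n b^-1 (b * c%:R) g by split=> // l; have [h _] := lall l.
have [_ [A [B [Cm [D [eA eB eC eD]]]]]] := (GammaP g x0 ya).1 Gc.
have GN : Gamma n b^-1 (b * N%:R) g.
  by apply/(GammaP g x0 y0); split=> //; exists A, B, 0, D; split=> //; rewrite g0 [iQ 0]map_mx0 scaler0.
have h1 : hfac g z = 1.
  by apply: (hfac_theta_invariant n_gt0 hz) => w hw; exact: theta_siegel Pg Sg eA eB eD hw.
have := hm g z GN hz; rewrite /slash /jk h1 mul1r.
have -> : jfac g z = ratr (\det (drsubmx g)).
  by rewrite /jfac cd_mxE g0 [rC R 0]map_mx0 mul0mx add0r [RHS](esym (det_map_mx _ _)).
have [a1 d1] := siegelP_det Pg.
have [_ _ AD] := Sp_blocks_tr Sg; rewrite g0 trmx0 mulmx0 subr0 eA eD -iQ_tr -iQM in AD.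
have dd : `|\det (drsubmx g)| = 1.
  have dDA : \det A * \det D = 1.
    by rewrite -(det_tr D) -det_mulmx (iQ_inj (etrans AD (esym (map_mx1 _ _)))) det1.
  rewrite eD det_map_mx -intr_norm.
  have := congr1 absz dDA; rewrite abszM => /eqP; rewrite muln_eq1 => /andP[_ /eqP h].
  by rewrite -abszE h.
have e1 : `|ratr (\det (drsubmx g)) : R| = 1 by rewrite -ratr_norm dd rmorph1.
rewrite /cf e1 sqrtr1 invr1 mulr1 => E.
have := psi_ideal_neq0 psi_hecke c a1; move: E; rewrite -invr_expz.
move: (psi_ideal _ _ _) (_ ^ k)^-1 (phi (act g z)) => u v t E u0.
by rewrite -mulrA E mulKf.
Qed.
End Level.

(** * The Weil representation at p *)

Section EqChar.
Variables (R : realType) (q : primeT).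
Local Notation C := R[i].
Local Notation K := (padic q).
Local Notation qK := ((val q)%:R : K).
Implicit Types x y : K.

Definition qfrac (y : rat) := exists k : nat, y * (val q)%:R ^+ k \is a Num.int.

Lemma qfracD (y z : rat) : qfrac y -> qfrac z -> qfrac (y + z).
Proof.
move=> [k hk] [l hl]; exists (k + l)%N; rewrite mulrDl exprD mulrA [X in _ + X]mulrCA [X in _ + X]mulrC.
by apply: rpredD; apply: rpredM => //; rewrite -natrX natr_int.
Qed.

Lemma qfracN (y : rat) : qfrac y -> qfrac (- y).
Proof. by move=> [k hk]; exists k; rewrite mulNr rpredN. Qed.

Lemma qfrac_int (y : rat) : qfrac y -> in_Zq (rq q y) -> y \is a Num.int.
Proof.
move=> hy h; apply: rat_int_local => l; have [->|lq] := eqVneq l q; first exact: h.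
have [k /intrP[m e]] := hy.
have ql : ~~ (val l %| val q)%N by rewrite dvdn_prime2 ?(valP l) ?(valP q).
have u : Zq_unit ((val q)%:R ^+ k : padic l).
  by elim: k {e} => [|k IH]; rewrite ?expr0 // exprS; apply: Zq_unitM => //; exact: in_Zq_unitN.
have -> : rq l y = m%:~R * ((val q)%:R ^+ k)^-1.
  have := congr1 (rq l) e; rewrite rmorphM rmorphXn /= rmorph_nat rmorph_int => <-.
  by rewrite mulfK //; case: u.
by apply: in_ZqM; [exact: in_Zq_int|case: u => _ []].
Qed.

Lemma frac_partP x : qfrac (frac_part x) /\ in_Zq (x - rq q (frac_part x)).
Proof.
have [r [h1 h2]] := padic_rat_approx x 0.
by apply: (@xgetPex _ 0 [set y : rat | (exists k : nat, y * (val q)%:R ^+ k \is a Num.int) /\ in_Zq (x - ratr y)]);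
  exists r; split=> //; rewrite expr0 divr1 in h2.
Qed.

(** Two admissible y differ by an element of both Z[1/q] and Z_q, that is by an integer; so the
    chosen [frac_part] may be replaced by any convenient representative. *)
Lemma eq_charE x (y : rat) : qfrac y -> in_Zq (x - rq q y) -> eq_char R x = expC (- (ratr y : R))%:C.
Proof.
move=> hy h; have [h1 h2] := frac_partP x.
have /intrP[m e] : y - frac_part x \is a Num.int.
  apply: qfrac_int; first by apply: qfracD => //; exact: qfracN.
  have := in_ZqB h2 h; rewrite opprB addrC addrA subrK -rmorphB; exact.
rewrite /eq_char; have -> : frac_part x = y - m%:~R by rewrite -e opprB addrC subrK.
rewrite rmorphB /= ratr_int opprB rmorphB /= rmorph_int addrC.
by rewrite expCD expC_int mulr1 rmorphN.
Qed.

Lemma eq_charD x y : eq_char R (x + y) = eq_char R x * eq_char R y.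
Proof.
have [h1 h2] := frac_partP x; have [h3 h4] := frac_partP y.
rewrite (@eq_charE (x + y) (frac_part x + frac_part y)); last 2 first.
- exact: qfracD.
- rewrite rmorphD opprD addrACA; exact: in_ZqD.
by rewrite rmorphD opprD rmorphD expCD.
Qed.

Lemma eq_char_Zq x : in_Zq x -> eq_char R x = 1.
Proof.
move=> hx; rewrite (@eq_charE x 0).
- by rewrite rmorph0 oppr0 expC0.
- by exists 0%N; rewrite mul0r rpred0.
- by rewrite rmorph0 subr0.
Qed.

Lemma eq_char_norm x : `|eq_char R x| = 1.
Proof.
by rewrite /eq_char cabsE cabs_expC /= mulr0 oppr0 expR0.
Qed.

(** If x is not integral, some integral t makes x t = 1 / q, and e_q(1 / q) = e(- 1 / q) is not 1.
    This detects the support of a function fixed by integral modulations. *)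
Lemma eq_char_detect x : (forall t, in_Zq t -> eq_char R (x * t) = 1) -> in_Zq x.
Proof.
move=> h; apply: contrapT => nx.
have x0 : x != 0 by apply/eqP => x0; apply: nx; rewrite x0; exact: in_Zq0.
have [m [u [uu e]]] := padic_factor x0.
have m0 : m < 0.
  by rewrite ltNge; apply/negP => m0; apply: nx; rewrite e; apply/in_Zq_qexp.
have q0 := padic_q_neq0 q.
have ht : in_Zq (qK ^ (- m - 1) * u^-1).
  apply/(in_Zq_qexp _ (Zq_unitV uu)); move: m0; clear; lia.
have := h _ ht; have -> : x * (qK ^ (- m - 1) * u^-1) = qK^-1.
  have [u0 _] := uu; rewrite e mulrACA -expfzDr // mulfV // mulr1.
  by have -> : m + (- m - 1) = -1 by ring.
have qr0 : (val q)%:R != 0 :> rat by rewrite pnatr_eq0 -lt0n prime_gt0 ?(valP q).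
rewrite (@eq_charE _ ((val q)%:R^-1)); last 2 first.
- by exists 1%N; rewrite expr1 mulVf // rpred1.
- by rewrite fmorphV rmorph_nat subrr; exact: in_Zq0.
apply/eqP; apply: expC_ne1; first by rewrite normrN fmorphV rmorph_nat normr_gt0 invr_eq0 pnatr_eq0 -lt0n prime_gt0 ?(valP q).
rewrite normrN fmorphV rmorph_nat ger0_norm ?invr_ge0 // invf_lt1 ?ltr0n ?prime_gt0 ?(valP q) //.
by rewrite ltr1n prime_gt1 ?(valP q).
Qed.
End EqChar.

Lemma mul_shuffle (F : comPzRingType) (s t u v w : F) : s * t * (u * v) * w = s * u * (t * v * w).
Proof. by ring. Qed.

(** * The operators r_P on D_0 *)

Section WeilParabolic.
Variables (R : realType) (n : nat) (q : primeT).
Local Notation C := R[i].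
Local Notation K := (padic q).
Local Notation qK := ((val q)%:R : K).
Implicit Types (phi : 'rV[K]_n -> C) (g h : 'M[K]_(n + n)).
Local Notation qf a v x := ((x *m a *m v^T *m x^T) 0 0).

Lemma siegelP_blocks g : siegelP g -> [/\ ulsubmx g *m (drsubmx g)^T = 1%:M,
  ursubmx g *m (ulsubmx g)^T = ulsubmx g *m (ursubmx g)^T & \det (ulsubmx g) != 0].
Proof.
move=> hg; have [Sg g0] := hg.
have : Sp (block_mx (ulsubmx g) (ursubmx g) (dlsubmx g) (drsubmx g)) by rewrite submxK.
move=> /Sp_tr_block [e1 _ e3]; rewrite g0 trmx0 mulmx0 subr0 in e3.
split=> //; have := congr1 determinant e3; rewrite det_mulmx det1 => h.
by apply/eqP => z; move/eqP: h; rewrite z mul0r eq_sym oner_eq0.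
Qed.

Lemma siegelP_mul_blocks g h : siegelP g -> siegelP h ->
  ulsubmx (g *m h) = ulsubmx g *m ulsubmx h /\
  ursubmx (g *m h) = ulsubmx g *m ursubmx h + ursubmx g *m drsubmx h.
Proof.
move=> [_ g0] [_ h0].
have E : g *m h = block_mx (ulsubmx g *m ulsubmx h)
   (ulsubmx g *m ursubmx h + ursubmx g *m drsubmx h) 0 (drsubmx g *m drsubmx h).
  rewrite -[in LHS](submxK g) -[in LHS](submxK h) mulmx_block g0 h0.
  by rewrite !mulmx0 !mul0mx !addr0 !add0r.
by rewrite E block_mxKul block_mxKur.
Qed.

Lemma quad_parabolic (F : fieldType) (x : 'rV[F]_n) (a b a' b' d' : 'M[F]_n) :
  a' *m d'^T = 1%:M -> b *m a^T = a *m b^T ->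
  qf (a *m a') (a *m b' + b *m d') x = qf a b x + qf a' b' (x *m a).
Proof.
move=> e1 e2; rewrite linearD /= !trmx_mul mulmxDr mulmxDl [LHS]mxE addrC; congr (_ + _).
  congr (_ 0 0); congr (_ *m _); rewrite !mulmxA -(mulmxA (x *m a) a') e1 mulmx1.
  by [].
by congr (_ 0 0); rewrite !mulmxA.
Qed.

Lemma rPM g h phi : siegelP g -> siegelP h -> (rP R (g *m h)).2 phi = (rP R g).2 ((rP R h).2 phi).
Proof.
move=> Pg Ph; have [a1 b1 d1] := siegelP_blocks Pg; have [a2 b2 d2] := siegelP_blocks Ph.
have [e1 e2] := siegelP_mul_blocks Pg Ph.
apply/funext => x; rewrite /rP /= e1 e2 (quad_parabolic _ _ a2 b1) mulrDr eq_charD det_mulmx padic_valM //.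
have q0 : (val q)%:R != 0 :> R by rewrite pnatr_eq0 -lt0n prime_gt0 ?(valP q).
rewrite opprD expfzDr // sqrtrM ?exprz_ge0 // rmorphM /= mulmxA.
exact: mul_shuffle.
Qed.

Lemma det_unit_val (a : 'M[K]_n) : GLZq a -> padic_val (\det a) = 0.
Proof. by move=> /GLZqP[_ h]; exact: padic_val_Zq_unit. Qed.

Variables (b : rat) (c : nat).
Hypothesis b0 : b != 0.
Local Notation H := (@D0 n q b c).
Hypotheses (b_unit : Zq_unit (rq q b)) (two_unit : Zq_unit (2 : K)).

Lemma D0_blocks g : H g -> [/\ siegelP g, GLZq (ulsubmx g) & Zq_mx (ursubmx g)].
Proof.
move=> /D0P[d [v [h1 h2 h3 ->]]]; have ud := GLZq_unit h1.
have ht : GLZq (tilde d) by rewrite /tilde; apply: GLZqV; exact: GLZq_tr.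
split; first exact: siegelP_sg.
  by rewrite /sg block_mxKul.
rewrite /sg block_mxKur; apply: Zq_mxM; first by case: ht.
have -> : v = (rq q b)^-1 *: (rq q b *: v).
  by rewrite scalerA mulVf ?scale1r //; case: b_unit.
by apply: Zq_mxZ => //; case: b_unit => _ [].
Qed.

Lemma rP_D0E g phi x : H g -> (rP R g).2 phi x =
  eq_char R (2^-1 * (x *m (ulsubmx g *m (ursubmx g)^T) *m x^T) 0 0) * phi (x *m ulsubmx g).
Proof.
by move=> hg; have [_ h2 _] := D0_blocks hg; rewrite /rP /= (det_unit_val h2) oppr0 expr0z sqrtr1 mul1r mulmxA.
Qed.

Lemma Zq_mx_scalar_entry (x y : 'rV[K]_n) : Zq_mx x -> Zq_mx y -> in_Zq ((x *m y^T) 0 0).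
Proof. by move=> hx hy; apply: (Zq_mxM hx); exact: Zq_mx_tr. Qed.

Lemma rP_D0_phi0 g : H g -> (rP R g).2 (@phi0 R n q) = @phi0 R n q.
Proof.
move=> hg; have [_ h2 h3] := D0_blocks hg; have [u2 h21 h22] := h2.
apply/funext => x; rewrite rP_D0E // /phi0.
have iff : Zq_mx (x *m ulsubmx g) <-> Zq_mx x.
  split=> h; last exact: Zq_mxM.
  by rewrite -[x](mulmxK u2); exact: Zq_mxM.
have [hx|hx] := pselect (Zq_mx x).
  rewrite !indicE !mem_set //; last exact/iff.
  rewrite mulr1 eq_char_Zq //; apply: in_ZqM; first by case: two_unit => _ [].
  have h4 : Zq_mx (x *m (ulsubmx g *m (ursubmx g)^T) *m x^T).
    apply: Zq_mxM; last exact: Zq_mx_tr.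
    by apply: Zq_mxM => //; apply: Zq_mxM => //; exact: Zq_mx_tr.
  exact: h4.
have n1 : \1_[set y : 'rV[K]_n | Zq_mx y] x = 0 :> C by rewrite indicE memNset.
have n2 : \1_[set y : 'rV[K]_n | Zq_mx y] (x *m ulsubmx g) = 0 :> C by rewrite indicE memNset // => /iff.
by rewrite n1 n2 mulr0.
Qed.

Lemma Zq_mx_cancel (a : 'M[K]_n) (x : 'rV[K]_n) : GLZq a -> Zq_mx (x *m a) -> Zq_mx x.
Proof. by move=> [ua _ h] hx; rewrite -[x](mulmxK ua); exact: Zq_mxM. Qed.

Lemma quad_shift (F : fieldType) (m : 'M[F]_n) (x h : 'rV[F]_n) : m^T = m -> 2 != 0 :> F ->
  2^-1 * ((x + h) *m m *m (x + h)^T) 0 0 =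
  2^-1 * (x *m m *m x^T) 0 0 + (x *m m *m h^T) 0 0 + 2^-1 * (h *m m *m h^T) 0 0.
Proof.
move=> mm two0; have e : (h *m m *m x^T) 0 0 = (x *m m *m h^T) 0 0.
  have -> : h *m m *m x^T = (x *m m *m h^T)^T by rewrite !trmx_mul trmxK mm mulmxA.
  by rewrite [LHS]mxE.
have E : (x + h) *m m *m (x + h)^T = x *m m *m x^T + h *m m *m x^T + (x *m m *m h^T + h *m m *m h^T).
  by rewrite linearD /= mulmxDr !mulmxDl.
have add_e (A B : 'M[F]_1) : (A + B) 0 0 = A 0 0 + B 0 0 by rewrite mxE.
by rewrite E !add_e e; field.
Qed.

Lemma heis_identity (F : fieldType) (x u v : 'rV[F]_n) (a b' d : 'M[F]_n) :
  a *m d^T = 1%:M -> (a *m b'^T)^T = a *m b'^T -> 2 != 0 :> F ->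
  2^-1 * (u *m v^T) 0 0 + (x *m v^T) 0 0 + 2^-1 * ((x + u) *m (a *m b'^T) *m (x + u)^T) 0 0 =
  2^-1 * (x *m (a *m b'^T) *m x^T) 0 0 +
   (2^-1 * (u *m a *m (u *m b' + v *m d)^T) 0 0 + (x *m a *m (u *m b' + v *m d)^T) 0 0).
Proof.
move=> e1 e2 t0; rewrite (quad_shift x u e2 t0).
have H (y : 'rV[F]_n) : (y *m a *m (u *m b' + v *m d)^T) 0 0 = (y *m (a *m b'^T) *m u^T) 0 0 + (y *m v^T) 0 0.
  rewrite linearD /= !trmx_mul mulmxDr [LHS]mxE; congr (_ + _).
    by rewrite !mulmxA.
  by rewrite mulmxA -(mulmxA y) e1 mulmx1.
by rewrite !H; field.
Qed.

Lemma ul_ur_sym g : siegelP g -> (ulsubmx g *m (ursubmx g)^T)^T = ulsubmx g *m (ursubmx g)^T.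
Proof. by move=> /siegelP_blocks[_ e _]; rewrite trmx_mul trmxK e. Qed.

Lemma rP_D0_schwartz g phi : H g -> schwartz phi -> schwartz ((rP R g).2 phi).
Proof.
move=> hg [N [h1 h2]]; have [Pg ha hb] := D0_blocks hg; have [ua ha1 _] := ha.
have [t0 [t1 t2]] := two_unit; have qN0 := qX_neq0 q N.
have sc (x h : 'rV[K]_n) : Zq_mx (qK ^+ N *: x) -> Zq_mx (qK ^- N *: h) ->
    in_Zq ((x *m (ulsubmx g *m (ursubmx g)^T) *m h^T) 0 0).
  move=> hx hh; have h3 : Zq_mx ((qK ^+ N *: x) *m (ulsubmx g *m (ursubmx g)^T) *m (qK ^- N *: h)^T).
    apply: Zq_mxM; last exact: Zq_mx_tr.
    by apply: Zq_mxM => //; apply: Zq_mxM => //; exact: Zq_mx_tr.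
  have := h3 0 0; rewrite linearZ /= -scalemxAr -!scalemxAl scalerA mulVf //.
  by rewrite scale1r.
have scal (h : 'rV[K]_n) : Zq_mx (qK ^- N *: h) -> Zq_mx (qK ^+ N *: h).
  move=> hh; have -> : qK ^+ N *: h = (qK ^+ N * qK ^+ N) *: (qK ^- N *: h).
    by rewrite scalerA mulfK.
  by apply: Zq_mxZ => //; apply: in_ZqM; apply: in_ZqX; exact: in_Zq_nat.
(* The same N serves: a unimodular change of variables preserves the support bound and the period,
   and on the support the quadratic phase does not see a shift by q^N. *)
exists N; split.
  move=> x; rewrite rP_D0E // mulf_eq0 negb_or => /andP[_ /h1 hx].
  by apply: (Zq_mx_cancel ha); rewrite -scalemxAl.
move=> x h hh; rewrite (rP_D0E phi (x + h) hg) (rP_D0E phi x hg) (mulmxDl x h (ulsubmx g)).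
have ee : phi (x *m ulsubmx g + h *m ulsubmx g) = phi (x *m ulsubmx g).
  by apply: h2; rewrite scalemxAl; exact: Zq_mxM.
rewrite ee; have [->|nz] := eqVneq (phi (x *m ulsubmx g)) 0.
  exact: (etrans (mulr0 _) (esym (mulr0 _))).
apply: (congr1 (fun t => t * phi (x *m ulsubmx g))).
have hx : Zq_mx (qK ^+ N *: x) by apply: (Zq_mx_cancel ha); rewrite -scalemxAl; exact: h1.
rewrite (quad_shift x h (ul_ur_sym Pg) t0) eq_charD eq_charD.
rewrite (eq_char_Zq R (sc x h hx hh)) (eq_char_Zq R (in_ZqM t2 (sc h h (scal h hh) hh))).
by rewrite !mulr1.
Qed.

Lemma D0_1 : H 1%:M. Proof. exact: D01. Qed.

Lemma rP1 phi : (rP R (1%:M : 'M[K]_(n + n))).2 phi = phi.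
Proof.
apply/funext => x; rewrite (rP_D0E phi x D0_1) scalar_mx_block block_mxKul block_mxKur.
rewrite trmx0 mulmx0 mulmx0 mul0mx mxE mulr0 mulmx1.
by rewrite (eq_char_Zq R (in_Zq0 q)) mul1r.
Qed.

Lemma rP_D0_heisenberg g w phi : H g ->
  heisenberg w ((rP R g).2 phi) = (rP R g).2 (heisenberg (w *m g) phi).
Proof.
move=> hg; have [Pg _ _] := D0_blocks hg; have [t0 _] := two_unit.
have [e1 _ _] := siegelP_blocks Pg; have [_ g0] := Pg.
apply/funext => x; rewrite (rP_D0E _ x hg) /heisenberg (rP_D0E _ _ hg).
set u := lsubmx w; set v := rsubmx w.
have E : w *m g = row_mx (u *m ulsubmx g) (u *m ursubmx g + v *m drsubmx g).
  by rewrite -[in LHS](hsubmxK w) -[in LHS](submxK g) mul_row_block g0 mulmx0 addr0.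
have -> : lsubmx (w *m g) = u *m ulsubmx g by rewrite E row_mxKl.
have -> : rsubmx (w *m g) = u *m ursubmx g + v *m drsubmx g by rewrite E row_mxKr.
rewrite -(mulmxDl x u (ulsubmx g)).
etransitivity; first exact: mulrA.
etransitivity; last exact: esym (mulrA _ _ _).
apply: (congr1 (fun t => t * phi ((x + u) *m ulsubmx g))).
etransitivity; first exact: esym (eq_charD R _ _).
etransitivity; last exact: (eq_charD R _ _).
by rewrite (heis_identity x u v e1 (ul_ur_sym Pg) t0).
Qed.

Lemma rP_D0_inv g phi : H g -> (rP R g).2 ((rP R (invmx g)).2 phi) = phi.
Proof.
move=> hg; have [Pg _ _] := D0_blocks hg.
by rewrite -(rPM phi Pg (siegelPV Pg)) (mulmxV (siegelP_unit Pg)) rP1.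
Qed.

(* Right multiplication by a unimodular matrix permutes the classes of (q^-N Z_q / q^N Z_q)^n. *)
Section ChangeOfVariable.
Variables (a : 'M[K]_n) (N : nat).
Hypothesis ha : GLZq a.
Local Notation D := {ffun 'I_n -> 'I_(val q ^ (2 * N))}.
Definition grid (m : D) : 'rV[K]_n := \row_i ((m i : nat)%:R / qK ^+ N).

Lemma grid_shift_ex (m : D) : exists m' : D, Zq_mx (qK ^- N *: (grid m *m a - grid m')).
Proof.
have /choice[f hf] : forall j : 'I_n, exists k : 'I_(val q ^ (2 * N)),
    in_Zq (((\sum_i (m i : nat)%:R * a i j) - (k : nat)%:R) / qK ^+ (2 * N)).
  move=> j; have [|k hk1 hk2] := @in_Zq_approx q (\sum_i (m i : nat)%:R * a i j) (2 * N).
    apply: in_Zq_sum => i _; apply: in_ZqM; first exact: in_Zq_nat.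
    by case: ha => _ h _; exact: h.
  by exists (Ordinal hk1).
exists [ffun j => f j] => i j; have := hf j.
have -> : (qK ^- N *: (grid m *m a - grid [ffun j => f j])) i j =
    qK ^- N * ((grid m *m a) i j - (f j : nat)%:R * qK ^- N).
  by rewrite [LHS]mxE; congr (_ * _); rewrite [LHS]mxE; congr (_ + _); rewrite [LHS]mxE; congr (- _); rewrite mxE ffunE.
have -> : (grid m *m a) i j = (\sum_l (m l : nat)%:R * a l j) * qK ^- N.
  by rewrite mxE mulr_suml; apply: eq_bigr => l _; rewrite mxE mulrAC.
have -> : qK ^+ (2 * N) = qK ^+ N * qK ^+ N by rewrite mul2n -addnn exprD.
have sh (F : fieldType) (x y z : F) : z^-1 * (x / z - y / z) = (x - y) / (z * z).
  by rewrite -mulrBl mulrC -mulrA -invfM.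
by rewrite sh.
Qed.

Lemma grid_congr (m m' : D) : Zq_mx (qK ^- N *: (grid m - grid m')) -> m = m'.
Proof.
move=> h; apply/ffunP => i; apply: val_inj => /=; have := h 0 i.
rewrite !mxE -mulrBl mulrC -mulrA -invfM -exprD addnn -mul2n.
have -> : (m i : nat)%:R - (m' i : nat)%:R = ((m i : nat)%:Z - (m' i : nat)%:Z)%:~R :> K by rewrite intrB.
move=> /in_Zq_intP; have := ltn_ord (m i); have := ltn_ord (m' i).
rewrite -PoszX; move: (val q ^ (2 * N))%N (m i : nat) (m' i : nat) => P u v hv hu /dvdzP[t e].
by clear -hv hu e; case: (ltgtP t 0) => h; nia.
Qed.

Lemma sum_grid (psi : 'rV[K]_n -> C) : (forall (x h : 'rV[K]_n), Zq_mx (qK ^- N *: h) -> psi (x + h) = psi x) ->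
  \sum_(m : D) psi (grid m *m a) = \sum_(m : D) psi (grid m).
Proof.
move=> per; have /choice[s hs] := grid_shift_ex.
have sinj : injective s.
  move=> m m' e; apply: grid_congr; have h1 := hs m; have h2 := hs m'; rewrite e in h1.
  have : Zq_mx (qK ^- N *: (grid m - grid m') *m a).
    have -> : qK ^- N *: (grid m - grid m') *m a =
        qK ^- N *: (grid m *m a - grid (s m')) + - (qK ^- N *: (grid m' *m a - grid (s m'))).
      by rewrite -scalemxAl mulmxBl -scalerBr opprB addrA subrK.
    by apply: Zq_mxD => //; exact: Zq_mxN.
  exact: Zq_mx_cancel.
rewrite [RHS](reindex_inj sinj) /=; apply: eq_bigr => m _.
by rewrite -[grid m *m a](subrK (grid (s m))) addrC per.
Qed.
End ChangeOfVariable.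

Lemma lim_eventually (u v : nat -> C^o) N0 : (forall N, (N0 <= N)%N -> u N = v N) ->
  lim (u @ \oo) = lim (v @ \oo).
Proof.
move=> e; have e1 : \forall N \near \oo, u N = v N by exists N0.
have e2 : \forall N \near \oo, v N = u N by exists N0 => // N hN; rewrite e.
have i1 : v @ \oo `=>` u @ \oo by exact: near_eq_cvg e1.
have i2 : u @ \oo `=>` v @ \oo by exact: near_eq_cvg e2.
by congr (lim _); apply/seteqP; split.
Qed.

Lemma haar_GL (a : 'M[K]_n) (psi : 'rV[K]_n -> C) N0 : GLZq a ->
  (forall (x h : 'rV[K]_n), Zq_mx (qK ^- N0 *: h) -> psi (x + h) = psi x) ->
  haar (fun x => psi (x *m a)) = haar psi.
Proof.
move=> ha per; apply: (@lim_eventually _ _ N0) => N hN; congr (_ / _).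
apply: (sum_grid ha) => x h hh; apply: per.
have -> : qK ^- N0 *: h = qK ^+ (N - N0) *: (qK ^- N *: h).
  by rewrite scalerA -{2}(subnK hN) exprD invfM mulrA mulfV ?mul1r // qX_neq0.
by apply: Zq_mxZ => //; apply: in_ZqX; exact: in_Zq_nat.
Qed.

Lemma rP_D0_Mp g : H g -> Mp (rP R g).
Proof.
move=> hg; have [Pg ha hb] := D0_blocks hg; split; first by case: Pg.
split.
- by move=> phi; exact: rP_D0_schwartz.
- move=> t phi1 phi2 _ _; apply/funext => x; rewrite !(rP_D0E _ _ hg).
  by move: (eq_char R _) (phi1 _) (phi2 _) => u v w; ring.
- move=> phi hphi; exists ((rP R (invmx g)).2 phi); last exact: rP_D0_inv.
  by apply: rP_D0_schwartz => //; exact: D0V.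
- move=> phi [N [_ h2]].
  rewrite -(@haar_GL (ulsubmx g) (fun x => `|phi x| ^+ 2) N ha); last by move=> x h hh; rewrite h2.
  congr haar; apply/funext => x; by rewrite (rP_D0E _ _ hg) normrM eq_char_norm mul1r.
- by move=> w phi _; exact: rP_D0_heisenberg.
Qed.
End WeilParabolic.

Lemma count_multiples (P m : nat) : (0 < P)%N -> (\sum_(j < m * P) (P %| j) = m)%N.
Proof.
move=> P0; rewrite -(big_mkord xpredT (fun j => (P %| j)%N : nat)) big_nat_mul.
rewrite -[RHS]subn0 -[RHS]muln1 -sum_nat_const_nat; apply: eq_bigr => i _.
rewrite big_ltn; last by rewrite mulSn -[X in (X < _)%N]add0n ltn_add2r.
rewrite dvdn_mull // big1_seq ?addn0 // => j; rewrite mem_index_iota => /andP[_ /andP[h1 h2]].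
apply/eqP; rewrite eqb0; apply/negP => /dvdnP[t e]; move: h1 h2.
by rewrite e mulSn ltn_mul2r P0 /= => h1; rewrite addnC -mulSnr ltn_mul2r P0 /= ltnS leqNgt h1.
Qed.

(** * Operators over the integral symplectic group, and the factor J *)

Section WeilIntegral.
Variables (R : realType) (n : nat) (q : primeT).
Local Notation C := R[i].
Local Notation K := (padic q).
Local Notation qK := ((val q)%:R : K).
Implicit Types g : 'M[K]_(n + n).
Variables (b : rat) (c : nat).
Hypothesis b0 : b != 0.
Local Notation H := (@D0 n q b c).
Local Notation D := (Dgrp n q b^-1 (b * c%:R)).
Hypotheses (b_unit : Zq_unit (rq q b)) (c_unit : Zq_unit (c%:R : K)) (two_unit : Zq_unit (2 : K)).
Local Notation phi0 := (@phi0 R n q).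
Local Notation Mp := (@Mp R n q).
Local Notation mp_elt := (mp_elt R n q).

Lemma Dgrp_O_integral : D = Dgrp_O (@in_Zq q) (n:=n).
Proof.
have u1 : Zq_unit (ratr b^-1 : K)^-1 by rewrite rqE fmorphV invrK.
have u2 : Zq_unit (ratr (b * c%:R) : K)^-1.
  by apply: Zq_unitV; rewrite rqE rmorphM rmorph_nat; exact: Zq_unitM.
apply/seteqP; split=> g.
  move=> [hs h1 h2 /(Zq_mx_unitZ _ u1) h3 /(Zq_mx_unitZ _ u2) h4]; split=> //.
  by rewrite -(submxK g); apply/mxO_block.
move=> [hs hg]; have : mxO (@in_Zq q) (block_mx (ulsubmx g) (ursubmx g) (dlsubmx g) (drsubmx g)) by rewrite submxK.
move=> /mxO_block[h1 h2 h3 h4]; split=> //; first exact/(Zq_mx_unitZ _ u1).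
exact/(Zq_mx_unitZ _ u2).
Qed.

Lemma phi0_in (x : 'rV[K]_n) : Zq_mx x -> phi0 x = 1.
Proof. by move=> h; rewrite /phi0 indicE mem_set. Qed.
Lemma phi0_out (x : 'rV[K]_n) : ~ Zq_mx x -> phi0 x = 0.
Proof. by move=> h; rewrite /phi0 indicE memNset. Qed.

Lemma phi0_shift (x h : 'rV[K]_n) : Zq_mx h -> phi0 (x + h) = phi0 x.
Proof.
move=> hh; have [hx|hx] := pselect (Zq_mx x).
  by rewrite !phi0_in //; exact: Zq_mxD.
rewrite !phi0_out // => hx'; apply: hx; rewrite -[x](addrK h); apply: Zq_mxD => //; exact: Zq_mxN.
Qed.

Lemma phi0_schwartz : schwartz phi0.
Proof.
exists 0%N; split=> [x|x h]; rewrite expr0 ?invr1 scale1r; last exact: phi0_shift.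
by move=> hx; apply: contrapT => h; move: hx; rewrite phi0_out ?eqxx.
Qed.

Lemma heisenberg_phi0 (w : 'rV[K]_(n + n)) : Zq_mx w -> heisenberg w phi0 = phi0.
Proof.
move=> hw; apply/funext => x; rewrite /heisenberg.
have hu : Zq_mx (lsubmx w) by move=> i j; rewrite mxE; exact: hw.
have hv : Zq_mx (rsubmx w) by move=> i j; rewrite mxE; exact: hw.
rewrite phi0_shift //; have [hx|hx] := pselect (Zq_mx x); last first.
  by rewrite phi0_out // mulr0.
rewrite phi0_in // eq_char_Zq ?mulr1 //; apply: in_ZqD.
  by apply: in_ZqM; [case: two_unit => _ []|exact: Zq_mx_scalar_entry].
exact: Zq_mx_scalar_entry.
Qed.

Lemma Zq_mx_grid N (m : {ffun 'I_n -> 'I_(val q ^ (2 * N))}) :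
  phi0 (\row_i ((m i)%:R / qK ^+ N)) = \prod_i ((val q ^ N %| m i)%N%:R).
Proof.
have e i : in_Zq ((m i)%:R / qK ^+ N) <-> (val q ^ N %| m i)%N.
  have -> : (m i)%:R = ((m i : nat)%:Z)%:~R :> K by [].
  split; first by move/in_Zq_intP; rewrite -PoszX dvdzE !absz_nat.
  move=> /dvdnP[t ->]; rewrite PoszM intrM.
  have -> : ((val q ^ N)%N%:Z)%:~R = qK ^+ N by rewrite -natrX.
  by rewrite mulfK ?qX_neq0 //; exact: in_Zq_int.
have [hx|hx] := pselect (forall i, (val q ^ N %| m i)%N).
  rewrite phi0_in; last by move=> i j; rewrite mxE; apply/e.
  by rewrite big1 // => i _; rewrite hx.
have [i hi] : exists i, ~~ (val q ^ N %| m i)%N by apply: contrapT => /forallNP h; apply: hx => i; apply: contrapT => /negP; exact: h.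
rewrite phi0_out; first by rewrite (bigD1 i) //= (negbTE hi) mul0r.
by move=> h; have := h 0 i; rewrite mxE => /e; rewrite (negbTE hi).
Qed.

Lemma haar_phi0 : haar (fun x => `|phi0 x| ^+ 2) = 1.
Proof.
have -> : (fun x => `|phi0 x| ^+ 2) = phi0.
  apply/funext => x; have [hx|hx] := pselect (Zq_mx x).
    by rewrite phi0_in // normr1 expr1n.
  by rewrite phi0_out // normr0 expr0n.
have q0 : (val q)%:R != 0 :> C by rewrite pnatr_eq0 -lt0n prime_gt0 ?(valP q).
rewrite /haar; have -> : (fun N : nat => (\sum_(m : {ffun 'I_n -> 'I_(val q ^ (2 * N))})
     phi0 (\row_i ((m i)%:R / qK ^+ N))) / (val q)%:R ^+ (n * N) : C^o) = fun=> 1.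
  apply/funext => N; rewrite (eq_bigr _ (fun m _ => Zq_mx_grid m)).
  rewrite -(bigA_distr_bigA (fun (i : 'I_n) (j : 'I_(val q ^ (2 * N))) => (val q ^ N %| j)%N%:R : C)).
  have qN : (val q ^ (2 * N) = val q ^ N * val q ^ N)%N by rewrite mul2n -addnn expnD.
  rewrite (eq_bigr (fun _ => (val q)%:R ^+ N)); last first.
    move=> i _; rewrite -natr_sum qN count_multiples ?natrX //.
    by rewrite expn_gt0 prime_gt0 ?(valP q).
  by rewrite prodr_const card_ord -exprM mulnC mulfV // expf_neq0.
apply: (@cvg_lim C^o); [exact: norm_hausdorff|exact: cvg_cst].
Qed.

(** Up to scalars [phi0] is the only function fixed by the integral part of the Heisenberg group:
    modulations confine the support to Z_q^n, translations make the function constant there. An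
    operator over an integral matrix preserves this property, and unitarity makes the scalar
    nonzero. *)
Lemma Mp_integral_phi0 (s : mp_elt) : Mp s -> Zq_mx s.1 ->
  s.2 phi0 = (fun x => s.2 phi0 0 * phi0 x) /\ s.2 phi0 0 != 0.
Proof.
move=> [_ [h1 _ _ h4 h5]] hs; set phi := s.2 phi0.
have inv w : Zq_mx w -> heisenberg w phi = phi.
  move=> hw; rewrite /phi h5; last exact: phi0_schwartz.
  by rewrite heisenberg_phi0 //; exact: Zq_mxM.
have supp x : phi x != 0 -> Zq_mx x.
  move=> nz i j; apply: (@eq_char_detect R q) => t ht.
  have hw : Zq_mx (row_mx 0 (t *: delta_mx i j) : 'rV[K]_(n + n)).
    move=> i' j'; rewrite mxE; case: splitP => l _; first by rewrite mxE; exact: in_Zq0.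
    rewrite mxE [X in _ * X]mxE; apply: (in_ZqM ht).
    by case: (_ && _); [exact: in_Zq1|exact: in_Zq0].
  have /(congr1 (fun f => f x)) := inv _ hw; rewrite /heisenberg row_mxKl row_mxKr mul0mx addr0.
  rewrite [X in 2^-1 * X]mxE mulr0 add0r => e.
  have e2 : eq_char R ((x *m (t *: delta_mx i j)^T) 0 0) = 1.
    by apply: (mulIf nz); rewrite mul1r.
  rewrite -e2; congr (eq_char R _); rewrite mxE (bigD1 j) //= big1 => [|l lj].
    by rewrite !mxE (ord1 i) !eqxx mulr1 addr0.
  by rewrite !mxE (negbTE lj) andbF mulr0 mulr0.
have shift x h : Zq_mx h -> phi (x + h) = phi x.
  move=> hh; have hw : Zq_mx (row_mx h 0 : 'rV[K]_(n + n)).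
    move=> i' j'; rewrite mxE; case: splitP => l _; first exact: hh.
    by rewrite mxE; exact: in_Zq0.
  have /(congr1 (fun f => f x)) := inv _ hw; rewrite /heisenberg row_mxKl row_mxKr trmx0 !mulmx0.
  by rewrite mxE mulr0 addr0 (eq_char_Zq R (in_Zq0 q)) mul1r.
have E : phi = (fun x => phi 0 * phi0 x).
  apply/funext => x; have [hx|hx] := pselect (Zq_mx x).
    by rewrite phi0_in // mulr1 -[x]add0r shift.
  rewrite phi0_out // mulr0; apply/eqP; apply: contraT => /supp /hx [].
split=> //; apply/eqP => z; have := h4 _ phi0_schwartz; rewrite haar_phi0 -/phi.
have -> : (fun x => `|phi x| ^+ 2) = fun=> 0.
  by apply/funext => x; rewrite E z mul0r normr0 expr0n.
rewrite /haar; have -> : (fun N : nat => (\sum_(m : {ffun 'I_n -> 'I_(val q ^ (2 * N))}) 0) / (val q)%:R ^+ (n * N) : C^o) = fun=> 0.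
  by apply/funext => N; rewrite big1 // mul0r.
have -> : lim ((fun=> 0 : C^o) @ \oo) = 0 by apply: (@cvg_lim C^o); [exact: norm_hausdorff|exact: cvg_cst].
by move=> /eqP; rewrite eq_sym oner_eq0.
Qed.

Lemma Mp_mul (s t : mp_elt) : Mp s -> Mp t -> Mp (mp_mul s t).
Proof.
move=> [s0 [s1 s2 s3 s4 s5]] [t0 [t1 t2 t3 t4 t5]]; split; first exact: SpM.
split=> /=.
- by move=> phi h; apply: s1; exact: t1.
- by move=> a phi1 phi2 h1 h2; rewrite t2 // s2 //; exact: t1.
- move=> phi h; have [phi1 h1 e1] := s3 _ h; have [phi2 h2 e2] := t3 _ h1.
  by exists phi2 => //; rewrite e2.
- by move=> phi h; rewrite s4 ?t4 //; exact: t1.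
- by move=> w phi h; rewrite s5 ?t5 ?mulmxA //; exact: t1.
Qed.

Lemma Mp_id : Mp (1%:M, id).
Proof.
split; first exact: Sp1.
split=> [phi h|a phi1 phi2 _ _|phi h|phi h|w phi _]; [exact: h|by []|by exists phi|by []|].
by rewrite [(_, _).1]/= mulmx1.
Qed.

Lemma Dgrp1 : D 1%:M.
Proof. by rewrite Dgrp_O_integral; split; [exact: Sp1|exact: Zq_mx1]. Qed.

Lemma DgrpM g h : D g -> D h -> D (g *m h).
Proof.
by rewrite Dgrp_O_integral => -[g1 g2] [h1 h2]; split; [exact: SpM|exact: Zq_mxM].
Qed.

Definition Jset g : set C := [set t : C | exists y beta gamma,
  [/\ @admissible n q y, Mp beta /\ D beta.1, Mp gamma /\ D gamma.1,
      mp_eq (rP R g) (mp_mul beta (mp_mul (rP R (levi y)) gamma))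
    & t = hloc beta * hloc gamma]].

Lemma JfacE g : Jfac R b c g = xget 0 (Jset g). Proof. by []. Qed.

Lemma rP_0 g phi : H g -> (rP R g).2 phi 0 = phi 0.
Proof.
move=> hg; rewrite (rP_D0E b_unit phi 0 hg) !mul0mx [X in 2^-1 * X]mxE mulr0.
by rewrite (eq_char_Zq R (in_Zq0 q)) mul1r.
Qed.

(** r_P(d) is absorbed into beta; it does not change the value of a function at 0, so [hloc beta]
    stays the same. *)
Lemma Jset_mull d g : H d -> siegelP g -> Jset g `<=` Jset (d *m g).
Proof.
move=> hd hg t [y [s [s' [hy [Ms Ds] hs' [e1 e2] et]]]].
have Md : Mp (rP R d) by exact: rP_D0_Mp hd.
exists y, (mp_mul (rP R d) s), s'; split.
- exact: hy.
- split; first exact: Mp_mul Md Ms.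
  by apply: DgrpM Ds; case: hd.
- exact: hs'.
- split; first by rewrite /= -mulmxA; apply: (congr1 (mulmx d)); exact: e1.
  move=> phi hphi; exact: (etrans (rPM phi (proj2 hd) hg) (congr1 (rP R d).2 (e2 _ hphi))).
have -> : hloc (mp_mul (rP R d) s) = hloc s by exact: (congr1 GRing.inv (rP_0 (s.2 phi0) hd)).
exact: et.
Qed.

(** r_P(d) is absorbed into gamma, and [hloc gamma] stays the same because r_P(d) fixes [phi0]. *)
Lemma Jset_mulr d g : H d -> siegelP g -> Jset g `<=` Jset (g *m d).
Proof.
move=> hd hg t [y [s [s' [hy hs [Ms' Ds'] [e1 e2] et]]]].
have Md : Mp (rP R d) by exact: rP_D0_Mp hd.
exists y, s, (mp_mul s' (rP R d)); split.
- exact: hy.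
- exact: hs.
- split; first exact: Mp_mul Ms' Md.
  by apply: (DgrpM Ds'); case: hd.
- split; first by rewrite /= !mulmxA; apply: (congr1 (fun h => h *m d)); rewrite -mulmxA; exact: e1.
  move=> phi hphi; exact: (etrans (rPM phi hg (proj2 hd)) (e2 _ (rP_D0_schwartz b_unit two_unit hd hphi))).
have -> : hloc (mp_mul s' (rP R d)) = hloc s'.
  exact: (congr1 (fun f : 'rV[K]_n -> C => (s'.2 f 0)^-1) (rP_D0_phi0 R b_unit two_unit hd)).
exact: et.
Qed.

(** [Jfac] is a choice from [Jset], so equality of the sets of candidates already gives equality of
    the chosen values. *)
Lemma Jfac_mull d g : H d -> siegelP g -> Jfac R b c (d *m g) = Jfac R b c g.
Proof.
move=> hd hg; rewrite !JfacE; apply: (congr1 (xget 0)); apply/seteqP; split; last exact: Jset_mull.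
have hdg : siegelP (d *m g) by apply: siegelPM hg; case: hd.
have := Jset_mull (D0V hd) hdg.
by rewrite mulmxA mulVmx ?mul1mx //; apply: siegelP_unit; case: hd.
Qed.

Lemma Jfac_mulr d g : H d -> siegelP g -> Jfac R b c (g *m d) = Jfac R b c g.
Proof.
move=> hd hg; rewrite !JfacE; apply: (congr1 (xget 0)); apply/seteqP; split; last exact: Jset_mulr.
have hdg : siegelP (g *m d) by apply: siegelPM => //; case: hd.
have := Jset_mulr (D0V hd) hdg.
by rewrite -mulmxA mulmxV ?mulmx1 //; apply: siegelP_unit; case: hd.
Qed.

Lemma hloc_neq0 (s : mp_elt) : Mp s -> D s.1 -> hloc s != 0.
Proof.
move=> hs; rewrite Dgrp_O_integral => -[_ h].
by rewrite /hloc invr_eq0; have [] := Mp_integral_phi0 hs h.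
Qed.

(** The factorisation with trivial beta and gamma shows that there is a candidate, and [hloc_neq0]
    excludes 0 from the candidates. *)
Lemma Jfac_levi_neq0 (y : 'M[K]_n) : admissible y -> Jfac R b c (levi y) != 0.
Proof.
move=> hy; have : Jset (levi y) (Jfac R b c (levi y)).
  rewrite JfacE; apply: (@xgetPex _ _ (Jset (levi y))).
  pose e : mp_elt := (1%:M, id); exists (hloc e * hloc e), y, e, e; split.
  - exact: hy.
  - by split; [exact: Mp_id|exact: Dgrp1].
  - by split; [exact: Mp_id|exact: Dgrp1].
  - by split; [rewrite /= mul1mx mulmx1|].
  - by [].
move=> [y' [s [s' [_ [h1 h2] [h3 h4] _ ->]]]].
by apply: mulf_neq0; exact: hloc_neq0.
Qed.

End WeilIntegral.

(** * The Hecke polynomial and the p-stabilisation *)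

Section SatakePolynomial.
Variables (R : realType) (n : nat) (p : primeT).
Local Notation C := R[i].
Local Notation I := {ffun 'I_n -> bool}.
Implicit Types (X : 'I_n -> C) (J : {set I}).

(** Exponents of the product, over the sign patterns in J, of the corresponding monomials in the X i
    and their inverses. *)
Definition exps J : {ffun 'I_n -> int} := [ffun i => \sum_(d in J) (if (d : I) i then 1 else - 1)].

Definition pw : C := (val p)%:R ^+ 'C(n.+1, 2).

Lemma pw_neq0 : (val p)%:R != 0 :> C.
Proof. by rewrite pnatr_eq0 -lt0n prime_gt0 ?(valP p). Qed.

Lemma exps_sum (d : I) X : \prod_i (if d i then X i else (X i)^-1) = \prod_i X i ^ (if d i then 1 else - 1).
Proof. by apply: eq_bigr => i _; case: (d i); rewrite ?expr1z ?exprN1. Qed.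

Lemma coef_Rtilde X m : (forall i, X i != 0) ->
  (Rtilde p X)`_m = \sum_(J : {set I} | #|J| == m) (- pw) ^+ m * \prod_i X i ^ (exps J i).
Proof.
move=> X0; rewrite /Rtilde.
pose a (d : I) := - (pw * \prod_i (if d i then X i else (X i)^-1)).
rewrite (eq_bigr (fun d => a d *: 'X + 1)); last first.
  by move=> d _; rewrite addrC scaleNr.
rewrite bigA_distr big_mkcond /= coef_sum [RHS]big_mkcond; apply: eq_bigr => J _.
rewrite -big_mkcond /=.
have -> : \prod_(i in J) (a i *: 'X : {poly C}) = (\prod_(i in J) a i) *: 'X^#|J|.
  rewrite -prodr_const; elim/big_rec3: _ => [|i u v w _ ->]; first by rewrite scale1r.
  by rewrite -scalerAl -scalerAr scalerA mulrC.
rewrite coefZ coefXn [m == _]eq_sym; have [e|ne] := eqVneq #|J| m; last by rewrite mulr0.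
rewrite mulr1 /a (eq_bigr (fun d : I => - pw * \prod_i (if d i then X i else (X i)^-1))) => [|d _]; last by rewrite mulNr.
rewrite big_split /= prodr_const e; congr (_ * _).
under eq_bigr do rewrite exps_sum; rewrite exchange_big /=; apply: eq_bigr => i _.
rewrite ffunE; elim/big_rec2: _ => [|d u v _ ->]; first by rewrite expr0z.
by rewrite expfzDr.
Qed.

(** The signs at i cancel over all patterns, so the sum over J is the opposite of the sum over the
    complement, which has 2^n - #|J| elements. *)
Lemma exps_le J i : exps J i <= (2 ^ n - #|J|)%N%:Z.
Proof.
have tot : \sum_(d : I) (if d i then 1 else - 1) = 0 :> int.
  pose S : int := \sum_(d : I) (if d i then 1 else - 1).
  have inj : injective (fun d : I => [ffun j => ~~ d j] : I).
    by move=> d d' /ffunP h; apply/ffunP => j; have := h j; rewrite !ffunE => /negb_inj.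
  have : S = - S.
    rewrite {1}/S (reindex_inj inj) -sumrN; apply: eq_bigr => d _.
    by rewrite ffunE; case: (d i); rewrite ?opprK.
  by rewrite -/S; move: S => S; lia.
have card : (#|~: J| = 2 ^ n - #|J|)%N.
  have := cardsC J; rewrite card_ffun card_bool card_ord => <-; by rewrite addKn.
rewrite ffunE -card; have : \sum_(d in J) (if d i then 1 else - 1) = \sum_(d in ~: J) (if d i then - 1 else 1) :> int.
  apply/eqP; rewrite -subr_eq0 -sumrN -[X in _ == X]tot (bigID (fun d => d \in J) predT) /=; apply/eqP.
  congr (_ + _); apply: eq_big => d; first by rewrite inE.
  by case: (d i); rewrite ?opprK.
move=> ->; apply: (@le_trans _ _ (\sum_(d in ~: J) 1 : int)).
  by apply: ler_sum => d _; case: (d i).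
by rewrite sumr_const natz.
Qed.

(** The factor of the all-positive sign pattern vanishes at the inverse of [pw * \prod_i X i]; the
    relation is then multiplied by the power 2^n. *)
Lemma Rtilde_root X : (forall i, X i != 0) ->
  \sum_(l < (2 ^ n).+1) (Rtilde p X)`_l * (pw * \prod_i X i) ^+ (2 ^ n - l) = 0.
Proof.
move=> X0; set x := pw * _; have x0 : x != 0.
  by rewrite mulf_neq0 ?expf_neq0 ?pw_neq0 //; apply/prodf_neq0.
have sz : (size (Rtilde p X) <= (2 ^ n).+1)%N.
  apply/leq_sizeP => j hj; rewrite coef_Rtilde // big_pred0 // => J.
  apply/negbTE/eqP => e; move: (max_card (mem J)); rewrite e card_ffun card_bool card_ord.
  by rewrite leqNgt hj.
have r : (Rtilde p X).[x^-1] = 0.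
  rewrite /Rtilde horner_prod (bigD1 [ffun=> true]) //=; apply/eqP; rewrite mulf_eq0; apply/orP; left.
  rewrite !hornerE; under eq_bigr do rewrite ffunE.
  by rewrite -/pw -/x mulfV // subrr.
have E : x ^+ (2 ^ n) * (Rtilde p X).[x^-1] = 0 by rewrite r mulr0.
rewrite -[RHS]E (horner_coef_wide _ sz) mulr_sumr; apply: eq_bigr => l _.
have eX : x ^+ (2 ^ n) = x ^+ (2 ^ n - l) * x ^+ l by rewrite -exprD subnK // -ltnS.
by rewrite mulrCA eX exprVn mulfK // expf_neq0.
Qed.

(** The degree p^(n (n + 1)) of U against the product p^(- n (n + 1) / 2) of the weights: what
    remains is the power of p in lambda. *)
Lemma lambda_weight X : ((val p ^ 2) ^ 'C(n.+1, 2))%:R * \prod_(i < n) ((val p)%:R ^- i.+1 * X i) = pw * \prod_i X i.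
Proof.
rewrite big_split /= mulrA; congr (_ * _).
have -> : \prod_(i < n) (val p)%:R ^- i.+1 = (pw^-1 : C).
  rewrite -[X in _ = X^-1]/((val p)%:R ^+ 'C(n.+1, 2)) -triangular_sum big_mkord big_ord_recl add0n.
  by rewrite -prodrXr -prodfV; apply: eq_bigr.
rewrite -expnM natrX /pw mul2n -addnn exprD mulfK // expf_neq0 // pw_neq0.
by [].
Qed.
End SatakePolynomial.

Lemma Sp_invmx (F : fieldType) n (g : 'M[F]_(n + n)) : Sp g ->
  invmx g = - iota_mx F n *m g^T *m iota_mx F n.
Proof.
move=> hg; have u := Sp_unit hg; apply: (can_inj (mulmxK u)); rewrite mulVmx //.
rewrite -!mulmxA (mulmxA g^T) hg mulNmx -mulmxN.
by rewrite iota_mxK.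
Qed.

Lemma quotient_identity (F : fieldType) (w y z t : F) : w != 0 ->
  (w * y - z) / (w * w) - (w * t - z) / (w * w) = w^-1 * (y - t).
Proof. by move=> w0; field. Qed.

(** * The image of R_p in the Hecke ring of the parabolic *)

Section Embedding.
Variables (R : realType) (n : nat) (k : int) (b : rat) (c : nat) (psi : adele_tuple R -> R[i]) (p : primeT).
Hypotheses (n_gt0 : (0 < n)%N) (b_gt0 : 0 < b) (c_gt0 : (0 < c)%N)
    (b_even : b^-1 / 2 \is a Num.int) (bc_even : b * c%:R / 2 \is a Num.int)
    (p_ndiv_c : ~~ (val p %| c)%N).
Local Notation C := R[i].
Local Notation K := (padic p).
Local Notation pQ := ((val p)%:R : K).
Local Notation P := (@siegelP K n).
Local Notation H := (@D0 n p b c).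
Local Notation D := (Dgrp n p b^-1 (b * c%:R)).
Implicit Types (g h : 'M[K]_(n + n)).

Let b0 : b != 0. Proof. by rewrite gt_eqF. Qed.
Let b_unit : Zq_unit (rq p b) := b_unit n_gt0 b_gt0 c_gt0 b_even bc_even p_ndiv_c.
Let c_unit : Zq_unit (c%:R : K). Proof. exact: in_Zq_unitN. Qed.
Let two_unit : Zq_unit (2 : K).
Proof. exact: in_Zq_unitN (p_ndiv2 n_gt0 b_gt0 c_gt0 b_even bc_even p_ndiv_c). Qed.
Let HE : H = Hgrp (@in_Zq p) (n:=n) := D0_Hgrp n_gt0 b_gt0 c_gt0 b_even bc_even p_ndiv_c.
Let DE : D = Dgrp_O (@in_Zq p) (n:=n) := Dgrp_O_integral n b_unit c_unit.

Lemma iota_integral : Zq_mx (iota_mx K n).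
Proof.
rewrite /iota_mx; apply/mxO_block; split; [exact: Zq_mx0|exact/Zq_mxN/Zq_mx1|exact: Zq_mx1|exact: Zq_mx0].
Qed.

(** The inverse of a symplectic matrix is - iota g^T iota, so it has the same denominators as g. *)
Lemma integral_invmx (x : K) g : Sp g -> Zq_mx (x *: g) -> Zq_mx (x *: invmx g).
Proof.
move=> hg h; rewrite (Sp_invmx hg) scalemxAl scalemxAr.
apply: Zq_mxM; last exact: iota_integral.
apply: Zq_mxM; first exact/Zq_mxN/iota_integral.
have -> : x *: g^T = (x *: g)^T by apply/matrixP => i j; rewrite !mxE.
exact: Zq_mx_tr.
Qed.

Lemma siegelP_integral g : P g -> Zq_mx g -> H g.
Proof.
move=> Pg hg; rewrite HE; have [Sg _] := Pg.
have hV : Zq_mx (invmx g) by rewrite -[invmx g]scale1r; apply: integral_invmx; rewrite ?scale1r.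
have /siegelPP[d [v [ud vv e]]] := Pg; rewrite e in hg hV *.
exists d, v; have /mxO_block[_ h2 _ h4] := hg; split=> //.
  by split=> //; rewrite sgV // in hV; have /mxO_block[_ _ _ h5] := hV.
rewrite -[v]mul1mx -(tildeV ud) -mulmxA; apply: Zq_mxM => //; exact: Zq_mx_tr.
Qed.

Lemma integral_quotient e g h : P g -> P h -> Zq_mx (pQ ^+ e *: h) -> Zq_mx (pQ ^- e *: (g - h)) ->
  H (g *m invmx h).
Proof.
move=> Pg Ph hh hgh; apply: siegelP_integral; first by apply: siegelPM => //; exact: siegelPV.
have uh := siegelP_unit Ph; have -> : g *m invmx h = 1%:M + (pQ ^- e *: (g - h)) *m (pQ ^+ e *: invmx h).
  by rewrite -scalemxAl -scalemxAr scalerA mulVf ?qX_neq0 // scale1r mulmxBl (mulmxV uh) addrC subrK.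
apply: Zq_mxD; first exact: Zq_mx1.
apply: (Zq_mxM hgh); apply: integral_invmx => //; by case: Ph.
Qed.

Local Notation J e := {ffun 'I_(n + n) * 'I_(n + n) -> 'I_(val p ^ (2 * e))}.
Definition residue e (j : J e) : set 'M[K]_(n + n) := [set g | [/\ P g, Zq_mx (pQ ^+ e *: g) &
  forall x, in_Zq ((pQ ^+ e * g x.1 x.2 - (j x : nat)%:R) / pQ ^+ (2 * e))]].

(** If p^e g and p^e h are congruent modulo p^(2e), then g h^-1 is 1 plus an integral matrix, hence
    lies in D_0. So one representative for each residue class suffices. *)
Lemma bounded_cover e : exists s, covers P H s (fun g => Zq_mx (pQ ^+ e *: g)).
Proof.
exists [seq xget 1%:M (residue j) | j <- enum {: J e}]; split.
  move=> h /mapP[j _ ->]; case: xgetP => [x _ []//|_]; exact: siegelP1.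
move=> g Pg hg; have /choice[j hj] : forall x : 'I_(n + n) * 'I_(n + n), exists t : 'I_(val p ^ (2 * e)),
    in_Zq ((pQ ^+ e * g x.1 x.2 - (t : nat)%:R) / pQ ^+ (2 * e)).
  move=> x; have hx : in_Zq (pQ ^+ e * g x.1 x.2) by have := hg x.1 x.2; rewrite mxE.
  by have [t ht h] := in_Zq_approx (2 * e) hx; exists (Ordinal ht).
pose jf : J e := [ffun x => j x].
have rg : residue jf g by split=> // x; rewrite ffunE.
exists (xget 1%:M (residue jf)); first by apply: map_f; rewrite mem_enum.
have [Ph hh ah] : residue jf (xget 1%:M (residue jf)) by exact: xgetPex (ex_intro _ g rg).
set h := xget _ _ in Ph hh ah *.
exists (g *m invmx h); last by rewrite mulmxKV //; exact: siegelP_unit.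
apply: (integral_quotient Pg Ph hh) => i l.
have [_ _ ag] := rg; have := in_ZqB (ag (i, l)) (ah (i, l)) => /=.
have -> : pQ ^+ (2 * e) = pQ ^+ e * pQ ^+ e by rewrite mul2n -addnn exprD.
rewrite (quotient_identity _ _ _ (qX_neq0 p e)).
by rewrite !mxE.
Qed.

Lemma common_denominator (s : seq 'M[K]_(n + n)) : exists e, forall g, g \in s -> Zq_mx (pQ ^+ e *: g).
Proof.
have up (e e' : nat) g : (e <= e')%N -> Zq_mx (pQ ^+ e *: g) -> Zq_mx (pQ ^+ e' *: g).
  move=> le h; rewrite -(subnK le) exprD -scalerA; apply: Zq_mxZ => //.
  by apply: in_ZqX; exact: in_Zq_nat.
have one g : exists e, Zq_mx (pQ ^+ e *: g).
  have /choice[f hf] : forall x : 'I_(n + n) * 'I_(n + n), exists e, in_Zq (pQ ^+ e * g x.1 x.2).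
    by move=> x; exact: padic_den.
  exists (\max_x f x) => i j; rewrite mxE -(subnK (leq_bigmax (i, j))) exprD -mulrA.
  by apply: in_ZqM; [apply: in_ZqX; exact: in_Zq_nat|exact: (hf (i, j))].
elim: s => [|g s [e he]]; first by exists 0%N.
have [e' he'] := one g; exists (maxn e e') => h; rewrite inE => /orP[/eqP ->|/he].
  by apply: up he'; exact: leq_maxr.
by apply: up; exact: leq_maxl.
Qed.

Variable A : 'M[K]_(n + n) -> C.
Hypothesis hA : Rq b c A.
Local Notation F := (eps b c A).

Lemma Rq_bounded : exists e, forall g, A g != 0 -> Zq_mx (pQ ^+ e *: g).
Proof.
have [_ [s [sa ss]]] := hA; have [e he] := common_denominator [seq levi y | y <- s].
exists e => g /ss[y ys [d [d' [hd hd' ->]]]].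
rewrite DE in hd hd'; have [_ Od] := hd; have [_ Od'] := hd'.
rewrite scalemxAl scalemxAr; apply: (Zq_mxM _ Od'); apply: (Zq_mxM Od).
by apply: he; exact: map_f.
Qed.

Lemma epsE g : P g -> F g = (Jfac R b c g)^-1 * A g.
Proof. by move=> Pg; rewrite /eps asboolT. Qed.

Lemma eps_linv : linv P H F.
Proof.
move=> d g hd Pg; have Pdg : P (d *m g) by apply: siegelPM => //; case: hd.
rewrite (epsE Pdg) (epsE Pg) (Jfac_mull R b_unit c_unit two_unit hd Pg).
have [inv _] := hA; have D1 := Dgrp1 n b_unit c_unit; have [hD _] := hd.
by rewrite -[d *m g]mulmx1 (inv _ _ _ hD D1).
Qed.

Lemma eps_rinv : rinv P H F.
Proof.
move=> d g hd Pg; have Pdg : P (g *m d) by apply: siegelPM => //; case: hd.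
rewrite (epsE Pdg) (epsE Pg) (Jfac_mulr R b_unit c_unit two_unit hd Pg).
have [inv _] := hA; have D1 := Dgrp1 n b_unit c_unit; have [hD _] := hd.
by rewrite -[g *m d]mul1mx mulmxA (inv _ _ _ D1 hD).
Qed.

Lemma eps_fsupp : fsupp P H F.
Proof.
have [e he] := Rq_bounded; have [s hs] := bounded_cover e; exists s; apply: covers_sub hs => g Pg.
by rewrite (epsE Pg) mulf_eq0 negb_or => /andP[_ /he].
Qed.

Definition wt (i : 'I_n) : C := (val p)%:R ^- i.+1.
Lemma wt_neq0 i : wt i != 0.
Proof. by rewrite invr_eq0 expf_neq0 ?pw_neq0. Qed.

Lemma omega_satake X : omega b c A X = satake (@in_Zq p) pQ wt F X.
Proof.
have -> : omega b c A X = csum P H (fun g => F g * om0 (@in_Zq p) pQ wt (drsubmx g) X) by [].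
by rewrite HE.
Qed.
End Embedding.

(** * Vanishing of V_N on the parabolic *)

Section Vanishing.
Variables (R : realType) (n : nat) (b : rat) (c : nat) (p : primeT).
Hypotheses (n_gt0 : (0 < n)%N) (b_gt0 : 0 < b) (c_gt0 : (0 < c)%N)
    (b_even : b^-1 / 2 \is a Num.int) (bc_even : b * c%:R / 2 \is a Num.int)
    (p_ndiv_c : ~~ (val p %| c)%N).
Local Notation C := R[i].
Local Notation K := (padic p).
Local Notation pQ := ((val p)%:R : K).
Local Notation P := (@siegelP K n).
Local Notation H := (@D0 n p b c).
Local Notation D := (Dgrp n p b^-1 (b * c%:R)).
Local Notation N := (2 ^ n)%N.
Implicit Types (g h : 'M[K]_(n + n)).
Variable T : nat -> 'M[K]_(n + n) -> C.
Hypothesis hT : is_T b c T.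
Local Notation O := (@in_Zq p).

Let O0 : in_Zq (0 : K) := in_Zq0 p.
Let O1 : in_Zq (1 : K) := in_Zq1 p.
Let OD : forall x y : K, in_Zq x -> in_Zq y -> in_Zq (x + y) := @in_ZqD p.
Let ON : forall x : K, in_Zq x -> in_Zq (- x) := @in_ZqN p.
Let OM : forall x y : K, in_Zq x -> in_Zq y -> in_Zq (x * y) := @in_ZqM p.
Let Q0 : pQ != 0 := padic_q_neq0 p.
Let OQ (m : int) : in_Zq (pQ ^ m) <-> 0 <= m.
Proof. by have := in_Zq_qexp m (Zq_unit1 p); rewrite mulr1. Qed.
Let HE : H = Hgrp (@in_Zq p) (n:=n) := D0_Hgrp n_gt0 b_gt0 c_gt0 b_even bc_even p_ndiv_c.
Let b_unit : Zq_unit (rq p b) := b_unit n_gt0 b_gt0 c_gt0 b_even bc_even p_ndiv_c.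
Let c_unit : Zq_unit (c%:R : K). Proof. exact: in_Zq_unitN. Qed.
Let two_unit : Zq_unit (2 : K).
Proof. exact: in_Zq_unitN (p_ndiv2 n_gt0 b_gt0 c_gt0 b_even bc_even p_ndiv_c). Qed.
Let DE : D = Dgrp_O (@in_Zq p) (n:=n) := Dgrp_O_integral n b_unit c_unit.
Let PHH : group_pair P (Hgrp O (n:=n)) := PH O0 O1 OD ON OM n.

Lemma T_Rq l : (l <= N)%N -> Rq b c (T l).
Proof. by move=> lN; have [] := hT lN. Qed.

Lemma epsT_props l : (l <= N)%N ->
  [/\ linv P H (eps b c (T l)), rinv P H (eps b c (T l)) & fsupp P H (eps b c (T l))].
Proof.
move=> /T_Rq h; split.
- exact: (eps_linv n_gt0 b_gt0 c_gt0 b_even bc_even p_ndiv_c h).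
- exact: (eps_rinv n_gt0 b_gt0 c_gt0 b_even bc_even p_ndiv_c h).
- exact: (eps_fsupp n_gt0 b_gt0 c_gt0 b_even bc_even p_ndiv_c h).
Qed.

Lemma satake_epsT l (X : 'I_n -> C) : (l <= N)%N -> (forall i, X i != 0) ->
  satake O pQ (@wt R n p) (eps b c (T l)) X = (-1) ^+ l * (Rtilde p X)`_l.
Proof.
move=> lN X0; have [h1 h2] := hT lN.
rewrite -(omega_satake n_gt0 b_gt0 c_gt0 b_even bc_even p_ndiv_c).
exact: h2.
Qed.

(** An application of [satake_support] with kappa = J^-1; the subsets J with l elements index the
    monomials of the transform, and [exps_le] bounds their exponents by N - l. *)
Lemma epsT_support l g : (l <= N)%N -> P g -> eps b c (T l) g != 0 -> Zq_mx (pQ ^+ (N - l) *: g).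
Proof.
move=> lN Pg nz; have [lF rF fF] := epsT_props lN; rewrite HE in lF rF fF.
have [inv [s [sa ss]]] := T_Rq lN.
have sat X : (forall i, X i != 0) -> satake O pQ (@wt R n p) (eps b c (T l)) X =
    \sum_(J <- enum [pred J : {set {ffun 'I_n -> bool}} | #|J| == l]) (pw R n p ^+ l) * mono_at (exps J) X.
  move=> X0; rewrite (satake_epsT lN X0) coef_Rtilde // -big_distrr /= mulrA -exprMn mulN1r opprK big_enum /=.
  by rewrite mulr_sumr.
have ex J i : J \in enum [pred J : {set {ffun 'I_n -> bool}} | #|J| == l] -> exps J i <= (N - l)%N%:Z.
  by rewrite mem_enum inE => /eqP <-; exact: exps_le.
have inv' d h d' : Dgrp_O O d -> Dgrp_O O d' -> T l (d *m h *m d') = T l h.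
  by rewrite -DE; exact: inv.
have ss' h : T l h != 0 -> exists2 y, y \in s &
     exists d d', [/\ Dgrp_O O d, Dgrp_O O d' & h = d *m levi y *m d'].
  by rewrite -DE; exact: ss.
have kap h : P h -> eps b c (T l) h = (Jfac R b c h)^-1 * T l h by move=> Ph; exact: epsE.
have kap0 (y : 'M[K]_n) : y \in unitmx -> mxO O y -> (Jfac R b c (levi y))^-1 != 0.
  move=> h1 h2; rewrite invr_eq0; apply: (Jfac_levi_neq0 R b_unit c_unit two_unit); by split.
have e0 : 0 <= (N - l)%N%:Z by [].
exact: (satake_support O0 O1 OD ON OM Q0 OQ (@hermite p) (@smith p) (@wt_neq0 R n p) n_gt0 e0
  lF rF fF sat ex inv' sa ss' kap kap0 Pg nz).
Qed.

Lemma cmul_scalar (F G : 'M[K]_(n + n) -> C) a g : rinv P H F -> linv P H G -> fsupp P H G -> P g ->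
  cmul P H (fun h => F h * a) G g = cmul P H F G g * a.
Proof.
rewrite HE => rF lG fG Pg; rewrite !S0_mulE -(csum_distr PHH).
- by apply: (eq_csum PHH) => h Ph; rewrite mulrAC.
- exact: (S0_mul_kernel_linv PHH rF lG).
- exact: (S0_mul_kernel_fsupp F fG Pg).
Qed.

Lemma S0_expE m : S0_exp b c (@U_op R n p b c) m = @Uexp K O pQ C n m.
Proof.
transitivity (iter m (@cmul C K (n + n) P H (@U_op R n p b c)) \1_H); first by [].
by rewrite (U_opE R n_gt0 b_gt0 c_gt0 b_even bc_even p_ndiv_c) HE.
Qed.

Lemma V_op_eq0 g : P g -> V_op b c T N g = 0.
Proof.
move=> Pg; have pr := @prepO n b c p n_gt0 b_gt0 c_gt0 b_even bc_even p_ndiv_c.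
have prx := @prep_ex n b c p n_gt0 b_gt0 c_gt0 b_even bc_even p_ndiv_c.
have pri := @prep_inj n b c p n_gt0 b_gt0 c_gt0 b_even bc_even p_ndiv_c.
pose F l := fun h => eps b c (T l) h * (-1) ^+ l : C.
have HF l : (l <= N)%N -> [/\ linv P H (F l), rinv P H (F l) & fsupp P H (F l)].
  move=> lN; have [lF rF fF] := epsT_props lN; split.
  - by move=> d h hd Ph; rewrite /F lF.
  - by move=> d h hd Ph; rewrite /F rF.
  - have [s hs] := fF; exists s; apply: covers_sub hs => h Ph.
    by rewrite mulf_eq0 negb_or => /andP[].
have supp l h : (l <= N)%N -> P h -> F l h != 0 -> mxO O (pQ ^+ (N - l) *: h).
  move=> lN Ph; rewrite mulf_eq0 negb_or => /andP[nz _]; exact: epsT_support.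
have sat0 (X : 'I_n -> C) : (forall i, X i != 0) -> \sum_(l < N.+1) satake O pQ (@wt R n p) (F l) X *
   (((val p ^ 2) ^ 'C(n.+1, 2))%:R * \prod_i (@wt R n p i * X i)) ^+ (N - l) = 0.
  move=> X0; rewrite -[RHS](Rtilde_root p X0); apply: eq_bigr => l _.
  (* The degree of U combined with the weights is lambda as a function of X, so the required
     relation is that of [Rtilde_root]. *)
  rewrite lambda_weight; congr (_ * _); have lN : (l <= N)%N by rewrite -ltnS.
  have [lF rF fF] := epsT_props lN; rewrite HE in lF rF fF.
  rewrite -[RHS](signrMK l) -(satake_epsT lN X0) mulrC /satake -(csum_distr PHH).
  - by apply: (eq_csum PHH) => h Ph; rewrite /F mulrAC.
  - exact: (satake_linv O0 OD OM Q0 OQ (@hermite p) (@wt R n p) X lF).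
  - have [s hs] := fF; exists s; apply: covers_sub hs => h Ph.
    by rewrite mulf_eq0 negb_or => /andP[].
have HF' := HF; rewrite HE in HF'.
have := sum_cmulU_eq0 O0 O1 OD ON OM Q0 OQ (@hermite p) (@smith p) (@wt_neq0 R n p) pr prx pri n_gt0 HF' supp sat0 Pg.
move=> <-; apply: eq_bigr => l _; have lN : (l <= N)%N by rewrite -ltnS.
have [lF rF fF] := epsT_props lN.
have [lm rm fm] := Uexp_prop O0 O1 OD ON OM Q0 C n pr prx (N - l); rewrite -HE in lm rm fm.
have -> : S0_mul b c (eps b c (T l)) (S0_exp b c (U_op R b c) (N - l)) g =
   cmul P H (eps b c (T l)) (Uexp O pQ C (N - l)) g by rewrite S0_expE.
by rewrite mulrC -cmul_scalar // HE.
Qed.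
End Vanishing.

(** Used with S m = f|V_m, r m the coefficients of Rtilde, x = f at a point, and y = lambda_0. The
    terms r m x add up to a multiple of Rtilde(y^-1) = 0, so they can be inserted on the right; S N
    = 0 and S 0 = r 0 x then remove the two ends. *)
Lemma telescope_eigen (F : fieldType) (N : nat) (S r : nat -> F) (x y : F) : y != 0 ->
  S 0%N = r 0%N * x -> S N = 0 -> \sum_(m < N.+1) r m * y ^+ (N - m) = 0 ->
  \sum_(m < N) y ^- m * (S m.+1 - r m.+1 * x) = y * \sum_(m < N) y ^- m * S m.
Proof.
move=> y0 S0 SN rN.
have rN' : \sum_(m < N.+1) y ^- m * r m = 0.
  apply: (mulfI (expf_neq0 N y0)); rewrite mulr0 -[RHS]rN mulr_sumr; apply: eq_bigr => m _.
  have e : y ^+ N = y ^+ (N - m) * y ^+ m by rewrite -exprD subnK // -ltnS.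
  by rewrite e mulrA mulfK ?expf_neq0 // mulrC.
have E : \sum_(m < N) y ^- m * S m = \sum_(m < N.+1) y ^- m * (S m - r m * x).
  rewrite [RHS](eq_bigr (fun m : 'I_N.+1 => y ^- m * S m - x * (y ^- m * r m))) => [|m _]; last first.
    by rewrite mulrBr [r m * x]mulrC mulrCA.
  by rewrite sumrB -mulr_sumr rN' mulr0 subr0 big_ord_recr /= SN mulr0 addr0.
rewrite E big_ord_recl S0 subrr mulr0 add0r mulr_sumr; apply: eq_bigr => m _.
by rewrite mulrA lift0 exprS invfM mulrA mulfV // mul1r.
Qed.

(** * The p-stabilisation *)

Section Stabilisation.
Variables (R : realType) (n : nat) (k : int) (b : rat) (c : nat) (psi : adele_tuple R -> R[i]) (p : primeT).
Hypotheses (n_gt0 : (0 < n)%N) (b_gt0 : 0 < b) (c_gt0 : (0 < c)%N)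
    (b_even : b^-1 / 2 \is a Num.int) (bc_even : b * c%:R / 2 \is a Num.int)
    (psi_hecke : hecke_character psi)
    (psi_cond : forall (q : primeT) (a : padic q), Zq_unit a ->
       in_Zq ((a - 1) / c%:R) -> psi (at_prime R a) = 1)
    (p_ndiv_c : ~~ (val p %| c)%N).
Local Notation C := R[i].
Local Notation K := (padic p).
Local Notation pQ := ((val p)%:R : K).
Local Notation P := (@siegelP K n).
Local Notation H := (@D0 n p b c).
Local Notation N := (2 ^ n)%N.
Local Notation O := (@in_Zq p).
Local Notation act_by F := (hecke_act k b c psi F).
Local Notation Up := (@U_op R n p b c).
Local Notation Pinv := (@Pinv R n k b c psi p).
Local Notation mod_inv := (@mod_inv R n k b c psi).
Implicit Types (phi : 'M[C]_n -> C) (z : 'M[C]_n).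

Let b0 : b != 0. Proof. by rewrite gt_eqF. Qed.
Let HE : H = Hgrp (@in_Zq p) (n:=n) := D0_Hgrp n_gt0 b_gt0 c_gt0 b_even bc_even p_ndiv_c.
Let Ul : linv P H Up := U_linv R n_gt0 b_gt0 c_gt0 b_even bc_even p_ndiv_c.
Let Ur : rinv P H Up := U_rinv R n_gt0 b_gt0 c_gt0 b_even bc_even p_ndiv_c.
Let Uf : fsupp P H Up := U_fsupp R n_gt0 b_gt0 c_gt0 b_even bc_even p_ndiv_c.
Let PHD : group_pair P H.
Proof. rewrite HE; exact: (PH (in_Zq0 p) (in_Zq1 p) (@in_ZqD p) (@in_ZqN p) (@in_ZqM p) n). Qed.

Lemma S0_exp_props m : [/\ linv P H (S0_exp b c Up m), rinv P H (S0_exp b c Up m) & fsupp P H (S0_exp b c Up m)].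
Proof.
rewrite (S0_expE R n_gt0 b_gt0 c_gt0 b_even bc_even p_ndiv_c) HE.
exact: (Uexp_prop (in_Zq0 p) (in_Zq1 p) (@in_ZqD p) (@in_ZqN p) (@in_ZqM p) (padic_q_neq0 p) C n
  (prepO n_gt0 b_gt0 c_gt0 b_even bc_even p_ndiv_c) (prep_ex n_gt0 b_gt0 c_gt0 b_even bc_even p_ndiv_c) m).
Qed.

Lemma hecke_one phi z : Pinv phi -> Hn z -> act_by (@S0_one R n p b c) phi z = phi z.
Proof.
move=> hphi hz; have [l1 _ _] := S0_exp_props 0.
have g1 : GP p b c (1%:M : 'M[rat]_(n + n)).
  split; first exact: siegelP1.
  by move=> l _; rewrite loc1; exact: D01.
rewrite (hecke_act_csum b0 psi_hecke l1 hphi hz (r := [:: true]) (E := fun _ => 1%:M)).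
- by rewrite big_seq1; apply: hphi => //; rewrite loc1; exact: D01.
- by move=> _; exact: g1.
- move=> G lG; rewrite big_seq1 loc1.
  have one : S0_one R b c (1%:M : 'M[K]_(n + n)) = 1 by rewrite /S0_one indicE mem_set //; exact: D01.
  have lE : linv P H (fun g => S0_one R b c g * G g) by move=> d g hd Pg; exact: (congr2 *%R (l1 d g hd Pg) (lG d g hd Pg)).
  rewrite (csumE PHD lE (s := [:: 1%:M])) ?big_seq1 ?one ?mul1r //.
  split=> [h|g Pg]; first by rewrite inE => /eqP ->; exact: siegelP1.
  move=> nz; exists 1%:M; first by rewrite inE.
  exists g; last by rewrite mulmx1.
  apply: contrapT => nH; move: nz; rewrite /S0_one indicE memNset // mul0r eqxx.
  by [].
Qed.

Lemma hecke_S0_exp m phi z : Pinv phi -> Hn z ->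
  act_by (S0_exp b c Up m) phi z = iter m (act_by Up) phi z.
Proof.
elim: m phi => [|m IH] phi hphi hz; first exact: hecke_one.
(* [S0_exp] puts the new factor on the left, where it acts first; it is therefore the innermost
   iterate. *)
have [l1 _ f1] := S0_exp_props m; rewrite iterSr.
have E := hecke_act_cmul b0 psi_hecke Ul Ur Uf l1 f1 hphi hz.
have hU : Pinv (act_by Up phi) by exact: (hecke_act_Pinv b0 psi_hecke Ul Ur Uf hphi).
exact: (etrans E (IH _ hU hz)).
Qed.

Variables (f : 'M[C]_n -> C) (lam : 'I_n -> C) (T : nat -> 'M[K]_(n + n) -> C).
Hypotheses (f_form : modular_form k b c psi f) (lam_satake : satake_parameters k b c psi p f lam)
  (T_spec : is_T b c T).
Local Notation y := (lambda0 p lam).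
Local Notation r := (fun l => (Rtilde p lam)`_l).
Local Notation fU := (fun j => iter j (act_by Up) f).

Lemma p2c_gt0 : (0 < c * val p ^ 2)%N.
Proof. by rewrite muln_gt0 c_gt0 expn_gt0 prime_gt0 ?(valP p). Qed.

Lemma fU_mod j : mod_inv (c * val p ^ 2) (fU j) /\ Pinv (fU j).
Proof.
have pin phi : mod_inv (c * val p ^ 2) phi -> Pinv phi.
  exact: (mod_Pinv n_gt0 b_gt0 c_gt0 b_even bc_even psi_hecke p_ndiv_c p2c_gt0).
elim: j => [|j [IH1 IH2]].
  have h : mod_inv (c * val p ^ 2) f.
    apply: (mod_inv_sub b_gt0 c_gt0 p2c_gt0 (dvdn_mulr _ (dvdnn c))).
    by have [_ _ h] := f_form => g z hg hz; exact: h.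
  by split; last exact: pin.
have h : mod_inv (c * val p ^ 2) (act_by Up (fU j)).
  exact: (U_mod_inv n_gt0 b_gt0 c_gt0 b_even bc_even psi_hecke psi_cond p_ndiv_c IH1 IH2).
by split; [exact: h|exact: pin].
Qed.

Lemma y_neq0 : y != 0.
Proof.
have [l0 _] := lam_satake; rewrite mulf_neq0 ?expf_neq0 ?pw_neq0 //; exact/prodf_neq0.
Qed.

Lemma term_props m l : (m <= N)%N -> (l < m.+1)%N ->
  linv P H (S0_mul b c (eps b c (T l)) (S0_exp b c Up (m - l))) /\
  fsupp P H (S0_mul b c (eps b c (T l)) (S0_exp b c Up (m - l))).
Proof.
move=> mN lm; have lN : (l <= N)%N by exact: leq_trans mN.
have [lF rF fF] := epsT_props n_gt0 b_gt0 c_gt0 b_even bc_even p_ndiv_c T_spec lN.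
have [lm' rm fm] := S0_exp_props (m - l); split.
  exact: (S0_mul_linv PHD _ lF).
exact: (S0_mul_fsupp PHD rF fF fm).
Qed.

Lemma combination_props m (a : nat -> C) (F : nat -> 'M[K]_(n + n) -> C) :
  (forall l, (l < m)%N -> linv P H (F l) /\ fsupp P H (F l)) ->
  linv P H (fun g => \sum_(l < m) a l * F l g) /\ fsupp P H (fun g => \sum_(l < m) a l * F l g).
Proof.
move=> h; split.
  by move=> d g hd Pg; apply: eq_bigr => l _; rewrite ((h l (ltn_ord l)).1 d g hd Pg).
elim: m h => [|m IH] h.
  by exists [::]; split=> // g _; rewrite big_ord0 eqxx.
have -> : (fun g => \sum_(l < m.+1) a l * F l g) = fun g => \sum_(l < m) a l * F l g + a m * F m g.
  by apply/funext => g; rewrite big_ord_recr.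
apply: fsuppD; last by apply: fsuppZ; exact: (h m (ltnSn m)).2.
by apply: IH => l lm; apply: h; exact: ltnW.
Qed.

Lemma V_op_props m : (m <= N)%N -> linv P H (V_op b c T m) /\ fsupp P H (V_op b c T m).
Proof.
move=> mN; exact: (@combination_props m.+1 (fun l => (-1) ^+ l)
  (fun l => S0_mul b c (eps b c (T l)) (S0_exp b c Up (m - l))) (fun l h => term_props mN h)).
Qed.

(** In each product the left factor T_l meets f first and acts by its eigenvalue; the sign in [V_op]
    cancels that of [Ttilde]. *)
Lemma hecke_V m z : (m <= N)%N -> Hn z ->
  act_by (V_op b c T m) f z = \sum_(l < m.+1) r l * fU (m - l)%N z.
Proof.
move=> mN hz; have [_ Pf] := fU_mod 0.
have E := hecke_act_coef_sum k psi b0 (fun l => (-1) ^+ l : C)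
  (F := fun l => S0_mul b c (eps b c (T l)) (S0_exp b c Up (m - l))) f z
  (fun l h => (term_props mN h).1) (fun l h => (term_props mN h).2).
rewrite [LHS]E; apply: eq_bigr => l _; have lm := ltn_ord l.
have lN : (l <= N)%N by exact: leq_trans mN.
have [lF rF fF] := epsT_props n_gt0 b_gt0 c_gt0 b_even bc_even p_ndiv_c T_spec lN.
have [l1 _ f1] := S0_exp_props (m - l).
have E1 := hecke_act_cmul b0 psi_hecke lF rF fF l1 f1 Pf hz.
have [lam0 sat] := lam_satake; have [RT om] := T_spec lN.
have E2 := eq_hecke_act k psi b0 l1 f1 (fun w hw => sat _ RT w hw) hz.
have E3 := hecke_act_linear k psi b0 [:: true] (fun _ => omega b c (T l) lam) (fun _ => f) z l1 f1.
rewrite !big_seq1 in E3.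
have -> : act_by (S0_mul b c (eps b c (T l)) (S0_exp b c Up (m - l))) f z = omega b c (T l) lam * fU (m - l)%N z.
  apply: (etrans E1); apply: (etrans E2).
  have -> : (fun w => omega b c (T l) lam * f w) = (fun w => \sum_(i <- [:: true]) omega b c (T l) lam * f w).
    by apply/funext => w; rewrite big_seq1.
  by rewrite E3 hecke_S0_exp.
by rewrite (om lam lam0) /Ttilde mulrA signrMK.
Qed.

Lemma hecke_V_0 z : Hn z -> act_by (V_op b c T 0) f z = r 0%N * f z.
Proof. by move=> hz; rewrite (hecke_V (leq0n _) hz) big_ord_recl big_ord0 addr0. Qed.

Lemma hecke_V_N z : Hn z -> act_by (V_op b c T N) f z = 0.
Proof.
move=> hz; have [lV _] := V_op_props (leqnn N).
apply: (hecke_act_coef0 k psi b0 f z lV) => g Pg.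
exact: (V_op_eq0 n_gt0 b_gt0 c_gt0 b_even bc_even p_ndiv_c T_spec Pg).
Qed.

(** Applying U raises every power by one and gives all the terms of f|V_(m+1) except the one without
    U. *)
Lemma hecke_V_U m z : (m < N)%N -> Hn z ->
  act_by Up (act_by (V_op b c T m) f) z = act_by (V_op b c T m.+1) f z - r m.+1 * f z.
Proof.
move=> mN hz; rewrite (hecke_V mN hz) big_ord_recr /= subnn /= addrK.
have E := eq_hecke_act k psi b0 Ul Uf (fun w hw => hecke_V (ltnW mN) hw) hz.
apply: (etrans E).
have E2 := hecke_act_linear k psi b0 (index_enum 'I_m.+1) (fun l : 'I_m.+1 => r l) (fun l => fU (m - l)%N) z Ul Uf.
apply: (etrans E2); apply: eq_bigr => l _.
by rewrite subSn // -ltnS.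
Qed.

Local Notation f0 := (p_stabilisation k b c psi T lam f).

Lemma stabilisation_eigen z : Hn z -> act_by Up f0 z = y * f0 z.
Proof.
move=> hz.
have E := hecke_act_linear k psi b0 (index_enum 'I_N) (fun m : 'I_N => y ^- m) (fun m => act_by (V_op b c T m) f) z Ul Uf.
have -> : act_by Up f0 z = \sum_(m < N) y ^- m * (act_by (V_op b c T m.+1) f z - r m.+1 * f z).
  apply: (etrans E); apply: eq_bigr => m _; apply: (congr1 (fun t => y ^- m * t)).
  exact: hecke_V_U.
have [lam0 _] := lam_satake.
exact: (telescope_eigen (S := fun m => act_by (V_op b c T m) f z) y_neq0 (hecke_V_0 hz) (hecke_V_N hz) (Rtilde_root p lam0)).
Qed.

(** Writing f_0 as the action of a single element gives holomorphy and the condition at the cusps at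
    once. *)
Lemma stabilisation_act : exists2 W : 'M[K]_(n + n) -> C, linv P H W /\ fsupp P H W & f0 = act_by W f.
Proof.
have h l : (l < N)%N -> linv P H (V_op b c T l) /\ fsupp P H (V_op b c T l).
  by move=> lN; exact: V_op_props (ltnW lN).
exists (fun g => \sum_(m < N) y ^- m * V_op b c T m g).
  exact: (combination_props (fun m => y ^- m) h).
apply/funext => z.
exact: (esym (hecke_act_coef_sum k psi b0 (fun m => y ^- m) f z (fun l lN => (h l lN).1) (fun l lN => (h l lN).2))).
Qed.

(** By [hecke_V], f_0 is a combination of the f|U^j, and each of these has level c p^2. *)
Lemma stabilisation_mod : mod_inv (c * val p ^ 2) f0.
Proof.
move=> g z Gg hz; have [Sg _] := Gg; have hgz := act_Hn Sg hz.
have E w : Hn w -> f0 w = \sum_(m < N) y ^- m * \sum_(l < m.+1) r l * fU (m - l)%N w.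
  by move=> hw; apply: eq_bigr => m _; rewrite hecke_V // ltnW.
rewrite /slash (E _ hgz) (E _ hz) !mulr_sumr; apply: eq_bigr => m _.
rewrite mulrCA [RHS]mulrCA; apply: (congr1 (fun t => y ^- m * t)).
rewrite !mulr_sumr; apply: eq_bigr => l _.
rewrite mulrCA [RHS]mulrCA; apply: (congr1 (fun t => r l * t)).
by have [h _] := fU_mod (m - l); exact: h.
Qed.

Lemma stabilisation_form m : (1 < m)%N -> modular_form k b (c * val p ^ m)%N psi f0.
Proof.
move=> m1; have [W [lW fW] eW] := stabilisation_act; have [holf cuspf modf] := f_form; split.
- rewrite eW; exact: (hecke_act_holomorphic k psi b0 lW fW holf).
- move=> n1; rewrite eW; exact: (hecke_act_cusps psi b0 lW fW (cuspf n1)).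
move=> g Gg z hz.
have pm : (0 < c * val p ^ m)%N by rewrite muln_gt0 c_gt0 expn_gt0 prime_gt0 ?(valP p).
have G2 : Gamma n b^-1 (b * (c * val p ^ 2)%:R) g.
  by apply: (Gamma_sub b_gt0 p2c_gt0 pm _ Gg); rewrite dvdn_pmul2l // dvdn_exp2l.
rewrite (stabilisation_mod G2 hz); apply: (congr1 (fun t => t * f0 z)).
have x0 : b^-1 != 0 by rewrite invr_eq0.
have y0 : b * (c * val p ^ m)%:R != 0 by rewrite mulf_neq0 // pnatr_eq0 -lt0n.
have [Sg [A [B [D [E [eA eB eC eD]]]]]] := (GammaP g x0 y0).1 Gg.
have xy : b^-1 * (b * (c * val p ^ m)%:R) = ((c * val p ^ m)%N%:Z)%:~R by rewrite mulKf.
have dv := det_congr_unit x0 y0 xy Sg eA eB eC eD.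
rewrite eA det_map_mx; exact: (esym (psi_ideal_level psi_cond c_gt0 p_ndiv_c (ltnW m1) dv)).
Qed.
End Stabilisation.

Theorem proposition4p5 (R : realType) (n : nat) (n_gt0 : (0 < n)%N) (k : int)
    (b : rat) (b_gt0 : 0 < b) (c : nat) (c_gt0 : (0 < c)%N)
    (b_even : b^-1 / 2 \is a Num.int) (bc_even : b * c%:R / 2 \is a Num.int)
    (psi : adele_tuple R -> R[i])
    (psi_hecke : hecke_character psi) (psi_norm : normalised psi)
    (psi_cond : forall (q : primeT) (a : padic q), Zq_unit a ->
       in_Zq ((a - 1) / c%:R) -> psi (at_prime R a) = 1)
    (psi_infty : forall x : R, x != 0 ->
       psi (at_infty x) ^+ n = (Num.sg x)%:C ^ (n%:Z * k))
    (p : primeT) (p_ndiv_c : ~~ (val p %| c)%N)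
    (f : 'M[R[i]]_n -> R[i])
    (f_form : modular_form k b c psi f) (f_eigen : hecke_eigenform k b c psi f)
    (lam : 'I_n -> R[i]) (lam_satake : satake_parameters k b c psi p f lam)
    (T : nat -> 'M[padic p]_(n + n) -> R[i]) (T_spec : is_T b c T) :
  let f0 := p_stabilisation k b c psi T lam f in
  modular_form k b (c * val p ^ (2 * (2 ^ n - 1)))%N psi f0 /\
  forall z, Hn z ->
    hecke_act k b c psi (@U_op R n p b c) f0 z = lambda0 p lam * f0 z.
Proof.
(* From n >= 1, the exponent of p in the level is at least 2, the level at which f_0 is known to be
   modular. *)
have n2 : (1 < 2 * (2 ^ n - 1))%N.
  have h : (2 <= 2 ^ n)%N by case: (n) n_gt0 => // m _; rewrite expnS leq_pmulr // expn_gt0.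
  by move: h; case: (2 ^ n)%N => [|[|t]] // _; rewrite subn1 mulnS.
split; first exact: (stabilisation_form n_gt0 b_gt0 c_gt0 b_even bc_even psi_hecke psi_cond p_ndiv_c f_form lam_satake T_spec n2).
move=> z hz.
exact: (stabilisation_eigen n_gt0 b_gt0 c_gt0 b_even bc_even psi_hecke psi_cond p_ndiv_c f_form lam_satake T_spec hz).
Qed.
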